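(* Let $a\in A^s_2$ (on $\mathbb R^{n+1}$) and $\eta>0$. There is a constant $C$ depending only on $a$ (and $n$) and $\eta$ such that for every prismatic element $P=K\times[y_0,y_1]$, where $K\subset\mathbb R^n$ is an $n$-simplex with $h_K/\rho_K\le\eta$ and $y_0<y_1$, and every vector field $\pmb\sigma=(\tilde{\pmb\sigma},\sigma_{n+1})$ on $P$ with weakly differentiable components in $L^2_a(P)$: if the right-hand side of the following inequality is finite, then $$\|\tilde{\pmb\sigma}-\Pi_K\tilde{\pmb\sigma}\|_{L^2_a(P)}\le C\left\{\left\|(y-y_0)\frac{\partial\tilde{\pmb\sigma}}{\partial y}\right\|_{L^2_a(P)}+h_K\left\|D_x\tilde{\pmb\sigma}\right\|_{L^2_a(P)}\right\},$$ and if the right-hand side of the following inequality is finite, then $$\|\sigma_{n+1}-\Pi_{n+1}\sigma_{n+1}\|_{L^2_a(P)}\le C\left\{(y_1-y_0)\left\|\frac{\partial\sigma_{n+1}}{\partial y}\right\|_{L^2_a(P)}+h_K\left\|\nabla_x\sigma_{n+1}\right\|_{L^2_a(P)}\right\}.$$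
   Context: Points of $\mathbb R^{n+1}$ are written $(x,y)$ with $x=(x_1,\dots,x_n)\in\mathbb R^n$, $y\in\mathbb R$. A non-negative $a\in L^1_{loc}(\mathbb R^{n+1})$ belongs to $A^s_2$ (strong $A_2$) if $\sup_R\big(\frac1{|R|}\int_Ra\big)\big(\frac1{|R|}\int_Ra^{-1}\big)<\infty$, the supremum being over all $(n+1)$-dimensional rectangles with faces parallel to the coordinate axes. $L^2_a(P)$ is the $L^2$ space with measure $a\,dx\,dy$. $h_K$ is the diameter of $K$, $\rho_K$ the diameter of the largest ball contained in $K$. No relation between $h_K$ and $y_1-y_0$ is required. $D_x$ and $\nabla_x$ denote derivatives with respect to $x$ only. For $\pmb\sigma=(\sigma_1,\dots,\sigma_{n+1})$ write $\tilde{\pmb\sigma}=(\sigma_1,\dots,\sigma_n)$. The local Raviart--Thomas space is $\mathcal{RT}_0(P)=\{(a_1+bx_1,\dots,a_n+bx_n,a_{n+1}+cy):a_i,b,c\in\mathbb R\}$. The Raviart--Thomas interpolation is $\Pi_P\pmb\sigma=(\Pi_K\tilde{\pmb\sigma},\Pi_{n+1}\sigma_{n+1})\in\mathcal{RT}_0(P)$, where $\Pi_K\tilde{\pmb\sigma}$ is of the form $(a_1+bx_1,\dots,a_n+bx_n)$ with $$\int_{F\times[y_0,y_1]}\Pi_K\tilde{\pmb\sigma}\cdot\pmb n_F=\int_{F\times[y_0,y_1]}\tilde{\pmb\sigma}\cdot\pmb n_F$$ for every face $F$ of $K$ ($\pmb n_F$ a unit normal to $F$ in $\mathbb R^n$),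 and $\Pi_{n+1}\sigma_{n+1}$ is of the form $a_{n+1}+cy$ with $\int_{K\times\{y_j\}}\Pi_{n+1}\sigma_{n+1}=\int_{K\times\{y_j\}}\sigma_{n+1}$ for $j=0,1$. *)

(* Defs.v *)
From HB Require Import structures.
From mathcomp Require Import all_boot all_order all_algebra.
From mathcomp Require Import all_classical all_reals all_analysis.

Set Implicit Arguments.
Unset Strict Implicit.
Unset Printing Implicit Defensive.

Import Order.TTheory GRing.Theory Num.Theory.
Import numFieldNormedType.Exports.

Local Open Scope classical_set_scope.
Local Open Scope ring_scope.

(* The sigma-algebra on ['rV[R]_n] is the product one, generated by the
   coordinates, as the library does for [n.-tuple T]. *)
Definition rV_display : measure_display -> measure_display.
Proof. exact. Qed.

Section measurable_rV.
Context {R : realType} {n : nat}.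

Definition rV_coord (i : 'I_n) (x : 'rV[R]_n) : R := x ord0 i.

Let rV_set0 : g_sigma_preimage rV_coord set0.
Proof. exact: sigma_algebra0. Qed.

Let rV_setC A : g_sigma_preimage rV_coord A -> g_sigma_preimage rV_coord (~` A).
Proof. exact: sigma_algebraC. Qed.

Let rV_bigcup (F : _^nat) : (forall i, g_sigma_preimage rV_coord (F i)) ->
  g_sigma_preimage rV_coord (\bigcup_i (F i)).
Proof. exact: sigma_algebra_bigcup. Qed.

HB.instance Definition _ := @isMeasurable.Build
  (rV_display default_measure_display) 'rV[R]_n
  (g_sigma_preimage rV_coord) rV_set0 rV_setC rV_bigcup.

End measurable_rV.

Section measurable_rV_lemmas.
Context {R : realType}.

Lemma measurable_rV_coord n (i : 'I_n) :
  measurable_fun [set: 'rV[R]_n] (rV_coord i).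
Proof.
move=> _ Y mY; rewrite setTI; apply: sub_sigma_algebra => /=.
rewrite -bigcup_seq/=; exists i => /=; first by rewrite mem_index_enum.
by exists Y => //; rewrite setTI.
Qed.

Lemma measurable_fun_rV d (T : measurableType d) n (f : T -> 'rV[R]_n) :
  (forall i, measurable_fun [set: T] (rV_coord i \o f)) ->
  measurable_fun [set: T] f.
Proof.
move=> mf.
have : g_sigma_preimage (fun i => rV_coord i \o f) `<=` measurable.
  apply: smallest_sub; first exact: sigma_algebra_measurable.
  case: n => [|n] in f mf *; first by rewrite big_ord0.
  rewrite -bigcup_mkord_ord; apply: bigcup_sub => i Ii.
  by move=> A [B mB <-]; exact: mf.
by rewrite g_sigma_preimage_comp => prefS _ A mA; apply: prefS; exists A.
Qed.

Definition rV_cons n (p : measurableTypeR R * 'rV[R]_n) : 'rV[R]_n.+1 :=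
  \row_i (if unlift ord0 i is Some j then p.2 ord0 j else p.1).

Lemma measurable_rV_cons n : measurable_fun setT (@rV_cons n).
Proof.
apply: measurable_fun_rV => i.
rewrite (_ : _ \o _ = fun p : measurableTypeR R * 'rV[R]_n =>
    if unlift ord0 i is Some j then rV_coord j p.2 else p.1); last first.
  by apply/funext => p /=; rewrite /rV_coord /rV_cons mxE.
case: unliftP => [j _|_]; last exact: measurable_fst.
by apply: (measurableT_comp (measurable_rV_coord j)).
Qed.

End measurable_rV_lemmas.

(* The library proves this, but the instance it declares is shadowed by the one
   for products of subprobabilities. *)
Lemma product_measure_sigma_finite d1 d2 (T1 : measurableType d1)
    (T2 : measurableType d2) (R : realType)
    (m1 : {sigma_finite_measure set T1 -> \bar R})
    (m2 : {sigma_finite_measure set T2 -> \bar R}) :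
  sigma_finite setT (m1 \x m2)%E.
Proof.
have /sigma_finiteP[F [TF ndF Foo]] := sigma_finiteT m1.
have /sigma_finiteP[G [TG ndG Goo]] := sigma_finiteT m2.
exists (fun n => F n `*` G n).
 rewrite -setXTT TF TG predeqE => -[x y]; split.
    move=> [/= [n _ Fnx] [k _ Gky]]; exists (maxn n k) => //; split.
    - by move: x Fnx; exact/subsetPset/ndF/leq_maxl.
    - by move: y Gky; exact/subsetPset/ndG/leq_maxr.
  by move=> [n _ []/= ? ?]; split; exists n.
move=> k; have [? ?] := Foo k; have [? ?] := Goo k.
split; first exact: measurableX.
by rewrite product_measure1E// lte_mul_pinfty// ge0_fin_numE.
Qed.

Section lebesgue_rV.
Context {R : realType}.

Section step.
Context {n : nat} (m : {sigma_finite_measure set 'rV[R]_n -> \bar R}).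

Definition lebesgue_rV_step : set 'rV[R]_n.+1 -> \bar R :=
  pushforward (@lebesgue_measure R \x m)%E (@rV_cons R n).

Let pushforward_step := measure_function_pushforward__canonical__measure_function_Measure
  (@lebesgue_measure R \x m)%E (@measurable_rV_cons R n).

HB.instance Definition _ := isMeasure.Build _ _ _ lebesgue_rV_step
  (measure0 pushforward_step) (measure_ge0 pushforward_step)
  (@measure_semi_sigma_additive _ _ _ pushforward_step).

Lemma lebesgue_rV_step_sigma_finite : sigma_finite setT lebesgue_rV_step.
Proof.
have [F FT mF] := product_measure_sigma_finite (@lebesgue_measure R) m.
pose h (x : 'rV[R]_n.+1) : measurableTypeR R * 'rV[R]_n :=
  (x ord0 ord0, \row_j x ord0 (lift ord0 j)).
have hK p : h (rV_cons p) = p.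
  case: p => t x; rewrite /h /rV_cons mxE unlift_none /=; congr pair.
  by apply/rowP => j; rewrite !mxE liftK.
have mh : measurable_fun setT h.
  apply/measurable_fun_pairP; split; first exact: (measurable_rV_coord ord0).
  apply: measurable_fun_rV => i.
  rewrite (_ : _ \o _ = rV_coord (lift ord0 i)); first exact: measurable_rV_coord.
  by apply/funext => x; rewrite /rV_coord /= mxE.
exists (fun k => h @^-1` F k).
  by rewrite -preimage_bigcup -FT preimage_setT.
move=> k; have [mFk Fk] := mF k; split.
  by rewrite -[X in measurable X]setTI; exact: mh.
rewrite /lebesgue_rV_step /pushforward (_ : _ @^-1` _ = F k)//.
by apply/seteqP; split => p /=; rewrite hK.
Qed.

HB.instance Definition _ := @Measure_isSigmaFinite.Build _ _ _ lebesgue_rV_step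
  lebesgue_rV_step_sigma_finite.

End step.

Fixpoint lebesgue_rV (n : nat) : {sigma_finite_measure set 'rV[R]_n -> \bar R} :=
  if n is n'.+1 then lebesgue_rV_step (lebesgue_rV n') else \d_(0 : 'rV[R]_0).

End lebesgue_rV.

Notation pt R n := ('rV[R]_n * R)%type.

(* The same type as a measurable type: [measurableTypeR R] is [R] with the
   sigma-algebra on which the library defines the Lebesgue measure. *)
Notation mpt R n := ('rV[R]_n * measurableTypeR R)%type.

Section prismatic.
Context {R : realType}.

Definition vol (n : nat) : set (mpt R n) -> \bar R :=
  (lebesgue_rV n \x @lebesgue_measure R)%E.

HB.instance Definition _ n := Measure.on (@vol n).

HB.instance Definition _ n := @Measure_isSigmaFinite.Build _ _ _ (@vol n)
  (product_measure_sigma_finite (lebesgue_rV n) (@lebesgue_measure R)).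

(* Euclidean (for matrices: Frobenius) norm; the library's norm on matrices is
   the sup norm. *)
Definition enorm (k l : nat) (M : 'M[R]_(k, l)) : R :=
  Num.sqrt (\sum_i \sum_j M i j ^+ 2).

Definition dot (n : nat) (x z : 'rV[R]_n) : R := \sum_i x ord0 i * z ord0 i.

Definition e_x (n : nat) (j : 'I_n) : pt R n := (delta_mx ord0 j, 0).

Definition e_y (n : nat) : pt R n := (0, 1).

Definition loc_integrable (n : nat) (U : set (pt R n)) (f : pt R n -> R) :=
  forall Q, compact Q -> Q `<=` U -> (@vol n).-integrable Q (EFin \o f).

Definition box (n : nat) (l u : 'rV[R]_n) (c d : R) : set (pt R n) :=
  [set z : pt R n | (forall i, l ord0 i <= z.1 ord0 i <= u ord0 i) /\ c <= z.2 <= d].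

Definition is_rectangle (n : nat) (S : set (pt R n)) := exists (l u : 'rV[R]_n) (c d : R),
  [/\ (forall i, l ord0 i < u ord0 i), c < d & S = box l u c d].

Definition average (n : nat) (S : set (pt R n)) (f : pt R n -> \bar R) :=
  (\int[@vol n]_(z in S) f z / vol S)%E.

(* The inverse is taken in [\bar R], so that it is [+oo] where the weight
   vanishes. In the library [0 * +oo = 0], whereas the supremum has to be read
   with [0 * +oo = +oo]; the third condition restores this and only excludes the
   weights that vanish almost everywhere. *)
Definition strong_A2 (n : nat) (a : pt R n -> R) :=
  [/\ (forall z, 0 <= a z),
      loc_integrable setT a,
      (forall S, is_rectangle S ->
         \int[@vol n]_(z in S) ((a z)%:E^-1)%E < +oo)%E &
      (ereal_sup [set average S (fun z => (a z)%:E) *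
                      average S (fun z => (a z)%:E^-1) |
                      S in @is_rectangle n] < +oo)%E].

Definition L2norm (n : nat) (a : pt R n -> R) (P : set (pt R n))
    (f : pt R n -> R) : \bar R :=
  ((\int[@vol n]_(z in P) (f z ^+ 2 * a z)%:E) `^ 2^-1)%E.

Definition in_L2 (n : nat) (a : pt R n -> R) (P : set (pt R n))
    (f : pt R n -> R) :=
  measurable_fun (P : set (mpt R n)) f /\ (L2norm a P f < +oo)%E.

(* C^infinity: all iterated directional derivatives exist and are continuous. *)
Definition smooth (n : nat) (f : pt R n -> R) := forall s : seq (pt R n),
  let g := foldr (fun e g => 'D_e g) f s in
  continuous g /\ forall z e, derivable g z e.

Definition test_function (n : nat) (U : set (pt R n)) (phi : pt R n -> R) :=
  [/\ smooth phi, compact (closure [set z | phi z != 0]) &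
      closure [set z | phi z != 0] `<=` U].

(* [w] is the weak derivative of [u] in the direction [e] in the interior of
   [P]; the boundary of [P] is negligible in what follows, and the measurability
   of [w] on [P] only restricts its values there. *)
Definition weak_derivative (n : nat) (P : set (pt R n)) (u : pt R n -> R)
    (e : pt R n) (w : pt R n -> R) :=
  [/\ loc_integrable P° u, loc_integrable P° w, measurable_fun (P : set (mpt R n)) w &
      forall phi, test_function P° phi ->
        \int[@vol n]_(z in P°) (u z * 'D_e phi z) =
        - \int[@vol n]_(z in P°) (w z * phi z)].

(* [g] is the trace of [u] on the hypersurface parametrised by [psi] on [D],
   the latter being equipped with the measure [nu]: the trace is the continuous
   extension of the restriction of smooth functions. Continuity refers to the
   norm [|u|_{L^1(P)} + \sum_i |w i|_{L^1(P)}], where [w i] is the weak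
   derivative of [u] in the direction [e i]; only derivatives in directions
   that control the trace are to be listed. *)
Definition has_trace (n : nat) (P : set (pt R n)) (u : pt R n -> R)
    (I : Type) (e : I -> pt R n) (w : I -> pt R n -> R)
    (d : measure_display) (T : measurableType d) (nu : set T -> \bar R)
    (D : set T) (psi : T -> pt R n) (g : pt R n -> R) :=
  nu.-integrable D (EFin \o g \o psi) /\
  exists u_ : nat -> pt R n -> R,
    [/\ (forall k, smooth (u_ k)),
        (\int[@vol n]_(z in P) `|u_ k z - u z|%:E)%E @[k --> \oo] --> 0%E,
        (forall i, (\int[@vol n]_(z in P) `|'D_(e i) (u_ k) z - w i z|%:E)%E
                     @[k --> \oo] --> 0%E) &
        (\int[nu]_(s in D) `|u_ k (psi s) - g (psi s)|%:E)%E
          @[k --> \oo] --> 0%E].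

Definition simplex (n k : nat) (v : 'I_k -> 'rV[R]_n) : set 'rV[R]_n :=
  [set x : 'rV[R]_n | exists2 l : 'I_k -> R, (forall i, 0 <= l i) /\ \sum_i l i = 1 &
           x = \sum_i l i *: v i].

Definition edges (n k : nat) (v : 'I_k.+1 -> 'rV[R]_n) : 'M[R]_(k, n) :=
  \matrix_i (v (lift ord0 i) - v ord0).

Definition affinely_independent (n k : nat) (v : 'I_k.+1 -> 'rV[R]_n) :=
  row_free (edges v).

Definition diameter (n : nat) (K : set 'rV[R]_n) : R :=
  sup [set enorm (x - z) | x in K & z in K].

Definition inner_diameter (n : nat) (K : set 'rV[R]_n) : R :=
  sup [set 2 * r | r in [set r | 0 < r /\
    exists c : 'rV[R]_n, [set x | enorm (x - c) <= r] `<=` K]].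

Definition face (n k : nat) (v : 'I_k.+1 -> 'rV[R]_n) (i : 'I_k.+1) :
  'I_k -> 'rV[R]_n := v \o lift i.

Definition unit_normal (n k : nat) (F : 'I_k.+1 -> 'rV[R]_n) (nu : 'rV[R]_n) :=
  enorm nu = 1 /\ forall i, dot (row i (edges F)) nu = 0.

Definition unit_simplex (k : nat) : set 'rV[R]_k :=
  [set t : 'rV[R]_k | (forall i, 0 <= t ord0 i) /\ \sum_i t ord0 i <= 1].

(* Parametrisation of [simplex F * R] by [unit_simplex * R]. Its Jacobian is
   the square root of the Gram determinant of the edges. *)
Definition face_param (n k : nat) (F : 'I_k.+1 -> 'rV[R]_n) (s : pt R k) :
  pt R n := (F ord0 + s.1 *m edges F, s.2).

Definition face_jacobian (n k : nat) (F : 'I_k.+1 -> 'rV[R]_n) : R :=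
  Num.sqrt (\det (edges F *m (edges F)^T)).

(* Surface integral over [simplex F * [y0, y1]]; for [k = 0], [simplex F] is a
   point carrying a unit mass. *)
Definition lateral_integral (n k : nat) (F : 'I_k.+1 -> 'rV[R]_n) (y0 y1 : R)
    (f : pt R n -> R) : R :=
  face_jacobian F *
  \int[@vol k]_(s in @unit_simplex k `*` `[y0, y1]) f (face_param F s).

Definition prism (n : nat) (v : 'I_n.+1 -> 'rV[R]_n) (y0 y1 : R) :
  set (pt R n) := simplex v `*` `[y0, y1].

(* The dimension is [m.+1], so that faces are [m]-simplices. [q] is the
   interpolate [Pi_K tau] of a field [tau] with weak derivatives
   [d tau_i / d x_j = Dx _ i j]; these alone control the traces on the lateral
   faces. *)
Definition is_Pi_K (m : nat) (v : 'I_m.+2 -> 'rV[R]_m.+1) (y0 y1 : R)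
    (tau : pt R m.+1 -> 'rV[R]_m.+1) (Dx : pt R m.+1 -> 'M[R]_m.+1)
    (q : 'rV[R]_m.+1 -> 'rV[R]_m.+1) :=
  (exists (A : 'rV[R]_m.+1) (b : R), forall x, q x = A + b *: x) /\
  forall i (nu : 'rV[R]_m.+1), unit_normal (face v i) nu ->
    exists2 g : pt R m.+1 -> 'rV[R]_m.+1,
      (forall j, has_trace (prism v y0 y1) (fun z => tau z ord0 j)
         (@e_x m.+1) (fun k z => Dx z j k)
         (@vol m) (@unit_simplex m `*` `[y0, y1]) (face_param (face v i))
         (fun z => g z ord0 j)) &
      lateral_integral (face v i) y0 y1 (fun z => dot (q z.1) nu) =
      lateral_integral (face v i) y0 y1 (fun z => dot (g z) nu).

(* [q] is the interpolate [Pi_{n+1} s] of a function [s] with weak derivative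
   [d s / d y = Dy]. *)
Definition is_Pi_y (n : nat) (v : 'I_n.+1 -> 'rV[R]_n) (y0 y1 : R)
    (s Dy : pt R n -> R) (q : R -> R) :=
  (exists A c : R, forall y, q y = A + c * y) /\
  forall y, y \in [:: y0; y1] ->
    exists2 g : pt R n -> R,
      has_trace (prism v y0 y1) s (fun _ : unit => e_y n) (fun _ => Dy)
        (lebesgue_rV n) (simplex v) (fun x => (x, y)) g &
      \int[lebesgue_rV n]_(x in simplex v) q y =
      \int[lebesgue_rV n]_(x in simplex v) g (x, y).

End prismatic.

(* Main.v *)
Require Import Defs.
From HB Require Import structures.
From mathcomp Require Import all_boot all_order all_algebra.
From mathcomp Require Import all_classical all_reals all_analysis.
From mathcomp Require Import measurable_realfun ring lra.

(** Fix a prism [P = K * [y0, y1]], and let [h] be the diameter of [K]. The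
interpolation error is compared with constants: if [c] is close to a function in
the weighted norm, the interpolate minus [c] is a polynomial whose coefficients
are fluxes of the difference through the faces of [P], so that a trace inequality
in [L^1(P)] bounds it by the mean over [P] of the difference and of the
derivatives. Cauchy-Schwarz and the A_2 condition on a rectangle around [P] turn
means over [P] into weighted norms ([L2norm_average]). All rectangles are allowed in
the strong A_2 condition, which is why [h] and [y1 - y0] need not be related; the
shape condition on [K] ensures that [P] fills a fixed part of a rectangle with its
own widths ([prism_fill]).

The constant for the last component is its mean over [P]. The distance of a function
to its mean is bounded by the integral of its derivatives along the segments in [P],
each derivative being weighted by the width of [P] in its direction
([segment_poincare]); averages over rectangles of these proportions are bounded in
the weighted norm ([weighted_segop]), so the usual Poincare inequality holds with
each derivative multiplied by the corresponding width ([weighted_poincare]).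

For the other components only [(y - y0)] times the vertical derivative is
controlled. The prism is therefore cut into layers whose heights decrease
geometrically towards the bottom. On two consecutive layers [y - y0] is comparable
to their height and the previous inequality applies. The means over overlapping
pairs are close to each other, and a slab weighs at most a multiple of any slab
inside it of comparable height, so the differences of the means add up to a
discrete Hardy inequality ([hardy_poincare]).

Traces are obtained by integrating along segments. For a lateral face the segments
start from the opposite vertex at the same height, so only derivatives in [x] are
met ([ray_trace_formula]); for a horizontal face they are vertical
([horizontal_formula]). These formulas hold for smooth functions, and extend to
functions with integrable weak derivatives because smooth functions are dense: on a
convex body, average over small balls whose centres are moved towards an interior
point ([smooth_density]). The fields [x - v k], for [k] running over the vertices,
span the affine fields with scalar linear part, and each has a flux through a single
lateral face ([rt_flux]), which makes the coefficients of the interpolate explicit. *)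

Set Implicit Arguments.
Unset Strict Implicit.
Unset Printing Implicit Defensive.

Import Order.TTheory GRing.Theory Num.Theory.
Import numFieldNormedType.Exports.

Local Open Scope classical_set_scope.
Local Open Scope ring_scope.

(** * Integration over products and affine changes of variables *)

Section tonelli.
Local Open Scope ereal_scope.
Context d1 d2 {T1 : measurableType d1} {T2 : measurableType d2} {R : realType}
  (m1 : {sigma_finite_measure set T1 -> \bar R})
  (m2 : {sigma_finite_measure set T2 -> \bar R}).

Lemma tonelli (f : T1 -> T2 -> \bar R) :
  measurable_fun setT (fun p => f p.1 p.2) -> (forall x y, 0 <= f x y) ->
  \int[m1]_x \int[m2]_y f x y = \int[m2]_y \int[m1]_x f x y.
Proof. by move=> mf f0; apply: (fubini_tonelli (fun p => f p.1 p.2)). Qed.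

Lemma integral_section (A : set T1) (B : set T2) (f : T1 -> T2 -> \bar R) :
  \int[m1]_(x in A) \int[m2]_(y in B) f x y =
  \int[m1]_x \int[m2]_y ((fun p => f p.1 p.2) \_ (A `*` B)) (x, y).
Proof.
rewrite integral_mkcond; apply: eq_integral => x _; rewrite patchE.
case: ifPn => [/set_mem Ax|Ax].
  rewrite integral_mkcond; apply: eq_integral => y _; rewrite !patchE /=.
  case: ifPn => [/set_mem By|By]; first by rewrite mem_set.
  by rewrite memNset// => -[_] /mem_set; rewrite (negbTE By).
rewrite integral0_eq// => y _; rewrite patchE memNset// => -[/mem_set /=].
by rewrite (negbTE Ax).
Qed.

Lemma tonelli_in (A : set T1) (B : set T2) (f : T1 -> T2 -> \bar R) :
  measurable A -> measurable B ->
  measurable_fun (A `*` B) (fun p => f p.1 p.2) ->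
  (forall x y, A x -> B y -> 0 <= f x y) ->
  \int[m1]_(x in A) \int[m2]_(y in B) f x y =
  \int[m2]_(y in B) \int[m1]_(x in A) f x y.
Proof.
move=> mA mB mf f0; rewrite integral_section.
rewrite (tonelli (f := fun x y => ((fun p => f p.1 p.2) \_ (A `*` B)) (x, y))).
- rewrite [RHS]integral_mkcond; apply: eq_integral => y _; rewrite patchE.
  case: ifPn => [/set_mem By|By].
    rewrite [RHS]integral_mkcond; apply: eq_integral => x _; rewrite !patchE /=.
    case: ifPn => [/set_mem [Ax _]|]; first by rewrite mem_set.
    by case: ifPn => // /set_mem Ax; rewrite mem_set.
  rewrite integral0_eq// => x _; rewrite patchE memNset// => -[_ /mem_set /=].
  by rewrite (negbTE By).
- have := (measurable_restrictT _ (measurableX mA mB)).1 mf.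
  by congr (measurable_fun _ _); apply/funext => -[].
- by move=> x y; rewrite patchE; case: ifPn => // /set_mem[]; exact: f0.
Qed.

Lemma integral_prod_in (A : set T1) (B : set T2) (f : T1 * T2 -> \bar R) :
  measurable A -> measurable B ->
  measurable_fun (A `*` B) f -> (forall p, (A `*` B) p -> 0 <= f p) ->
  \int[m1 \x m2]_(p in A `*` B) f p = \int[m1]_(x in A) \int[m2]_(y in B) f (x, y).
Proof.
move=> mA mB mf f0; rewrite integral_mkcond fubini_tonelli1.
- rewrite integral_section; apply: eq_integral => x _; apply: eq_integral => y _.
  by rewrite !patchE; case: ifP.
- exact: (measurable_restrictT _ (measurableX mA mB)).1.
- by move=> p; rewrite patchE; case: ifPn => // /set_mem; exact: f0.
Qed.

Lemma measurable_integral_in (A : set T1) (B : set T2) (f : T1 -> T2 -> \bar R) :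
  measurable A -> measurable B ->
  measurable_fun (A `*` B) (fun p => f p.1 p.2) ->
  (forall x y, A x -> B y -> 0 <= f x y) ->
  measurable_fun A (fun x => \int[m2]_(y in B) f x y).
Proof.
move=> mA mB mf f0.
pose F x := \int[m2]_y ((fun p => f p.1 p.2) \_ (A `*` B)) (x, y).
have mF : measurable_fun setT F.
  apply: (measurable_fun_fubini_tonelli_F ((fun p => f p.1 p.2) \_ (A `*` B))).
    by apply/measurable_restrict => //; [exact: measurableX|rewrite setTI].
  by move=> [x y]; rewrite patchE; case: ifPn => // /set_mem[]; exact: f0.
apply: eq_measurable_fun (measurable_funTS mF) => x /set_mem Ax.
rewrite /F [RHS]integral_mkcond; apply: eq_integral => y _; rewrite !patchE /=.
case: ifPn => [/set_mem [_ By]|]; first by rewrite mem_set.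
by case: ifPn => // /set_mem By; rewrite mem_set.
Qed.

End tonelli.

Section lebesgue_affine.
Context {R : realType}.
Notation mu := (@lebesgue_measure R).

Lemma measurable_affine1 (r w : R) :
  measurable_fun setT (fun t : measurableTypeR R => r * t + w : measurableTypeR R).
Proof. by apply: measurable_funD => //; apply: measurable_funM. Qed.

(** The image of Lebesgue measure under an affine map agrees, up to the factor [r],
with Lebesgue measure on half-open intervals, which determine the measure. *)
Lemma ge0_integral_affine1 (r w : R) (f : measurableTypeR R -> \bar R) : 0 < r ->
  measurable_fun setT f -> (forall t, 0 <= f t)%E ->
  (\int[mu]_t f (r * t + w)%R = r^-1%:E * \int[mu]_t f t)%E.
Proof.
move=> r0 mf f0.
have mphi := @measurable_affine1 r w.
pose nu := measure_function_pushforward__canonical__measure_function_Measure mu mphi.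
pose r' : {nonneg R} := NngNum (ltW r0).
have E : forall A, measurable A -> mu A = mscale r' nu A.
  apply: lebesgue_measure_unique => X [[a b] _ <-] /=.
  rewrite /mscale /= /pushforward.
  have -> : (fun t : measurableTypeR R => (r * t + w)) @^-1` `]a, b] =
    `](a - w) / r, (b - w) / r]%classic.
    apply/seteqP; split => t /=; rewrite !in_itv/= ltr_pdivrMr// ler_pdivlMr//
      ltrBlDr lerBrDr mulrC//.
  rewrite !lebesgue_measure_itv /=.
  rewrite !lte_fin ltr_pM2r ?invr_gt0// ltrD2r.
  case: ifPn => _; last by rewrite mule0.
  rewrite -EFinD -EFinM; congr (_%:E).
  by field; rewrite gt_eqF.
have -> : (\int[mu]_t f t = \int[mscale r' nu]_t f t)%E.
  by apply: eq_measure_integral => A mA _; exact: E.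
rewrite ge0_integral_mscale//= ge0_integral_pushforward//.
by rewrite muleA -EFinM mulVf ?gt_eqF// mul1e.
Qed.

End lebesgue_affine.

Section rV_integral.
Context {R : realType}.
Local Open Scope ereal_scope.

Lemma ge0_integral_rV0 (f : 'rV[R]_0 -> \bar R) : measurable_fun setT f ->
  \int[lebesgue_rV 0]_x f x = f 0%R.
Proof. by move=> mf; rewrite integral_dirac// diracT mul1e. Qed.

Lemma ge0_integral_rVS n (f : 'rV[R]_n.+1 -> \bar R) :
  measurable_fun setT f -> (forall x, 0 <= f x) ->
  \int[lebesgue_rV n.+1]_x f x =
  \int[@lebesgue_measure R]_t \int[lebesgue_rV n]_x f (rV_cons (t, x)).
Proof.
move=> mf f0; rewrite /= ge0_integral_pushforward//; last exact: measurable_rV_cons.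
rewrite preimage_setT fubini_tonelli1//.
- by apply: (measurableT_comp mf); exact: measurable_rV_cons.
- by move=> x /=.
Qed.

Lemma rV_cons_affine n (r : R) (p q : R * 'rV[R]_n) :
  (r *: rV_cons p + rV_cons q = rV_cons (r * p.1 + q.1, r *: p.2 + q.2))%R.
Proof. by apply/rowP => i; rewrite !mxE; case: unlift => [j|//]; rewrite !mxE. Qed.

Lemma rV_consE n (x : 'rV[R]_n.+1) :
  x = rV_cons (x ord0 ord0, \row_j x ord0 (lift ord0 j)).
Proof.
apply/rowP => i; rewrite mxE; case: unliftP => [j ->|->]//=; by rewrite mxE.
Qed.

Lemma measurable_rV_affine n (r : R) (w : 'rV[R]_n) :
  measurable_fun setT (fun x : 'rV[R]_n => r *: x + w)%R.
Proof.
apply: measurable_fun_rV => i.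
rewrite (_ : _ \o _ = fun x => (r * rV_coord i x + w ord0 i)%R); last first.
  by apply/funext => x; rewrite /rV_coord /= !mxE.
apply: measurable_funD => //; apply: measurable_funM => //.
exact: measurable_rV_coord.
Qed.

(** By induction on the dimension, splitting off one coordinate with [rV_cons]. *)
Lemma ge0_integral_affine n (r : R) (w : 'rV[R]_n) (f : 'rV[R]_n -> \bar R) :
  (0 < r)%R -> measurable_fun setT f -> (forall t, 0 <= f t) ->
  \int[lebesgue_rV n]_x f (r *: x + w)%R =
  (r^-1 ^+ n)%:E * \int[lebesgue_rV n]_x f x.
Proof.
move=> r0; elim: n => [|n ih] in w f *.
  move=> mf f0; rewrite !ge0_integral_rV0//; last first.
    by apply: (measurableT_comp mf); exact: measurable_rV_affine.
  by rewrite expr0 mul1e; congr f; apply/rowP => -[].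
move=> mf f0.
rewrite !ge0_integral_rVS//; last first.
  by apply: (measurableT_comp mf); exact: measurable_rV_affine.
have mfc : measurable_fun setT (fun p => f (rV_cons p)).
  by apply: (measurableT_comp mf); exact: measurable_rV_cons.
rewrite {1}(rV_consE w); set w0 := w _ _; set w' := \row_j _.
under eq_integral => t _.
  under eq_integral => x _ do rewrite rV_cons_affine/=.
  rewrite (ih w' (fun x => f (rV_cons (r * t + w0, x)%R)))//; last first.
    apply: (measurableT_comp mfc); exact: measurable_pair1.
  over.
have mF : measurable_fun setT
    (fun s : measurableTypeR R => \int[lebesgue_rV n]_x f (rV_cons (s, x))).
  by apply: (measurable_fun_fubini_tonelli_F (fun p => f (rV_cons p))).
rewrite ge0_integralZl.
- rewrite (@ge0_integral_affine1 R r w0 (fun s => \int[lebesgue_rV n]_x f (rV_cons (s, x)))) => //.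
    by rewrite muleA -EFinM exprSr.
  by move=> t; apply: integral_ge0 => x _; exact: f0.
- exact: measurableT.
- apply: (measurableT_comp mF); exact: measurable_affine1.
- by move=> t _; apply: integral_ge0 => x _; exact: f0.
- by rewrite lee_fin exprn_ge0// invr_ge0 ltW.
Qed.

End rV_integral.

(** * Open sets and volumes of boxes *)

Section pt_measurable.
Context {R : realType} {n : nat}.
Notation V := (mpt R n).

Lemma measurable_fun_mptP d (T : measurableType d) (f : T -> V) :
  (forall i, measurable_fun setT (fun t => (f t).1 ord0 i)) ->
  measurable_fun setT (fun t => (f t).2 : measurableTypeR R) ->
  measurable_fun setT f.
Proof.
move=> m1 m2; apply/measurable_fun_pairP; split => //.
by apply: measurable_fun_rV.
Qed.

Lemma measurable_mpt1 i : measurable_fun setT (fun z : V => z.1 ord0 i).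
Proof. exact: (measurableT_comp (measurable_rV_coord i) measurable_fst). Qed.

Lemma measurable_mpt2 : measurable_fun setT (fun z : V => z.2).
Proof. exact: measurable_snd. Qed.

Lemma measurable_pt_comb d (T : measurableType d) (c : T -> measurableTypeR R)
    (f g : T -> V) (b : T -> measurableTypeR R) :
  measurable_fun setT c -> measurable_fun setT b ->
  measurable_fun setT f -> measurable_fun setT g ->
  measurable_fun setT (fun t => ((c t : R) *: (f t : pt R n) + (b t : R) *: (g t : pt R n)) : V).
Proof.
move=> mc mb mf mg; apply: measurable_fun_mptP => [i|].
  rewrite (_ : (fun t => _) = fun t => c t * (f t).1 ord0 i + b t * (g t).1 ord0 i); last first.
    by apply/funext => t; rewrite /= !mxE.
  by apply: measurable_funD; apply: measurable_funM => //;
    apply: (measurableT_comp (measurable_mpt1 i)).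
rewrite (_ : (fun t => _) = fun t => c t * (f t).2 + b t * (g t).2)//.
by apply: measurable_funD; apply: measurable_funM => //;
  apply: (measurableT_comp measurable_mpt2).
Qed.

Lemma ballptE (z : pt R n) (r : R) : 0 < r ->
  ball z r = [set w : pt R n | (forall i, `|z.1 ord0 i - w.1 ord0 i| < r) /\ `|z.2 - w.2| < r].
Proof.
move=> r0; apply/seteqP; split => w /=.
  by case=> -[_ h1] h2; split => // i; exact: h1.
by case=> h1 h2; split => //; split => // i j; rewrite ord1; exact: h1.
Qed.

Lemma measurable_ballpt (z : pt R n) (r : R) : 0 < r -> measurable (ball z r : set V).
Proof.
move=> r0; rewrite ballptE//.
rewrite (_ : mkset _ = \bigcap_(i : 'I_n) [set w : V | `|z.1 ord0 i - w.1 ord0 i| < r]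
   `&` [set w : V | `|z.2 - w.2| < r]); last first.
  apply/seteqP; split => w /= [h1 h2]; split => // i; first by move=> _; exact: h1.
  exact: h1.
apply: measurableI.
  apply: fin_bigcap_measurable => [|i _]; first exact: finite_finset.
  rewrite -[X in measurable X]setTI.
  by apply: measurable_fun_ltr => //; apply: measurableT_comp => //;
    apply: measurable_funB => //; exact: measurable_mpt1.
rewrite -[X in measurable X]setTI.
by apply: measurable_fun_ltr => //; apply: measurableT_comp => //;
  apply: measurable_funB => //; exact: measurable_mpt2.
Qed.

(** The sigma-algebra is generated by the coordinates, not by the topology: an open
set has to be written as a countable union of balls, which are boxes, with
rational centres. *)
Lemma open_measurable_pt (U : set (pt R n)) : open U -> measurable (U : set V).
Proof.
move=> oU.
pose c (p : 'rV[rat]_n * rat * nat) : pt R n := (map_mx ratr p.1.1, ratr p.1.2).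
pose r (p : 'rV[rat]_n * rat * nat) : R := p.2.+1%:R^-1.
pose F p : set V := if asbool (ball (c p) (r p) `<=` U) then ball (c p) (r p) else set0.
rewrite (_ : U = \bigcup_p F p); last first.
  apply/seteqP; split => [z Uz|z [p _]]; last by rewrite /F; case: asboolP => // s /s.
  have /nbhs_ballP[e /= e0 eU] : nbhs z U by exact: open_nbhs_nbhs.
  have [k ke] : exists k : nat, k.+1%:R^-1 < e / 2.
    have [k _ /(_ k (leqnn k)) hk] := @near_infty_natSinv_lt R (PosNum (divr_gt0 e0 (ltr0n _ 2))).
    by exists k.
  have k0 : 0 < k.+1%:R^-1 :> R by rewrite invr_gt0.
  have Q (t : R) : exists q : rat, `|t - ratr q| < k.+1%:R^-1.
    have [|q] := @rat_in_itvoo R t (t + k.+1%:R^-1); first by rewrite ltrDl.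
    rewrite in_itv/= => /andP[h1 h2]; exists q.
    by rewrite ltr0_norm ?subr_lt0// opprB ltrBlDl.
  pose p : 'rV[rat]_n * rat * nat :=
    (\row_i projT1 (cid (Q (z.1 ord0 i))), projT1 (cid (Q z.2)), k).
  have zp : ball z (r p) (c p).
    rewrite ballptE//; split => [i|] /=; last by case: cid.
    by rewrite !mxE; case: cid.
  exists p => //; rewrite /F asboolT; first exact: ball_sym.
  apply: subset_trans eU => w /(ball_triangle zp); apply: le_ball.
  by rewrite /r /= [leRHS]splitr lerD // ltW.
apply: countable_bigcupT_measurable => [|p]; first exact: countableP.
rewrite /F; case: ifPn => // _; apply: measurable_ballpt.
by rewrite invr_gt0.
Qed.

End pt_measurable.

Section pt_measure.
Context {R : realType} {n : nat}.
Notation V := (mpt R n).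

Lemma continuous_measurable_pt (f : pt R n -> R) : continuous f ->
  measurable_fun setT (f : V -> R).
Proof.
move=> /continuousP cf; apply: (measurability _ (RGenOpens.measurableE R)).
move=> _ [_ [x [y ->]] <-]; rewrite setTI; apply: open_measurable_pt.
exact/cf/interval_open.
Qed.

Local Open Scope ereal_scope.

Lemma ge0_integral_vol (f : V -> \bar R) : measurable_fun setT f ->
  (forall z, 0 <= f z) ->
  \int[vol (n:=n)]_z f z =
  \int[lebesgue_rV n]_x \int[@lebesgue_measure R]_y f (x, y).
Proof. by move=> mf f0; rewrite /vol fubini_tonelli1. Qed.

Lemma ge0_integral_vol_affine (r : R) (w : pt R n) (f : V -> \bar R) :
  (0 < r)%R -> measurable_fun setT f -> (forall z, 0 <= f z) ->
  \int[vol (n:=n)]_z f ((r *: (z : pt R n) + w)%R : V) =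
  (r^-1 ^+ n.+1)%:E * \int[vol (n:=n)]_z f z.
Proof.
move=> r0 mf f0.
have mphi : measurable_fun setT (fun z : V => (r *: (z : pt R n) + w)%R : V).
  rewrite (_ : (fun z => _) = fun z : V => (r *: (z : pt R n) + 1 *: w)%R).
    exact: measurable_pt_comb.
  by apply/funext => z; rewrite scale1r.
rewrite !ge0_integral_vol//; last exact: (measurableT_comp mf).
have mF := @measurable_fun_fubini_tonelli_F _ _ _ _ R (@lebesgue_measure R) f mf f0.
have F0 x : 0 <= fubini_F (@lebesgue_measure R) f x.
  by apply: integral_ge0 => y _; exact: f0.
have := @ge0_integral_affine R n r w.1 _ r0 mF F0.
rewrite /fubini_F => E.
transitivity ((r^-1)%:E * \int[lebesgue_rV n]_x
  fubini_F (@lebesgue_measure R) f (r *: x + w.1)%R).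
  rewrite -ge0_integralZl//; first last.
  - by rewrite lee_fin invr_ge0 ltW.
  - by apply: (measurableT_comp mF); exact: measurable_rV_affine.
  apply: eq_integral => x _; rewrite /fubini_F.
  rewrite -(@ge0_integral_affine1 R r w.2 (fun y => f ((r *: x + w.1)%R, y)))//.
  by apply: (measurableT_comp mf); exact: measurable_pair1.
by rewrite /fubini_F E muleA -EFinM -exprS.
Qed.

End pt_measure.

Section box_volume.
Context {R : realType}.
Local Open Scope ereal_scope.

Definition rbox n (l u : 'rV[R]_n) : set 'rV[R]_n :=
  [set x | forall i, (l ord0 i <= x ord0 i <= u ord0 i)%R].

Lemma measurable_rbox n (l u : 'rV[R]_n) : measurable (rbox l u).
Proof.
rewrite (_ : rbox l u = \bigcap_(i : 'I_n) [set x | (l ord0 i <= rV_coord i x <= u ord0 i)%R]).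
  apply: fin_bigcap_measurable => [|i _]; first exact: finite_finset.
  rewrite (_ : mkset _ = rV_coord i @^-1` `[l ord0 i, u ord0 i]); last first.
    by apply/seteqP; split => x /=; rewrite in_itv.
  by rewrite -[X in measurable X]setTI; apply: measurable_rV_coord.
by apply/seteqP; split => x h i; [move=> _; exact: (h i)|exact: (h i)].
Qed.

Lemma lebesgue_segment (a b : R) : (a <= b)%R ->
  lebesgue_measure (`[a, b]%classic : set (measurableTypeR R)) = (b - a)%:E.
Proof.
rewrite lebesgue_measure_itv /= lte_fin le_eqVlt => /predU1P[->|->].
  by rewrite ltxx subrr.
by rewrite EFinB.
Qed.

Lemma lebesgue_rbox n (l u : 'rV[R]_n) : (forall i, l ord0 i <= u ord0 i)%R ->
  lebesgue_rV n (rbox l u) = (\prod_i (u ord0 i - l ord0 i)%R)%:E.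
Proof.
elim: n => [|n ih] in l u *.
  by move=> _; rewrite big_ord0 /= diracE mem_set// => -[].
move=> lu.
rewrite /= /lebesgue_rV_step /pushforward.
pose l' := (\row_j l ord0 (lift ord0 j)); pose u' := \row_j u ord0 (lift ord0 j).
rewrite (_ : _ @^-1` _ = `[l ord0 ord0, u ord0 ord0] `*` rbox l' u'); last first.
  apply/seteqP; split => -[t x] /=.
    move=> h; split; first by have := h ord0; rewrite mxE unlift_none /= in_itv.
    by move=> j; have := h (lift ord0 j); rewrite !mxE liftK.
  move=> [h1 h2] i; rewrite mxE; case: unliftP => [j ->|->] /=.
    by have := h2 j; rewrite !mxE.
  by move: h1; rewrite /= in_itv.
rewrite product_measure1E//; last exact: measurable_rbox.
rewrite ih; last by move=> i; rewrite !mxE.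
rewrite big_ord_recl EFinM; congr (_ * _); first exact: lebesgue_segment.
by congr (_%:E); apply: eq_bigr => i _; rewrite !mxE.
Qed.

Lemma measurable_box n (l u : 'rV[R]_n) (c d : R) : measurable (box l u c d : set (mpt R n)).
Proof.
rewrite (_ : box l u c d = rbox l u `*` `[c, d]).
  by apply: measurableX => //; exact: measurable_rbox.
by apply/seteqP; split => -[x y] /= []; rewrite /= in_itv.
Qed.

Lemma vol_box n (l u : 'rV[R]_n) (c d : R) :
  (forall i, l ord0 i <= u ord0 i)%R -> (c <= d)%R ->
  vol (box l u c d : set (mpt R n)) = (\prod_i (u ord0 i - l ord0 i) * (d - c))%:E.
Proof.
move=> lu cd.
rewrite (_ : box l u c d = rbox l u `*` `[c, d]); last first.
  by apply/seteqP; split => -[x y] /= []; rewrite /= in_itv.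
rewrite /vol product_measure1E//; last exact: measurable_rbox.
by rewrite EFinM; congr (_ * _); [exact: lebesgue_rbox|exact: lebesgue_segment].
Qed.

End box_volume.

(** * Linear changes of variables *)

Section linear_change.
Context {R : realType}.
Local Open Scope ereal_scope.

Lemma measurable_mulmx d (T : measurableType d) n k (E : 'M[R]_(n, k)) (f : T -> 'rV[R]_n) :
  measurable_fun setT f -> measurable_fun setT (fun t => f t *m E).
Proof.
move=> mf; apply: measurable_fun_rV => i.
rewrite (_ : _ \o _ = (fun t => \sum_j (f t ord0 j * E j i))%R); last first.
  by apply/funext => t; rewrite /rV_coord /= mxE.
apply: measurable_sum => j; apply: measurable_funM => //.
exact: (measurableT_comp (measurable_rV_coord j)).
Qed.

Lemma measurable_rV_comb d (T : measurableType d) n (c b : T -> measurableTypeR R)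
    (f g : T -> 'rV[R]_n) :
  measurable_fun setT c -> measurable_fun setT b ->
  measurable_fun setT f -> measurable_fun setT g ->
  measurable_fun setT (fun t => (c t : R) *: f t + (b t : R) *: g t)%R.
Proof.
move=> mc mb mf mg; apply: measurable_fun_rV => i.
rewrite (_ : _ \o _ = fun t => (c t * f t ord0 i + b t * g t ord0 i)%R); last first.
  by apply/funext => t; rewrite /rV_coord /= !mxE.
by apply: measurable_funD; apply: measurable_funM => //;
    apply: (measurableT_comp (measurable_rV_coord i)).
Qed.

Lemma measurable_rV_add d (T : measurableType d) n (f g : T -> 'rV[R]_n) :
  measurable_fun setT f -> measurable_fun setT g ->
  measurable_fun setT (fun t => f t + g t)%R.
Proof.
move=> mf mg.
rewrite (_ : (fun t => _) = (fun t => 1 *: f t + 1 *: g t)%R).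
  exact: measurable_rV_comb.
by apply/funext => t; rewrite !scale1r.
Qed.

Definition cube n (r : R) : set 'rV[R]_n := rbox (const_mx (- r))%R (const_mx r).

Lemma cubeE n r (x : 'rV[R]_n) : cube r x <-> forall i, (`|x ord0 i| <= r)%R.
Proof.
by split => h i; have := h i; rewrite !mxE ler_norml.
Qed.

Lemma lebesgue_cube n r : (0 <= r)%R ->
  lebesgue_rV n (cube r) = ((2 * r) ^+ n)%:E.
Proof.
move=> r0; rewrite lebesgue_rbox; last by move=> i; rewrite !mxE; rewrite ge0_cp.
under eq_bigr => i _ do rewrite !mxE opprK -mulr2n -mulr_natl.
by rewrite prodr_const card_ord.
Qed.

Lemma ge0_integral_translate n (w : 'rV[R]_n) (f : 'rV[R]_n -> \bar R) :
  measurable_fun setT f -> (forall t, 0 <= f t) ->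
  \int[lebesgue_rV n]_x f (x + w)%R = \int[lebesgue_rV n]_x f x.
Proof.
move=> mf f0; have := @ge0_integral_affine R n 1 w f ltr01 mf f0.
rewrite invr1 expr1n mul1e => <-.
by apply: eq_integral => x _; rewrite scale1r.
Qed.

Lemma mulmx_coord_le n (E : 'M[R]_n) (x : 'rV[R]_n) r i : (0 <= r)%R ->
  (forall j, `|x ord0 j| <= r)%R ->
  (`|(x *m E) ord0 i| <= r * (1 + \sum_j \sum_k `|E j k|))%R.
Proof.
move=> r0 h; rewrite mxE (le_trans (ler_norm_sum _ _ _))//.
apply: (@le_trans _ _ (\sum_j r * `|E j i|))%R.
  by apply: ler_sum => j _; rewrite normrM ler_wpM2r.
rewrite -mulr_sumr ler_wpM2l// ler_wpDl// ler_sum// => j _.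
by rewrite (bigD1 i)//= lerDl sumr_ge0.
Qed.

(** Translation invariance determines a measure up to a factor: integrate
[f (x E) g (y + x E)] in both orders, with [f] the indicator of a cube. The factor
is [1 / |det E|], here the volume of the preimage of the cube divided by that of
the cube. *)
Lemma ge0_integral_linear n (E : 'M[R]_n) : E \in unitmx ->
  exists2 c : R, (0 < c)%R & forall g : 'rV[R]_n -> \bar R,
    measurable_fun setT g -> (forall x, 0 <= g x) ->
    \int[lebesgue_rV n]_x g (x *m E)%R = c%:E * \int[lebesgue_rV n]_x g x.
Proof.
move=> uE; pose phi (x : 'rV[R]_n) := x *m E.
have mphi : measurable_fun setT phi by exact: measurable_mulmx.
pose B := phi @^-1` cube 1.
have mcube : measurable (@cube n 1) by exact: measurable_rbox.
have mB : measurable B by rewrite -[B]setTI; exact: mphi.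
have S1 (M : 'M[R]_n) : (0 < 1 + \sum_j \sum_k `|M j k|)%R.
  by rewrite ltr_pwDl// sumr_ge0// => j _; rewrite sumr_ge0.
have Bfin : lebesgue_rV n B < +oo.
  pose M := (1 + \sum_j \sum_k `|invmx E j k|)%R.
  apply: (@le_lt_trans _ _ (lebesgue_rV n (cube M))).
    apply: le_measure; rewrite ?inE//; first exact: measurable_rbox.
    move=> x /cubeE Bx; apply/cubeE => i.
    have := @mulmx_coord_le n (invmx E) (phi x) 1%R i ler01 Bx.
    by rewrite mul1r /phi mulmxK.
  by rewrite lebesgue_cube ?ltry//; exact/ltW/S1.
have Bpos : 0 < lebesgue_rV n B.
  pose M := (1 + \sum_j \sum_k `|E j k|)%R.
  apply: (@lt_le_trans _ _ (lebesgue_rV n (cube M^-1))).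
    rewrite lebesgue_cube; last by rewrite invr_ge0; exact/ltW/S1.
    by rewrite lte_fin exprn_gt0// mulr_gt0// invr_gt0; exact: S1.
  apply: le_measure; rewrite ?inE//; first exact: measurable_rbox.
  move=> x /cubeE Bx; apply/cubeE => i.
  have := @mulmx_coord_le n E x _ i (ltW _) Bx.
  by rewrite mulVf ?gt_eqF ?S1// => -> //; rewrite invr_gt0; exact: S1.
have [b bE] : exists b : R, lebesgue_rV n B = b%:E.
  by exists (fine (lebesgue_rV n B)); rewrite fineK// ge0_fin_numE.
exists (b / 2 ^+ n)%R.
  by rewrite divr_gt0 ?exprn_gt0// -lte_fin -bE.
move=> g mg g0.
pose f (x : 'rV[R]_n) : \bar R := (\1_(cube 1) x)%:E.
have mf : measurable_fun setT f by apply/measurable_EFinP; exact: measurable_indic.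
have f0 x : 0 <= f x by rewrite lee_fin.
have fB x : f (phi x) = (\1_B x)%:E by [].
have L : \int[lebesgue_rV n]_x \int[lebesgue_rV n]_y (f (phi x) * g (y + phi x)%R)
    = b%:E * \int[lebesgue_rV n]_x g x.
  under eq_integral => x _.
    rewrite ge0_integralZl//; last by apply: (measurableT_comp mg); exact: measurable_rV_add.
    rewrite ge0_integral_translate// fB muleC.
    over.
  rewrite ge0_integralZl//; first by rewrite integral_indic// setIT muleC; congr (_ * _); exact: bE.
  - by apply/measurable_EFinP; exact: measurable_indic.
  - by apply: integral_ge0.
have U : \int[lebesgue_rV n]_y \int[lebesgue_rV n]_x (f (phi x) * g (y + phi x)%R)
    = (2 ^+ n)%:E * \int[lebesgue_rV n]_x g (phi x).
  transitivity (\int[lebesgue_rV n]_y \int[lebesgue_rV n]_x (f (phi x - y)%R * g (phi x))).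
    apply: eq_integral => y _.
    rewrite -(@ge0_integral_translate n (- (y *m invmx E))%R)//; last first.
    - by move=> x; rewrite mule_ge0.
    - apply: emeasurable_funM; first exact: (measurableT_comp mf).
      by apply: (measurableT_comp mg); exact: measurable_rV_add.
    apply: eq_integral => x _.
    by rewrite /phi mulmxDl mulNmx mulmxKV// addrCA subrr addr0.
  rewrite tonelli /=; first last.
  - by move=> x y; rewrite /= mule_ge0.
  - apply: emeasurable_funM; last first.
      by apply: (measurableT_comp mg); exact: measurableT_comp.
    apply: (measurableT_comp mf).
    rewrite (_ : (fun _ => _) = (fun p : 'rV[R]_n * 'rV[R]_n => 1 *: phi p.2 + (-1) *: p.1)%R).
      by apply: measurable_rV_comb => //; exact: measurableT_comp.
    by apply/funext => p; rewrite scale1r scaleN1r.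
  transitivity (\int[lebesgue_rV n]_x ((2 ^+ n)%:E * g (phi x))); last first.
    by rewrite ge0_integralZl//; exact: (measurableT_comp mg).
  apply: eq_integral => x _.
  rewrite ge0_integralZr//; last first.
    apply: (measurableT_comp mf).
    rewrite (_ : (fun _ => _) = (fun y => (-1) *: y + phi x)%R).
      exact: measurable_rV_affine.
    by apply/funext => y; rewrite scaleN1r addrC.
  congr (_ * _).
  rewrite (_ : (fun y => _) = (fun y => (\1_(rbox (phi x - const_mx 1) (phi x + const_mx 1)) y)%:E)%R); last first.
    apply/funext => y; rewrite /f !indicE; congr (_%:E); congr ((_ : bool)%:R).
    apply/idP/idP; rewrite !inE => h i; have := h i; rewrite !mxE ?ler_norml;
      move=> /andP[h1 h2]; apply/andP; split; lra.
  rewrite integral_indic//; last exact: measurable_rbox.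
  rewrite setIT; apply: etrans.
    by apply: lebesgue_rbox => i; rewrite !mxE; lra.
  rewrite (eq_bigr (fun=> 2%R)); last by move=> i _; rewrite !mxE; lra.
  by rewrite prodr_const card_ord.
have LU : \int[lebesgue_rV n]_x \int[lebesgue_rV n]_y (f (phi x) * g (y + phi x)%R) =
  \int[lebesgue_rV n]_y \int[lebesgue_rV n]_x (f (phi x) * g (y + phi x)%R).
  apply: tonelli; last by move=> x y; rewrite mule_ge0.
  apply: emeasurable_funM; first by apply: (measurableT_comp mf); exact: measurableT_comp.
  by apply: (measurableT_comp mg); apply: measurable_rV_add => //; exact: measurableT_comp.
rewrite L U in LU.
rewrite mulrC EFinM -muleA LU muleA -EFinM mulVf ?mul1e//.
Qed.

End linear_change.

(** * Simplices and prisms swept by segments from a vertex *)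

Section simplex_geometry.
Context {R : realType} {n : nat}.
Implicit Types (v : 'I_n.+1 -> 'rV[R]_n) (x : 'rV[R]_n).

Definition edges_at v (i : 'I_n.+1) : 'M[R]_n := \matrix_j (v (lift i j) - v i).

Lemma sum_vertices (F : 'I_n.+1 -> R) v i : \sum_k F k = 1 ->
  \sum_k F k *: v k = v i + (\row_j F (lift i j)) *m edges_at v i.
Proof.
move=> F1; rewrite mulmx_sum_row (bigD1_ord i)//=.
move: F1; rewrite (bigD1_ord i)//= => /(canRL (addrK _)) ->.
rewrite scalerBl scale1r -addrA; congr (_ + _); rewrite addrC.
rewrite scaler_suml -sumrB; apply: eq_bigr => j _.
by rewrite mxE rowK scalerBr.
Qed.

Lemma simplex_from_vertex v i x : simplex v x <->
  exists2 l : 'rV[R]_n, unit_simplex l & x = v i + l *m edges_at v i.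
Proof.
split=> [[l [l0 l1] ->]|[l [l0 l1] ->]].
  exists (\row_j l (lift i j)); last exact: sum_vertices.
  split=> [j|]; first by rewrite mxE.
  rewrite -l1 (bigD1_ord i)//=; under eq_bigr do rewrite mxE.
  by rewrite lerDr.
pose L k := if unlift i k is Some j then l ord0 j else 1 - \sum_j l ord0 j.
have L1 : \sum_k L k = 1.
  rewrite (bigD1_ord i)//= /L unlift_none.
  by under [X in _ + X]eq_bigr do rewrite liftK; rewrite subrK.
exists L; first split => // k.
  by rewrite /L; case: unlift => // ; rewrite subr_ge0.
rewrite (sum_vertices v i L1); congr (_ + _ *m _).
by apply/rowP => j; rewrite mxE /L liftK.
Qed.

Lemma edges_at_unit v i : affinely_independent v -> edges_at v i \in unitmx.
Proof.
move=> av; have u0 : edges v \in unitmx by rewrite -row_free_unit.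
rewrite -row_free_unit -kermx_eq0; apply/eqP/row_matrixP => j0.
rewrite row0; set l := row j0 _.
have lE : l *m edges_at v i = 0 by apply/eqP; rewrite -sub_kermx row_sub.
pose L k := if unlift i k is Some j then l ord0 j else - \sum_j l ord0 j.
have L0 : \sum_k L k = 0.
  rewrite (bigD1_ord i)//= /L unlift_none.
  by under [X in _ + X]eq_bigr do rewrite liftK; rewrite addNr.
have LE : \sum_k L k *: v k = 0.
  rewrite (bigD1_ord i)//= -[RHS]lE mulmx_sum_row /L unlift_none.
  rewrite scaleNr addrC scaler_suml -sumrB; apply: eq_bigr => j _.
  by rewrite liftK rowK scalerBr.
have : (\row_j L (lift ord0 j)) *m edges v = 0.
  rewrite mulmx_sum_row -[RHS]LE (bigD1_ord ord0)//= addrC.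
  move: L0; rewrite (bigD1_ord ord0)//= => /eqP; rewrite addr_eq0 => /eqP ->.
  rewrite scaleNr scaler_suml -sumrB; apply: eq_bigr => j _.
  by rewrite mxE rowK scalerBr.
move=> /(congr1 (mulmx^~ (invmx (edges v)))); rewrite mulmxK// mul0mx => Lr.
have Ll k : L (lift ord0 k) = 0 by have /rowP/(_ k) := Lr; rewrite !mxE.
have LL k : L k = 0.
  case: (unliftP ord0 k) => [j ->//|->].
  by move: L0; rewrite (bigD1_ord ord0)//= big1 ?addr0// => j _; exact: Ll.
by apply/rowP => j; have := LL (lift i j); rewrite /L liftK => ->; rewrite mxE.
Qed.

Lemma simplexE v i x : affinely_independent v ->
  simplex v x <-> unit_simplex ((x - v i) *m invmx (edges_at v i)).
Proof.
move=> av; have u := edges_at_unit i av.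
split; first by move/(simplex_from_vertex _ i) => [l ul ->]; rewrite addrC addKr mulmxK.
move=> ul; apply/(simplex_from_vertex _ i); eexists; first exact: ul.
by rewrite mulmxKV// addrC subrK.
Qed.

Lemma measurable_unit_simplex k : measurable (@unit_simplex R k).
Proof.
rewrite (_ : @unit_simplex R k = \bigcap_(i : 'I_k) [set x | 0 <= rV_coord i x] `&`
  [set x | \sum_i rV_coord i x <= 1]); last first.
  by apply/seteqP; split => x [h1 h2]; split => // i; [move=> _; exact: h1|exact: h1].
apply: measurableI.
  apply: fin_bigcap_measurable => [|i _]; first exact: finite_finset.
  rewrite -[X in measurable X]setTI; apply: measurable_fun_ler => //.
  exact: measurable_rV_coord.
rewrite -[X in measurable X]setTI; apply: measurable_fun_ler => //.
by apply: measurable_sum => i; exact: measurable_rV_coord.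
Qed.

Lemma measurable_simplex v : affinely_independent v -> measurable (simplex v).
Proof.
move=> av.
rewrite (_ : simplex v = (fun x => (x - v ord0) *m invmx (edges_at v ord0)) @^-1` unit_simplex (k:=n)); last first.
  by apply/seteqP; split => x /(simplexE ord0 x av).
rewrite -[X in measurable X]setTI.
apply: measurable_mulmx => //; last exact: measurable_unit_simplex.
rewrite (_ : (fun _ => _) = (fun x => 1 *: x + (- v ord0))); first exact: measurable_rV_affine.
by apply/funext => x; rewrite scale1r.
Qed.

End simplex_geometry.

Section cone.
Context {R : realType}.
Local Open Scope ereal_scope.

Definition rsum m (x : 'rV[R]_m) : R := (\sum_i x ord0 i)%R.

Lemma measurable_rsum m : measurable_fun setT (@rsum m).
Proof. by apply: measurable_sum => i; exact: measurable_rV_coord. Qed.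

Lemma rsumZ m r (x : 'rV[R]_m) : rsum (r *: x) = (r * rsum x)%R.
Proof. by rewrite /rsum mulr_sumr; apply: eq_bigr => i _; rewrite mxE. Qed.

Lemma unit_simplex_cons m (t : R) (x : 'rV[R]_m) : unit_simplex (rV_cons (t, x)) <->
  [/\ (0 <= t)%R, (forall i, 0 <= x ord0 i)%R & (t + rsum x <= 1)%R].
Proof.
have sE : (\sum_i rV_cons (t, x) ord0 i = t + rsum x)%R.
  rewrite big_ord_recl mxE unlift_none; congr (_ + _)%R.
  by apply: eq_bigr => i _; rewrite mxE liftK.
split=> [[h1 h2]|[h1 h2 h3]].
  split; last by rewrite -sE.
    by have := h1 ord0; rewrite mxE unlift_none.
  by move=> i; have := h1 (lift ord0 i); rewrite mxE liftK.
split; last by rewrite sE.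
by move=> i; rewrite mxE; case: unliftP => [j _|_].
Qed.

(** The unit simplex is the cone from the origin over the face where the coordinates
have sum 1, and [r] is the height in the cone: Fubini after the shear
[t = r - |x|], then the dilation [x = r s]. *)
Lemma integral_unit_simplex_cone m (f : 'rV[R]_m.+1 -> \bar R) :
  measurable_fun setT f -> (forall l, 0 <= f l) ->
  \int[lebesgue_rV m.+1]_(l in unit_simplex (k:=m.+1)) f l =
  \int[@lebesgue_measure R]_(r in `]0%R, 1%R]) ((r ^+ m)%:E *
    \int[lebesgue_rV m]_(s in unit_simplex (k:=m)) f (rV_cons (r * (1 - rsum s), r *: s)%R)).
Proof.
move=> mf f0; pose g := f \_ (unit_simplex (k:=m.+1)).
have mg : measurable_fun setT g.
  exact: (measurable_restrictT _ (@measurable_unit_simplex R m.+1)).1 (measurable_funTS mf).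
have g0 l : 0 <= g l by rewrite /g patchE; case: ifP.
rewrite integral_mkcond -/g ge0_integral_rVS// tonelli//; last first.
  by apply: (measurableT_comp mg); exact: measurable_rV_cons.
transitivity (\int[lebesgue_rV m]_x \int[@lebesgue_measure R]_r g (rV_cons (r - rsum x, x)%R)).
  apply: eq_integral => x _.
  have mgx : measurable_fun setT (fun t : measurableTypeR R => g (rV_cons (t, x))).
    apply: (measurableT_comp mg); apply: (measurableT_comp (@measurable_rV_cons R m)).
    exact: measurable_pair2.
  have := @ge0_integral_affine1 R 1 (- rsum x) _ ltr01 mgx (fun t => g0 _).
  rewrite invr1 mul1e => <-.
  by apply: eq_integral => r _; rewrite mul1r.
have mshear : measurable_fun setT (fun p : 'rV[R]_m * measurableTypeR R =>
    g (rV_cons (p.2 - rsum p.1, p.1)%R)).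
  apply: (measurableT_comp mg); apply: (measurableT_comp (@measurable_rV_cons R m)).
  apply: measurable_fun_pair => //; apply: measurable_funB => //.
  by apply: (measurableT_comp (@measurable_rsum m)).
rewrite tonelli//.
pose G (r : measurableTypeR R) := \int[lebesgue_rV m]_x g (rV_cons (r - rsum x, x)%R).
have mG : measurable_fun setT G.
  exact: (measurable_fun_fubini_tonelli_G _ mshear).
transitivity (\int[@lebesgue_measure R]_(r in `[0%R, 1%R]) G r).
  rewrite [RHS]integral_mkcond; apply: eq_integral => r _; rewrite patchE.
  case: ifPn => // r01; rewrite integral0_eq// => x _.
  rewrite /g patchE memNset// => /unit_simplex_cons[h1 h2 h3].
  move: r01; rewrite notin_setE /= in_itv /=; apply.
  rewrite subrK in h3; rewrite h3 andbT.
  by rewrite subr_ge0 in h1; rewrite (le_trans _ h1)// sumr_ge0.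
rewrite -integral_itv_obnd_cbnd; last exact: measurable_funTS.
apply: eq_integral => r; rewrite inE /= in_itv/= => /andP[r0 r1].
have mh : measurable_fun setT (fun x => g (rV_cons (r - rsum x, x)%R)).
  apply: (measurableT_comp mg); apply: (measurableT_comp (@measurable_rV_cons R m)).
  by apply: measurable_fun_pair => //; apply: measurable_funB => //; exact: measurable_rsum.
have := @ge0_integral_affine R m r 0%R _ r0 mh (fun x => g0 _).
move=> /(congr1 (fun e => (r ^+ m)%:E * e)).
rewrite muleA -EFinM exprVn mulfV ?expf_neq0 ?gt_eqF// mul1e => E; rewrite {1}/G -E; congr (_ * _).
rewrite [RHS]integral_mkcond; apply: eq_integral => s _.
rewrite addr0 rsumZ /g !patchE mulrBr mulr1.
case: ifPn => [/set_mem/unit_simplex_cons[h1 h2 h3]|h].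
  rewrite mem_set//; split => [i|].
    by have := h2 i; rewrite mxE pmulr_rge0.
  by move: h1; rewrite -{1}(mulr1 r) -mulrBr pmulr_rge0// subr_ge0.
rewrite memNset// => -[h1 h2].
move/negP : h; apply; apply/mem_set/unit_simplex_cons; split.
- by rewrite -{1}(mulr1 r) -mulrBr mulr_ge0 ?subr_ge0// ltW.
- by move=> i; rewrite mxE mulr_ge0// ltW.
- by rewrite rsumZ subrK.
Qed.

End cone.

Section prism_integrals.
Local Open Scope ereal_scope.

Lemma integral_vol_setX {R : realType} n (A : set 'rV[R]_n) (B : set (measurableTypeR R))
    (H : mpt R n -> \bar R) : measurable A -> measurable B ->
  measurable_fun (A `*` B) H -> (forall z, (A `*` B) z -> 0 <= H z) ->
  \int[vol (n:=n)]_(z in A `*` B) H z =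
  \int[@lebesgue_measure R]_(y in B) \int[lebesgue_rV n]_(x in A) H (x, y).
Proof.
move=> mA mB mH H0; rewrite integral_mkcond ge0_integral_vol.
- transitivity (\int[lebesgue_rV n]_(x in A) \int[@lebesgue_measure R]_(y in B) H (x, y)).
    rewrite [RHS]integral_section; apply: eq_integral => x _.
    by apply: eq_integral => y _; rewrite !patchE; case: ifP.
  apply: (tonelli_in _ _ (f := fun x y => H (x, y))) => //.
  + by apply: eq_measurable_fun mH => -[].
  + by move=> x y Ax By; apply: H0.
- exact: (measurable_restrictT _ (measurableX mA mB)).1.
- by move=> z; rewrite patchE; case: ifPn => // /set_mem/H0.
Qed.

Context {R : realType} {n : nat}.
Variables (v : 'I_n.+1 -> 'rV[R]_n).
Hypothesis av : affinely_independent v.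
Local Open Scope ereal_scope.

Lemma simplex_change_of_variables i : exists2 c : R, (0 < c)%R &
  forall g : 'rV[R]_n -> \bar R, measurable_fun setT g -> (forall x, 0 <= g x) ->
  \int[lebesgue_rV n]_(l in unit_simplex (k:=n)) g (v i + l *m edges_at v i)%R =
  c%:E * \int[lebesgue_rV n]_(x in simplex v) g x.
Proof.
have u := edges_at_unit i av; have [c c0 cE] := ge0_integral_linear u.
exists c => // g mg g0.
pose h := g \_ (simplex v).
have mh : measurable_fun setT h.
  exact: (measurable_restrictT _ (measurable_simplex av)).1 (measurable_funTS mg).
have h0 x : 0 <= h x by rewrite /h patchE; case: ifP.
have E1 := cE (fun x : 'rV[R]_n => h (x + v i)%R).
have mhv : measurable_fun setT (fun x : 'rV[R]_n => h (x + v i)%R).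
  apply: (measurableT_comp mh).
  rewrite (_ : (fun _ => _) = (fun x : 'rV[R]_n => 1 *: x + v i)%R); first exact: measurable_rV_affine.
  by apply/funext => x; rewrite scale1r.
rewrite ge0_integral_translate// in E1.
rewrite [in RHS]integral_mkcond -/h -E1//.
rewrite integral_mkcond; apply: eq_integral => l _.
rewrite /h !patchE addrC.
case: ifPn => [/set_mem ul|ul].
  by rewrite mem_set// addrC; apply/(simplex_from_vertex _ i); exists l.
rewrite memNset// => /(simplexE i _ av); rewrite addrK mulmxK// => /mem_set ul'.
by rewrite ul' in ul.
Qed.

End prism_integrals.

Section prism_cone.
Context {R : realType} {m : nat}.
Variables (v : 'I_m.+2 -> 'rV[R]_m.+1) (y0 y1 : R).
Hypothesis av : affinely_independent v.
Local Open Scope ereal_scope.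

(** The segment from the vertex [v i] to the point of the opposite face with
parameter [s]. *)
Definition ray i (s : 'rV[R]_m) (r : R) : 'rV[R]_m.+1 :=
  v i + r *: ((face_param (face v i) (s, 0%R)).1 - v i).

Lemma ray_cons i s r :
  (v i + rV_cons (r * (1 - rsum s), r *: s) *m edges_at v i)%R = ray i s r.
Proof.
rewrite /ray /face_param /=; congr (_ + _)%R.
rewrite mulmx_sum_row big_ord_recl mxE unlift_none/=.
rewrite rowK mulmx_sum_row -scalerA addrAC scalerDr.
under eq_bigr => j _ do rewrite rowK mxE liftK mxE -scalerA.
rewrite -scaler_sumr -!scalerDr; congr (r *: _)%R.
under [in RHS]eq_bigr => j _ do rewrite rowK.
rewrite /face /= scalerBl scale1r -[LHS]addrA; congr (_ + _)%R.
rewrite /rsum scaler_suml -sumrN -big_split/=; apply: eq_bigr => j _.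
by rewrite -scalerN -scalerDr opprB addrC addrA subrK.
Qed.

Lemma measurable_ray i : measurable_fun setT
  (fun p : 'rV[R]_m * measurableTypeR R => ray i p.1 p.2).
Proof.
rewrite (_ : (fun _ => _) = (fun p : 'rV[R]_m * measurableTypeR R =>
  1 *: v i + p.2 *: (p.1 *m edges (face v i) + (face v i ord0 - v i)))%R).
  apply: measurable_rV_comb => //; apply: measurable_rV_add => //.
  exact: measurable_mulmx.
by apply/funext => p; rewrite /ray /= scale1r addrAC [(_ - _ + _)%R]addrC.
Qed.

(** The segments from the points above the vertex [v i] to the points of the
opposite lateral face sweep the prism, with a Jacobian proportional to [r ^ m]. *)
Lemma integral_prism_cone i : exists2 c : R, (0 < c)%R &
  forall H : mpt R m.+1 -> \bar R, measurable_fun setT H -> (forall z, 0 <= H z) ->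
  \int[vol (n:=m)]_(s in unit_simplex (k:=m) `*` `[y0, y1])
    \int[@lebesgue_measure R]_(r in `[0%R, 1%R]) ((r ^+ m)%:E * H (ray i s.1 r, s.2)) =
  c%:E * \int[vol (n:=m.+1)]_(z in prism v y0 y1) H z.
Proof.
have [c c0 cE] := simplex_change_of_variables av i.
exists c => // H mH H0.
have mS := @measurable_unit_simplex R m.
have mr (y : R) : measurable_fun setT (fun p : 'rV[R]_m * measurableTypeR R =>
    (p.2 ^+ m)%:E * H (ray i p.1 p.2, y)).
  apply: emeasurable_funM; first by apply/measurable_EFinP; exact: measurable_funX.
  apply: (measurableT_comp mH); apply: measurable_fun_pair => //; exact: measurable_ray.
have mr3 : measurable_fun setT (fun q : (mpt R m) * measurableTypeR R =>
    (q.2 ^+ m)%:E * H (ray i q.1.1 q.2, q.1.2)).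
  apply: emeasurable_funM; first by apply/measurable_EFinP; exact: measurable_funX.
  apply: (measurableT_comp mH); apply: measurable_fun_pair => /=.
    have -> : (fun q : (mpt R m) * measurableTypeR R => ray i q.1.1 q.2) =
      (fun p : 'rV[R]_m * measurableTypeR R => ray i p.1 p.2) \o (fun q => (q.1.1, q.2)).
      by [].
    apply: measurableT_comp; first exact: measurable_ray.
    by apply: measurable_fun_pair => //; exact: measurableT_comp.
  exact: measurableT_comp.
have pos r s y : `[0%R, 1%R]%classic r -> 0 <= (r ^+ m)%:E * H (ray i s r, y).
  by rewrite /= in_itv/= => /andP[r0 _]; rewrite mule_ge0// lee_fin exprn_ge0.
rewrite !integral_vol_setX//; first last.
- by move=> s _; apply: integral_ge0 => r; exact: pos.
- apply: measurable_integral_in => //.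
  + exact: measurableX.
  + exact: measurable_funTS.
  + by move=> s r _; exact: pos.
- exact: measurable_funTS.
- exact: measurable_simplex.
have mHy y : measurable_fun setT (fun x => H (x, y)).
  by apply: (measurableT_comp mH); exact: measurable_pair2.
rewrite -ge0_integralZl//; first last.
- by rewrite lee_fin ltW.
- by move=> y _; apply: integral_ge0.
- apply: (measurable_integral_in _ (f := fun y x => H (x, y))) => //.
    exact: measurable_simplex.
  apply: measurable_funTS; apply: (measurableT_comp mH).
  by apply: measurable_fun_pair.
apply: eq_integral => y _ /=.
rewrite -(cE (fun x => H (x, y)))//.
rewrite (integral_unit_simplex_cone (f := fun l => H (v i + l *m edges_at v i, y)%R))//; last first.
  apply: (measurableT_comp (mHy y)); apply: measurable_rV_add => //.
  exact: measurable_mulmx.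
rewrite (tonelli_in _ _ (f := fun (s : 'rV[R]_m) (r : measurableTypeR R) =>
  ((r : R) ^+ m)%:E * H (ray i s r, y))) //; first last.
- by move=> s r _; exact: pos.
- exact: measurable_funTS.
rewrite -integral_itv_obnd_cbnd; last first.
  apply: (measurable_integral_in _ (f := fun (r : measurableTypeR R) (s : 'rV[R]_m) =>
    ((r : R) ^+ m)%:E * H (ray i s r, y))) => //.
    apply: measurable_funTS.
    have -> : (fun p : measurableTypeR R * 'rV[R]_m => ((p.1 : R) ^+ m)%:E * H (ray i p.2 p.1, y)) =
      (fun p : 'rV[R]_m * measurableTypeR R => (p.2 ^+ m)%:E * H (ray i p.1 p.2, y)) \o (fun q => (q.2, q.1)).
      by [].
    by apply: measurableT_comp => //; exact: measurable_fun_pair.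
  move=> r s; rewrite /= in_itv/= => /andP[r0 r1] _; apply: pos.
  by rewrite /= in_itv/= ltW.
apply: eq_integral => r; rewrite inE /= in_itv/= => /andP[r0 r1].
rewrite ge0_integralZl//; last by rewrite lee_fin exprn_ge0// ltW.
  by congr (_ * _); apply: eq_integral => s _; rewrite ray_cons.
apply: measurable_funTS; apply: (measurableT_comp (mHy y)).
have -> : ray i ^~ r = (fun p : 'rV[R]_m * measurableTypeR R => ray i p.1 p.2) \o (fun s => (s, r)) by [].
by apply: measurableT_comp; [exact: measurable_ray|exact: measurable_pair2].
Qed.

End prism_cone.

(** * Smooth functions and bump functions *)

Section bump1.
Context {R : realType}.

(** [theta 0] is the classical flat function [exp (- 1 / x)]. The powers of [1 / x]
make the family stable under derivation, up to sums. *)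
Definition theta (k : nat) (x : R) : R := if 0 < x then x^-1 ^+ k * expR (- x^-1) else 0.

Lemma theta_ge0 k x : 0 <= theta k x.
Proof. by rewrite /theta; case: ifP => // x0; rewrite mulr_ge0 ?expR_ge0// exprn_ge0// invr_ge0 ltW. Qed.

Lemma theta_gt0 x : 0 < x -> 0 < theta 0 x.
Proof. by move=> x0; rewrite /theta x0 expr0 mul1r expR_gt0. Qed.

Lemma theta_eq0 k x : x <= 0 -> theta k x = 0.
Proof. by move=> x0; rewrite /theta ltNge x0. Qed.

Lemma thetaS k x : 0 < x -> theta k x = x * theta k.+1 x.
Proof. by move=> x0; rewrite /theta x0 exprS mulrA mulrA mulfV ?mul1r// gt_eqF. Qed.

(** The exponential beats every power: [u ^ k <= k ^ k * exp u]. *)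
Lemma theta_bound k x : theta k.+1 x <= k.+1%:R ^+ k.+1.
Proof.
rewrite /theta; case: ifPn => x0; last by rewrite exprn_ge0.
set u := x^-1; have u0 : 0 <= u by rewrite invr_ge0 ltW.
rewrite expRN ler_pdivrMr ?expR_gt0//.
rewrite -[X in expR X](@divfK R k.+1%:R)// expRM_natr -exprMn.
rewrite lerXn2r ?nnegrE ?mulr_ge0 ?expR_ge0//.
rewrite -ler_pdivrMl// mulrC (le_trans _ (expR_ge1Dx _))//.
by rewrite lerDr.
Qed.

(** At the origin the difference quotient is [h * theta k.+2 h], and [theta k.+2] is
bounded. *)
Lemma is_derive_theta (k : nat) (x : R) :
  is_derive x (1:R) (theta k) (theta k.+2 x - k%:R * theta k.+1 x).
Proof.
have [x0|x0|->] := ltgtP x 0.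
- rewrite !theta_eq0 ?ltW// mulr0 subr0.
  apply: (@near_eq_is_derive _ _ _ (cst 0)).
  near=> z; rewrite theta_eq0// ltW//.
  by near: z; exact: lt_nbhsl.
- apply: (@near_eq_is_derive _ _ _ ((fun z => z^-1) ^+ k * (expR \o (- (fun z => z^-1))))).
    near=> z; rewrite /theta ifT; last by near: z; exact: lt_nbhsr.
    by rewrite /= fctE /= exprfctE.
  have x0' : x != 0 by rewrite gt_eqF.
  have dV : is_derive x (1 : R) (fun z : R => z^-1) (- x ^- 2).
    apply: is_derive_eq; first exact: (@is_deriveV R id x 1 1).
    by rewrite /GRing.scale /= mulr1.
  have dE : is_derive x (1 : R) (expR \o (- (fun z : R => z^-1))) (expR (- x^-1) * x ^- 2).
    apply: is_derive1_comp.
    by apply: is_derive_eq; rewrite opprK.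
  have dX := @is_deriveX R _ _ k x (1:R) _ dV.
  have dM := @is_deriveM R _ _ _ x (1:R) _ _ dX dE.
  apply: is_derive_eq.
  rewrite /theta x0 /GRing.scale /= exprfctE.
  rewrite [in X in _ + X]fctE -!exprVn; clear dX dM dE dV.
  move: (expR (- x^-1)) => E; move: (x^-1) => u.
  by case: k => [|k] /=; rewrite !exprS; ring.
- rewrite !theta_eq0// mulr0 subr0.
  pose C : R := k.+2%:R ^+ k.+2.
  have C0 : 0 < C by rewrite exprn_gt0.
  have L : h^-1 *: (theta k (h *: (1:R) + 0) - theta k 0) @[h --> 0^'] --> (0 : R).
    apply/cvgrPdist_le => e e0; near=> h.
    rewrite sub0r normrN [theta k 0]theta_eq0// subr0 addr0 /GRing.scale /= mulr1.
    have he : `|h| <= e / C.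
      near: h; apply: dnbhs0_le; exact: divr_gt0.
    have [h0|h0] := leP h 0; first by rewrite theta_eq0// mulr0 normr0 ltW.
    rewrite thetaS// mulKf ?gt_eqF// thetaS// normrM [X in _ * X]ger0_norm ?theta_ge0//.
    apply: (@le_trans _ _ (`|h| * C)); first by rewrite ler_wpM2l// theta_bound.
    by rewrite -ler_pdivlMr.
  apply: DeriveDef; first by apply/cvg_ex; exists 0.
  by apply/cvg_lim => //; exact: L.
Unshelve. all: by end_near. Qed.

End bump1.

Section smooth_closed.
Context {R : realType} {n : nat}.
Notation V := (pt R n).

(** Smoothness speaks of all iterated derivatives, so it is proved for a class of
functions stable under derivation, never for one function alone. *)
Lemma smooth_family (S : (V -> R) -> Prop) :
  (forall f, S f -> continuous f) ->
  (forall f z e, S f -> derivable f z e) ->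
  (forall f e, S f -> S ('D_e f)) ->
  forall f, S f -> smooth f.
Proof.
move=> S1 S2 S3 f Sf s /=.
have Sg : S (foldr (fun e g => 'D_e g) f s) by elim: s => //= e s; exact: S3.
by split; [exact: S1|move=> z e; exact: S2].
Qed.

Lemma smooth_derive (f : V -> R) e : smooth f -> smooth ('D_e f).
Proof.
move=> sf s; have := sf (rcons s e).
by rewrite foldr_rcons.
Qed.

Lemma smooth_continuous (f : V -> R) : smooth f -> continuous f.
Proof. by move=> /(_ [::])[]. Qed.

Lemma smooth_derivable (f : V -> R) z e : smooth f -> derivable f z e.
Proof. by move=> /(_ [::])[_]; exact. Qed.

Inductive poly_fun : (V -> R) -> Prop :=
| poly_cst c : poly_fun (cst c)
| poly_lin (f : {linear V -> R}) : continuous f -> poly_fun f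
| poly_add f g : poly_fun f -> poly_fun g -> poly_fun (f + g)
| poly_mul f g : poly_fun f -> poly_fun g -> poly_fun (f * g).

(** The algebra generated by the polynomials and the functions [theta k \o Q]; the
chain rule keeps the directional derivatives of its elements inside. *)
Inductive bump_fun (Q : V -> R) : (V -> R) -> Prop :=
| bump_poly f : poly_fun f -> bump_fun Q f
| bump_theta k : bump_fun Q (theta k \o Q)
| bump_add f g : bump_fun Q f -> bump_fun Q g -> bump_fun Q (f + g)
| bump_mul f g : bump_fun Q f -> bump_fun Q g -> bump_fun Q (f * g).

Lemma poly_fun_diff f z : poly_fun f -> differentiable f z.
Proof.
elim=> [c|g cg|g h _ dg _ dh|g h _ dg _ dh].
- exact: differentiable_cst.
- exact: linear_differentiable.
- exact: differentiableD.
- exact: differentiableM.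
Qed.

Lemma poly_fun_derive f e : poly_fun f -> poly_fun ('D_e f).
Proof.
elim=> [c|g cg|g h pg dg ph dh|g h pg dg ph dh].
- rewrite (_ : 'D_e _ = cst 0); first exact: poly_cst.
  by apply/funext => z; rewrite derive_cst.
- rewrite (_ : 'D_e _ = cst (g e)); first exact: poly_cst.
  apply/funext => z; rewrite deriveE; last exact: linear_differentiable.
  by rewrite diff_lin.
- rewrite (_ : 'D_e _ = 'D_e g + 'D_e h); first exact: poly_add.
  by apply/funext => z; rewrite deriveD//; apply: diff_derivable; exact: poly_fun_diff.
- rewrite (_ : 'D_e _ = g * 'D_e h + h * 'D_e g); first by apply: poly_add; exact: poly_mul.
  by apply/funext => z; rewrite deriveM//; apply: diff_derivable; exact: poly_fun_diff.
Qed.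

Lemma differentiable_theta k (x : R) : differentiable (theta k) x.
Proof. by apply/derivable1_diffP; have [] := is_derive_theta k x. Qed.

Section with_Q.
Variable Q : V -> R.
Hypothesis pQ : poly_fun Q.

Lemma bump_fun_diff f z : bump_fun Q f -> differentiable f z.
Proof.
elim=> [g|k|g h _ dg _ dh|g h _ dg _ dh].
- exact: poly_fun_diff.
- by apply: differentiable_comp; [exact: poly_fun_diff|exact: differentiable_theta].
- exact: differentiableD.
- exact: differentiableM.
Qed.

Lemma bump_fun_derive f e : bump_fun Q f -> bump_fun Q ('D_e f).
Proof.
elim=> [g pg|k|g h pg dg ph dh|g h pg dg ph dh].
- by apply: bump_poly; exact: poly_fun_derive.
- rewrite (_ : 'D_e _ = 'D_e Q * ((theta k.+2 \o Q) + (cst (- k%:R)) * (theta k.+1 \o Q))).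
    apply: bump_mul; first by apply: bump_poly; exact: poly_fun_derive.
    apply: bump_add; first exact: bump_theta.
    by apply: bump_mul; [apply: bump_poly; exact: poly_cst|exact: bump_theta].
  apply/funext => z.
  have dQ := poly_fun_diff z pQ; have dt := differentiable_theta k (Q z).
  rewrite deriveE; last exact: differentiable_comp.
  rewrite diff_comp//= diff1E// derive1E.
  have [_ ->] := is_derive_theta k (Q z).
  by rewrite /GRing.scale /= !fctE /= deriveE// mulNr.
- rewrite (_ : 'D_e _ = 'D_e g + 'D_e h); first exact: bump_add.
  by apply/funext => z; rewrite deriveD//; apply: diff_derivable; exact: bump_fun_diff.
- rewrite (_ : 'D_e _ = g * 'D_e h + h * 'D_e g); first by apply: bump_add; exact: bump_mul.
  by apply/funext => z; rewrite deriveM//; apply: diff_derivable; exact: bump_fun_diff.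
Qed.

Lemma smooth_bump f : bump_fun Q f -> smooth f.
Proof.
apply: smooth_family => [g bg z|g z e bg|g e].
- by apply: differentiable_continuous; exact: bump_fun_diff.
- by apply: diff_derivable; exact: bump_fun_diff.
- exact: bump_fun_derive.
Qed.

End with_Q.

Definition coord1 (i : 'I_n) (z : V) : R := z.1 ord0 i.
Definition coord2 (z : V) : R := z.2.

Lemma coord1_linear i : linear (coord1 i).
Proof. by move=> a x y; rewrite /coord1 /= !mxE. Qed.
HB.instance Definition _ i := GRing.isLinear.Build R V R _ (coord1 i) (coord1_linear i).

Lemma coord2_linear : linear coord2.
Proof. by move=> a x y. Qed.
HB.instance Definition _ := GRing.isLinear.Build R V R _ coord2 coord2_linear.

Lemma continuous_coord1 i : continuous (coord1 i).
Proof.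
move=> z; apply: (@continuous_comp _ _ _ fst (fun x : 'rV[R]_n => x ord0 i)).
  exact: cvg_fst.
exact: coord_continuous.
Qed.

Lemma continuous_coord2 : continuous coord2.
Proof. by move=> z; exact: cvg_snd. Qed.

Definition paraboloid (c : V) (r : R) (z : V) : R :=
  r ^+ 2 - (\sum_i (z.1 ord0 i - c.1 ord0 i) ^+ 2 + (z.2 - c.2) ^+ 2).

Lemma poly_fun_paraboloid c r : poly_fun (paraboloid c r).
Proof.
pose sq (f : V -> R) (a : R) := (f + cst (- a)) * (f + cst (- a)).
have psq f a : poly_fun f -> poly_fun (sq f a).
  by move=> pf; apply: poly_mul; apply: poly_add => //; exact: poly_cst.
pose S (s : seq 'I_n) (z : V) := \sum_(i <- s) (z.1 ord0 i - c.1 ord0 i) ^+ 2.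
have pS s : poly_fun (S s).
  elim: s => [|i s ih].
    rewrite (_ : S _ = cst 0); first exact: poly_cst.
    by apply/funext => z; rewrite /S big_nil.
  rewrite (_ : S _ = sq (coord1 i) (c.1 ord0 i) + S s).
    by apply: poly_add => //; apply: psq; apply: poly_lin; exact: continuous_coord1.
  by apply/funext => z; rewrite /S big_cons /sq !fctE expr2.
rewrite (_ : paraboloid c r = cst (r ^+ 2) + cst (-1) * (S (index_enum 'I_n) + sq coord2 c.2)).
  apply: poly_add; first exact: poly_cst.
  apply: poly_mul; first exact: poly_cst.
  by apply: poly_add => //; apply: psq; apply: poly_lin; exact: continuous_coord2.
by apply/funext => z; rewrite /paraboloid !fctE /= mulN1r /S /sq !fctE expr2.
Qed.

Lemma derivative_support (f : V -> R) e :
  closure [set w | 'D_e f w != 0] `<=` closure [set w | f w != 0].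
Proof.
have cl : closed (closure [set w | f w != 0]) by exact: closed_closure.
apply: subset_trans (closure_subset _) _; last by move=> w /cl.
move=> w /= Dw; apply: contrapT => nw; move: Dw => /eqP; apply.
have : \forall w' \near w, f w' = 0.
  have oc : open (~` closure [set w | f w != 0]) by exact: closed_openC.
  have := open_nbhs_nbhs (conj oc nw); apply: filterS => w' nw'.
  by apply: contrapT => /eqP fw'; apply: nw'; exact: subset_closure.
by move=> /(@near_eq_derive _ _ _ f (cst 0)) ->; rewrite ?derive_cst.
Qed.

Lemma test_derive (U : set V) (f : V -> R) e : test_function U f -> test_function U ('D_e f).
Proof.
move=> [sf cf fU]; split; first exact: smooth_derive.
- apply: subclosed_compact cf _; first exact: closed_closure.
  exact: (@derivative_support f e).
- by apply: subset_trans fU; exact: (@derivative_support f e).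
Qed.

Lemma compact_pt (A : set V) M : closed A -> (forall z, A z -> `|z| <= M) -> compact A.
Proof.
move=> cA bA.
have c1 : compact [set x : 'rV[R]_n | `|x| <= M].
  apply: bounded_closed_compact.
    exists M; split; first exact: num_real.
    by move=> t Mt x /= /le_trans; apply; exact: ltW.
  apply: (@closed_comp _ _ (fun x : 'rV[R]_n => `|x|) [set t | t <= M]); last exact: closed_le.
  by move=> x _; exact: norm_continuous.
have c2 : compact (`[- M, M]%classic : set R) by exact: segment_compact.
apply: subclosed_compact cA (compact_setX c1 c2) _ => -[x y] /bA.
rewrite prod_normE /= ge_max => /andP[hx hy]; split => //=.
by rewrite in_itv /= -ler_norml.
Qed.

Definition bump (c : V) (r : R) : V -> R := theta 0 \o paraboloid c r.

Lemma bump_ge0 c r z : 0 <= bump c r z.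
Proof. exact: theta_ge0. Qed.

Lemma bump_gt0 c r : 0 < r -> 0 < bump c r c.
Proof.
move=> r0; apply: theta_gt0; rewrite /paraboloid subrr expr0n addr0 big1 ?subr0 ?exprn_gt0//.
by move=> i _; rewrite subrr expr0n.
Qed.

Lemma bump_support c r : 0 < r -> [set z | bump c r z != 0] `<=` [set z | `|z - c| <= r].
Proof.
move=> r0 z /=; have [|h] := leP (paraboloid c r z) 0.
  by move=> h; rewrite /bump /= theta_eq0// eqxx.
move=> _; move: h; rewrite subr_gt0 => h.
have sq (t : R) : t ^+ 2 <= r ^+ 2 -> `|t| <= r.
  by rewrite -(real_normK (num_real t)) ler_sqr ?nnegrE// ltW.
rewrite prod_normE ge_max; apply/andP; split.
  rewrite [leLHS]mx_normrE.
  apply/bigmax_leP; split => [|[i0 i] _] /=; first exact: ltW.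
  rewrite ord1 !mxE; apply: sq; apply: le_trans (ltW h).
  rewrite (bigD1 i)//= -addrA lerDl addr_ge0 ?sqr_ge0// sumr_ge0// => j _.
  exact: sqr_ge0.
apply: sq; apply: le_trans (ltW h).
by rewrite lerDr sumr_ge0// => j _; exact: sqr_ge0.
Qed.

Lemma test_bump (U : set V) (c : V) (r : R) : 0 < r -> [set z | `|z - c| <= r] `<=` U ->
  test_function U (bump c r).
Proof.
move=> r0 rU.
have cl : closed [set z : V | `|z - c| <= r].
  apply: (@closed_comp _ _ (fun z : V => `|z - c|) [set t | t <= r]); last exact: closed_le.
  move=> z _; apply: (@continuous_comp _ _ _ (fun z : V => z - c) (fun z : V => `|z|)).
    by apply: continuousB; [exact: cvg_id|exact: cvg_cst].
  exact: norm_continuous.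
have sub : closure [set z | bump c r z != 0] `<=` [set z | `|z - c| <= r].
  by apply: subset_trans (closure_subset (bump_support r0)) _ => z /cl.
split.
- by apply: (@smooth_bump (paraboloid c r)); [exact: poly_fun_paraboloid|exact: bump_theta].
- apply: (@compact_pt _ (r + `|c|)); first exact: closed_closure.
  move=> z /sub /= h; rewrite -[z](subrK c); apply: le_trans (ler_normD _ _) _.
  by rewrite lerD2r.
- exact: subset_trans rU.
Qed.

End smooth_closed.

(** * Directional derivatives of smooth functions *)

Section directional.
Context {R : realType}.

Lemma is_derive_dirP (W : normedModType R) (f : W -> R) (x v : W) (d : R) :
  is_derive x v f d <-> is_derive (0 : R) (1 : R) (fun h => f (h *: v + x)) d.
Proof.
have E : (fun h : R => h^-1 *: (((fun h => f (h *: v + x)) \o shift (0:R)) (h *: (1:R)) -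
   (fun h => f (h *: v + x)) (0:R))) = (fun h => h^-1 *: ((f \o shift x) (h *: v) - f x)).
  by apply/funext => h; rewrite /= addr0 scale0r add0r [h *: 1]mulr1.
by split=> -[h1 h2]; split; move: h1 h2; rewrite /derivable /derive /= -?E //.
Qed.

Lemma is_derive_line (W : normedModType R) (f : W -> R) (q e : W) (s d : R) :
  is_derive (q + s *: e) e f d -> is_derive s (1 : R) (fun s => f (q + s *: e)) d.
Proof.
move=> /is_derive_dirP H.
have -> : (fun s : R => f (q + s *: e)) =
    (fun h => f (h *: e + (q + s *: e))) \o (fun t => t - s).
  by apply/funext => t /=; congr f; rewrite addrCA -scalerDl subrK.
rewrite -[d]mulr1; apply: is_derive1_comp; first by rewrite subrr.
by apply: is_derive_eq; rewrite subr0.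
Qed.

Lemma is_derive_lineZ (W : normedModType R) (f : W -> R) (q e : W) (k d : R) :
  is_derive q e f d -> is_derive q (k *: e) f (k * d).
Proof.
move=> /is_derive_dirP H; apply/is_derive_dirP.
have -> : (fun h : R => f (h *: (k *: e) + q)) =
    (fun h => f (h *: e + q)) \o (fun t => t * k).
  by apply/funext => t /=; rewrite scalerA.
rewrite mulrC; apply: is_derive1_comp; first by rewrite mul0r.
by apply: is_derive_eq; rewrite /GRing.scale /= mulr1 mulr0 add0r.
Qed.

End directional.

Section smooth_calculus.
Context {R : realType} {n : nat}.
Notation V := (pt R n).
Variable f : V -> R.
Hypothesis sf : smooth f.

Lemma smooth_is_derive (z e : V) : is_derive z e f ('D_e f z).
Proof. by apply: derivableP; exact: smooth_derivable. Qed.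

Lemma smooth_line (q e : V) (s : R) : is_derive s (1 : R) (fun s => f (q + s *: e)) ('D_e f (q + s *: e)).
Proof. exact/is_derive_line/smooth_is_derive. Qed.

Lemma line_continuous (q e : V) : continuous (fun s : R => q + s *: e).
Proof.
move=> s; apply: cvgD; first exact: cvg_cst.
by apply: cvgZr_tmp; exact: cvg_id.
Qed.

Lemma smooth_line_continuous (q e : V) : continuous (fun s : R => f (q + s *: e)).
Proof.
move=> s; apply: (@continuous_comp _ _ _ (fun s : R => q + s *: e) f).
  exact: line_continuous.
exact: smooth_continuous.
Qed.

Lemma smooth_MVT (q e : V) : exists2 s : R, `|s| <= 1 & f (q + e) - f q = 'D_e f (q + s *: e).
Proof.
have c01 : {within `[0, 1], continuous (fun s : R => f (q + s *: e))}.
  by apply: continuous_subspaceT; exact: smooth_line_continuous.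
have [s s01 E] := @MVT R _ _ 0 1 ltr01 (fun x _ => smooth_line q e x) c01.
exists s; last by move: E; rewrite scale1r scale0r addr0 subr0 mulr1.
by move: s01; rewrite in_itv /= => /andP[s0 s1]; rewrite ger0_norm ltW.
Qed.

Lemma deriveZdir (z e : V) (k : R) : 'D_(k *: e) f z = k * 'D_e f z.
Proof. by have [_ ->] := is_derive_lineZ k (smooth_is_derive z e). Qed.

(** Smooth functions are only known to have continuous directional derivatives:
split the increment into two, and apply the mean value theorem to the second. *)
Lemma deriveDdir (z a b : V) : 'D_(a + b) f z = 'D_a f z + 'D_b f z.
Proof.
apply/cvg_lim => //.
have La : h^-1 *: (f (h *: a + z) - f z) @[h --> 0^'] --> 'D_a f z.
  have Da : derivable f z a by exact: smooth_derivable.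
  exact: Da.
have Lb : h^-1 *: (f (h *: (a + b) + z) - f (h *: a + z)) @[h --> 0^'] --> 'D_b f z.
  have cDb : continuous ('D_b f) by apply/smooth_continuous/smooth_derive.
  apply/cvgrPdist_le => e e0.
  have /cvgrPdist_le/(_ _ e0) := cDb z.
  move=> /nbhs_ballP[d /= d0 Hd].
  near=> h.
  have h0 : h != 0 by near: h; exact: nbhs_dnbhs_neq.
  have [s s1 ->] : exists2 s : R, `|s| <= 1 &
      f (h *: (a + b) + z) - f (h *: a + z) = h * 'D_b f (h *: a + z + s *: (h *: b)).
    have [s s1 E] := smooth_MVT (h *: a + z) (h *: b); exists s => //.
    by rewrite -deriveZdir -E scalerDr addrAC.
  rewrite [_ *: _]mulKf//; apply: Hd.
  rewrite -ball_normE /ball_ /=.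
  have -> : z - (h *: a + z + s *: (h *: b)) = - (h *: (a + s *: b)).
    rewrite scalerDr !scalerA (mulrC s) (addrC (h *: a)) -addrA opprD.
    by rewrite addrA subrr add0r.
  rewrite normrN normrZ.
  have hd : `|h| < d / (`|a| + `|b| + 1).
    by near: h; apply: dnbhs0_lt; rewrite divr_gt0// ltr_wpDl// addr_ge0.
  have ab : 0 < `|a| + `|b| + 1 by rewrite ltr_wpDl// addr_ge0.
  rewrite ltr_pdivlMr// in hd; apply: le_lt_trans hd; rewrite ler_wpM2l//.
  rewrite ler_wpDr// (le_trans (ler_normD _ _))// lerD2l normrZ.
  by rewrite -[leRHS]mul1r ler_wpM2r.
rewrite [X in X @ _](_ : _ = (fun h => h^-1 *: (f (h *: a + z) - f z)) +
   (fun h => h^-1 *: (f (h *: (a + b) + z) - f (h *: a + z)))).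
  exact: (cvgD La Lb).
apply/funext => h; rewrite !fctE /= -scalerDr; congr (_ *: _).
by rewrite [RHS]addrC subrKA.
Unshelve. all: by end_near. Qed.

Lemma derive0dir (z : V) : 'D_0 f z = 0.
Proof. exact: derive0. Qed.

Lemma pt_basis (w : V) : w = \sum_j w.1 ord0 j *: @e_x R n j + w.2 *: e_y n.
Proof.
rewrite /e_x /e_y; apply: injective_projections => /=.
  rewrite raddf_sum /= scaler0 addr0; apply/rowP => k.
  rewrite summxE (bigD1 k)//= !mxE !eqxx mulr1 big1 ?addr0// => j jk.
  by rewrite !mxE eqxx /= eq_sym (negbTE jk) mulr0.
rewrite raddf_sum /= big1 ?add0r; first by rewrite [_ *: 1]mulr1.
by move=> j _; rewrite /= scaler0.
Qed.

Lemma derive_sum_dir (z : V) (I : Type) (s : seq I) (w : I -> V) :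
  'D_(\sum_(j <- s) w j) f z = \sum_(j <- s) 'D_(w j) f z.
Proof.
elim: s => [|j s ih]; first by rewrite !big_nil derive0dir.
by rewrite !big_cons deriveDdir ih.
Qed.

Lemma derive_basis (z w : V) : 'D_w f z =
  \sum_j w.1 ord0 j * 'D_(e_x j) f z + w.2 * 'D_(e_y n) f z.
Proof.
rewrite {1}(pt_basis w) deriveDdir deriveZdir derive_sum_dir.
by congr (_ + _); apply: eq_bigr => j _; rewrite deriveZdir.
Qed.

End smooth_calculus.

Section FTC.
Context {R : realType}.
Notation mu := (@lebesgue_measure R).

Lemma FTC_is_derive (G g : R -> R) (a b : R) : a < b ->
  (forall s, is_derive s (1 : R) G (g s)) -> continuous g ->
  (\int[mu]_(s in `[a, b]) (g s)%:E = (G b - G a)%:E)%E.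
Proof.
move=> ab dG cg.
have cG : continuous G.
  move=> s; apply: differentiable_continuous; apply/derivable1_diffP.
  by have [] := dG s.
rewrite EFinB; apply: continuous_FTC2 => //.
- exact: continuous_subspaceT.
- split; first by move=> x _; have [] := dG x.
  + by apply: cvg_at_right_filter; exact: cG.
  + by apply: cvg_at_left_filter; exact: cG.
- by move=> x _; rewrite derive1E; have [_ ->] := dG x.
Qed.

Lemma smooth_FTC n (f : pt R n -> R) (q e : pt R n) : smooth f ->
  (\int[mu]_(s in `[0%R, 1%R]) ('D_e f (q + s *: e))%:E = (f (q + e) - f q)%:E)%E.
Proof.
move=> sf.
have E := @FTC_is_derive (fun s => f (q + s *: e)) _ 0 1 ltr01 (smooth_line sf q e)
  (@smooth_line_continuous _ _ _ (smooth_derive e sf) q e).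
by rewrite E scale1r scale0r addr0.
Qed.

End FTC.

(** * Convex bodies *)

Section convex_body.
Context {R : realType} {n : nat}.
Notation V := (pt R n).
Notation vol := (@vol R n).
Implicit Types (P : set V) (z w c : V).

Definition convex_body P :=
  [/\ measurable (P : set (mpt R n)), (exists M, forall z, P z -> `|z| <= M),
      (forall z w t, P z -> P w -> 0 <= t <= 1 -> P ((1 - t) *: z + t *: w)) &
      P° !=set0].

Lemma normpt_leP z (M : R) : 0 <= M ->
  `|z| <= M <-> (forall i, `|z.1 ord0 i| <= M) /\ `|z.2| <= M.
Proof.
move=> M0; rewrite prod_normE ge_max; split=> [/andP[h1 h2]|[h1 h2]].
  split => // i; apply: le_trans h1; rewrite [leRHS]mx_normrE.
  exact: (le_bigmax _ (fun ij : 'I_1 * 'I_n => `|z.1 ij.1 ij.2|) (ord0, i)).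
apply/andP; split => //; rewrite [leLHS]mx_normrE.
by apply/bigmax_leP; split => // -[i0 i] _ /=; rewrite ord1.
Qed.

Lemma cballE c (r : R) : 0 <= r -> [set z : V | `|z - c| <= r] =
  box (c.1 - const_mx r) (c.1 + const_mx r) (c.2 - r) (c.2 + r).
Proof.
move=> r0; apply/seteqP; split => z /=.
  move=> /(normpt_leP _ r0)[h1 h2]; split.
    by move=> i; have := h1 i; rewrite !mxE ler_distl.
  by move: h2; rewrite ler_distl.
move=> [h1 h2]; apply/normpt_leP => //; split.
  by move=> i; have := h1 i; rewrite !mxE ler_distl.
by rewrite ler_distl.
Qed.

Lemma measurable_cball c (r : R) : 0 <= r ->
  measurable ([set z : V | `|z - c| <= r] : set (mpt R n)).
Proof. by move=> r0; rewrite cballE//; exact: measurable_box. Qed.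

Lemma vol_cball c (r : R) : 0 <= r ->
  vol [set z : V | `|z - c| <= r] = ((2 * r) ^+ n.+1)%:E.
Proof.
move=> r0; rewrite cballE// vol_box; last 2 first.
- by move=> i; rewrite !mxE; lra.
- by lra.
rewrite (eq_bigr (fun=> 2 * r)); last by move=> i _; rewrite !mxE; lra.
by rewrite prodr_const card_ord exprSr; congr (_ * _)%:E; lra.
Qed.

Section body.
Variable P : set V.
Hypothesis bP : convex_body P.

Lemma body_measurable : measurable (P : set (mpt R n)).
Proof. by case: bP. Qed.

Lemma body_ball : exists c, exists2 r : R, 0 < r & [set z | `|z - c| <= r] `<=` P.
Proof.
case: bP => _ _ _ [c]; rewrite /interior => /nbhs_ballP[r /= r0 rP].
exists c, (r / 2); first by rewrite divr_gt0.
move=> z /= h; apply: rP; rewrite -ball_normE /ball_ /= distrC.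
by rewrite (le_lt_trans h)// gtr_pMr// invf_lt1// ltr1n.
Qed.

Lemma body_fin : (vol P < +oo)%E.
Proof.
case: bP => mP [M PM] _ [c /interior_subset Pc].
have M0 : 0 <= M by rewrite (le_trans _ (PM _ Pc)).
apply: (@le_lt_trans _ _ (vol [set z : V | `|z - 0| <= M])).
  apply: le_measure; rewrite ?inE//; first exact: measurable_cball.
  by move=> z /PM /=; rewrite subr0.
by rewrite vol_cball// ltry.
Qed.

Lemma body_gt0 : (0 < vol P)%E.
Proof.
have [c [r r0 rP]] := body_ball.
apply: (@lt_le_trans _ _ (vol [set z : V | `|z - c| <= r])).
  by rewrite vol_cball ?ltW// lte_fin exprn_gt0// mulr_gt0.
apply: le_measure; rewrite ?inE//; last exact: body_measurable.
by apply: measurable_cball; exact: ltW.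
Qed.

Lemma body_shrink c (r t : R) z : 0 < t <= 1 -> [set z | `|z - c| <= r] `<=` P -> P z ->
  [set w | `|w - ((1 - t) *: z + t *: c)| <= t * r] `<=` P.
Proof.
move=> /andP[t0 t1] rP Pz w /= h.
have -> : w = (1 - t) *: z + t *: (c + t^-1 *: (w - ((1 - t) *: z + t *: c))).
  rewrite scalerDr scalerA mulfV ?gt_eqF// scale1r addrA addrC subrK//.
case: bP => _ _ cvx _; apply: cvx => //; last by rewrite ltW.
apply: rP => /=; rewrite addrAC subrr add0r normrZ gtr0_norm ?invr_gt0//.
by rewrite ler_pdivrMl.
Qed.

Lemma body_shrink_interior c (r t : R) z : 0 < r -> 0 < t <= 1 ->
  [set z | `|z - c| <= r] `<=` P -> P z -> P° ((1 - t) *: z + t *: c).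
Proof.
move=> r0 t01 rP Pz; apply/nbhs_ballP; exists (t * r) => /=.
  by rewrite mulr_gt0//; case/andP: t01.
move=> w; rewrite -ball_normE /ball_ /= distrC => /ltW h.
exact: (body_shrink t01 rP Pz).
Qed.

Lemma measurable_interior : measurable (P° : set (mpt R n)).
Proof. by apply: open_measurable_pt; exact: open_interior. Qed.

(** [(1 - t) P + t c] lies in the interior of [P], and its volume tends to that
of [P]. *)
Lemma body_boundary_null : vol (P `\` P°) = 0%E.
Proof.
have mP := body_measurable; have mI := measurable_interior.
have [c [r r0 rP]] := body_ball.
have I_fin : (vol P° < +oo)%E.
  apply: le_lt_trans body_fin; apply: le_measure; rewrite ?inE//.
  exact: interior_subset.
have P_fin := body_fin.
have H (t : R) : 0 < t < 1 -> (((1 - t) ^+ n.+1)%:E * vol P <= vol P°)%E.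
  move=> /andP[t0 t1]; have t1' : 0 < 1 - t by rewrite subr_gt0.
  pose f (z : mpt R n) : \bar R := (\1_(P°) z)%:E.
  have mf : measurable_fun setT f by apply/measurable_EFinP; exact: measurable_indic.
  have := ge0_integral_vol_affine (t *: c) t1' mf.
  have f0 z : (0 <= f z)%E by rewrite lee_fin.
  move=> /(_ f0).
  have If : (\int[vol]_z f z = vol P°)%E by rewrite integral_indic// setIT.
  rewrite If => E.
  have : (vol P <= \int[vol]_z f ((1 - t) *: (z : V) + t *: c)%R)%E.
    rewrite -[X in (vol X <= _)%E]setIT -integral_indic//.
    apply: ge0_le_integral => //.
    - by apply/measurable_EFinP; exact: measurable_indic.
    - apply: (measurableT_comp mf).
      have -> : (fun z : mpt R n => (1 - t) *: (z : V) + t *: c : mpt R n) =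
        (fun z : mpt R n => (1 - t : R) *: (z : V) + (t : R) *: c : mpt R n) by [].
      exact: measurable_pt_comb.
    - move=> z _; rewrite /f lee_fin !indicE.
      have [/set_mem Pz|_] := boolP (z \in P); last by [].
      by rewrite mem_set//; apply: body_shrink_interior rP Pz => //; rewrite t0 ltW.
  rewrite E => h; apply: le_trans (lee_wpmul2l _ h) _.
    by rewrite lee_fin exprn_ge0// ltW.
  by rewrite muleA -EFinM exprVn mulfV ?mul1e// expf_neq0// gt_eqF.
have Pfin : vol P \is a fin_num by rewrite ge0_fin_numE.
have Ifin : vol P° \is a fin_num by rewrite ge0_fin_numE.
rewrite measureD// setIidr; last exact: interior_subset.
have IP : (vol P° <= vol P)%E.
  by apply: le_measure; rewrite ?inE//; exact: interior_subset.
transitivity (vol P - vol P°)%E; first by [].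
suff -> : vol P° = vol P by rewrite subee.
apply/eqP; rewrite eq_le IP /=.
have I0 : (0 <= vol P°)%E by exact: measure_ge0.
move: (vol P) (vol P°) Pfin Ifin H IP body_gt0 I0 => [a| |] [b| |]//= _ _ H.
rewrite !lee_fin lte_fin => ba a0 b0; rewrite leNgt; apply/negP => ba'.
pose t := (a - b) / (2 * n.+1%:R * a).
have N0 : (0 : R) < n.+1%:R by [].
have t0 : 0 < t by rewrite divr_gt0// ?subr_gt0// !mulr_gt0.
have t1 : t < 1.
  rewrite ltr_pdivrMr ?mul1r; last by rewrite !mulr_gt0.
  rewrite (@le_lt_trans _ _ a)//; first lra.
  by rewrite ltr_pMl// (@lt_le_trans _ _ 2)// ?ltr1n// ler_peMr// ler1n.
have B k : 1 - k%:R * t <= (1 - t) ^+ k.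
  elim: k => [|k ih]; first by rewrite mul0r subr0 expr0.
  rewrite exprS; apply: (@le_trans _ _ ((1 - t) * (1 - k%:R * t))).
    rewrite -natr1; have : 0 <= k%:R * t * t by apply: mulr_ge0; [apply: mulr_ge0|]; rewrite ?ler0n ?(ltW t0).
    lra.
  by rewrite ler_wpM2l// subr_ge0 ltW.
have := H t; rewrite t0 t1 -EFinM lee_fin => /(_ isT).
have : (1 - n.+1%:R * t) * a <= (1 - t) ^+ n.+1 * a by rewrite ler_wpM2r// ltW.
have -> : (1 - n.+1%:R * t) * a = a - (a - b) / 2.
  by rewrite /t; field; rewrite ?gt_eqF//= pnatr_eq0.
lra.
Qed.

End body.
End convex_body.

(** * Density of continuous functions in the integrable functions *)

Section ecvg.
Context {R : realType}.
Local Open Scope ereal_scope.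

Lemma ecvg0P (x : nat -> \bar R) : (forall k, 0 <= x k) ->
  x @ \oo --> 0 <-> forall e : R, (0 < e)%R -> \forall k \near \oo, x k <= e%:E.
Proof.
move=> x0; split=> [/fine_cvgP[fx /cvgrPdist_le cx] e e0|H].
  near=> k.
  have fk : x k \is a fin_num by near: k; exact: fx.
  rewrite -(fineK fk) lee_fin.
  have : (`|0 - fine (x k)| <= e)%R by near: k; exact: cx.
  by rewrite sub0r normrN; exact/le_trans/ler_norm.
have fx : \forall k \near \oo, x k \is a fin_num.
  have := H _ ltr01; apply: filterS => k h.
  by rewrite ge0_fin_numE// (le_lt_trans h)// ltry.
apply/fine_cvgP; split => //; apply/cvgrPdist_le => e e0.
near=> k.
have fk : x k \is a fin_num by near: k.
rewrite sub0r normrN ger0_norm /=; last by rewrite fine_ge0.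
by rewrite -lee_fin fineK//; near: k; exact: H.
Unshelve. all: by end_near. Qed.

End ecvg.

Import HBSimple.

Section L1_density.
Context {R : realType} {n : nat}.
Notation V := (pt R n).
Notation vol := (@vol R n).
Variable P : set V.
Hypothesis bP : convex_body P.
Local Open Scope ereal_scope.

Let mP : measurable (P : set (mpt R n)) := body_measurable bP.
Let P_fin : vol P < +oo := body_fin bP.

Definition L1dist (u v : V -> R) : \bar R := \int[vol]_(z in P) `|u z - v z|%:E.

Lemma L1dist_ge0 u v : 0 <= L1dist u v.
Proof. by apply: integral_ge0. Qed.

Lemma measurable_abs_dist (u v : mpt R n -> R) (D : set (mpt R n)) :
  measurable_fun D u -> measurable_fun D v ->
  measurable_fun D (fun z => `|u z - v z|%:E).
Proof.
move=> mu mv; apply/measurable_EFinP; apply: measurableT_comp => //.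
exact: measurable_funB.
Qed.

Lemma L1dist_triangle u v w :
  measurable_fun (P : set (mpt R n)) u -> measurable_fun (P : set (mpt R n)) v ->
  measurable_fun (P : set (mpt R n)) w ->
  L1dist u w <= L1dist u v + L1dist v w.
Proof.
move=> mu mv mw; rewrite /L1dist -ge0_integralD//; try exact: measurable_abs_dist.
apply: ge0_le_integral => //; try exact: measurable_abs_dist.
  by apply: emeasurable_funD; exact: measurable_abs_dist.
by move=> z _; rewrite -EFinD lee_fin ler_distD.
Qed.

Lemma L1dist_eventually (u : V -> R) (v : nat -> V -> R) :
  measurable_fun setT (u : mpt R n -> R) ->
  (forall k, measurable_fun setT (v k : mpt R n -> R)) ->
  (forall k z, (`|u z - v k z| <= 1)%R) ->
  (forall z, \forall k \near \oo, v k z = u z) ->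
  forall e : R, (0 < e)%R -> exists k, L1dist u (v k) <= e%:E.
Proof.
move=> mu mv uv1 uv e e0.
have [] := @dominated_convergence _ _ R vol P mP (fun k (z : mpt R n) => `|u z - v k z|%:E)
  (cst 0) (cst 1%:E).
- by move=> k; apply: measurable_abs_dist; exact: measurable_funTS.
- exact: measurable_cst.
- apply/aeW => z _; apply: cvg_near_cst; have := uv z; apply: filterS => k ->.
  by rewrite subrr normr0.
- apply/integrableP; split; first exact: measurable_cst.
  rewrite (eq_integral (cst 1%:E)); first by rewrite integral_cst// mul1e.
  by move=> z _; rewrite /= normr1.
- by apply/aeW => z k _; rewrite lee_fin normr_id.
move=> _ _; rewrite integral0 => H.
have [k _ /(_ k (leqnn k)) h] := (ecvg0P (fun k => L1dist_ge0 u (v k))).1 H e e0.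
by exists k.
Qed.

(** The sets with this property form a sigma-algebra, and contain [c < f] for every
continuous [f]; hence all measurable sets have it. *)
Definition set_approx (A : set (mpt R n)) := measurable A /\
  forall e : R, (0 < e)%R -> exists v : V -> R,
    [/\ continuous v, (forall z, 0 <= v z <= 1)%R & L1dist (\1_A) v <= e%:E].

Lemma set_approxC A : set_approx A -> set_approx (~` A).
Proof.
move=> [mA HA]; split; first exact: measurableC.
move=> e /HA [v [cv v01 h]]; exists (fun z => 1 - v z)%R; split.
- by move=> z; apply: cvgB; [exact: cvg_cst|exact: cv].
- by move=> z; have := v01 z; lra.
- apply: le_trans h; rewrite le_eqVlt; apply/orP; left; apply/eqP.
  apply: eq_integral => z _; congr (_%:E).
  rewrite !indicE in_setC; case: (z \in A) => /=.
    by rewrite sub0r opprB distrC.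
  by rewrite sub0r normrN subKr.
Qed.

Lemma set_approxU A B : set_approx A -> set_approx B -> set_approx (A `|` B).
Proof.
move=> [mA HA] [mB HB]; split; first exact: measurableU.
move=> e e0; have e2 : (0 < e / 2)%R by rewrite divr_gt0.
have [v [cv v01 hv]] := HA _ e2; have [w [cw w01 hw]] := HB _ e2.
exists (fun z => Num.max (v z) (w z)); split.
- by move=> z; apply: continuous_max; [exact: cv|exact: cw].
- move=> z; have /andP[? ?] := v01 z; have /andP[? ?] := w01 z.
  by rewrite le_max ge_max; apply/andP; split; apply/orP || apply/andP; [left|split].
rewrite [e]splitr EFinD; apply: le_trans (leeD hv hw).
have mv : measurable_fun setT (v : mpt R n -> R) by exact: continuous_measurable_pt.
have mw : measurable_fun setT (w : mpt R n -> R) by exact: continuous_measurable_pt.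
have mAv : measurable_fun P (fun z : mpt R n => `|\1_A z - v z|%:E).
  by apply: measurable_abs_dist; apply: measurable_funTS => //; exact: measurable_indic.
have mBw : measurable_fun P (fun z : mpt R n => `|\1_B z - w z|%:E).
  by apply: measurable_abs_dist; apply: measurable_funTS => //; exact: measurable_indic.
rewrite /L1dist -ge0_integralD//.
apply: ge0_le_integral => //.
- apply: measurable_abs_dist; apply: measurable_funTS.
    by apply: measurable_indic; exact: measurableU.
  exact: measurable_maxr.
- exact: emeasurable_funD.
move=> z _; rewrite -EFinD lee_fin !indicE in_setU.
have /andP[? ?] := v01 z; have /andP[? ?] := w01 z.
case: (z \in A); case: (z \in B) => /=; case: (leP (v z) (w z)) => ?;
  rewrite ?[(`|1 - _|)%R]ger0_norm ?subr_ge0// ?sub0r ?normrN ?[(`|_|)%R]ger0_norm//; lra.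
Qed.

Lemma set_approxI A B : set_approx A -> set_approx B -> set_approx (A `&` B).
Proof.
move=> HA HB; rewrite -(setCK (A `&` B)) setCI.
by apply: set_approxC; apply: set_approxU; exact: set_approxC.
Qed.

Lemma set_approx0 : set_approx set0.
Proof.
split; first exact: measurable0.
move=> e e0; exists (fun=> 0%R); split.
- by move=> z; exact: cvg_cst.
- by move=> z; rewrite lexx ler01.
- rewrite /L1dist integral0_eq ?lee_fin ?ltW// => z _.
  by rewrite indic0 subrr normr0.
Qed.

Lemma set_approx_bigcup (F : (set (mpt R n))^nat) :
  (forall k, set_approx (F k)) -> set_approx (\bigcup_k F k).
Proof.
move=> HF.
have mF : measurable (\bigcup_k F k) by apply: bigcupT_measurable => k; case: (HF k).
split => // e e0.
have e2 : (0 < e / 2)%R by rewrite divr_gt0.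
pose B k := \big[setU/set0]_(i < k) F i.
have HB k : set_approx (B k).
  rewrite /B; elim: k => [|k ih]; first by rewrite big_ord0; exact: set_approx0.
  by rewrite big_ord_recr; apply: set_approxU.
have [k hk] : exists k, L1dist (\1_(\bigcup_k F k)) (\1_(B k)) <= (e / 2)%:E.
  apply: L1dist_eventually => //.
  - by move=> k; apply: measurable_indic; case: (HB k).
  - move=> k z; rewrite !indicE; case: (_ \in _); case: (_ \in _) => /=;
      by rewrite ?subrr ?subr0 ?sub0r ?normrN ?normr0 ?normr1.
  - move=> z; rewrite !indicE.
    have [/set_mem[i _ Fi]|zF] := boolP (z \in \bigcup_k F k).
      exists i.+1 => // k ik; rewrite indicE mem_set//.
      by rewrite /B -bigcup_mkord; exists i.
    apply: nearW => k; rewrite indicE memNset//.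
    rewrite /B -bigcup_mkord => -[i _ Fi]; move/negP : zF; apply.
    by apply/mem_set; exists i.
have [_ /(_ _ e2)[v [cv v01 hv]]] := HB k.
exists v; split => //; rewrite [e]splitr EFinD; apply: le_trans (leeD hk hv).
apply: L1dist_triangle; apply: measurable_funTS.
- exact: measurable_indic.
- by apply: measurable_indic; case: (HB k).
- exact: continuous_measurable_pt.
Qed.

Lemma set_approx_sigma : sigma_algebra setT set_approx.
Proof.
split; first exact: set_approx0.
- by move=> A HA; rewrite setTD; exact: set_approxC.
- exact: set_approx_bigcup.
Qed.

(** The indicator of this set is the limit of the continuous functions
[min 1 (k * max 0 (f - c))]. *)
Lemma set_approx_half (f : V -> R) c : continuous f -> set_approx [set z | (c < f z)%R].
Proof.
move=> cf.
have mf : measurable_fun setT (f : mpt R n -> R) by exact: continuous_measurable_pt.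
have mA : measurable ([set z | (c < f z)%R] : set (mpt R n)).
  by apply: open_measurable_pt; move/continuousP : cf => /(_ _ (@open_gt _ c)).
split => // e e0.
pose v (k : nat) (z : V) : R := (Num.min 1 (k%:R * Num.max 0 (f z - c)))%R.
have cv k : continuous (v k).
  move=> z; rewrite /v; apply: (@continuous_min _ _ (fun=> 1%R) _ z); first exact: cvg_cst.
  apply: cvgM; first exact: cvg_cst.
  apply: (@continuous_max _ _ (fun=> 0%R) _ z); first exact: cvg_cst.
  by apply: cvgB; [exact: cf|exact: cvg_cst].
have v01 k z : (0 <= v k z <= 1)%R.
  rewrite /v ge_min lexx le_min ler01 /= andbT mulr_ge0//.
  by rewrite le_max lexx.
have [k hk] : exists k, L1dist (\1_[set z | (c < f z)%R]) (v k) <= e%:E.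
  apply: L1dist_eventually => //.
  - by move=> k; exact: continuous_measurable_pt.
  - move=> k z; have := v01 k z; rewrite indicE ler_norml.
    by case: (_ \in _) => /=; lra.
  - move=> z; rewrite indicE; have [zc|zc] := ltP c (f z).
      have d0 : (0 < f z - c)%R by rewrite subr_gt0.
      near=> k; rewrite mem_set// /v (max_idPr _) ?ltW//.
      rewrite (min_idPl _)// -ler_pdivrMr// mul1r.
      by near: k; exact: nbhs_infty_ger.
    apply: nearW => k; rewrite memNset /=; last by rewrite ltNge zc.
    by rewrite /v (max_idPl _) ?subr_le0// mulr0 (min_idPr _)// ler01.
by exists (v k).
Unshelve. all: by end_near. Qed.

Lemma set_approx_preimage (f : V -> R) (B : set (measurableTypeR R)) :
  continuous f -> measurable B -> set_approx (f @^-1` B).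
Proof.
move=> cf; rewrite RGenOInfty.measurableE.
suff : <<s @RGenOInfty.G R >> `<=` [set B | set_approx (f @^-1` B)] by exact.
apply: smallest_sub.
  split => /=; first by rewrite preimage_set0; exact: set_approx0.
  - by move=> A HA; rewrite setTD preimage_setC; exact: set_approxC.
  - by move=> F HF; rewrite preimage_bigcup; exact: set_approx_bigcup.
move=> _ [c ->] /=; rewrite preimage_itvoy; exact: set_approx_half.
Qed.

Lemma measurable_set_approx (A : set (mpt R n)) : measurable A -> set_approx A.
Proof.
rewrite measurable_prod_measurableType.
apply: smallest_sub; first exact: set_approx_sigma.
clear A => _ [A mA] [B mB] <-.
have -> : A `*` B = (fst @^-1` A) `&` (snd @^-1` B) by [].
apply: set_approxI; last first.
  by apply: set_approx_preimage => //; exact: continuous_coord2.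
move: A mA; suff : measurable `<=` [set A : set 'rV[R]_n | set_approx (fst @^-1` A)] by exact.
apply: smallest_sub.
  split => /=; first by rewrite preimage_set0; exact: set_approx0.
  - by move=> A HA; rewrite setTD preimage_setC; exact: set_approxC.
  - by move=> F HF; rewrite preimage_bigcup; exact: set_approx_bigcup.
rewrite -bigcup_seq => _ [i _ [C mC <-]] /=.
rewrite setTI; apply: (@set_approx_preimage (coord1 i)) => //.
exact: continuous_coord1.
Qed.

(** Through simple functions, with [measurable_set_approx] for the indicators. *)
Lemma continuous_dense_L1 (u : V -> R) : vol.-integrable P (EFin \o u) ->
  forall e : R, (0 < e)%R -> exists v : V -> R, continuous v /\ L1dist u v <= e%:E.
Proof.
move=> iu e e0.
have mu : measurable_fun P (u : mpt R n -> R).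
  by move/integrableP : iu => [/measurable_EFinP].
have e2 : (0 < e / 2)%R by rewrite divr_gt0.
have [g [ig _ /ecvg0P H]] := approximation_sfun_integrable mP iu.
have {H}[|k _ /(_ k (leqnn k)) hk] := H _ (e / 2)%R e2.
  by move=> k; exact: integral_ge0.
pose L (f : V -> R) := forall e : R, (0 < e)%R ->
  exists v : V -> R, continuous v /\ L1dist f v <= e%:E.
suff : L (g k).
  move=> /(_ _ e2)[v [cv hv]]; exists v; split => //.
  rewrite [e]splitr EFinD; apply: le_trans (leeD hk hv).
  apply: L1dist_triangle => //; apply: measurable_funTS => //.
  exact: continuous_measurable_pt.
have Lsum (I : Type) (s : seq I) (c : I -> R) (A : I -> set (mpt R n)) :
    (forall i, measurable (A i)) ->
    L (fun z => \sum_(i <- s) c i * \1_(A i) z)%R.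
  move=> mA; elim: s => [|i s ih] d d0.
    exists (fun=> 0%R); split; first by move=> z; exact: cvg_cst.
    rewrite /L1dist integral0_eq ?lee_fin ?ltW// => z _.
    by rewrite big_nil subrr normr0.
  have d2 : (0 < d / 2)%R by rewrite divr_gt0.
  have [v [cv hv]] := ih _ d2.
  have c1 : (0 < `|c i| + 1)%R by rewrite ltr_wpDl.
  have [_ /(_ (d / 2 / (`|c i| + 1))%R)[|w [cw _ hw]]] := measurable_set_approx (mA i).
    by rewrite !divr_gt0.
  have mv : measurable_fun setT (v : mpt R n -> R) by exact: continuous_measurable_pt.
  have mw : measurable_fun setT (w : mpt R n -> R) by exact: continuous_measurable_pt.
  have mS : measurable_fun setT (fun z : mpt R n => \sum_(i <- s) c i * \1_(A i) z)%R.
    by apply: measurable_sum => j; apply: measurable_funM => //; exact: measurable_indic.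
  exists (fun z => c i * w z + v z)%R; split.
    by move=> z; apply: cvgD; [apply: cvgM; [exact: cvg_cst|exact: cw]|exact: cv].
  rewrite [d]splitr EFinD.
  apply: (@le_trans _ _ (`|c i|%:E * L1dist (\1_(A i)) w +
    L1dist (fun z => \sum_(i <- s) c i * \1_(A i) z)%R v)); last first.
    apply: leeD => //; apply: le_trans (lee_wpmul2l _ hw) _; first by rewrite lee_fin.
    rewrite -EFinM lee_fin mulrCA ger_pMr//.
    by rewrite ler_pdivrMr// mul1r lerDl.
  have m1 : measurable_fun P (fun z : mpt R n => `|\1_(A i) z - w z|%:E).
    by apply: measurable_abs_dist; apply: measurable_funTS => //; exact: measurable_indic.
  have m2 : measurable_fun P (fun z : mpt R n => `|\sum_(i <- s) c i * \1_(A i) z - v z|%:E)%R.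
    by apply: measurable_abs_dist; apply: measurable_funTS.
  have m3 : measurable_fun P (fun z : mpt R n => `|c i|%:E * `|\1_(A i) z - w z|%:E).
    exact: measurable_funeM.
  rewrite /L1dist -ge0_integralZl//; last first.
  rewrite -ge0_integralD//; last first.
  apply: ge0_le_integral => //.
  - apply: measurable_abs_dist; apply: measurable_funTS.
      rewrite (_ : (fun _ => _) = (fun z : mpt R n => c i * \1_(A i) z + \sum_(i <- s) c i * \1_(A i) z)%R).
        by apply: measurable_funD => //; apply: measurable_funM => //; exact: measurable_indic.
      by apply/funext => z; rewrite big_cons.
    by apply: measurable_funD => //; apply: measurable_funM.
  - exact: emeasurable_funD.
  move=> z _; rewrite -EFinM -EFinD lee_fin big_cons -normrM mulrBr.
  by rewrite opprD addrACA ler_normD.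
rewrite (_ : g k = (fun z => \sum_(y <- finmap.enum_fset (fset_set (range (g k)))) y * \1_(g k @^-1` [set y]) z)%R :> (V -> R)).
  by apply: Lsum => y.
apply/funext => z; rewrite fimfunE fsbig_finite//=.
Qed.

End L1_density.

(** * Oscillation under a contraction *)

Section bounded_convergence.
Context d (T : measurableType d) {R : realType} (mu : {measure set T -> \bar R}).
Local Open Scope ereal_scope.

Lemma bounded_cvg0 (D : set T) (M : R) (f : nat -> T -> \bar R) :
  measurable D -> mu D < +oo -> (forall k, measurable_fun D (f k)) ->
  (forall k z, D z -> 0 <= f k z <= M%:E) ->
  (forall z, D z -> f k z @[k --> \oo] --> 0) ->
  \int[mu]_(z in D) f k z @[k --> \oo] --> 0.
Proof.
move=> mD fD mf f0 fc.
have [] := @dominated_convergence _ _ R mu D mD f (cst 0) (cst M%:E) mf (measurable_cst _).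
- exact/aeW.
- apply/integrableP; split; first exact: measurable_cst.
  rewrite (eq_integral (cst `|M|%:E)); last by move=> z _.
  by rewrite integral_cst// lte_mul_pinfty.
- apply/aeW => z k Dz; have /andP[h1 h2] := f0 k z Dz.
  by rewrite gee0_abs.
by move=> _ _; rewrite integral0.
Qed.

End bounded_convergence.

Section oscillation.
Context {R : realType} {n : nat}.
Notation V := (pt R n).
Notation vol := (@vol R n).
Variable P : set V.
Hypothesis bP : convex_body P.
Local Open Scope ereal_scope.

Let mP : measurable (P : set (mpt R n)) := body_measurable bP.
Let P_fin : vol P < +oo := body_fin bP.
Let cvx z w t : P z -> P w -> (0 <= t <= 1)%R -> P ((1 - t) *: z + t *: w)%R.
Proof. by case: bP => _ _ h _; exact: h. Qed.

Lemma measurable_pt_affine (s : R) (b : V) :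
  measurable_fun setT (fun z : mpt R n => (s *: (z : V) + b)%R : mpt R n).
Proof.
rewrite (_ : (fun _ => _) = (fun z : mpt R n => (s *: (z : V) + 1 *: b)%R : mpt R n)).
  exact: measurable_pt_comb.
by apply/funext => z; rewrite scale1r.
Qed.

Lemma integral_affine_le (g : mpt R n -> \bar R) (s : R) (b : V) : (0 < s)%R ->
  measurable_fun setT g -> (forall z, 0 <= g z) ->
  (forall z, P z -> P (s *: z + b)%R) ->
  \int[vol]_(z in P) g (s *: (z : V) + b)%R <= (s^-1 ^+ n.+1)%:E * \int[vol]_(z in P) g z.
Proof.
move=> s0 mg g0 Psb.
pose h := g \_ P.
have mh : measurable_fun setT h.
  exact: (measurable_restrictT _ mP).1 (measurable_funTS mg).
have h0 z : 0 <= h z by rewrite /h patchE; case: ifP.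
rewrite [X in _ * X]integral_mkcond -/h -(ge0_integral_vol_affine b s0 mh h0).
rewrite integral_mkcond; apply: ge0_le_integral => //.
- by move=> z _; rewrite patchE; case: ifP.
- apply: (measurable_restrictT _ mP).1; apply: measurable_funTS.
  by apply: (measurableT_comp mg); exact: measurable_pt_affine.
- by apply: (measurableT_comp mh); exact: measurable_pt_affine.
- move=> z _; rewrite patchE; case: ifPn => [/set_mem Pz|//].
  by rewrite /h patchE mem_set//; exact: Psb.
Qed.

Lemma measurable_comb2 (s t : R) : measurable_fun setT
  (fun p : mpt R n * mpt R n => (s *: (p.1 : V) + t *: (p.2 : V))%R : mpt R n).
Proof. exact: measurable_pt_comb. Qed.

(** The map [z |-> (1 - t) z + t w] has the Jacobian [(1 - t) ^ (n + 1)], and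
[w |-> (1 - t) z + t w] has [t ^ (n + 1)]; one of the factors [t] and [1 - t] is at
least [1 / 2]. *)
Lemma integral2_comb_le (g : mpt R n -> \bar R) (t : R) :
  (0 <= t <= 1)%R -> measurable_fun setT g -> (forall z, 0 <= g z) ->
  \int[vol]_(z in P) \int[vol]_(w in P) g ((1 - t) *: (z : V) + t *: (w : V))%R <=
  (2 ^+ n.+1)%:E * (vol P * \int[vol]_(z in P) g z).
Proof.
move=> t01 mg g0.
have mgc : measurable_fun setT (fun p : mpt R n * mpt R n =>
    g ((1 - t) *: (p.1 : V) + t *: (p.2 : V))%R).
  by apply: (measurableT_comp mg); exact: measurable_comb2.
have I0 : 0 <= \int[vol]_(z in P) g z by exact: integral_ge0.
(* the variable with the larger weight is integrated first *)
have half (s : R) : (2^-1 <= s)%R -> ((s^-1 ^+ n.+1) <= (2 ^+ n.+1))%R.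
  move=> s2; have s0 : (0 < s)%R by rewrite (lt_le_trans _ s2).
  by rewrite lerXn2r ?nnegrE ?invr_ge0 ?(ltW s0)// -[leRHS]invrK lef_pV2 ?posrE ?invr_gt0.
have fin (F : mpt R n -> \bar R) (s : R) : (2^-1 <= s)%R -> measurable_fun P F ->
    (forall w, P w -> 0 <= F w) ->
    (forall w, P w -> F w <= (s^-1 ^+ n.+1)%:E * \int[vol]_(z in P) g z) ->
    \int[vol]_(w in P) F w <= (2 ^+ n.+1)%:E * (vol P * \int[vol]_(z in P) g z).
  move=> s2 mF F0 FI.
  apply: (@le_trans _ _ (\int[vol]_(w in P) ((2 ^+ n.+1)%:E * \int[vol]_(z in P) g z))).
    apply: ge0_le_integral => // w Pw; apply: le_trans (FI w Pw) _; rewrite lee_wpmul2r// lee_fin.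
    exact: half.
  by rewrite integral_cst// -muleA; rewrite (muleC (vol P)).
have [t2|t2] := leP t (2^-1)%R.
  rewrite (tonelli_in _ _ (f := fun z w : mpt R n => g ((1 - t) *: (z : V) + t *: (w : V))%R))//;
    last exact: measurable_funTS.
  apply: (fin _ (1 - t)%R); first lra.
  - apply: (measurable_integral_in _ (f := fun w z : mpt R n => g ((1 - t) *: (z : V) + t *: (w : V))%R)) => //.
    apply: measurable_funTS; apply: (measurableT_comp mg).
    apply: (measurable_pt_comb (f := fun p : mpt R n * mpt R n => p.2)) => //; exact: measurable_snd.
  - by move=> w _; exact: integral_ge0.
  - move=> w Pw; apply: integral_affine_le => //; first lra.
    by move=> z Pz; exact: cvx.
apply: (fin _ t); first lra.
- apply: (measurable_integral_in _ (f := fun z w : mpt R n => g ((1 - t) *: (z : V) + t *: (w : V))%R)) => //.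
  exact: measurable_funTS.
- by move=> w _; exact: integral_ge0.
- move=> z Pz.
  rewrite (eq_integral (fun w : mpt R n => g (t *: (w : V) + (1 - t) *: (z : V))%R)); last first.
    by move=> w _; rewrite addrC.
  apply: integral_affine_le => //; first lra.
  by move=> w Pw; rewrite addrC; exact: cvx.
Qed.

Let mPP : measurable ((P : set (mpt R n)) `*` (P : set (mpt R n))) := measurableX mP mP.

Let PP_fin : (vol \x vol)%E ((P : set (mpt R n)) `*` (P : set (mpt R n))) < +oo.
Proof.
by rewrite product_measure1E// lte_mul_pinfty ?measure_ge0// ge0_fin_numE ?measure_ge0.
Qed.

(** The change of [u] when every point moves by the fraction [t] towards a random
point of [P]; it controls the distance of [u] to its averages. *)
Definition osc (u : V -> R) (t : R) : \bar R :=
  \int[(vol \x vol)%E]_(p in (P : set (mpt R n)) `*` (P : set (mpt R n)))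
    `|u ((1 - t) *: (p.1 : V) + t *: (p.2 : V))%R - u p.1|%:E.

Lemma osc_ge0 u t : 0 <= osc u t.
Proof. exact: integral_ge0. Qed.

Lemma measurable_osc (u : mpt R n -> R) t : measurable_fun setT u ->
  measurable_fun setT (fun p : mpt R n * mpt R n =>
    `|u ((1 - t) *: (p.1 : V) + t *: (p.2 : V))%R - u p.1|%:E).
Proof.
move=> mu; apply/measurable_EFinP; apply: measurableT_comp => //.
apply: measurable_funB; first by apply: (measurableT_comp mu); exact: measurable_comb2.
exact: measurableT_comp.
Qed.

Lemma osc_le (u v : V -> R) (t : R) : (0 <= t <= 1)%R ->
  measurable_fun setT (u : mpt R n -> R) -> measurable_fun setT (v : mpt R n -> R) ->
  osc u t <= osc v t + (2 ^+ n.+1 + 1)%:E * (vol P * L1dist P u v).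
Proof.
move=> t01 mu mv.
pose d (z : mpt R n) : \bar R := `|u z - v z|%:E.
have md : measurable_fun setT d by exact: measurable_abs_dist.
have d0 z : 0 <= d z by rewrite lee_fin.
pose A (p : mpt R n * mpt R n) := d ((1 - t) *: (p.1 : V) + t *: (p.2 : V))%R.
pose B (p : mpt R n * mpt R n) := d p.1.
pose C (p : mpt R n * mpt R n) := `|v ((1 - t) *: (p.1 : V) + t *: (p.2 : V))%R - v p.1|%:E.
have mA : measurable_fun setT A by apply: (measurableT_comp md); exact: measurable_comb2.
have mB : measurable_fun setT B by exact: (measurableT_comp md).
have mC : measurable_fun setT C by exact: measurable_osc.
have EA : \int[(vol \x vol)%E]_(p in (P : set (mpt R n)) `*` (P : set (mpt R n))) A p
    <= (2 ^+ n.+1)%:E * (vol P * L1dist P u v).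
  rewrite integral_prod_in; [|exact: mP|exact: mP|exact: measurable_funTS|by move=> p _; exact: d0].
  exact: (integral2_comb_le t01 md d0).
have EB : \int[(vol \x vol)%E]_(p in (P : set (mpt R n)) `*` (P : set (mpt R n))) B p
    = vol P * L1dist P u v.
  rewrite integral_prod_in; [|exact: mP|exact: mP|exact: measurable_funTS|by move=> p _; exact: d0].
  transitivity (\int[vol]_(z in P) (d z * vol P)).
    by apply: eq_integral => z _; rewrite /B /=; exact: integral_cst.
  by rewrite ge0_integralZr//; [rewrite muleC|exact: measurable_funTS].
rewrite EFinD ge0_muleDl// mul1e -{2}EB.
apply: (@le_trans _ _ (osc v t +
  (\int[(vol \x vol)%E]_(p in (P : set (mpt R n)) `*` (P : set (mpt R n))) A p +
   \int[(vol \x vol)%E]_(p in (P : set (mpt R n)) `*` (P : set (mpt R n))) B p))); last first.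
  by apply: leeD2l; exact: leeD2r.
rewrite -(@ge0_integralD _ _ R (vol \x vol)%E _ mPP A B (fun p _ => d0 _) (measurable_funTS mA)
  (fun p _ => d0 _) (measurable_funTS mB)).
have mAB : measurable_fun setT (A \+ B) by exact: emeasurable_funD.
have C0 p : 0 <= C p by rewrite /C lee_fin.
have AB0 p : 0 <= (A \+ B) p by rewrite adde_ge0 ?d0.
rewrite /osc -(@ge0_integralD _ _ R (vol \x vol)%E _ mPP C (A \+ B) (fun p _ => C0 _)
  (measurable_funTS mC) (fun p _ => AB0 _) (measurable_funTS mAB)).
apply: ge0_le_integral => //.
- by apply: measurable_funTS; exact: measurable_osc.
- by apply: measurable_funTS; exact: emeasurable_funD.
move=> [z w] _; rewrite /A /B /d /= -!EFinD lee_fin.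
set x := ((1 - t) *: z + t *: w)%R.
rewrite (_ : u x - u z = (v x - v z) + ((u x - v x) + - (u z - v z)))%R; last by ring.
apply: le_trans (ler_normD _ _) _; rewrite lerD2l.
by apply: le_trans (ler_normD _ _) _; rewrite normrN.
Qed.

Lemma body_in_compact : exists2 M : R, (0 <= M)%R & P `<=` [set z | (`|z| <= M)%R].
Proof.
have [_ [M PM] _ _] := bP; exists (Num.max 0 M)%R; first by rewrite le_max lexx.
by move=> z /PM /= h; rewrite le_max h orbT.
Qed.

Lemma continuous_bounded_body (v : V -> R) : continuous v ->
  exists M : R, forall z, P z -> (`|v z| <= M)%R.
Proof.
move=> cv; have [M M0 PM] := body_in_compact.
have cK : compact [set z : V | (`|z| <= M)%R].
  apply: (@compact_pt _ _ _ M) => //.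
  apply: (@closed_comp _ _ (fun z : V => `|z|%R) [set t | (t <= M)%R]); last exact: closed_le.
  by move=> z _; exact: norm_continuous.
have [||c _ Hc] := @compact_EVT_max _ R (fun z => `|v z|)%R _ _ cK.
- by exists 0%R; rewrite /= normr0.
- apply: continuous_subspaceT => z; apply: (@continuous_comp _ _ _ v (fun t => `|t|)%R).
    exact: cv.
  exact: norm_continuous.
exists `|v c|%R => z /PM Kz; apply: Hc; exact/mem_set.
Qed.

Lemma osc_continuous (v : V -> R) : continuous v ->
  osc v k.+2%:R^-1 @[k --> \oo] --> 0.
Proof.
move=> cv.
have mv : measurable_fun setT (v : mpt R n -> R) by exact: continuous_measurable_pt.
have [M vM] := continuous_bounded_body cv.
have t01 k : (0 <= (k.+2%:R^-1 : R) <= 1)%R by rewrite invr_ge0 ler0n /= invf_le1// ler1n.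
apply: (@bounded_cvg0 _ _ R (vol \x vol)%E _ (2 * M)%R) => //.
- by move=> k; apply: measurable_funTS; exact: measurable_osc.
- move=> k [z w] [/= Pz Pw]; rewrite !lee_fin normr_ge0 /=.
  rewrite (le_trans (ler_normB _ _))// mulr2n mulrDl mul1r.
  by apply: lerD; apply: vM => //; exact: cvx.
move=> [z w] [/= Pz Pw].
apply/fine_cvgP; split; first exact: nearW.
rewrite -(normr0 R) -(subrr (v z)).
apply: cvg_norm; apply: cvgB; last exact: cvg_cst.
apply: (@cvg_comp _ _ _ (fun k => (1 - k.+2%:R^-1) *: z + k.+2%:R^-1 *: w)%R v _ (nbhs z)); last exact: cv.
have t0 : (fun k : nat => k.+2%:R^-1 : R)%R @ \oo --> (0 : R)%R.
  apply/cvgrPdist_le => e e0; near=> k.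
  rewrite sub0r normrN gtr0_norm ?invr_gt0//.
  apply: (@le_trans _ _ (k.+1%:R^-1)%R); first by rewrite lef_pV2 ?posrE// ler_nat.
  by apply: ltW; near: k; exact: (near_infty_natSinv_lt (PosNum e0)).
have cz : (fun k : nat => (1 - k.+2%:R^-1) *: (z : V) + k.+2%:R^-1 *: (w : V))%R @ \oo -->
    ((1 - 0) *: (z : V) + 0 *: (w : V))%R.
  apply: cvgD; last exact: cvgZr_tmp.
  by apply: cvgZr_tmp; apply: cvgB => //; exact: cvg_cst.
by rewrite subr0 scale1r scale0r addr0 in cz; exact: cz.
Unshelve. all: by end_near. Qed.

(** For continuous functions this is bounded convergence. They are dense, and by
[osc_le] the error of the approximation is uniform in [t]. *)
Lemma osc_cvg (u : V -> R) : measurable_fun setT (u : mpt R n -> R) ->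
  vol.-integrable P (EFin \o u) -> osc u k.+2%:R^-1 @[k --> \oo] --> 0.
Proof.
move=> mu iu; apply/ecvg0P; first by move=> k; exact: osc_ge0.
move=> e e0.
have t01 k : (0 <= (k.+2%:R^-1 : R) <= 1)%R by rewrite invr_ge0 ler0n /= invf_le1// ler1n.
pose c := ((2 ^+ n.+1 + 1) * (fine (vol P) + 1))%R.
have volP0 : (0 <= fine (vol P))%R by rewrite fine_ge0.
have c0 : (0 < c)%R by rewrite mulr_gt0// ?ltr_wpDl// exprn_ge0.
have [v [cv uv]] := continuous_dense_L1 bP iu (divr_gt0 (divr_gt0 e0 (ltr0n _ 2)) c0).
have /ecvg0P := osc_continuous cv => /(_ (fun k => osc_ge0 _ _) _ (divr_gt0 e0 (ltr0n _ 2))).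
apply: filterS => k hk.
have mv : measurable_fun setT (v : mpt R n -> R) by exact: continuous_measurable_pt.
apply: le_trans (osc_le (t01 k) mu mv) _.
rewrite [X in _ <= X%:E]splitr [X in _ <= X]EFinD; apply: leeD => //.
apply: (@le_trans _ _ (c%:E * L1dist P u v)).
  rewrite muleA; apply: lee_wpmul2r; first exact: L1dist_ge0.
  have -> : vol P = (fine (vol P))%:E by rewrite fineK// ge0_fin_numE.
  by rewrite -EFinM lee_fin /= ler_wpM2l ?lerDl// addr_ge0// exprn_ge0.
apply: le_trans (lee_wpmul2l _ uv) _; first by rewrite lee_fin ltW.
by rewrite -EFinM lee_fin mulrC divfK// gt_eqF.
Qed.

End oscillation.

(** * Convolution with test functions *)

Section compactly_supported.
Context {R : realType} {n : nat}.
Notation V := (pt R n).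
Implicit Types (g : V -> R).

Lemma test_bounded g : test_function setT g -> exists2 M : R, 0 <= M & forall z, `|g z| <= M.
Proof.
move=> [sg cg _].
have [[c Kc]|K0] := pselect (closure [set z | g z != 0] !=set0); last first.
  exists 0 => // z; have [->|gz] := eqVneq (g z) 0; first by rewrite normr0.
  by exfalso; apply: K0; exists z; exact: subset_closure.
have cng : {within closure [set z | g z != 0], continuous (fun z => `|g z|)}.
  apply: continuous_subspaceT => z; apply: (@continuous_comp _ _ _ g (fun t => `|t|)).
    exact: smooth_continuous.
  exact: norm_continuous.
have [|d _ Hd] := @compact_EVT_max _ R _ _ _ cg cng; first by exists c.
exists `|g d| => // z; have [->|gz] := eqVneq (g z) 0; first by rewrite normr0.
by apply: Hd; apply/mem_set; exact: subset_closure.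
Qed.

Lemma test_lipschitz g : test_function setT g ->
  exists2 L : R, 0 <= L & forall q e, `|g (q + e) - g q| <= L * `|e|.
Proof.
move=> tg.
have sg : smooth g by case: tg.
have H (w : V) : exists M : R, 0 <= M /\ forall z, `|'D_w g z| <= M.
  by have [M M0 HM] := test_bounded (test_derive w tg); exists M.
have [M HM] := choice H.
exists (\sum_j M (e_x j) + M (e_y n)).
  apply: addr_ge0; last exact: (HM (e_y n)).1.
  by apply: sumr_ge0 => j _; exact: (HM (e_x j)).1.
move=> q e; have [s _ ->] := smooth_MVT sg q e.
have /(normpt_leP _ (normr_ge0 _))[h1 h2] := lexx `|e|.
rewrite (derive_basis sg) mulrDl (le_trans (ler_normD _ _))// lerD//.
  rewrite mulr_suml (le_trans (ler_norm_sum _ _ _))// ler_sum// => j _.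
  by rewrite normrM mulrC ler_pM//; case: (HM (e_x j)).
by rewrite normrM mulrC ler_pM//; case: (HM (e_y n)).
Qed.

End compactly_supported.

Section convolution.
Context {R : realType} {n : nat}.
Notation V := (pt R n).
Notation vol := (@vol R n).
Variable P : set V.
Hypothesis mP : measurable (P : set (mpt R n)).
Variable u : V -> R.
Hypothesis iu : vol.-integrable P (EFin \o u).

Definition conv (g : V -> R) (a b : R) (z : V) : R :=
  \int[vol]_(p in P) (u p * g (a *: p + b *: z)).

Let mu : measurable_fun (P : set (mpt R n)) u.
Proof. by move/integrableP : iu => [/measurable_EFinP]. Qed.

Lemma integrable_mul_bounded (h : V -> R) (M : R) :
  measurable_fun (P : set (mpt R n)) h -> (forall z, `|h z| <= M) ->
  vol.-integrable P (fun p => (u p * h p)%:E).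
Proof.
move=> mh hM; apply: (@le_integrable _ _ R vol P mP _ (fun p => (M * u p)%:E)).
- by apply/measurable_EFinP; exact: measurable_funM.
- move=> z _; rewrite lee_fin !normrM mulrC ler_wpM2r//.
  by rewrite (le_trans (hM z))// ler_norm.
- by rewrite /=; under eq_fun do rewrite EFinM; exact: integrableZl.
Qed.

Lemma measurable_test_comp (g : V -> R) (a : R) (b : V) : continuous g ->
  measurable_fun setT (fun p : mpt R n => g (a *: (p : V) + b)).
Proof.
move=> cg; apply: (measurableT_comp (continuous_measurable_pt cg)).
exact: measurable_pt_affine.
Qed.

Lemma integrable_conv (g : V -> R) (a : R) (b : V) : test_function setT g ->
  vol.-integrable P (fun p => (u p * g (a *: p + b))%:E).
Proof.
move=> tg; have [M M0 HM] := test_bounded tg.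
apply: (@integrable_mul_bounded (fun p => g (a *: p + b)) M) => //.
apply: measurable_funTS; apply: measurable_test_comp.
by apply: smooth_continuous; case: tg.
Qed.

(** Differentiation under the integral sign: the derivatives of [g] are bounded. *)
Lemma conv_derive (g : V -> R) (a b : R) (z e : V) : test_function setT g ->
  is_derive z e (conv g a b) (b * conv ('D_e g) a b z).
Proof.
move=> tg; have sg : smooth g by case: tg.
apply/is_derive_dirP.
pose f (h : R) (p : V) := u p * g (a *: p + b *: (h *: e + z)).
have fE h p : f h p = u p * g ((a *: p + b *: z) + h *: (b *: e)).
  by rewrite /f scalerDr addrA addrAC !scalerA (mulrC b).
have df h p : is_derive h (1 : R) (f ^~ p) (u p * (b * 'D_e g (a *: p + b *: (h *: e + z)))).
  have -> : f ^~ p = fun h => u p * g ((a *: p + b *: z) + h *: (b *: e)).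
    by apply/funext => h'; rewrite fE.
  have := smooth_line sg (a *: p + b *: z) (b *: e) h.
  move=> /(@is_deriveZ _ _ _ _ (u p)); rewrite deriveZdir//.
  have -> : a *: p + b *: z + h *: (b *: e) = a *: p + b *: (h *: e + z).
    by rewrite scalerDr addrA addrAC !scalerA (mulrC b).
  by apply.
have tDg := test_derive e tg.
have [M M0 HM] := test_bounded tDg.
have I0 : (`]-1, 1[%classic : set R) 0 by rewrite /= in_itv /= ltrN10 ltr01.
have intf x : (`]-1, 1[%classic : set R) x -> vol.-integrable P (EFin \o f x).
  by move=> _; exact: integrable_conv.
have derf x y : (`]-1, 1[%classic : set R) x -> P y -> derivable (f ^~ y) x 1.
  by move=> _ _; have [] := df x y.
have G0 y : 0 <= `|u y| * (`|b| * M) by rewrite !mulr_ge0.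
have intG : vol.-integrable P (EFin \o (fun y => `|u y| * (`|b| * M))).
  have := integrableZl mP (`|b| * M) (integrable_abse iu).
  apply: eq_integrable => // p _; rewrite /= -EFinM mulrC//.
have Gub x y : (`]-1, 1[%classic : set R) x -> P y -> `|partial1of2 f x y| <= `|u y| * (`|b| * M).
  move=> _ _; rewrite partial1of2E; have [_ ->] := df x y.
  by rewrite !normrM ler_wpM2l// ler_wpM2l.
have D1 := @derivable_under_integral R _ _ vol f P mP 0 (-1) 1 I0 intf derf _ G0 intG Gub.
have D2 := @differentiation_under_integral R _ _ vol f P mP 0 (-1) 1 I0 intf derf _ G0 intG Gub.
apply: DeriveDef; first exact: D1.
rewrite derive1E in D2; rewrite [LHS]D2 /conv -(@RintegralZl _ _ _ vol P _ b mP (integrable_conv a (b *: z) tDg)).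
apply: eq_Rintegral => p _; rewrite partial1of2E; have [_ ->] := df 0 p.
by rewrite scale0r add0r mulrCA.
Qed.

Lemma conv_continuous (g : V -> R) (a b : R) : test_function setT g -> continuous (conv g a b).
Proof.
move=> tg z; have [L L0 HL] := test_lipschitz tg.
pose C := L * `|b| * \int[vol]_(p in P) `|u p|.
have I0 : 0 <= \int[vol]_(p in P) `|u p| by apply: Rintegral_ge0.
have C0 : 0 <= C by rewrite !mulr_ge0.
have key z' : `|conv g a b z - conv g a b z'| <= C * `|z - z'|.
  rewrite /conv -RintegralB//; [|exact: integrable_conv|exact: integrable_conv].
  have iB : vol.-integrable P (EFin \o (fun p => u p * g (a *: p + b *: z) - u p * g (a *: p + b *: z'))).
    exact: (integrableB mP (integrable_conv a (b *: z) tg) (integrable_conv a (b *: z') tg)).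
  apply: le_trans (le_normr_Rintegral mP iB) _.
  rewrite /C mulrAC -RintegralZl//; last exact: (integrable_abse iu).
  apply: le_Rintegral => //.
  - exact: (integrable_abse iB).
  - exact: (integrableZl mP (L * `|b| * `|z - z'|) (integrable_abse iu)).
  move=> p _; rewrite -mulrBr normrM mulrC ler_wpM2r//.
  have := HL (a *: p + b *: z') (b *: (z - z')).
  by rewrite normrZ mulrA scalerBr -addrA [b *: z' + _]addrC subrK.
apply/cvgrPdist_le => e e0.
have ez : 0 < e / (C + 1) by rewrite divr_gt0// ltr_wpDl.
have Hn : nbhs (z : V) (ball (z : V) (e / (C + 1))) by exact: nbhsx_ballx.
apply: filterS Hn => z'; rewrite -ball_normE /ball_ /= => h.
apply: le_trans (key z') _.
rewrite ltr_pdivlMr ?ltr_wpDl// in h.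
by apply: le_trans (ltW h); rewrite mulrC ler_wpM2l// lerDl.
Qed.

Lemma smooth_conv (g : V -> R) (k a b : R) : test_function setT g ->
  smooth (fun z => k * conv g a b z).
Proof.
move=> tg.
pose S f := exists k g, test_function setT g /\ f = (fun z => k * conv g a b z).
apply: (@smooth_family _ _ S); last by exists k, g.
- move=> _ [k' [h [th ->]]] z; apply: cvgM; first exact: cvg_cst.
  exact: conv_continuous.
- move=> _ z e [k' [h [th ->]]].
  by have [] := @is_deriveZ _ _ _ _ k' _ _ _ (conv_derive a b z e th).
- move=> _ e [k' [h [th ->]]]; exists (k' * b), ('D_e h).
  split; first exact: test_derive.
  apply/funext => z.
  have [_ ->] := @is_deriveZ _ _ _ _ k' _ _ _ (conv_derive a b z e th).
  by rewrite /GRing.scale /= mulrA.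
Qed.

End convolution.

(** * Averages over small balls inside a convex body *)

Section mollification.
Context {R : realType} {n : nat}.
Notation V := (pt R n).
Notation vol := (@vol R n).

Lemma bump_le1 (c : V) (r : R) z : bump c r z <= 1.
Proof.
rewrite /bump /= /theta; case: ifPn => // q0.
by rewrite expr0 mul1r -expR0 ler_expR oppr_le0 invr_ge0 ltW.
Qed.

Lemma continuous_bump (c : V) (r : R) : continuous (bump c r).
Proof.
apply: smooth_continuous; apply: (@smooth_bump _ _ (paraboloid c r)).
  exact: poly_fun_paraboloid.
exact: bump_theta.
Qed.

Lemma integral_bump (c : V) (r : R) : 0 < r ->
  exists2 J : R, 0 < J & (\int[vol]_z (bump c r z)%:E = J%:E)%E.
Proof.
move=> r0.
have mb : measurable_fun setT (bump c r : mpt R n -> R).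
  by apply: continuous_measurable_pt; exact: continuous_bump.
have mball (s : R) : 0 < s -> measurable ([set z | `|z - c| <= s] : set (mpt R n)).
  by move=> s0; apply: measurable_cball; exact: ltW.
have up : (\int[vol]_z (bump c r z)%:E <= ((2 * r) ^+ n.+1)%:E)%E.
  rewrite -(vol_cball c (ltW r0)).
  have -> : (vol [set z : V | (`|z - c| <= r)%R] = \int[vol]_z (\1_[set z : V | `|z - c| <= r] z)%:E)%E.
    by rewrite integral_indic ?setIT//; exact: mball.
  apply: ge0_le_integral => //.
  - by move=> z _; rewrite lee_fin bump_ge0.
  - exact/measurable_EFinP.
  - by apply/measurable_EFinP; apply: measurable_indic; exact: mball.
  move=> z _; rewrite lee_fin indicE.
  have [/set_mem _|h] := boolP (z \in _); first exact: bump_le1.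
  have [->//|bz] := eqVneq (bump c r z) 0.
  by exfalso; move/negP : h; apply; apply/mem_set; exact: (bump_support r0).
have bc := bump_gt0 c r0.
have lo : (0 < \int[vol]_z (bump c r z)%:E)%E.
  have /cvgrPdist_lt/(_ _ (divr_gt0 bc (ltr0n _ 2))) := @continuous_bump c r c.
  move=> /nbhs_ballP[s /= s0 Hs].
  have s20 : 0 < s / 2 by rewrite divr_gt0.
  apply: (@lt_le_trans _ _ (\int[vol]_(z in [set z | (`|z - c| <= s / 2)%R]) (bump c r c / 2)%:E)%E).
    rewrite integral_cst//; last exact: mball.
    rewrite [X in (_ < _ * X)%E](_ : _ = ((2 * (s / 2)) ^+ n.+1)%:E); last exact: vol_cball (ltW s20).
    by rewrite -EFinM lte_fin mulr_gt0// ?divr_gt0// exprn_gt0// mulr_gt0.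
  apply: (@le_trans _ _ (\int[vol]_(z in [set z | (`|z - c| <= s / 2)%R]) (bump c r z)%:E)%E).
    apply: ge0_le_integral => //.
    - exact: mball.
    - by move=> z _; rewrite lee_fin divr_ge0// ltW.
    - by apply/measurable_EFinP; exact: measurable_funTS.
    move=> z /= h; rewrite lee_fin.
    have : `|bump c r c - bump c r z| < bump c r c / 2.
      apply: Hs; rewrite -ball_normE /ball_ /= distrC (le_lt_trans h)//.
      by rewrite gtr_pMr// invf_lt1// ltr1n.
    by move/ltr_normlP => [_]; lra.
  apply: ge0_subset_integral => //.
  - exact: mball.
  - exact/measurable_EFinP.
  - by move=> z _; rewrite lee_fin bump_ge0.
move: up lo; case: (\int[vol]_z _)%E => [J| |]//.
by rewrite lte_fin => _ J0; exists J.
Qed.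

Lemma smooth_affine (g : V -> R) (a : R) (b : V) : smooth g -> smooth (fun p => g (a *: p + b)).
Proof.
move=> sg.
have D h z e : smooth h -> is_derive z e (fun p => h (a *: p + b)) (a * 'D_e h (a *: z + b)).
  move=> sh; apply/is_derive_dirP.
  have -> : (fun s : R => h (a *: (s *: e + z) + b)) = (fun s : R => h (a *: z + b + s *: (a *: e))).
    by apply/funext => s; congr h; rewrite scalerDr !scalerA (mulrC a s) -addrA addrC.
  have := smooth_line sh (a *: z + b) (a *: e) 0.
  by rewrite scale0r addr0 deriveZdir.
pose S f := exists (k : R) h, smooth h /\ f = (fun p => k * h (a *: p + b)).
apply: (@smooth_family _ _ S); last first.
- by exists 1, g; split => //; apply/funext => p; rewrite mul1r.
- move=> _ e [k [h [sh ->]]]; exists (k * a), ('D_e h); split; first exact: smooth_derive.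
  apply/funext => z; have [_ ->] := @is_deriveZ _ _ _ _ k _ _ _ (D h z e sh).
  by rewrite /GRing.scale /= mulrA.
- move=> _ z e [k [h [sh ->]]].
  by have [] := @is_deriveZ _ _ _ _ k _ _ _ (D h z e sh).
- move=> _ [k [h [sh ->]]] z; apply: cvgM; first exact: cvg_cst.
  apply: (@continuous_comp _ _ _ (fun p : V => a *: p + b) h).
    by apply: cvgD; [apply: cvgZl_tmp; exact: cvg_id|exact: cvg_cst].
  exact: smooth_continuous.
Qed.

Variable P : set V.
Hypothesis bP : convex_body P.
Let mP : measurable (P : set (mpt R n)) := body_measurable bP.
Variables (c : V) (r J : R).
Hypothesis r0 : 0 < r.
Hypothesis rP : [set z | `|z - c| <= 2 * r] `<=` P.
Hypothesis J0 : 0 < J.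
Hypothesis JE : (\int[vol]_z (bump c r z)%:E = J%:E)%E.

Section fixed_t.
Variable t : R.
Hypothesis t01 : 0 < t < 1.
Let t0 : 0 < t. Proof. by case/andP: t01. Qed.
Let b := - ((1 - t) / t).

(** The average of [u], weighted by a bump function, over a ball of radius [t r] about
[(1 - t) z + t c]. Moving the centre from [z] towards [c] keeps the ball inside
[P]. *)
Definition mol (u : V -> R) (z : V) : R :=
  (J * t ^+ n.+1)^-1 * conv P u (bump c r) t^-1 (- ((1 - t) / t)) z.

Let K z (p : V) := bump c r (t^-1 *: p + b *: z).

Lemma kernel_center z p : t^-1 *: p + b *: z - c = t^-1 *: (p - ((1 - t) *: z + t *: c)).
Proof.
rewrite scalerBr scalerDr !scalerA mulVf ?gt_eqF// scale1r opprD addrA /b.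
by rewrite scaleNr mulrC.
Qed.

Lemma kernel_support z : [set p | K z p != 0] `<=` [set p | `|p - ((1 - t) *: z + t *: c)| <= t * r].
Proof.
move=> p /(bump_support r0) /=.
by rewrite kernel_center normrZ gtr0_norm ?invr_gt0// ler_pdivrMl.
Qed.

(** By convexity the ball of twice the radius of the support lies in [P], so the
support lies in the interior of [P]. *)
Lemma kernel_test z : P z -> test_function P° (K z).
Proof.
move=> Pz; set z' := (1 - t) *: z + t *: c.
have cl : closed [set p : V | `|p - z'| <= t * r].
  apply: (@closed_comp _ _ (fun z : V => `|z - z'|) [set s | s <= t * r]); last exact: closed_le.
  move=> y _; apply: (@continuous_comp _ _ _ (fun z : V => z - z') (fun z : V => `|z|)).
    by apply: continuousB; [exact: cvg_id|exact: cvg_cst].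
  exact: norm_continuous.
have sub : closure [set p | K z p != 0] `<=` [set p | `|p - z'| <= t * r].
  by apply: subset_trans (closure_subset (@kernel_support z)) _ => p /cl.
split.
- apply: smooth_affine; apply: (@smooth_bump _ _ (paraboloid c r)).
    exact: poly_fun_paraboloid.
  exact: bump_theta.
- apply: (@compact_pt _ _ _ (t * r + `|z'|)); first exact: closed_closure.
  move=> p /sub /= h; rewrite -[p](subrK z'); apply: le_trans (ler_normD _ _) _.
  by rewrite lerD2r.
- move=> p /sub /= h.
  have tr0 : 0 < t * r by rewrite mulr_gt0.
  apply/nbhs_ballP; exists (t * r) => //= q; rewrite -ball_normE /ball_ /= => hq.
  have t1 : 0 < t <= 1 by case/andP: t01 => ? ?; rewrite t0 ltW.
  apply: (body_shrink bP t1 rP Pz) => /=.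
  rewrite -(subrKA p) (le_trans (ler_normD _ _))// mulrCA mulr2n mulrDl mul1r lerD//.
  by rewrite distrC ltW.
Qed.

Lemma kernel_in z : P z -> forall p, ~ P p -> K z p = 0.
Proof.
move=> Pz p Pp; apply/eqP; apply: contra_notT Pp => Kp.
have [_ _ KP] := kernel_test Pz.
by apply: interior_subset; apply: KP; exact: subset_closure.
Qed.

Lemma measurable_kernel z : measurable_fun setT (K z : mpt R n -> R).
Proof. by apply: measurable_test_comp; exact: continuous_bump. Qed.

Lemma integral_kernel z : P z -> (\int[vol]_(p in P) (K z p)%:E = (J * t ^+ n.+1)%:E)%E.
Proof.
move=> Pz.
have mb : measurable_fun setT (fun z : mpt R n => (bump c r z)%:E).
  by apply/measurable_EFinP; apply: continuous_measurable_pt; exact: continuous_bump.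
have ti0 : 0 < t^-1 by rewrite invr_gt0.
have := ge0_integral_vol_affine (b *: z) ti0 mb (fun z => bump_ge0 c r z).
rewrite JE invrK => E.
rewrite integral_mkcond mulrC EFinM -E.
apply: eq_integral => p _; rewrite patchE; case: ifPn => // Pp.
by rewrite -/(K z p) kernel_in// => /mem_set; exact/negP.
Qed.

(** Substitute [p = (1 - t) z + t w]; the bump function is at most 1. *)
Lemma mol_close_pointwise (u : V -> R) z : measurable_fun setT (u : mpt R n -> R) ->
  vol.-integrable P (EFin \o u) -> P z ->
  (`|mol u z - u z|%:E <= J^-1%:E * \int[vol]_(w in P) `|u ((1 - t) *: z + t *: w)%R - u z|%:E)%E.
Proof.
move=> mu iu Pz.
have Jt : 0 < J * t ^+ n.+1 by rewrite mulr_gt0// exprn_gt0.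
have tK : test_function setT (bump c r) by apply: test_bump.
have iuK : vol.-integrable P (fun p => (u p * K z p)%:E) by exact: integrable_conv.
have iK : vol.-integrable P (fun p => (K z p)%:E).
  apply/integrableP; split; first by apply/measurable_EFinP; apply: measurable_funTS; exact: measurable_kernel.
  under eq_integral => p _ do rewrite gee0_abs ?lee_fin ?bump_ge0//.
  by rewrite integral_kernel// ltry.
have izK : vol.-integrable P (fun p => (u z * K z p)%:E).
  by under eq_fun do rewrite EFinM; exact: integrableZl.
have iB : vol.-integrable P (fun p => ((u p - u z) * K z p)%:E).
  by under eq_fun do rewrite mulrBl; exact: (integrableB mP iuK izK).
have E : mol u z - u z = (J * t ^+ n.+1)^-1 * \int[vol]_(p in P) ((u p - u z) * K z p).
  have -> : \int[vol]_(p in P) ((u p - u z) * K z p) =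
      \int[vol]_(p in P) (u p * K z p) - \int[vol]_(p in P) (u z * K z p).
    by rewrite -RintegralB//; apply: eq_Rintegral => p _; rewrite mulrBl.
  have IK : \int[vol]_(p in P) K z p = J * t ^+ n.+1 by rewrite /Rintegral integral_kernel.
  rewrite RintegralZl// IK mulrBr /mol; congr (_ - _).
  by rewrite mulrCA mulVf ?mulr1// gt_eqF.
rewrite E normrM gtr0_norm ?invr_gt0// EFinM.
have -> : (J * t ^+ n.+1)^-1%:E = (J^-1%:E * (t^-1 ^+ n.+1)%:E)%E :> \bar R.
  by rewrite -EFinM invfM exprVn.
rewrite -muleA; apply: lee_wpmul2l; first by rewrite lee_fin invr_ge0 ltW.
apply: (@le_trans _ _ ((t^-1 ^+ n.+1)%:E * \int[vol]_(p in P) (`|u p - u z| * K z p)%:E)%E).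
  apply: lee_wpmul2l; first by rewrite lee_fin exprn_ge0// invr_ge0 ltW.
  have := le_normr_Rintegral mP iB; rewrite -lee_fin => h; apply: le_trans h _.
  have iN : vol.-integrable P (fun p => (`|u p - u z| * K z p)%:E).
    have := integrable_abse iB; apply: eq_integrable => // p _.
    by rewrite /= normrM (ger0_norm (bump_ge0 _ _ _)).
  rewrite /Rintegral fineK; last first.
    exact: (integrable_fin_num mP (integrable_abse iB)).
  rewrite le_eqVlt; apply/orP; left; apply/eqP; apply: eq_integral => p _ /=.
  by rewrite normrM (ger0_norm (bump_ge0 _ _ _)).
pose G (w : mpt R n) : \bar R := (`|u ((1 - t) *: z + t *: (w : V))%R - u z| * bump c r w)%:E.
have mG : measurable_fun setT G.
  apply/measurable_EFinP; apply: measurable_funM; last first.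
    by apply: continuous_measurable_pt; exact: continuous_bump.
  apply: measurableT_comp => //; apply: measurable_funB => //.
  apply: (measurableT_comp mu).
  rewrite (_ : (fun _ => _) = (fun w : mpt R n => (t *: (w : V) + (1 - t) *: z)%R : mpt R n)).
    exact: measurable_pt_affine.
  by apply/funext => w; rewrite addrC.
have G0 w : (0 <= G w)%E by rewrite lee_fin mulr_ge0// bump_ge0.
have ti0 : 0 < t^-1 by rewrite invr_gt0.
have := ge0_integral_vol_affine (b *: z) ti0 mG G0.
rewrite invrK => EG.
have -> : (\int[vol]_(p in P) (`|u p - u z| * K z p)%:E = \int[vol]_p G (t^-1 *: (p : V) + b *: z)%R)%E.
  rewrite integral_mkcond; apply: eq_integral => p _; rewrite patchE.
  have -> : G (t^-1 *: (p : V) + b *: z)%R = (`|u p - u z| * K z p)%:E.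
    rewrite /G; congr ((`|u _ - u z| * _)%:E).
    rewrite scalerDr !scalerA mulfV ?gt_eqF// scale1r addrCA -scalerDl /b mulrN.
    by rewrite mulrC divfK ?gt_eqF// subrr scale0r addr0.
  case: ifPn => // Pp.
  by rewrite kernel_in ?mulr0// => /mem_set; exact/negP.
rewrite EG muleA -EFinM exprVn mulVf ?expf_neq0 ?gt_eqF// mul1e.
rewrite [leRHS]integral_mkcond; apply: ge0_le_integral => //.
- apply/(measurable_restrictT _ mP); apply: measurable_funTS.
  apply/measurable_EFinP; apply: measurableT_comp => //; apply: measurable_funB => //.
  apply: (measurableT_comp mu).
  rewrite (_ : (fun _ => _) = (fun w : mpt R n => (t *: (w : V) + (1 - t) *: z)%R : mpt R n)).
    exact: measurable_pt_affine.
  by apply/funext => w; rewrite addrC.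
move=> w _; rewrite patchE /G; case: ifPn => [_|Pw].
  by rewrite lee_fin ler_piMr ?bump_le1.
rewrite [bump c r w](_ : _ = 0) ?mulr0//; apply/eqP.
apply: contraNT Pw => bw; apply/mem_set; apply: rP => /=.
apply: le_trans (bump_support r0 bw) _; rewrite ler_peMl ?ler1n//; exact: ltW.
Qed.

Lemma mol_close (u : V -> R) : measurable_fun setT (u : mpt R n -> R) ->
  vol.-integrable P (EFin \o u) -> (L1dist P (mol u) u <= J^-1%:E * osc P u t)%E.
Proof.
move=> mu iu.
have tK : test_function setT (bump c r) by apply: test_bump.
have mO := measurable_osc t mu.
pose F (x : mpt R n * mpt R n) : \bar R := `|u ((1 - t) *: (x.1 : V) + t *: (x.2 : V))%R - u x.1|%:E.
have mI : measurable_fun P (fun z => \int[vol]_(w in P) F (z, w))%E.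
  apply: (measurable_integral_in _ (f := fun z w => F (z, w))) => //.
  by apply: measurable_funTS; rewrite (_ : (fun _ => _) = F)//; apply/funext => -[].
  by move=> x y _ _; rewrite lee_fin.
rewrite /osc integral_prod_in; [|exact: mP|exact: mP|exact: measurable_funTS|by []].
rewrite -ge0_integralZl//; first last.
- by rewrite lee_fin invr_ge0 ltW.
- by move=> z _; exact: integral_ge0.
rewrite /L1dist; apply: ge0_le_integral => //.
- apply: measurable_abs_dist; apply: measurable_funTS => //.
  apply: continuous_measurable_pt => z; apply: cvgM; first exact: cvg_cst.
  exact: conv_continuous.
- apply: measurable_funeM.
  exact: mI.
- by move=> z Pz; exact: mol_close_pointwise.
Qed.

Lemma mol_smooth (u : V -> R) : vol.-integrable P (EFin \o u) -> smooth (mol u).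
Proof. by move=> iu; apply: smooth_conv => //; exact: test_bump. Qed.

(** The kernel is a function of [p - (1 - t) z], so its derivatives in [z] are
[- (1 - t)] times its derivatives in [p], and the definition of the weak derivative
applies to the latter. *)
Lemma mol_derive (u w : V -> R) (e z : V) :
  vol.-integrable P (EFin \o u) -> vol.-integrable P (EFin \o w) ->
  (forall phi, test_function P° phi ->
     \int[vol]_(z in P) (u z * 'D_e phi z) = - \int[vol]_(z in P) (w z * phi z)) ->
  P z -> 'D_e (mol u) z = (1 - t) * mol w z.
Proof.
move=> iu iw uw Pz.
have tK : test_function setT (bump c r) by apply: test_bump.
have sb : smooth (bump c r) by case: tK.
have [_ ->] := @is_deriveZ _ _ _ _ (J * t ^+ n.+1)^-1 _ _ _ (conv_derive mP iu t^-1 (- ((1 - t) / t)) z e tK).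
rewrite /GRing.scale /= /mol mulrCA.
have := uw _ (kernel_test Pz).
have DK p : 'D_e (K z) p = t^-1 * 'D_e (bump c r) (t^-1 *: p + b *: z).
  have : is_derive p e (K z) (t^-1 * 'D_e (bump c r) (t^-1 *: p + b *: z)).
    apply/is_derive_dirP.
    have -> : (fun s : R => K z (s *: e + p)) =
        (fun s : R => bump c r (t^-1 *: p + b *: z + s *: (t^-1 *: e))).
      by apply/funext => s; congr bump; rewrite scalerDr !scalerA (mulrC t^-1 s) -addrA addrC.
    have := smooth_line sb (t^-1 *: p + b *: z) (t^-1 *: e) 0.
    by rewrite scale0r addr0 deriveZdir.
  by case.
have -> : \int[vol]_(p in P) (u p * 'D_e (K z) p) = \int[vol]_(p in P) (t^-1 * (u p * 'D_e (bump c r) (t^-1 *: p + b *: z))).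
  by apply: eq_Rintegral => p _; rewrite DK mulrCA.
have iD : vol.-integrable P (fun p => (u p * 'D_e (bump c r) (t^-1 *: p + b *: z))%:E).
  have tD : test_function setT ('D_e (bump c r)) by exact: test_derive.
  exact: (integrable_conv mP iu t^-1 (b *: z) tD).
rewrite RintegralZl// -/(conv P u ('D_e (bump c r)) t^-1 b z) -/(conv P w (bump c r) t^-1 b z).
move=> H.
rewrite mulrCA [RHS]mulrCA; congr (_ * _).
have -> : - ((1 - t) / t) * conv P u ('D_e (bump c r)) t^-1 (- ((1 - t) / t)) z =
   - (1 - t) * (t^-1 * conv P u ('D_e (bump c r)) t^-1 b z) by rewrite mulNr mulNr -mulrA.
by rewrite H mulrNN.
Qed.

End fixed_t.
End mollification.

(** * Weak derivatives and density of smooth functions *)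

Section density.
Context {R : realType} {n : nat}.
Notation V := (pt R n).
Notation vol := (@vol R n).

Lemma test_functionS (U U' : set V) (phi : V -> R) : U `<=` U' ->
  test_function U phi -> test_function U' phi.
Proof. by move=> UU' [h1 h2 h3]; split => //; exact: subset_trans UU'. Qed.

Lemma test_integrable (P : set V) (u phi : V -> R) : measurable (P : set (mpt R n)) ->
  vol.-integrable P (EFin \o u) -> test_function setT phi ->
  vol.-integrable P (fun z => (u z * phi z)%:E).
Proof.
move=> mP iu tp; have [M _ HM] := test_bounded tp.
apply: (@integrable_mul_bounded _ _ P mP u iu phi M) => //.
apply: measurable_funTS; apply: continuous_measurable_pt; apply: smooth_continuous.
by case: tp.
Qed.

(** A variant of [weak_derivative] for functions that are integrable up to the
boundary. *)
Definition has_weak_derivative (P : set V) (u : V -> R) (e : V) (w : V -> R) :=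
  [/\ vol.-integrable P (EFin \o u), vol.-integrable P (EFin \o w) &
    forall phi, test_function P° phi ->
      \int[vol]_(z in P) (u z * 'D_e phi z) = - \int[vol]_(z in P) (w z * phi z)].

Lemma test_Rintegral_interior (Q P : set V) (u phi : V -> R) : convex_body Q -> Q `<=` P ->
  vol.-integrable Q (EFin \o u) -> test_function Q° phi ->
  \int[vol]_(z in P°) (u z * phi z) = \int[vol]_(z in Q) (u z * phi z).
Proof.
move=> bQ QP iu tp.
have mQ := body_measurable bQ; have mI := measurable_interior Q.
have Q0 z : ~ Q° z -> phi z = 0.
  move=> Qz; apply/eqP; apply: contra_notT Qz => pz.
  by case: tp => _ _; apply; exact: subset_closure.
have tT : test_function setT phi by apply: test_functionS tp.
transitivity (\int[vol]_(z in Q°) (u z * phi z)).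
  rewrite Rintegral_mkcond [RHS]Rintegral_mkcond; apply: eq_Rintegral => z _.
  rewrite !patchE; case: ifPn => [/set_mem Pz|Pz]; case: ifPn => [/set_mem Qz|Qz] //.
    by rewrite Q0 ?mulr0// => /mem_set; exact/negP.
  by exfalso; move/negP : Pz; apply; apply/mem_set; exact: filterS QP Qz.
rewrite /Rintegral; congr fine; apply/esym.
have mN : measurable (Q `\` Q° : set (mpt R n)) by exact: measurableD.
have QE : Q `\` (Q `\` Q°) = Q°.
  rewrite setDD; apply/seteqP; split => z; first by case.
  by move=> h; split => //; exact: interior_subset.
transitivity (\int[vol]_(z in Q `\` (Q `\` Q°)) (u z * phi z)%:E)%E; last by rewrite QE.
apply: negligible_integral => //; last exact: body_boundary_null.
exact: test_integrable.
Qed.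

(** The boundary of a convex body is null, and a function tested on a smaller
body is tested on the larger one. *)
Lemma weak_derivative_sub (P Q : set V) (u w : V -> R) (e : V) :
  convex_body Q -> Q `<=` P -> weak_derivative P u e w ->
  vol.-integrable Q (EFin \o u) -> vol.-integrable Q (EFin \o w) ->
  has_weak_derivative Q u e w.
Proof.
move=> bQ QP [_ _ _ H] iu iw; split => // phi tp.
have tP : test_function P° phi.
  by apply: test_functionS tp; move=> z; exact: filterS QP.
rewrite -(test_Rintegral_interior bQ QP iu (test_derive e tp)).
by rewrite -(test_Rintegral_interior bQ QP iw tp); exact: H.
Qed.

Lemma L1dist_eq (P : set V) (u u' v v' : V -> R) :
  (forall z, P z -> `|u z - v z| = `|u' z - v' z|) -> L1dist P u v = L1dist P u' v'.
Proof. by move=> E; apply: eq_integral => z /set_mem Pz; rewrite E. Qed.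

Lemma mol_cvg (P : set V) (c : V) (r J : R) (u : V -> R) : convex_body P ->
  0 < r -> [set z | `|z - c| <= 2 * r] `<=` P -> 0 < J ->
  (\int[vol]_z (bump c r z)%:E = J%:E)%E ->
  measurable_fun setT (u : mpt R n -> R) -> vol.-integrable P (EFin \o u) ->
  L1dist P (mol P c r J k.+2%:R^-1 u) u @[k --> \oo] --> 0%E.
Proof.
move=> bP r0 rP J0 JE mu iu.
have t01 k : 0 < (k.+2%:R^-1 : R) < 1 by rewrite invr_gt0 ltr0n /= invf_lt1// ltr1n.
have /ecvg0P := osc_cvg bP mu iu => /(_ (fun k => osc_ge0 _ _ _)) H.
apply/ecvg0P => [k|e e0]; first exact: L1dist_ge0.
have := H _ (mulr_gt0 J0 e0); apply: filterS => k h.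
apply: le_trans (mol_close bP r0 rP J0 JE (t01 k) mu iu) _.
rewrite lee_pdivrMl//.
Qed.

(** Averaging as in [mol] commutes with derivatives up to the factor [1 - t]. *)
Lemma smooth_density (P : set V) (u : V -> R) (I : Type) (e : I -> V) (w : I -> V -> R) :
  convex_body P -> vol.-integrable P (EFin \o u) ->
  (forall i, has_weak_derivative P u (e i) (w i)) ->
  exists u_ : nat -> V -> R,
    [/\ forall k, smooth (u_ k), L1dist P (u_ k) u @[k --> \oo] --> 0%E &
        forall i, L1dist P ('D_(e i) (u_ k)) (w i) @[k --> \oo] --> 0%E].
Proof.
move=> bP iu uw; have mP := body_measurable bP.
have [c [r1 r10 rP1]] := body_ball bP.
pose r := r1 / 2.
have r0 : 0 < r by rewrite divr_gt0.
have rP : [set z | `|z - c| <= 2 * r] `<=` P by rewrite /r mulrC divfK.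
have [J J0 JE] := integral_bump c r0.
have ext (f : V -> R) : vol.-integrable P (EFin \o f) ->
    measurable_fun setT (f \_ P : mpt R n -> R) /\ vol.-integrable P (EFin \o (f \_ P)).
  move=> fi; split.
    apply/(measurable_restrictT _ mP); apply/measurable_EFinP; exact: measurable_int fi.
  by apply: eq_integrable fi => // z Pz /=; rewrite patchE Pz.
have mE (f : V -> R) t : mol P c r J t (f \_ P) = mol P c r J t f.
  apply/funext => z; rewrite /mol /conv; congr (_ * _).
  by apply: eq_Rintegral => p Pp; rewrite patchE Pp.
have t01 k : 0 < (k.+2%:R^-1 : R) < 1 by rewrite invr_gt0 ltr0n /= invf_lt1// ltr1n.
have cv (f : V -> R) : vol.-integrable P (EFin \o f) ->
    L1dist P (mol P c r J k.+2%:R^-1 f) f @[k --> \oo] --> 0%E.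
  move=> fi; have [mf' fi'] := ext _ fi.
  have := mol_cvg bP r0 rP J0 JE mf' fi'.
  under eq_fun => k.
    rewrite mE.
    have -> : L1dist P (mol P c r J k.+2%:R^-1 f) (f \_ P) = L1dist P (mol P c r J k.+2%:R^-1 f) f.
      by apply: L1dist_eq => z /mem_set Pz; rewrite patchE Pz.
    over.
  by [].
exists (fun k => mol P c r J k.+2%:R^-1 u); split.
- by move=> k; exact: mol_smooth.
- exact: cv.
move=> i; have [_ iw H] := uw i.
have mw : measurable_fun (P : set (mpt R n)) (w i).
  by apply/measurable_EFinP; exact: measurable_int iw.
have /ecvg0P := cv _ iw => /(_ (fun k => L1dist_ge0 _ _ _)) Hw.
pose W := \int[vol]_(z in P) `|w i z|.
have W0 : 0 <= W by apply: Rintegral_ge0.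
have WE : (\int[vol]_(z in P) `|w i z|%:E = W%:E)%E.
  rewrite /W /Rintegral fineK//.
  exact: (integrable_fin_num mP (integrable_abse iw)).
apply/ecvg0P => [k|d d0]; first exact: L1dist_ge0.
near=> k.
have mm : measurable_fun (P : set (mpt R n)) (mol P c r J k.+2%:R^-1 (w i)).
  apply: measurable_funTS; apply: continuous_measurable_pt; apply: smooth_continuous.
  exact: mol_smooth.
apply: (@le_trans _ _ (L1dist P (mol P c r J k.+2%:R^-1 (w i)) (w i) + (k.+2%:R^-1)%:E * W%:E)%E).
  rewrite -WE -ge0_integralZl//; last by apply/measurable_EFinP; exact: measurableT_comp.
  rewrite /L1dist -ge0_integralD//; last 2 first.
  - exact: measurable_abs_dist.
  - by apply: measurable_funeM; apply/measurable_EFinP; exact: measurableT_comp.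
  have DE z : P z -> 'D_(e i) (mol P c r J k.+2%:R^-1 u) z = (1 - k.+2%:R^-1) * mol P c r J k.+2%:R^-1 (w i) z.
    by move=> Pz; exact: (mol_derive bP J r0 rP (t01 k) iu iw H Pz).
  apply: ge0_le_integral => //.
  - apply: measurable_abs_dist => //.
    apply: measurable_funTS; apply: continuous_measurable_pt; apply: smooth_continuous.
    by apply: smooth_derive; exact: mol_smooth.
  - apply: emeasurable_funD; first exact: measurable_abs_dist.
    by apply: measurable_funeM; apply/measurable_EFinP; exact: measurableT_comp.
  move=> z Pz; rewrite DE// -EFinM -EFinD lee_fin.
  set t := k.+2%:R^-1; set a := mol _ _ _ _ _ _ _.
  have /andP[t0 t1] := t01 k; rewrite -/t in t0 t1.
  have -> : (1 - t) * a - w i z = (1 - t) * (a - w i z) - t * w i z by ring.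
  apply: le_trans (ler_normB _ _) _.
  rewrite !normrM (gtr0_norm t0) lerD2r ger0_norm; last by rewrite subr_ge0 ltW.
  by rewrite ler_piMl// gerBl ltW.
rewrite [in leRHS](splitr d) EFinD; apply: leeD.
  by near: k; apply: Hw; rewrite divr_gt0.
rewrite -EFinM lee_fin mulrC ler_pdivrMr ?ltr0n//.
have : W / (d / 2) <= k.+2%:R.
  near: k; exists (Num.truncn (W / (d / 2))).+1 => // k /= h.
  apply: le_trans (ltW (truncnS_gt _)) _; rewrite ler_nat.
  by rewrite (leq_trans h)// -addn2 leq_addr.
by rewrite ler_pdivrMr ?divr_gt0// mulrC.
Unshelve. all: by end_near. Qed.

End density.

(** * The Poincare inequality along segments *)

Section coordinates.
Context {R : realType} {n : nat}.
Notation V := (pt R n).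

Definition dir (i : option 'I_n) : V := if i is Some j then e_x j else e_y n.

Definition coord (i : option 'I_n) (z : V) : R := if i is Some j then z.1 ord0 j else z.2.

Lemma coordD i z w : coord i (z + w) = coord i z + coord i w.
Proof. by case: i => [j|] //=; rewrite mxE. Qed.

Lemma coordZ i a z : coord i (a *: z) = a * coord i z.
Proof. by case: i => [j|] //=; rewrite mxE. Qed.

Lemma coordB i z w : coord i (z - w) = coord i z - coord i w.
Proof. by case: i => [j|] //=; rewrite !mxE. Qed.

Lemma measurable_coord i : measurable_fun setT (coord i : mpt R n -> R).
Proof. case: i => [j|]; [exact: measurable_mpt1|exact: measurable_mpt2]. Qed.

Lemma big_option (T : Type) (idx : T) (op : Monoid.com_law idx) (F : option 'I_n -> T) :
  \big[op/idx]_i F i = op (\big[op/idx]_j F (Some j)) (F None).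
Proof.
rewrite (bigD1 None)//= Monoid.mulmC; congr (op _ _).
rewrite (reindex_omap Some id)/=; last by case.
by apply: eq_bigl => j; rewrite eqxx.
Qed.

Lemma derive_coord (f : V -> R) (z w : V) : smooth f ->
  'D_w f z = \sum_i coord i w * 'D_(dir i) f z.
Proof. by move=> sf; rewrite derive_basis// big_option. Qed.

(** [k i] bounds the width of a body in the [i]-th coordinate; the sum then
bounds the variation of a function along any segment in the body. *)
Definition wgrad (k : option 'I_n -> R) (D : option 'I_n -> V -> R) (z : V) : R :=
  \sum_i k i * `|D i z|.

Lemma wgrad_ge0 k D z : (forall i, 0 <= k i) -> 0 <= wgrad k D z.
Proof. by move=> k0; apply: sumr_ge0 => i _; rewrite mulr_ge0. Qed.

Lemma measurable_wgrad k D (A : set (mpt R n)) : (forall i, measurable_fun A (D i : mpt R n -> R)) ->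
  measurable_fun A (wgrad k D : mpt R n -> R).
Proof.
move=> mD; apply: measurable_sum => i; apply: measurable_funM => //.
exact: measurableT_comp.
Qed.

Lemma wgrad_le k D D' z : (forall i, 0 <= k i) ->
  wgrad k D z <= wgrad k D' z + wgrad k (fun i z => D i z - D' i z) z.
Proof.
move=> k0; rewrite -big_split /=; apply: ler_sum => i _; rewrite -mulrDr ler_wpM2l//.
by rewrite -[in leLHS](subrK (D' i z) (D i z)) addrC; exact: ler_normD.
Qed.

End coordinates.

Section segment_operator.
Context {R : realType} {n : nat}.
Notation V := (pt R n).
Notation vol := (@vol R n).
Notation mu := (@lebesgue_measure R).
Notation mR := (measurableTypeR R).
Variable P : set V.
Hypothesis bP : convex_body P.
Local Open Scope ereal_scope.

Let mP : measurable (P : set (mpt R n)) := body_measurable bP.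

(** Up to the factor [vol P], the mean of [f] over the segments from [z] to the points
of [P]. *)
Definition segop (f : V -> \bar R) (z : V) : \bar R :=
  \int[mu]_(t in `[0%R, 1%R]) \int[vol]_(w in P) f ((1 - t) *: z + t *: w)%R.

Lemma segop_ge0 f z : (forall z, 0 <= f z) -> 0 <= segop f z.
Proof. by move=> f0; apply: integral_ge0 => t _; exact: integral_ge0. Qed.

Lemma measurable_segop_pair (f : mpt R n -> \bar R) : measurable_fun setT f -> (forall z, 0 <= f z) ->
  measurable_fun setT (fun x : mpt R n * mR =>
    \int[vol]_(w in P) f ((1 - x.2) *: (x.1 : V) + (x.2 : R) *: (w : V))%R).
Proof.
move=> mf f0.
apply: (measurable_integral_in _ (f := fun (x : mpt R n * mR) (w : mpt R n) =>
   f ((1 - x.2) *: (x.1 : V) + (x.2 : R) *: (w : V))%R)) => //.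
rewrite [setT `*` P]setTX; apply: measurable_funTS; apply: (measurableT_comp mf).
apply: (measurable_pt_comb (c := fun p : mpt R n * mR * mpt R n => (1 - p.1.2)%R : mR)
   (b := fun p => p.1.2) (f := fun p => p.1.1) (g := fun p => p.2)).
- apply: measurable_funB => //.
  by apply: measurableT_comp; [exact: measurable_snd|exact: measurable_fst].
- by apply: measurableT_comp; [exact: measurable_snd|exact: measurable_fst].
- by apply: measurableT_comp; [exact: measurable_fst|exact: measurable_fst].
- exact: measurable_snd.
Qed.

Lemma measurable_segop (f : mpt R n -> \bar R) : measurable_fun setT f -> (forall z, 0 <= f z) ->
  measurable_fun setT (segop f : mpt R n -> \bar R).
Proof.
move=> mf f0.
apply: (measurable_integral_in _ (f := fun (z : mpt R n) (t : mR) =>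
  \int[vol]_(w in P) f ((1 - t) *: (z : V) + (t : R) *: (w : V))%R)) => //.
  by apply: measurable_funTS; exact: measurable_segop_pair.
by move=> z t _ _; exact: integral_ge0.
Qed.

Lemma measurable_segop_t (f : mpt R n -> \bar R) (z : V) :
  measurable_fun setT f -> (forall z, 0 <= f z) ->
  measurable_fun setT (fun t : mR => \int[vol]_(w in P) f ((1 - t) *: z + (t : R) *: (w : V))%R).
Proof.
move=> mf f0.
exact: (measurableT_comp (measurable_segop_pair mf f0) (measurable_pair1 z)).
Qed.

Lemma measurable_segop_w (f : mpt R n -> \bar R) (z : V) (t : R) :
  measurable_fun setT f ->
  measurable_fun setT (fun w : mpt R n => f ((1 - t) *: z + (t : R) *: (w : V))%R).
Proof.
move=> mf; apply: (measurableT_comp mf).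
exact: (measurable_pt_comb (c := cst (1 - t)%R) (b := cst t) (f := cst z) (g := id)).
Qed.

Lemma segop_swap (f : mpt R n -> \bar R) (z : V) :
  measurable_fun setT f -> (forall z, 0 <= f z) ->
  segop f z = \int[vol]_(w in P) \int[mu]_(t in `[0%R, 1%R]) f ((1 - t) *: z + t *: w)%R.
Proof.
move=> mf f0; rewrite /segop.
apply: (tonelli_in _ _ (f := fun (t : mR) (w : mpt R n) => f ((1 - t) *: z + (t : R) *: (w : V))%R)) => //.
apply: measurable_funTS; apply: (measurableT_comp mf).
apply: (measurable_pt_comb (c := fun p : mR * mpt R n => (1 - p.1)%R : mR)
   (b := fun p => p.1) (f := cst z) (g := fun p => p.2)) => //.
- by apply: measurable_funB => //; exact: measurable_fst.
- exact: measurable_fst.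
- exact: measurable_snd.
Qed.

Lemma segop_le (f g : mpt R n -> \bar R) (z : V) :
  measurable_fun setT f -> (forall z, 0 <= f z) ->
  measurable_fun setT g -> (forall z, f z <= g z) -> segop f z <= segop g z.
Proof.
move=> mf f0 mg fg; have g0 w : 0 <= g w := le_trans (f0 w) (fg w).
apply: ge0_le_integral => //.
- by move=> t _; exact: integral_ge0.
- by apply: measurable_funTS; exact: measurable_segop_t.
- by apply: measurable_funTS; exact: measurable_segop_t.
move=> t _; apply: ge0_le_integral => //;
  by apply: measurable_funTS; exact: measurable_segop_w.
Qed.

Lemma segopD (f g : mpt R n -> \bar R) (z : V) :
  measurable_fun setT f -> (forall z, 0 <= f z) ->
  measurable_fun setT g -> (forall z, 0 <= g z) ->
  segop (fun z => f z + g z) z = segop f z + segop g z.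
Proof.
move=> mf f0 mg g0; rewrite /segop -ge0_integralD//; first last.
- by apply: measurable_funTS; exact: measurable_segop_t.
- by move=> t _; exact: integral_ge0.
- by apply: measurable_funTS; exact: measurable_segop_t.
- by move=> t _; exact: integral_ge0.
apply: eq_integral => t _; rewrite -ge0_integralD//;
  by apply: measurable_funTS; exact: measurable_segop_w.
Qed.

Lemma segop_L1 (f : mpt R n -> \bar R) : measurable_fun setT f -> (forall z, 0 <= f z) ->
  \int[vol]_(z in P) segop f z <= (2 ^+ n.+1)%:E * (vol P * \int[vol]_(z in P) f z).
Proof.
move=> mf f0; rewrite /segop.
rewrite (tonelli_in _ _ (f := fun (z : mpt R n) (t : mR) =>
  \int[vol]_(w in P) f ((1 - t) *: (z : V) + (t : R) *: (w : V))%R))//; last 2 first.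
- by apply: measurable_funTS; exact: measurable_segop_pair.
- by move=> z t _ _; exact: integral_ge0.
have I0 : 0 <= \int[vol]_(z in P) f z by exact: integral_ge0.
apply: (@le_trans _ _ (\int[mu]_(t in `[0%R, 1%R]) (cst ((2 ^+ n.+1)%:E * (vol P * \int[vol]_(z in P) f z)) t))).
  apply: ge0_le_integral => //.
  - by move=> t _; apply: integral_ge0 => z _; exact: integral_ge0.
  - apply: (measurable_integral_in _ (f := fun (t : mR) (z : mpt R n) =>
       \int[vol]_(w in P) f ((1 - t) *: (z : V) + (t : R) *: (w : V))%R)) => //.
      apply: measurable_funTS.
      have ms : measurable_fun setT (fun p : mR * mpt R n => (p.2, p.1) : mpt R n * mR).
        by apply: measurable_fun_pair; [exact: measurable_snd|exact: measurable_fst].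
      exact: (measurableT_comp (measurable_segop_pair mf f0) ms).
    by move=> t z _ _; exact: integral_ge0.
  by move=> t /= t01; apply: integral2_comb_le => //; move: t01; rewrite in_itv.
rewrite integral_cst// [X in _ * X](_ : _ = 1) ?mule1//.
by transitivity ((1 - 0 : R)%:E); [exact: lebesgue_segment|rewrite subr0].
Qed.

End segment_operator.

Section segment_poincare.
Context {R : realType} {n : nat}.
Notation V := (pt R n).
Notation vol := (@vol R n).
Notation mu := (@lebesgue_measure R).
Notation mR := (measurableTypeR R).
Variables (P : set V) (k : option 'I_n -> R).
Hypothesis bP : convex_body P.
Hypothesis k0 : forall i, 0 <= k i.
Hypothesis Pk : forall z w i, P z -> P w -> `|coord i w - coord i z| <= k i.
Let mP : measurable (P : set (mpt R n)) := body_measurable bP.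

(** The fundamental theorem of calculus on the segment from [z] to [w], whose
increments in the coordinates are bounded by [k]. *)
Lemma smooth_segment (f : V -> R) (z w : V) : smooth f -> P z -> P w ->
  (`|f w - f z|%:E <= \int[mu]_(t in `[0%R, 1%R])
     (wgrad k (fun i => 'D_(dir i) f) ((1 - t) *: z + t *: w)%R)%:E)%E.
Proof.
move=> sf Pz Pw.
have cD (e : V) : continuous (fun t : R => 'D_e f ((1 - t) *: z + t *: w)).
  have -> : (fun t : R => 'D_e f ((1 - t) *: z + t *: w)) = (fun t : R => 'D_e f (z + t *: (w - z))).
    by apply/funext => t; congr ('D_e f _); rewrite scalerBl scale1r scalerBr addrAC addrA.
  exact: (@smooth_line_continuous _ _ _ (smooth_derive e sf)).
have mD (e : V) : measurable_fun setT (fun t : mR => 'D_e f ((1 - t) *: z + t *: w)).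
  exact: continuous_measurable_fun.
have := smooth_FTC z (w - z) sf; have -> : z + (w - z) = w by rewrite addrC subrK.
move=> H.
rewrite -[leLHS]/(`|(f w - f z)%:E|)%E -H; apply: le_trans (le_abse_integral _ _ _) _ => //.
  apply/measurable_EFinP; apply: measurable_funTS.
  rewrite (_ : (fun _ => _) = (fun t : mR => 'D_(w - z) f ((1 - t) *: z + t *: w))); first exact: mD.
  by apply/funext => t; congr ('D_(w - z) f _); rewrite scalerBl scale1r scalerBr addrAC addrA.
apply: ge0_le_integral => //.
- apply/measurable_EFinP; apply: measurable_funTS; apply: measurableT_comp => //.
  rewrite (_ : (fun _ => _) = (fun t : mR => 'D_(w - z) f ((1 - t) *: z + t *: w))); first exact: mD.
  by apply/funext => t; congr ('D_(w - z) f _); rewrite scalerBl scale1r scalerBr addrAC addrA.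
- apply/measurable_EFinP; apply: measurable_funTS.
  apply: measurable_sum => i; apply: measurable_funM => //.
  by apply: measurableT_comp => //; exact: mD.
move=> t _; rewrite lee_fin derive_coord//.
have -> : z + t *: (w - z) = (1 - t) *: z + t *: w.
  by rewrite scalerBl scale1r scalerBr addrAC addrA.
apply: le_trans (ler_norm_sum _ _ _) _; apply: ler_sum => i _; rewrite normrM ler_wpM2r//.
by rewrite coordB; exact: Pk.
Qed.

Lemma smooth_poincare (f : V -> R) (z : V) : smooth f -> P z ->
  (\int[vol]_(w in P) `|f w - f z|%:E <=
   segop P (fun z => (wgrad k (fun i => 'D_(dir i) f) z)%:E) z)%E.
Proof.
move=> sf Pz.
have mW : measurable_fun setT (fun z : mpt R n => (wgrad k (fun i => 'D_(dir i) f) z)%:E).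
  apply/measurable_EFinP; apply: measurable_wgrad => i; apply: continuous_measurable_pt.
  by apply: smooth_continuous; exact: smooth_derive.
have W0 z' : (0 <= (wgrad k (fun i => 'D_(dir i) f) z')%:E)%E by rewrite lee_fin wgrad_ge0.
rewrite (segop_swap bP)//; apply: ge0_le_integral => //.
- apply: measurable_abs_dist => //; apply: measurable_funTS; apply: continuous_measurable_pt.
  exact: smooth_continuous.
- apply: (measurable_integral_in _ (f := fun (w : mpt R n) (t : mR) =>
    (wgrad k (fun i => 'D_(dir i) f) ((1 - t) *: z + (t : R) *: (w : V))%R)%:E)) => //.
  apply: measurable_funTS.
  apply: (measurableT_comp mW).
  apply: (measurable_pt_comb (c := fun p : mpt R n * mR => (1 - p.2)%R : mR)
     (b := fun p => p.2) (f := cst z) (g := fun p => p.1)) => //.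
  - by apply: measurable_funB => //; exact: measurable_snd.
  - exact: measurable_snd.
  - exact: measurable_fst.
by move=> w Pw; exact: smooth_segment.
Qed.

Variables (u : V -> R) (D : option 'I_n -> V -> R).
Hypothesis mu_ : measurable_fun setT (u : mpt R n -> R).
Hypothesis mD : forall i, measurable_fun setT (D i : mpt R n -> R).
Hypothesis uD : forall i, has_weak_derivative P u (dir i) (D i).

Let X (z : V) : \bar R := (\int[vol]_(w in P) `|u w - u z|%:E)%E.
Let Y (z : V) : \bar R := segop P (fun z => (wgrad k D z)%:E) z.

Let iu : vol.-integrable P (EFin \o u). Proof. by have [] := uD None. Qed.

Lemma measurable_wgradD : measurable_fun setT (fun z : mpt R n => (wgrad k D z)%:E).
Proof. by apply/measurable_EFinP; exact: measurable_wgrad. Qed.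

Lemma measurable_dist_integral : measurable_fun setT (X : mpt R n -> \bar R).
Proof.
apply: (measurable_integral_in _ (f := fun z w : mpt R n => `|u w - u z|%:E)%E) => //.
apply: measurable_funTS; apply/measurable_EFinP; apply: measurableT_comp => //.
by apply: measurable_funB; apply: (measurableT_comp mu_);
  [exact: measurable_snd|exact: measurable_fst].
Qed.

Let error (f : V -> R) (z : V) : \bar R :=
  (vol P * `|f z - u z|%:E + L1dist P f u +
   segop P (fun z => (wgrad k (fun i z => 'D_(dir i) f z - D i z) z)%:E) z)%E.

Lemma poincare_error (f : V -> R) z : smooth f -> P z -> (X z <= Y z + error f z)%E.
Proof.
move=> sf Pz.
have mf : measurable_fun setT (f : mpt R n -> R).
  by apply: continuous_measurable_pt; exact: smooth_continuous.
have mfD i : measurable_fun setT ('D_(dir i) f : mpt R n -> R).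
  by apply: continuous_measurable_pt; apply: smooth_continuous; exact: smooth_derive.
have mD' : measurable_fun setT (fun z : mpt R n => (wgrad k (fun i z => 'D_(dir i) f z - D i z) z)%:E).
  by apply/measurable_EFinP; apply: measurable_wgrad => i; exact: measurable_funB.
have W0 D' z' : (0 <= (wgrad k D' z')%:E)%E by rewrite lee_fin wgrad_ge0.
rewrite /error addeCA; apply: (@le_trans _ _ (vol P * `|f z - u z|%:E + L1dist P f u +
    \int[vol]_(w in P) `|f w - f z|%:E)%E).
  have m1 : measurable_fun P (fun w : mpt R n => `|f w - u w|%:E).
    by apply: measurable_funTS; exact: measurable_abs_dist.
  have m2 : measurable_fun P (fun w : mpt R n => `|f w - f z|%:E).
    by apply: measurable_funTS; exact: measurable_abs_dist.
  pose c : mpt R n -> \bar R := cst `|f z - u z|%:E.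
  have q0 (g : V -> R) w : P w -> (0 <= `|g w|%:E)%E by rewrite lee_fin.
  have mc : measurable_fun P c by exact: measurable_cst.
  have m3 : measurable_fun P (c \+ (fun w : mpt R n => `|f w - u w|%:E))%E by exact: emeasurable_funD.
  have p3 w : P w -> (0 <= (c \+ (fun w : mpt R n => `|f w - u w|%:E)) w)%E by move=> _; rewrite /= adde_ge0 /c //= lee_fin.
  have <- : (\int[vol]_(w in P) (c w + `|f w - u w|%:E + `|f w - f z|%:E) =
      vol P * `|f z - u z|%:E + L1dist P f u + \int[vol]_(w in P) `|f w - f z|%:E)%E.
    rewrite (@ge0_integralD _ _ R vol _ mP (c \+ (fun w : mpt R n => `|f w - u w|%:E))%E _ p3 m3 (q0 (fun w => f w - f z)) m2).
    rewrite (@ge0_integralD _ _ R vol _ mP c _ (q0 (fun=> f z - u z)) mc (q0 (fun w => f w - u w)) m1).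
    by rewrite integral_cst// muleC.
  apply: ge0_le_integral => //.
  - by apply: measurable_funTS; apply: measurable_abs_dist.
  - exact: emeasurable_funD.
  move=> w _; rewrite -!EFinD lee_fin.
  have -> : u w - u z = (f z - u z) - (f w - u w) + (f w - f z) by ring.
  by apply: le_trans (ler_normD _ _) _; rewrite lerD2r; exact: ler_normB.
apply: leeD => //; apply: le_trans (smooth_poincare sf Pz) _.
rewrite /Y -(segopD bP)//; last exact: measurable_wgradD.
apply: segop_le => //.
- by apply/measurable_EFinP; exact: measurable_wgrad.
- by apply: emeasurable_funD => //; exact: measurable_wgradD.
- by move=> w; rewrite -EFinD lee_fin; exact: wgrad_le.
Qed.

Lemma integral_error (f : V -> R) (d : R) : smooth f -> 0 <= d ->
  (L1dist P f u <= d%:E)%E -> (forall i, L1dist P ('D_(dir i) f) (D i) <= d%:E)%E ->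
  (\int[vol]_(z in P) error f z <= vol P * ((2 + 2 ^+ n.+1 * \sum_i k i) * d)%:E)%E.
Proof.
move=> sf d0 fd Dd.
have mf : measurable_fun setT (f : mpt R n -> R).
  by apply: continuous_measurable_pt; exact: smooth_continuous.
have mfD i : measurable_fun setT ('D_(dir i) f : mpt R n -> R).
  by apply: continuous_measurable_pt; apply: smooth_continuous; exact: smooth_derive.
have mD' : measurable_fun setT (fun z : mpt R n => (wgrad k (fun i z => 'D_(dir i) f z - D i z) z)%:E).
  by apply/measurable_EFinP; apply: measurable_wgrad => i; exact: measurable_funB.
have W0 D' z' : (0 <= (wgrad k D' z')%:E)%E by rewrite lee_fin wgrad_ge0.
have mdist : measurable_fun P (fun z : mpt R n => `|f z - u z|%:E).
  by apply: measurable_funTS; exact: measurable_abs_dist.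
have vP0 : (0 <= vol P)%E by [].
rewrite /error ge0_integralD//; last 4 first.
- by move=> z _; rewrite adde_ge0 ?mule_ge0 ?L1dist_ge0.
- by apply: emeasurable_funD => //; exact: measurable_funeM.
- by move=> z _; exact: segop_ge0.
- by apply: measurable_funTS; exact: measurable_segop.
rewrite ge0_integralD//; last 3 first.
- by move=> z _; rewrite mule_ge0.
- exact: measurable_funeM.
- by move=> z _; exact: L1dist_ge0.
rewrite ge0_integralZl// integral_cst// (muleC (L1dist _ _ _)).
have -> : ((2 + 2 ^+ n.+1 * \sum_i k i) * d)%:E =
   (d%:E + d%:E + (2 ^+ n.+1)%:E * (\sum_i k i * d)%:E)%E.
  by rewrite -EFinM -!EFinD -mulr_suml mulrA; congr EFin; ring.
rewrite [leRHS]ge0_muleDr; last 2 first.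
- by rewrite -EFinD lee_fin addr_ge0.
- by rewrite -EFinM lee_fin mulr_ge0 ?exprn_ge0// sumr_ge0// => i _; rewrite mulr_ge0.
rewrite [in leRHS]ge0_muleDr ?lee_fin//; apply: leeD.
  by apply: leeD; apply: lee_wpmul2l.
apply: le_trans (segop_L1 bP mD' _) _ => //.
rewrite muleCA; apply: lee_wpmul2l => //; apply: lee_wpmul2l; first by rewrite lee_fin exprn_ge0.
rewrite -sumEFin.
under eq_integral => z _ do rewrite /wgrad -sumEFin.
rewrite ge0_integral_sum//; last 2 first.
- move=> i; apply/measurable_EFinP; apply: measurable_funTS; apply: measurable_funM => //.
  by apply: measurableT_comp => //; exact: measurable_funB.
- by move=> i z _; rewrite lee_fin mulr_ge0.
apply: lee_sum => i _.
under eq_integral => z _ do rewrite EFinM.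
rewrite ge0_integralZl//.
- by rewrite EFinM; apply: lee_wpmul2l; [rewrite lee_fin|exact: Dd].
- by apply: measurable_funTS; exact: measurable_abs_dist.
- by rewrite lee_fin.
Qed.

(** The excess of the left-hand side is at most the approximation error, whose
integral is arbitrarily small. *)
Lemma segment_poincare : {ae vol, forall z, P z -> (X z <= Y z)%E}.
Proof.
pose S (z : mpt R n) : \bar R := maxe 0%E (X z - Y z)%E.
have mX := measurable_dist_integral.
have mY : measurable_fun setT (Y : mpt R n -> \bar R).
  by apply: measurable_segop => //; [exact: measurable_wgradD|move=> z; rewrite lee_fin wgrad_ge0].
have mS : measurable_fun setT S.
  by apply: measurable_maxe => //; exact: emeasurable_funB.
have S0 z : (0 <= S z)%E by rewrite le_max lexx.
have Xfin z : X z \is a fin_num.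
  rewrite ge0_fin_numE; last exact: integral_ge0.
  apply: (@le_lt_trans _ _ (\int[vol]_(w in P) (`|u w|%:E + `|u z|%:E))%E).
    apply: ge0_le_integral => //.
    - by apply: measurable_funTS; exact: measurable_abs_dist.
    - apply: measurable_funTS; apply: emeasurable_funD => //.
      by apply/measurable_EFinP; exact: measurableT_comp.
    - by move=> w _; rewrite -EFinD lee_fin ler_normB.
  rewrite ge0_integralD//; last first.
    by apply: measurable_funTS; apply/measurable_EFinP; exact: measurableT_comp.
  rewrite integral_cst//; apply: lte_add_pinfty; first by case/integrableP: iu.
  by rewrite lte_mul_pinfty//; exact: body_fin.
have Yn z : Y z != -oo%E.
  by rewrite -ltNye (lt_le_trans (ltNyr 0))//; apply: segop_ge0 => w; rewrite lee_fin wgrad_ge0.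
have S_small e : 0 < e -> (\int[vol]_(z in P) S z <= e%:E)%E.
  move=> e0.
  pose C := fine (vol P) * (2 + 2 ^+ n.+1 * \sum_i k i).
  have vP0 : 0 < fine (vol P) by rewrite fine_gt0// body_gt0// body_fin.
  have vPE : (vol P = (fine (vol P))%:E)%E by rewrite fineK// ge0_fin_numE// body_fin.
  have C0 : 0 < C.
    rewrite mulr_gt0// ltr_pwDl// mulr_ge0 ?exprn_ge0// sumr_ge0//.
  have d0 : 0 < e / C by rewrite divr_gt0.
  have [u_ [su uu uDu]] := smooth_density bP iu uD.
  have : \forall j \near \oo, (L1dist P (u_ j) u <= (e / C)%:E)%E /\
     forall i, (L1dist P ('D_(dir i) (u_ j)) (D i) <= (e / C)%:E)%E.
    apply: filterI; first by have /ecvg0P := uu; apply => // j; exact: L1dist_ge0.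
    have /choice[M HM] : forall i, exists N, forall j, (N <= j)%N ->
        (L1dist P ('D_(dir i) (u_ j)) (D i) <= (e / C)%:E)%E.
      move=> i; have /ecvg0P := uDu i => /(_ (fun j => L1dist_ge0 _ _ _) _ d0)[N _ HN].
      by exists N.
    exists (\max_i M i)%N => // j /= hj i; apply: HM; apply: leq_trans hj.
    exact: leq_bigmax.
  move=> [N _ /(_ N (leqnn N))[h1 h2]].
  apply: (@le_trans _ _ (\int[vol]_(z in P) error (u_ N) z)%E); last first.
    apply: le_trans (integral_error (su N) (ltW d0) h1 h2) _.
    by rewrite vPE -EFinM lee_fin mulrA -/C mulrCA mulfV ?mulr1// gt_eqF.
  have error0 z : (0 <= error (u_ N) z)%E.
    apply: adde_ge0; first by rewrite adde_ge0 ?mule_ge0 ?L1dist_ge0.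
    by apply: segop_ge0 => w; rewrite lee_fin wgrad_ge0.
  have mu_N : measurable_fun setT (u_ N : mpt R n -> R).
    by apply: continuous_measurable_pt; exact: smooth_continuous.
  apply: ge0_le_integral => //.
  - exact: measurable_funTS.
  - apply: measurable_funTS; apply: emeasurable_funD.
      apply: emeasurable_funD => //; apply: measurable_funeM; exact: measurable_abs_dist.
    apply: measurable_segop => //; last by move=> w; rewrite lee_fin wgrad_ge0.
    apply/measurable_EFinP; apply: measurable_wgrad => i; apply: measurable_funB => //.
    by apply: continuous_measurable_pt; apply: smooth_continuous; exact: smooth_derive.
  move=> z Pz; rewrite /S ge_max error0 /=.
  have := poincare_error (su N) Pz.
  case: (Y z) (Yn z) => [y| |]// _; last by rewrite -(fineK (Xfin z)) leNye.
  by move=> h; rewrite leeBlDl.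
have SI : (\int[vol]_(z in P) `|S z| = 0)%E.
  under eq_integral => z _ do rewrite gee0_abs//.
  apply/eqP; rewrite eq_le integral_ge0// andbT.
  by apply/lee_addgt0Pr => e e0; rewrite add0e; exact: S_small.
have /ae_eq_integral_abs := SI => /(_ mP (measurable_funTS mS)).
apply: filterS => z h Pz; have := h Pz; rewrite /S /=.
move=> E; have : (X z - Y z <= 0)%E by rewrite -E le_max lexx orbT.
case: (Y z) (Yn z) => [y| |]// _; last by rewrite leey.
by rewrite leeBlDl// adde0.
Qed.

End segment_poincare.

(** * Weights with bounded A_2 products over rectangles *)

Section weighted_cauchy_schwarz.
Context d (T : measurableType d) {R : realType} (m : {measure set T -> \bar R}).
Local Open Scope ereal_scope.

(** Integrate [2 f <= l f ^ 2 a + l^-1 a^-1] and choose [l] to be the ratio of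
the integrals of [a^-1] and [f]. *)
Lemma weighted_cauchy_schwarz (D : set T) (f : T -> \bar R) (a : T -> R) :
  measurable D -> measurable_fun D f -> (forall x, 0 <= f x) ->
  measurable_fun D a -> (forall x, 0 < a x)%R ->
  0 < \int[m]_(x in D) ((a x)^-1)%:E < +oo ->
  (\int[m]_(x in D) f x) ^+ 2 <=
  \int[m]_(x in D) (f x ^+ 2 * (a x)%:E) * \int[m]_(x in D) ((a x)^-1)%:E.
Proof.
move=> mD mf f0 ma a0 /andP[B0 Boo].
have mai : measurable_fun D (fun x => ((a x)^-1)%:E).
  apply/measurable_EFinP.
  apply: (measurable_comp (F := [set x : R | x != 0%R])) ma.
  - apply: open_measurable; exact: open_neq.
  - by move=> _ [x _ <-] /=; rewrite gt_eqF.
  - apply: open_continuous_measurable_fun; first exact: open_neq.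
    by move=> x; rewrite inE /= => x0; exact: inv_continuous.
have mfa : measurable_fun D (fun x => f x ^+ 2 * (a x)%:E).
  apply: emeasurable_funM; last exact/measurable_EFinP.
  by apply: emeasurable_funM.
set A := \int[m]_(x in D) (f x ^+ 2 * (a x)%:E).
set B := \int[m]_(x in D) _ in B0 Boo *.
set X := \int[m]_(x in D) f x.
have fa0 x : 0 <= f x ^+ 2 * (a x)%:E.
  by apply: mule_ge0; [exact: expe_ge0|rewrite lee_fin ltW].
have A0 : 0 <= A by exact: integral_ge0.
have X0 : 0 <= X by apply: integral_ge0.
have main (l : R) : (0 < l)%R -> X + X <= l%:E * A + (l^-1)%:E * B.
  move=> l0; rewrite /X -ge0_integralD// -ge0_integralZl//; last by rewrite lee_fin ltW.
  rewrite -[X in _ <= _ + X]ge0_integralZl//; last 2 first.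
  - by move=> x _; rewrite lee_fin invr_ge0 ltW.
  - by rewrite lee_fin invr_ge0 ltW.
  rewrite -ge0_integralD//; last 4 first.
  - by move=> x _; apply: mule_ge0 => //; rewrite lee_fin ltW.
  - exact: measurable_funeM.
  - by move=> x _; rewrite mule_ge0 ?lee_fin ?invr_ge0 ?ltW.
  - exact: measurable_funeM.
  apply: ge0_le_integral => //.
  - by move=> x _; rewrite adde_ge0.
  - exact: emeasurable_funD.
  - by apply: emeasurable_funD; exact: measurable_funeM.
  move=> x Dx; have ax := a0 x; have := f0 x; case: (f x) => [r| |] //.
    rewrite -EFin_expe -!EFinM -!EFinD !lee_fin => r0.
    have : (0 <= l^-1 * (a x)^-1 * (l * a x * r - 1) ^+ 2)%R.
      by rewrite mulr_ge0 ?sqr_ge0// mulr_ge0 ?invr_ge0 ?ltW.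
    have -> : (l^-1 * (a x)^-1 * (l * a x * r - 1) ^+ 2 =
      l * (r ^+ 2 * a x) + l^-1 * (a x)^-1 - (r + r))%R.
      by field; rewrite !gt_eqF.
    by rewrite subr_ge0.
  by move=> _; rewrite expe2 mulyy gt0_mulye ?lte_fin// gt0_muley ?lte_fin// addye ?leey.
have [->|Aoo] := eqVneq A +oo; first by rewrite gt0_mulye// leey.
have Af : A \is a fin_num by rewrite ge0_fin_numE// ltey.
have Bf : B \is a fin_num by rewrite ge0_fin_numE// ltW.
have Xoo : X < +oo.
  apply: le_lt_trans (leeDl X X0) _; apply: le_lt_trans (main 1%R ltr01) _.
  by rewrite -(fineK Af) -(fineK Bf) -!EFinM -EFinD ltry.
have Xf : X \is a fin_num by rewrite ge0_fin_numE.
move: main A0 X0 B0; rewrite -(fineK Af) -(fineK Bf) -(fineK Xf) !lee_fin lte_fin.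
set x := fine X; set y := fine A; set z := fine B => main y0 x0 z0.
have [->|xn] := eqVneq x 0%R; first by rewrite mul0r mulr_ge0// ltW.
have xp : (0 < x)%R by rewrite lt_neqAle eq_sym xn.
have := main (z / x)%R (divr_gt0 z0 xp).
rewrite -!EFinM -!EFinD lee_fin.
have -> : ((z / x)^-1 * z = x)%R by field; rewrite !gt_eqF.
by rewrite lerD2r mulrAC ler_pdivlMr// (mulrC z).
Qed.

End weighted_cauchy_schwarz.

Lemma measurable_inv_gt0 d (T : measurableType d) (R : realType) (a : T -> R) :
  measurable_fun setT a -> (forall x, 0 < a x) -> measurable_fun setT (fun x => ((a x)^-1)%:E).
Proof.
move=> ma a0; apply/measurable_EFinP.
apply: (measurable_comp (F := [set x : R | x != 0])) ma.
- apply: open_measurable; exact: open_neq.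
- by move=> _ [x _ <-] /=; rewrite gt_eqF.
- apply: open_continuous_measurable_fun; first exact: open_neq.
  by move=> x; rewrite inE /= => x0; exact: inv_continuous.
Qed.

(** A strong A_2 weight is positive almost everywhere. Taking it positive everywhere
keeps its inverse finite. *)
Definition positive_A2 {R : realType} {n : nat} (a : pt R n -> R) (A : R) :=
  [/\ 0 <= A, measurable_fun setT (a : mpt R n -> R), forall z, 0 < a z &
    forall S, is_rectangle S ->
      [/\ (\int[@vol R n]_(z in S) (a z)%:E < +oo)%E,
          (\int[@vol R n]_(z in S) ((a z)^-1)%:E < +oo)%E &
      (\int[@vol R n]_(z in S) (a z)%:E * \int[@vol R n]_(z in S) ((a z)^-1)%:E <=
      A%:E * vol S ^+ 2)%E]].

Section weighted_segop.
Context {R : realType} {n : nat}.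
Notation V := (pt R n).
Notation vol := (@vol R n).
Notation mu := (@lebesgue_measure R).
Notation mR := (measurableTypeR R).
Variables (k : option 'I_n -> R) (a : V -> R) (A : R).
Hypothesis k0 : forall i, 0 < k i.
Hypothesis aA : positive_A2 a A.

Let ma : measurable_fun setT (a : mpt R n -> R). Proof. by case: aA. Qed.
Let A_ge0 : 0 <= A. Proof. by case: aA. Qed.
Let a0 z : 0 < a z. Proof. by case: aA => _ _ h _; exact: h. Qed.
Let mai : measurable_fun setT (fun z : mpt R n => ((a z)^-1)%:E).
Proof. exact: measurable_inv_gt0. Qed.

(** Boxes with the proportions of the widths of a body. The A_2 condition concerns
all rectangles, so its constant does not see these proportions. *)
Definition kbox (t : R) (z : V) : set V :=
  [set w | forall i, `|coord i w - coord i z| <= t * k i].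

Lemma kboxE t z : kbox t z =
  box (z.1 - \row_j (t * k (Some j))) (z.1 + \row_j (t * k (Some j)))
      (z.2 - t * k None) (z.2 + t * k None).
Proof.
apply/seteqP; split => w /=.
  move=> h; split.
    by move=> i; have := h (Some i); rewrite /= ler_norml !mxE; lra.
  by have := h None; rewrite /= ler_norml; lra.
move=> [h1 h2] [i|] /=; rewrite ler_norml; last by lra.
by have := h1 i; rewrite !mxE; lra.
Qed.

Lemma kbox_rectangle t z : 0 < t -> is_rectangle (kbox t z).
Proof.
move=> t0; rewrite kboxE; do 4 eexists; split; last reflexivity.
- by move=> i; rewrite !mxE; have := mulr_gt0 t0 (k0 (Some i)); lra.
- by have := mulr_gt0 t0 (k0 None); lra.
Qed.

Lemma measurable_kbox t z : measurable (kbox t z : set (mpt R n)).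
Proof. by rewrite kboxE; exact: measurable_box. Qed.

Lemma vol_kbox t z : 0 < t -> vol (kbox t z) = ((2 * t) ^+ n.+1 * \prod_i k i)%:E.
Proof.
move=> t0; rewrite kboxE vol_box; last 2 first.
- by move=> i; rewrite !mxE; have := mulr_gt0 t0 (k0 (Some i)); lra.
- by have := mulr_gt0 t0 (k0 None); lra.
congr EFin; transitivity (\prod_i (2 * t * k i)).
  rewrite big_option /=; congr (_ * _); last by ring.
  by apply: eq_bigr => i _; rewrite !mxE; ring.
by rewrite big_split /= prodr_const card_option card_ord.
Qed.

Lemma kbox_sym t z w : kbox t z w -> kbox t w z.
Proof. by move=> h i; rewrite distrC; exact: h. Qed.

Lemma kbox_double t z p : kbox t z p -> kbox t z `<=` kbox (2 * t) p.
Proof.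
move=> hp w hw i; rewrite -(subrKA (coord i z)) -mulrA mulr2n mulrDl !mul1r.
by apply: le_trans (ler_normD _ _) _; rewrite lerD//; exact: (kbox_sym hp).
Qed.

Definition near_ind (t : R) (z w : V) : R := (asbool (kbox t z w))%:R.

Lemma near_ind_sym t z w : near_ind t z w = near_ind t w z.
Proof. by rewrite /near_ind; congr ((asbool _)%:R); apply/propext; split; exact: kbox_sym. Qed.

Lemma measurable_near_ind t :
  measurable_fun setT (fun x : mpt R n * mpt R n => near_ind t x.1 x.2).
Proof.
pose S := [set x : mpt R n * mpt R n | kbox t x.1 x.2].
have mS : measurable S.
  rewrite (_ : S = \bigcap_(i : option 'I_n)
      [set x : mpt R n * mpt R n | `|coord i x.2 - coord i x.1| <= t * k i]); last first.
    by apply/seteqP; split => [x /= h i _|x /= h i]; exact: h.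
  apply: fin_bigcap_measurable => [|i _]; first exact: finite_finset.
  rewrite (_ : mkset _ = (fun x : mpt R n * mpt R n => `|coord i x.2 - coord i x.1|) @^-1`
      `]-oo, t * k i]%classic); last by apply/seteqP; split => x /=; rewrite in_itv.
  rewrite -[X in measurable X]setTI.
  suff : measurable_fun setT (fun x : mpt R n * mpt R n => `|coord i x.2 - coord i x.1|).
    by apply => //; exact: measurable_itv.
  apply: measurableT_comp => //; apply: measurable_funB.
    by apply: (measurableT_comp (measurable_coord i)); exact: measurable_snd.
  by apply: (measurableT_comp (measurable_coord i)); exact: measurable_fst.
rewrite (_ : (fun _ => _) = \1_S); first exact: measurable_indic.
by apply/funext => x; rewrite indicE /near_ind /S /=; congr (nat_of_bool _)%:R; rewrite /in_mem.
Qed.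

Local Open Scope ereal_scope.

Lemma kbox_integral t z (F : mpt R n -> \bar R) :
  \int[vol]_(w in kbox t z) F w = \int[vol]_w ((near_ind t z w)%:E * F w).
Proof.
rewrite integral_mkcond; apply: eq_integral => w _; rewrite patchE /near_ind.
case: ifPn => [/set_mem h|/negP h]; first by rewrite asboolT// mul1e.
by rewrite asboolF ?mul0e// => h'; apply: h; exact/mem_set.
Qed.

Lemma measurable_kbox_integral t (F : mpt R n -> \bar R) : measurable_fun setT F ->
  (forall z, 0 <= F z) -> measurable_fun setT (fun z : mpt R n => \int[vol]_(w in kbox t z) F w).
Proof.
move=> mF F0; under eq_fun do rewrite kbox_integral.
apply: (measurable_integral_in _ (f := fun z w : mpt R n => (near_ind t z w)%:E * F w)) => //.
  apply: measurable_funTS; apply: emeasurable_funM.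
    by apply/measurable_EFinP; exact: measurable_near_ind.
  by apply: measurableT_comp => //; exact: measurable_snd.
by move=> x y _ _; rewrite mule_ge0// lee_fin.
Qed.

Lemma kbox_A2 t z : (0 < t)%R ->
  \int[vol]_(w in kbox t z) (a w)%:E * \int[vol]_(w in kbox t z) ((a w)^-1)%:E <=
  (A * ((2 * t) ^+ n.+1 * \prod_i k i) ^+ 2)%:E.
Proof.
move=> t0; have [_ _ _ /(_ _ (kbox_rectangle z t0))[_ _ h]] := aA.
by apply: le_trans h _; rewrite vol_kbox// EFinM EFin_expe.
Qed.

(** The inverse of the weight is positive, so its integral over a set of positive
volume does not vanish. *)
Lemma kbox_inv_bounds t z : (0 < t)%R -> 0 < \int[vol]_(w in kbox t z) ((a w)^-1)%:E < +oo.
Proof.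
move=> t0; have [_ _ _ /(_ _ (kbox_rectangle z t0))[_ -> _]] := aA; rewrite andbT.
rewrite lt_neqAle integral_ge0 ?andbT; last by move=> w _; rewrite lee_fin invr_ge0 ltW.
apply/eqP => E.
have : \int[vol]_(w in kbox t z) `|((a w)^-1)%:E| = 0.
  by rewrite [RHS]E; apply: eq_integral => w _; rewrite gee0_abs// lee_fin invr_ge0 ltW.
have mK := measurable_kbox t z.
move=> /(ae_eq_integral_abs _ mK (measurable_funTS mai))[N [mN N0 sub]].
have : vol (kbox t z) <= vol N.
  apply: le_measure; rewrite ?inE// => w Kw; apply: sub => /= /(_ Kw) [] /eqP.
  by rewrite invr_eq0 gt_eqF.
rewrite N0 vol_kbox// lee_fin leNgt => /negP; apply.
by rewrite mulr_gt0 ?exprn_gt0 ?mulr_gt0// prodr_gt0.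
Qed.

(** Cauchy-Schwarz on each box, and the [A_2] condition on the boxes of twice the
size, which contain all the boxes of the given size that contain a given point. *)
Lemma kbox_average t (f : mpt R n -> \bar R) : (0 < t)%R ->
  measurable_fun setT f -> (forall z, 0 <= f z) ->
  \int[vol]_z ((\int[vol]_(w in kbox t z) f w) ^+ 2 * (a z)%:E) <=
  (A * ((4 * t) ^+ n.+1 * \prod_i k i) ^+ 2)%:E * \int[vol]_z (f z ^+ 2 * (a z)%:E).
Proof.
move=> t0 mf f0.
have t20 : (0 < 2 * t)%R by rewrite mulr_gt0.
pose W z := \int[vol]_(w in kbox t z) ((a w)^-1)%:E.
pose W2 z := \int[vol]_(w in kbox (2 * t) z) ((a w)^-1)%:E.
pose fa z := f z ^+ 2 * (a z)%:E.
have ai0 z : 0 <= ((a z)^-1)%:E by rewrite lee_fin invr_ge0 ltW.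
have ae0 z : 0 <= (a z)%:E by rewrite lee_fin ltW.
have mae : measurable_fun setT (fun z : mpt R n => (a z)%:E) by exact/measurable_EFinP.
have fa0 z : 0 <= fa z by rewrite mule_ge0// expe_ge0.
have mfa : measurable_fun setT fa by apply: emeasurable_funM => //; exact: emeasurable_funM.
have mW2 : measurable_fun setT (W2 : mpt R n -> \bar R) by exact: measurable_kbox_integral.
have W20 z : 0 <= W2 z by exact: integral_ge0.
have nd0 z w : 0 <= (near_ind t z w)%:E by rewrite lee_fin.
have mnd : measurable_fun setT (fun x : mpt R n * mpt R n => (near_ind t x.1 x.2)%:E).
  by apply/measurable_EFinP; exact: measurable_near_ind.
pose H (z w : mpt R n) := (near_ind t z w)%:E * (fa w * W2 w * (a z)%:E).
have H0 z w : 0 <= H z w by rewrite !mule_ge0.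
have mH : measurable_fun setT (fun x : mpt R n * mpt R n => H x.1 x.2).
  apply: emeasurable_funM => //; apply: emeasurable_funM; last first.
    by apply: (measurableT_comp mae); exact: measurable_fst.
  by apply: emeasurable_funM; [apply: (measurableT_comp mfa)|apply: (measurableT_comp mW2)];
    exact: measurable_snd.
apply: (@le_trans _ _ (\int[vol]_z \int[vol]_w H z w)).
  apply: ge0_le_integral => //.
  - by move=> z _; rewrite mule_ge0// expe_ge0// integral_ge0.
  - apply: emeasurable_funM => //; apply: emeasurable_funM; exact: measurable_kbox_integral.
  - exact: (measurable_integral_in _ (f := H) measurableT measurableT (measurable_funTS mH)).
  move=> z _.
  have := @weighted_cauchy_schwarz _ _ _ vol (kbox t z) f a (measurable_kbox t z)
    (measurable_funTS mf) f0 (measurable_funTS ma) a0 (kbox_inv_bounds z t0).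
  rewrite -/(W z) => CS.
  apply: (@le_trans _ _ (\int[vol]_(w in kbox t z) fa w * W z * (a z)%:E)).
    by apply: lee_wpmul2r.
  rewrite -muleA muleC -ge0_integralZl//; last 3 first.
  - exact: measurable_kbox.
  - exact: measurable_funTS.
  - by rewrite mule_ge0// integral_ge0.
  rewrite kbox_integral; apply: ge0_le_integral => //.
  - by move=> w _; rewrite !mule_ge0// integral_ge0.
  - apply: emeasurable_funM; last exact: measurable_funeM.
    exact: (measurableT_comp mnd (measurable_pair1 z)).
  - exact: (measurableT_comp mH (measurable_pair1 z)).
  move=> w _; rewrite /H /near_ind; case: asboolP => [zw|_]; last by rewrite !mul0e.
  have -> : (nat_of_bool true)%:R = 1%R :> R by [].
  rewrite !mul1e [leLHS]muleC -[leRHS]muleA; apply: lee_wpmul2l => //; apply: lee_wpmul2r => //.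
  apply: ge0_subset_integral => //; try exact: measurable_kbox.
  - exact: measurable_funTS.
  - exact: kbox_double.
rewrite (tonelli _ _ (f := H))//.
rewrite -ge0_integralZl//; last 2 first.
- by move=> z _; exact: fa0.
- by rewrite lee_fin mulr_ge0 ?A_ge0// exprn_even_ge0.
apply: ge0_le_integral => //.
- by move=> w _; exact: integral_ge0.
- apply: (measurable_integral_in _ (f := fun w z => H z w)) => //.
  have ms : measurable_fun setT (fun p : mpt R n * mpt R n => (p.2, p.1)).
    by apply: measurable_fun_pair; [exact: measurable_snd|exact: measurable_fst].
  by apply: measurable_funTS; exact: (measurableT_comp mH ms).
- exact: measurable_funeM.
move=> w _.
have -> : \int[vol]_z H z w = fa w * (W2 w * \int[vol]_(z in kbox t w) (a z)%:E).
  rewrite muleA kbox_integral -ge0_integralZl//; last 3 first.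
  - by apply: emeasurable_funM => //; exact: (measurableT_comp mnd (measurable_pair1 w)).
  - by move=> z _; rewrite mule_ge0// lee_fin.
  - by rewrite mule_ge0.
  by apply: eq_integral => z _; rewrite /H near_ind_sym muleCA.
rewrite [leRHS]muleC; apply: lee_wpmul2l => //.
have -> : (A * ((4 * t) ^+ n.+1 * \prod_i k i) ^+ 2)%:E =
    (A * ((2 * (2 * t)) ^+ n.+1 * \prod_i k i) ^+ 2)%:E.
  by congr ((A * (_ ^+ _ * _) ^+ 2)%:E); ring.
apply: le_trans (kbox_A2 w t20); rewrite muleC; apply: lee_wpmul2r => //.
apply: ge0_subset_integral => //; try exact: measurable_kbox.
- exact: measurable_funTS.
- by move=> z h i; apply: le_trans (h i) _; rewrite ler_wpM2r ?ltW// ltr_pMl ?ltr1n.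
Qed.

Variable P : set V.
Hypothesis bP : convex_body P.
Hypothesis Pk : forall z w i, P z -> P w -> (`|coord i w - coord i z| <= k i)%R.
Let mP : measurable (P : set (mpt R n)) := body_measurable bP.

(** Substitute [w' = (1 - t) z + t w]: the contraction of ratio [t] about [z] maps [P]
into the box. *)
Lemma segop_kbox (f : mpt R n -> \bar R) (t : R) (z : V) : (0 < t)%R -> P z ->
  measurable_fun setT f -> (forall z, 0 <= f z) ->
  \int[vol]_(w in P) f ((1 - t) *: z + t *: (w : V))%R <=
  (t^-1 ^+ n.+1)%:E * \int[vol]_(w in kbox t z) f w.
Proof.
move=> t0 Pz mf f0.
pose G := f \_ (kbox t z).
have mG : measurable_fun setT G.
  by apply/(measurable_restrictT _ (measurable_kbox t z)); exact: measurable_funTS.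
have G0 w : 0 <= G w by rewrite /G patchE; case: ifP.
rewrite [X in _ * X]integral_mkcond -/G -(ge0_integral_vol_affine ((1 - t) *: z) t0 mG G0).
rewrite integral_mkcond; apply: ge0_le_integral => //.
- by move=> w _; rewrite patchE; case: ifP.
- apply/(measurable_restrictT _ mP); apply: measurable_funTS.
  exact: (measurable_segop_w z t mf).
- by apply: (measurableT_comp mG); exact: measurable_pt_affine.
move=> w _; rewrite patchE; case: ifPn => [/set_mem Pw|//].
rewrite /G patchE mem_set; first by rewrite addrC.
move=> i; rewrite coordD !coordZ.
have -> : (t * coord i w + (1 - t) * coord i z - coord i z = t * (coord i w - coord i z))%R by ring.
by rewrite normrM gtr0_norm// ler_wpM2l ?(ltW t0)//; exact: Pk.
Qed.

(** Jensen in [t]; the factors [t^-(n+1)] and [t^(n+1)] cancel. *)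
Lemma weighted_segop (f : mpt R n -> \bar R) : measurable_fun setT f -> (forall z, 0 <= f z) ->
  (forall z, ~ P z -> f z = 0) ->
  \int[vol]_(z in P) ((segop P f z) ^+ 2 * (a z)%:E) <=
  (A * (4 ^+ n.+1 * \prod_i k i) ^+ 2)%:E * \int[vol]_(z in P) (f z ^+ 2 * (a z)%:E).
Proof.
move=> mf f0 fP.
have ae0 z : 0 <= (a z)%:E by rewrite lee_fin ltW.
have mae : measurable_fun setT (fun z : mpt R n => (a z)%:E) by exact/measurable_EFinP.
pose g (z : mpt R n) (t : mR) := \int[vol]_(w in P) f ((1 - t) *: (z : V) + (t : R) *: (w : V))%R.
have g0 z t : 0 <= g z t by exact: integral_ge0.
have mg : measurable_fun setT (fun x : mpt R n * mR => g x.1 x.2) by exact: measurable_segop_pair.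
have mgz z : measurable_fun setT (g z) by exact: (measurableT_comp mg (measurable_pair1 z)).
have I01 : mu (`[0%R, 1%R]%classic : set mR) = 1.
  by transitivity ((1 - 0 : R)%:E); [exact: lebesgue_segment|rewrite subr0].
set C := (A * _)%:E.
have C0 : 0 <= C by rewrite lee_fin mulr_ge0 ?A_ge0// exprn_even_ge0.
have fint : \int[vol]_z (f z ^+ 2 * (a z)%:E) = \int[vol]_(z in P) (f z ^+ 2 * (a z)%:E).
  rewrite [RHS]integral_mkcond; apply: eq_integral => z _; rewrite patchE.
  by case: ifPn => // /negP h; rewrite fP ?expe2 ?mul0e// => Pz; apply: h; exact/mem_set.
apply: (@le_trans _ _ (\int[vol]_(z in P) \int[mu]_(t in `[0%R, 1%R]) (g z t ^+ 2 * (a z)%:E))).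
  apply: ge0_le_integral => //.
  - by move=> z _; rewrite mule_ge0// expe_ge0// segop_ge0.
  - apply: measurable_funTS; apply: emeasurable_funM => //.
    by apply: emeasurable_funM; exact: measurable_segop.
  - apply: (measurable_integral_in _ (f := fun z t => g z t ^+ 2 * (a z)%:E)) => //.
      apply: measurable_funTS; apply: emeasurable_funM; first by apply: emeasurable_funM.
      by apply: (measurableT_comp mae); exact: measurable_fst.
    by move=> z t _ _; rewrite mule_ge0// expe_ge0.
  move=> z Pz.
  under [leRHS]eq_integral => t _ do rewrite muleC.
  rewrite ge0_integralZl//; last 2 first.
  - by apply: measurable_funTS; apply: emeasurable_funM.
  - by move=> t _; rewrite expe_ge0.
  rewrite muleC; apply: lee_wpmul2l => //.
  have J1 : \int[mu]_(t in `[0%R, 1%R]) ((1 : R)^-1)%:E = 1.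
    by rewrite invr1 integral_cst// mul1e.
  have := @weighted_cauchy_schwarz _ _ _ mu `[0%R, 1%R]%classic (g z) (cst 1%R)
    (measurable_itv _) (measurable_funTS (mgz z)) (g0 z) (measurable_cst _) (fun _ => ltr01).
  rewrite J1 mule1 lte01 ltry => /(_ isT) h; apply: le_trans h _.
  by under eq_integral => t _ do rewrite mule1.
rewrite (tonelli_in _ _ (f := fun z t => g z t ^+ 2 * (a z)%:E))//; last 2 first.
- apply: measurable_funTS; apply: emeasurable_funM; first by apply: emeasurable_funM.
  by apply: (measurableT_comp mae); exact: measurable_fst.
- by move=> z t _ _; rewrite mule_ge0// expe_ge0.
apply: (@le_trans _ _ (\int[mu]_(t in `[0%R, 1%R]) (cst (C * \int[vol]_(z in P) (f z ^+ 2 * (a z)%:E)) t))); last first.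
  by rewrite integral_cst// [X in _ * X]I01 mule1.
apply: ae_ge0_le_integral => //.
- by move=> t _; apply: integral_ge0 => z _; rewrite mule_ge0// expe_ge0.
- apply: (measurable_integral_in _ (f := fun t z => g z t ^+ 2 * (a z)%:E)) => //.
    apply: measurable_funTS; apply: emeasurable_funM.
      have mg2 := measurable_funTS (measurableT_comp mg (@measurable_swap _ _ _ _)).
      by apply: emeasurable_funM; exact: mg2.
    by apply: (measurableT_comp mae); exact: measurable_snd.
  by move=> t z _ _; rewrite mule_ge0// expe_ge0.
- by move=> t _; rewrite mule_ge0// integral_ge0// => z _; rewrite mule_ge0// expe_ge0.
exists [set 0%R]; split; [exact: measurable_set1|exact: lebesgue_measure_set1|].
move=> t /= h; apply/eqP; apply: contra_notT h => tn0; rewrite in_itv /= => /andP[t0 t1].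
have tp : (0 < t)%R by rewrite lt_neqAle eq_sym tn0.
have ti0 : (0 <= t^-1 ^+ n.+1)%R by rewrite exprn_ge0// invr_ge0.
rewrite -fint.
apply: (@le_trans _ _ (((t^-1 ^+ n.+1) ^+ 2)%:E *
   \int[vol]_z ((\int[vol]_(w in kbox t z) f w) ^+ 2 * (a z)%:E))).
  rewrite -ge0_integralZl//; last 3 first.
  - by apply: emeasurable_funM => //; apply: emeasurable_funM; exact: measurable_kbox_integral.
  - by move=> z _; rewrite mule_ge0// expe_ge0// integral_ge0.
  - by rewrite lee_fin exprn_even_ge0.
  rewrite [leLHS]integral_mkcond; apply: ge0_le_integral => //.
  - by move=> z _; rewrite patchE; case: ifP => // _; apply: mule_ge0 => //; exact: mule_ge0.
  - apply/(measurable_restrictT _ mP); apply: measurable_funTS; apply: emeasurable_funM => //.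
    by apply: emeasurable_funM; exact: (measurableT_comp mg (measurable_pair2 t)).
  - apply: measurable_funeM; apply: emeasurable_funM => //.
    by apply: emeasurable_funM; exact: measurable_kbox_integral.
  move=> z _; rewrite patchE; case: ifPn => [/set_mem Pz|_]; last first.
    by rewrite mule_ge0 ?lee_fin ?exprn_even_ge0// mule_ge0// expe_ge0// integral_ge0.
  rewrite muleA; apply: lee_wpmul2r => //.
  have h := segop_kbox tp Pz mf f0.
  have -> : ((t^-1 ^+ n.+1) ^+ 2)%:E * (\int[vol]_(w in kbox t z) f w) ^+ 2 =
     ((t^-1 ^+ n.+1)%:E * \int[vol]_(w in kbox t z) f w) ^+ 2.
    by rewrite !expe2 expr2 EFinM muleACA.
  by rewrite !expe2; apply: lee_pmul.
apply: (@le_trans _ _ (((t^-1 ^+ n.+1) ^+ 2)%:E *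
   ((A * ((4 * t) ^+ n.+1 * \prod_i k i) ^+ 2)%:E * \int[vol]_z (f z ^+ 2 * (a z)%:E)))).
  apply: lee_wpmul2l; first by rewrite lee_fin exprn_even_ge0.
  exact: kbox_average.
rewrite muleA -EFinM /C [X in X%:E * _](_ : _ = (A * (4 ^+ n.+1 * \prod_i k i) ^+ 2)%R)//.
have Tn : (t ^+ n.+1 != 0)%R by rewrite expf_neq0.
rewrite [in LHS](exprMn n.+1 (4 : R)%R t) exprVn; move: Tn.
by set s := (t ^+ n.+1)%R; set q := (4 ^+ n.+1)%R => sn; field.
Qed.

End weighted_segop.

(** * The weighted Poincare inequality on convex bodies *)

Section weighted_poincare.
Context {R : realType} {n : nat}.
Notation V := (pt R n).
Notation vol := (@vol R n).

Definition mean (P : set V) (u : V -> R) : R :=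
  \int[vol]_(z in P) u z / fine (vol P).

Lemma body_fineK (P : set V) : convex_body P -> ((fine (vol P))%:E = vol P)%E.
Proof. by move=> bP; rewrite fineK// ge0_fin_numE// body_fin. Qed.

Lemma body_fine_gt0 (P : set V) : convex_body P -> 0 < fine (vol P).
Proof. by move=> bP; rewrite fine_gt0// body_gt0// body_fin. Qed.

Lemma integrable_cst_body (P : set V) (c : R) : convex_body P ->
  vol.-integrable P (EFin \o cst c).
Proof.
move=> bP; apply/integrableP; split.
  by apply/measurable_EFinP; exact: measurable_cst.
rewrite [X in (X < _)%E](_ : _ = (`|c|%:E * vol P)%E).
  by rewrite -body_fineK// -EFinM ltry.
by rewrite -integral_cst//; exact: body_measurable.
Qed.

Lemma mean_dist (P : set V) (u : V -> R) (z : V) : convex_body P ->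
  vol.-integrable P (EFin \o u) ->
  (vol P * `|u z - mean P u|%:E <= \int[vol]_(w in P) `|u w - u z|%:E)%E.
Proof.
move=> bP iu; have mP := body_measurable bP.
have V0 := body_fine_gt0 bP.
have ic := integrable_cst_body (u z) bP.
have id : vol.-integrable P (EFin \o (fun w => u w - u z)).
  exact: (integrableB mP iu ic).
have E : \int[vol]_(w in P) (u w - u z) = fine (vol P) * (mean P u - u z).
  rewrite (RintegralB mP iu ic) Rintegral_cst// /mean mulrBr mulrCA mulfV ?gt_eqF// mulr1.
  by rewrite mulrC.
have := le_normr_Rintegral mP id; rewrite E normrM gtr0_norm// distrC -lee_fin EFinM body_fineK//.
move=> h; apply: le_trans h _; rewrite /Rintegral fineK//.
exact: (integrable_fin_num mP (integrable_abse id)).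
Qed.

Lemma has_weak_derivative_patch (P : set V) (u w : V -> R) (e : V) : convex_body P ->
  has_weak_derivative P u e w -> has_weak_derivative P (u \_ P) e (w \_ P).
Proof.
move=> bP [iu iw H]; split.
- by apply: eq_integrable iu => [|z Pz /=]; [exact: body_measurable|rewrite patchE Pz].
- by apply: eq_integrable iw => [|z Pz /=]; [exact: body_measurable|rewrite patchE Pz].
move=> phi tp; transitivity (\int[vol]_(z in P) (u z * 'D_e phi z)).
  by apply: eq_Rintegral => z Pz; rewrite patchE Pz.
by rewrite H//; congr (- _); apply: eq_Rintegral => z Pz; rewrite patchE Pz.
Qed.

Definition wint (a : V -> R) (P : set V) (f : V -> R) : \bar R :=
  (\int[vol]_(z in P) (f z ^+ 2 * a z)%:E)%E.

Lemma wint_ge0 a P f : (forall z, 0 <= a z) -> (0 <= wint a P f)%E.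
Proof. by move=> a0; apply: integral_ge0 => z _; rewrite lee_fin mulr_ge0 ?sqr_ge0. Qed.

Lemma eq_wint a P f g : (forall z, P z -> f z = g z) -> wint a P f = wint a P g.
Proof. by move=> fg; apply: eq_integral => z /set_mem Pz; rewrite fg. Qed.

Variables (k : option 'I_n -> R) (a : V -> R) (A : R).
Hypothesis k0 : forall i, 0 < k i.
Hypothesis aA : positive_A2 a A.
Let a0 z : 0 < a z. Proof. by case: aA => _ _ h _; exact: h. Qed.
Let ma : measurable_fun setT (a : mpt R n -> R). Proof. by case: aA. Qed.

(** By [mean_dist] the distance to the mean is bounded by the mean distance, which
[segment_poincare] and [weighted_segop] estimate. [kappa] measures how much of its
circumscribed box the body fills. *)
Lemma weighted_poincare (P : set V) (kappa : R) (u : V -> R) (D : option 'I_n -> V -> R) :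
  convex_body P ->
  (forall z w i, P z -> P w -> `|coord i w - coord i z| <= k i) ->
  \prod_i k i <= kappa * fine (vol P) ->
  (forall i, has_weak_derivative P u (dir i) (D i)) ->
  (wint a P (fun z => (u z - mean P u)%R) <=
   (A * (4 ^+ n.+1 * kappa) ^+ 2)%:E * wint a P (wgrad k D))%E.
Proof.
move=> bP Pk kk uD0; have mP := body_measurable bP.
have V0 := body_fine_gt0 bP.
pose D' i := D i \_ P; pose u' := u \_ P.
have uD i : has_weak_derivative P u' (dir i) (D' i) by exact: has_weak_derivative_patch.
have iu' : vol.-integrable P (EFin \o u') by have [] := uD None.
have mpatch (f : V -> R) : vol.-integrable P (EFin \o f) -> measurable_fun setT (f \_ P : mpt R n -> R).
  move=> fi; apply/(measurable_restrictT _ mP); apply/measurable_EFinP; exact: measurable_int fi.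
have mu' : measurable_fun setT (u' : mpt R n -> R).
  by apply: mpatch; have [] := uD0 None.
have mD i : measurable_fun setT (D' i : mpt R n -> R).
  by apply: mpatch; have [] := uD0 i.
have k0' i := ltW (k0 i).
have E1 : mean P u = mean P u'.
  by rewrite /mean; congr (_ / _); apply: eq_Rintegral => z Pz; rewrite /u' patchE Pz.
have -> : wint a P (fun z => (u z - mean P u)%R) = wint a P (fun z => (u' z - mean P u')%R).
  by apply: eq_wint => z /mem_set Pz; rewrite E1 /u' patchE Pz.
have -> : wint a P (wgrad k D) = wint a P (wgrad k D').
  apply: eq_wint => z /mem_set Pz; apply: eq_bigr => i _.
  by rewrite /D' patchE Pz.
pose F z := (wgrad k D' z)%:E.
have mF : measurable_fun setT (F : mpt R n -> \bar R) by exact: measurable_wgradD.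
have F0 z : (0 <= F z)%E by rewrite lee_fin wgrad_ge0.
have FP z : ~ P z -> F z = 0%E.
  move=> Pz; rewrite /F /wgrad big1// => i _; rewrite /D' patchE ifF ?normr0 ?mulr0//.
  by apply/negP => /set_mem.
have A0 : 0 <= A by case: aA.
have kap0 : 0 <= kappa.
  by rewrite -(pmulr_lge0 _ V0) (le_trans _ kk)// prodr_ge0.
rewrite -(@lee_pmul2l _ (fine (vol P) ^+ 2)%:E)//; last by rewrite lte_fin exprn_gt0.
apply: (@le_trans _ _ (\int[vol]_(z in P) (segop P F z ^+ 2 * (a z)%:E))%E).
  rewrite /wint -ge0_integralZl//; first last.
  - by rewrite lee_fin exprn_ge0// ltW.
  - by move=> z _; rewrite lee_fin mulr_ge0 ?sqr_ge0// ltW.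
  - apply/measurable_EFinP; apply: measurable_funTS; apply: measurable_funM => //.
    by apply: measurable_funX; apply: measurable_funB.
  apply: ae_ge0_le_integral => //.
  - move=> z _; rewrite -EFinM lee_fin; apply: mulr_ge0; first exact: sqr_ge0.
    by apply: mulr_ge0; [exact: sqr_ge0|exact: ltW].
  - apply: measurable_funeM; apply/measurable_EFinP; apply: measurable_funTS; apply: measurable_funM => //.
    by apply: measurable_funX; apply: measurable_funB.
  - by move=> z _; apply: mule_ge0; [apply: expe_ge0; exact: segop_ge0|rewrite lee_fin ltW].
  - apply: measurable_funTS; apply: emeasurable_funM; last exact/measurable_EFinP.
    by apply: emeasurable_funM; exact: measurable_segop.
  have [N [mN N0 sub]] := segment_poincare bP k0' Pk mu' mD uD.
  exists N; split => // z /= nh; apply: sub => /= h; apply: nh => Pz.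
  have := le_trans (mean_dist z bP iu') (h Pz); rewrite -body_fineK// -EFinM => le1.
  have -> : ((fine (vol P) ^+ 2)%:E * ((u' z - mean P u') ^+ 2 * a z)%:E)%E =
     (((fine (vol P) * `|u' z - mean P u'|)%R)%:E ^+ 2 * (a z)%:E)%E.
    by rewrite -EFin_expe -!EFinM exprMn real_normK ?num_real// mulrA.
  apply: lee_wpmul2r; first by rewrite lee_fin ltW.
  by rewrite !expe2; apply: lee_pmul => //; rewrite lee_fin mulr_ge0// ltW.
apply: le_trans (weighted_segop k0 aA bP Pk mF F0 FP) _.
rewrite muleA -EFinM.
have -> : (\int[vol]_(z in P) (F z ^+ 2 * (a z)%:E) = wint a P (wgrad k D'))%E.
  by apply: eq_integral => z _; rewrite -EFin_expe -EFinM.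
apply: lee_wpmul2r; first by apply: wint_ge0 => z; exact: ltW.
rewrite lee_fin [leRHS]mulrCA; apply: ler_wpM2l => //; rewrite -exprMn.
rewrite lerXn2r ?nnegrE ?mulr_ge0 ?exprn_ge0 ?prodr_ge0//; first exact: ltW.
by rewrite mulrCA ler_wpM2l ?exprn_ge0// mulrC.
Qed.

End weighted_poincare.

(** * Slabs over a convex base *)

Section slabs.
Context {R : realType} {n : nat}.
Notation V := (pt R n).
Notation vol := (@vol R n).
Notation lam := (@lebesgue_measure R).
Notation mR := (measurableTypeR R).

(** [M] bounds the coordinates of the base, and [r] is half the side of a cube that it
contains. *)
Definition convex_base (S : set 'rV[R]_n) (M r : R) :=
  [/\ measurable S, forall x, S x -> forall i, `|x ord0 i| <= M,
      (forall x w t, S x -> S w -> 0 <= t <= 1 -> S ((1 - t) *: x + t *: w)), 0 < r &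
      exists x0 : 'rV[R]_n, forall x : 'rV[R]_n, (forall i, `|x ord0 i - x0 ord0 i| <= r) -> S x].

Variables (S : set 'rV[R]_n) (M r : R).
Hypothesis bS : convex_base S M r.

Definition slab (J : interval R) : set V := S `*` [set` J].

Lemma measurable_slab (J : interval R) : measurable (slab J : set (mpt R n)).
Proof. by case: bS => mS _ _ _ _; apply: measurableX. Qed.

Lemma vol_slab (J : interval R) : (vol (slab J) = lebesgue_rV n S * lam [set` J])%E.
Proof.
case: bS => mS _ _ _ _; rewrite /vol /slab product_measure1E//.
Qed.

Lemma base_gt0 : (0 < lebesgue_rV n S)%E.
Proof.
case: bS => mS _ _ r0 [x0 H].
apply: (@lt_le_trans _ _ (lebesgue_rV n (rbox (x0 - const_mx r) (x0 + const_mx r)))).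
  rewrite lebesgue_rbox; last by move=> i; rewrite !mxE; lra.
  by rewrite lte_fin prodr_gt0// => i _; rewrite !mxE; lra.
apply: le_measure; rewrite ?inE//; first exact: measurable_rbox.
by move=> x hx; apply: H => i; have := hx i; rewrite !mxE ler_norml; lra.
Qed.

Lemma base_fin : (lebesgue_rV n S < +oo)%E.
Proof.
case: bS => mS HM _ r0 [x0 H].
apply: (@le_lt_trans _ _ (lebesgue_rV n (rbox (const_mx (- `|M|)) (const_mx `|M|)))).
  apply: le_measure; rewrite ?inE//; first exact: measurable_rbox.
  move=> x Sx i; rewrite !mxE -ler_norml; apply: le_trans (HM _ Sx i) _; exact: ler_norm.
rewrite lebesgue_rbox; first by rewrite ltry.
by move=> i; rewrite !mxE; have := normr_ge0 M; lra.
Qed.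

Lemma slab_body (J : interval R) (c d : R) : c < d -> `]c, d[ `<=` [set` J] ->
  [set` J] `<=` `[c, d] -> convex_body (slab J).
Proof.
move=> cd cJ Jd; have [mS HM cS r0 [x0 Hx0]] := bS; split.
- exact: measurable_slab.
- exists (`|M| + `|c| + `|d|) => z [Sz Jz]; apply/normpt_leP; first by rewrite !addr_ge0.
  split.
    move=> i; apply: le_trans (HM _ Sz i) _; have := ler_norm M.
    by have := normr_ge0 c; have := normr_ge0 d; lra.
  have := Jd _ Jz; rewrite /= in_itv /= ler_norml.
  have := ler_norm c; have := ler_norm d; have := ler_norm (- c); have := ler_norm (- d).
  by rewrite !normrN; have := normr_ge0 M; lra.
- move=> z w t [Sz Jz] [Sw Jw] t01; split; first exact: cS.
  have [/andP[t0 t1]] := t01.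
  have oc := @interval_is_interval _ J.
  have [zw|wz] := leP z.2 w.2.
    apply: (oc _ _ Jz Jw); rewrite /=.
    have := mulr_ge0 t0 (_ : 0 <= w.2 - z.2); rewrite subr_ge0 => /(_ zw).
    have := mulr_ge0 (_ : 0 <= 1 - t) (_ : 0 <= w.2 - z.2); rewrite !subr_ge0 => /(_ t1 zw).
    by rewrite /GRing.scale /=; nra.
  apply: (oc _ _ Jw Jz); rewrite /=.
  have := mulr_ge0 t0 (_ : 0 <= z.2 - w.2); rewrite subr_ge0 => /(_ (ltW wz)).
  have := mulr_ge0 (_ : 0 <= 1 - t) (_ : 0 <= z.2 - w.2); rewrite !subr_ge0 => /(_ t1 (ltW wz)).
  by rewrite /GRing.scale /=; nra.
exists (x0, (c + d) / 2); rewrite /interior; apply/nbhs_ballP.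
exists (Num.min r ((d - c) / 2)) => /=.
  by rewrite lt_min r0 divr_gt0// subr_gt0.
move=> w; rewrite ballptE; last by rewrite lt_min r0 divr_gt0// subr_gt0.
move=> [h1 h2]; split.
  by apply: Hx0 => i; rewrite distrC ltW//; have := h1 i; rewrite lt_min => /andP[].
apply: cJ; rewrite /= in_itv /=; move: h2; rewrite /= lt_min => /andP[_].
by rewrite ltr_norml; lra.
Qed.

Lemma slab_oc_body (c d : R) : c < d -> convex_body (slab `]c, d]).
Proof.
move=> cd; apply: (@slab_body _ c d cd).
  by move=> t /=; rewrite !in_itv /= => /andP[-> /ltW].
by move=> t /=; rewrite !in_itv /= => /andP[/ltW ->].
Qed.

Lemma slab_cc_body (c d : R) : c < d -> convex_body (slab `[c, d]).
Proof.
move=> cd; apply: (@slab_body _ c d cd) => //.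
by move=> t /=; rewrite !in_itv /= => /andP[/ltW -> /ltW].
Qed.

Let sigma := fine (lebesgue_rV n S).

Lemma sigma_gt0 : 0 < sigma.
Proof. by rewrite fine_gt0// base_gt0 base_fin. Qed.

Lemma vol_slab_oc (c d : R) : c <= d -> vol (slab `]c, d]) = (sigma * (d - c))%:E.
Proof.
move=> cd; rewrite vol_slab EFinM /sigma fineK ?ge0_fin_numE ?base_fin//; congr (_ * _)%E.
rewrite [LHS]lebesgue_measure_itv /= lte_fin; case: ltP; first by rewrite EFinB.
by move=> dc; rewrite (@le_anti _ _ c d) ?cd// subrr.
Qed.

Lemma vol_slab_cc (c d : R) : c <= d -> vol (slab `[c, d]) = (sigma * (d - c))%:E.
Proof.
move=> cd; rewrite vol_slab EFinM /sigma fineK ?ge0_fin_numE ?base_fin//; congr (_ * _)%E.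
exact: lebesgue_segment.
Qed.

End slabs.

(** * A Hardy-Poincare inequality on prisms *)

(** One step of the telescoping argument: [d] and [d + delta] are the differences
between the first mean and two consecutive means, [l] and [lambda] the weights
of two consecutive layers, [g] the weight of what lies below the first. *)
Lemma hardy_step (R : realType) (gam l lambda g d delta e e' : R) :
  0 < gam -> 0 <= g -> g <= gam * l -> g <= gam * lambda -> 0 <= e -> 0 <= e' ->
  delta ^+ 2 * lambda <= 2 * (e + e') ->
  2 * e + 2 * d ^+ 2 * l + 4 * (d + delta) ^+ 2 * g <=
  (2 + 8 * gam * (1 + 2 * gam)) * (e + e') + 4 * d ^+ 2 * (l + g).
Proof.
move=> gam0 g0 gl glam e0 e'0 H.
have A1 : 4 * (d + delta) ^+ 2 * g <= 4 * (d ^+ 2 + d ^+ 2 / (2 * gam) + (1 + 2 * gam) * delta ^+ 2) * g.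
  rewrite ler_wpM2r// ler_wpM2l//.
  have : 0 <= (2 * gam)^-1 * (d - 2 * gam * delta) ^+ 2.
    by rewrite mulr_ge0 ?sqr_ge0// invr_ge0 mulr_ge0// ltW.
  have -> : (2 * gam)^-1 * (d - 2 * gam * delta) ^+ 2 =
      d ^+ 2 + d ^+ 2 / (2 * gam) + (1 + 2 * gam) * delta ^+ 2 - (d + delta) ^+ 2.
    by field; rewrite gt_eqF.
  by rewrite subr_ge0.
have A2 : 4 * (d ^+ 2 / (2 * gam)) * g <= 2 * d ^+ 2 * l.
  have -> : 4 * (d ^+ 2 / (2 * gam)) * g = 2 * d ^+ 2 * (g / gam) by field; rewrite gt_eqF.
  apply: ler_wpM2l; first by rewrite mulr_ge0 ?sqr_ge0.
  by rewrite ler_pdivrMr// mulrC.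
have A3 : 4 * ((1 + 2 * gam) * delta ^+ 2) * g <= 8 * gam * (1 + 2 * gam) * (e + e').
  have -> : 8 * gam * (1 + 2 * gam) * (e + e') = 4 * (1 + 2 * gam) * (gam * (2 * (e + e'))) by ring.
  have -> : 4 * ((1 + 2 * gam) * delta ^+ 2) * g = 4 * (1 + 2 * gam) * (delta ^+ 2 * g) by ring.
  apply: ler_wpM2l; first by rewrite mulr_ge0// addr_ge0// mulr_ge0// ltW.
  apply: le_trans (_ : gam * (delta ^+ 2 * lambda) <= _); last by rewrite ler_wpM2l// ltW.
  by rewrite mulrCA ler_wpM2l ?sqr_ge0.
move: A1 A2 A3; set p := d ^+ 2 / (2 * gam); set q := (d + delta) ^+ 2.
rewrite !mulrDr !mulrDl.
set t1 := _ * _ * g; set t2 := _ * p * g.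
move=> *; lra.
Qed.

Section weighted_sets.
Context {R : realType} {n : nat}.
Notation V := (pt R n).
Notation vol := (@vol R n).
Variables (a : V -> R).
Hypothesis ma : measurable_fun setT (a : mpt R n -> R).
Hypothesis a0 : forall z, 0 < a z.
Local Open Scope ereal_scope.

Definition wmass (E : set V) : \bar R := \int[vol]_(z in E) (a z)%:E.

Lemma wmass_ge0 E : 0 <= wmass E.
Proof. by apply: integral_ge0 => z _; rewrite lee_fin ltW. Qed.

Lemma measurable_wint (E : set V) (f : V -> R) : measurable_fun (E : set (mpt R n)) f ->
  measurable_fun (E : set (mpt R n)) (fun z => (f z ^+ 2 * a z)%:E).
Proof.
move=> mf; apply/measurable_EFinP; apply: measurable_funM; last exact: measurable_funTS.
exact: measurable_funX.
Qed.

Lemma wint_le (E : set V) (f g : V -> R) : measurable (E : set (mpt R n)) ->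
  measurable_fun (E : set (mpt R n)) f -> measurable_fun (E : set (mpt R n)) g ->
  (forall z, E z -> (`|f z| <= `|g z|)%R) -> wint a E f <= wint a E g.
Proof.
move=> mE mf mg fg; apply: ge0_le_integral => //.
- by move=> z _; rewrite lee_fin mulr_ge0 ?sqr_ge0// ltW.
- exact: measurable_wint.
- exact: measurable_wint.
move=> z Ez; rewrite lee_fin; apply: ler_wpM2r; first exact: ltW.
by rewrite -[leLHS]real_normK ?num_real// -[leRHS]real_normK ?num_real// lerXn2r ?nnegrE// fg.
Qed.

Lemma wint_subset (E E' : set V) (f : V -> R) : measurable (E : set (mpt R n)) ->
  measurable (E' : set (mpt R n)) -> measurable_fun (E' : set (mpt R n)) f -> E `<=` E' ->
  wint a E f <= wint a E' f.
Proof.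
move=> mE mE' mf EE'; apply: ge0_subset_integral => //; first exact: measurable_wint.
by move=> z _; rewrite lee_fin mulr_ge0 ?sqr_ge0// ltW.
Qed.

Lemma wintU (E E' : set V) (f : V -> R) : measurable (E : set (mpt R n)) ->
  measurable (E' : set (mpt R n)) -> measurable_fun (E `|` E' : set (mpt R n)) f ->
  [disjoint E & E'] -> wint a (E `|` E') f = wint a E f + wint a E' f.
Proof.
move=> mE mE' mf EE'; apply: ge0_integral_setU => //; first exact: measurable_wint.
by move=> z _; rewrite lee_fin mulr_ge0 ?sqr_ge0// ltW.
Qed.

Lemma wint_parallelogram (E : set V) (f g p : V -> R) : measurable (E : set (mpt R n)) ->
  measurable_fun (E : set (mpt R n)) f -> measurable_fun (E : set (mpt R n)) g ->
  measurable_fun (E : set (mpt R n)) p ->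
  (forall z, E z -> p z = f z + g z)%R ->
  wint a E p <= 2%:E * wint a E f + 2%:E * wint a E g.
Proof.
move=> mE mf mg mp fgp; rewrite -!ge0_integralZl//; first last.
- by move=> z _; rewrite lee_fin mulr_ge0 ?sqr_ge0// ltW.
- exact: measurable_wint.
- by move=> z _; rewrite lee_fin mulr_ge0 ?sqr_ge0// ltW.
- exact: measurable_wint.
rewrite -ge0_integralD//; first last.
- by apply: measurable_funeM; exact: measurable_wint.
- by move=> z _; apply: mule_ge0; rewrite ?lee_fin// mulr_ge0 ?sqr_ge0// ltW.
- by apply: measurable_funeM; exact: measurable_wint.
- by move=> z _; apply: mule_ge0; rewrite ?lee_fin// mulr_ge0 ?sqr_ge0// ltW.
apply: ge0_le_integral => //.
- by move=> z _; rewrite lee_fin mulr_ge0 ?sqr_ge0// ltW.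
- exact: measurable_wint.
- by apply: emeasurable_funD; apply: measurable_funeM; exact: measurable_wint.
move=> z Ez; rewrite -!EFinM -EFinD lee_fin fgp// !mulrA -mulrDl.
apply: ler_wpM2r; first exact: ltW.
have := sqr_ge0 (f z - g z); rewrite sqrrB sqrrD; lra.
Qed.

Lemma wint_cst (E : set V) (c : R) : measurable (E : set (mpt R n)) ->
  wint a E (cst c) = (c ^+ 2)%:E * wmass E.
Proof.
move=> mE; transitivity (\int[vol]_(z in E) ((c ^+ 2)%:E * (a z)%:E)); first by apply: eq_integral => z _; rewrite -EFinM.
rewrite ge0_integralZl//.
- by apply/measurable_EFinP; exact: measurable_funTS.
- by move=> z _; rewrite lee_fin ltW.
- by rewrite lee_fin sqr_ge0.
Qed.

End weighted_sets.

Section hardy.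
Context {R : realType} {n : nat}.
Notation V := (pt R n).
Notation vol := (@vol R n).
Variables (S : set 'rV[R]_n) (M r h kappa : R) (a : V -> R) (A : R).
Hypothesis bS : convex_base S M r.
Hypothesis h0 : 0 < h.
Hypothesis Sh : forall x w i, S x -> S w -> `|w ord0 i - x ord0 i| <= h.
Let sigma := fine (lebesgue_rV n S).
Hypothesis hk : h ^+ n <= kappa * sigma.
Hypothesis aA : positive_A2 a A.

Let a0 z : 0 < a z. Proof. by case: aA => _ _ H _; exact: H. Qed.
Let ma : measurable_fun setT (a : mpt R n -> R). Proof. by case: aA. Qed.
Let A0 : 0 <= A. Proof. by case: aA. Qed.
Let s0 : 0 < sigma. Proof. exact: sigma_gt0 bS. Qed.

Definition widths (t : R) (i : option 'I_n) : R := if i is Some _ then h else t.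

Lemma widths_gt0 t i : 0 < t -> 0 < widths t i. Proof. by case: i. Qed.

Lemma prod_widths t : \prod_i widths t i = h ^+ n * t.
Proof. by rewrite big_option /= prodr_const card_ord. Qed.

Definition doubling_const : R := A * (2 ^+ n.+1 * (4 * kappa)) ^+ 2.

Lemma slab_subbox (c d y : R) x : c < d -> S x -> c <= y <= d ->
  slab S `]c, d] `<=` kbox (widths (d - c)) 1 (x, y).
Proof.
move=> cd Sx /andP[cy yd] z [Sz /=]; rewrite in_itv /= => /andP[cz zd] [j|] /=.
  by rewrite mul1r; exact: Sh.
by rewrite mul1r ler_norml; lra.
Qed.

Lemma wmass_fin (c d : R) : c < d -> (wmass a (slab S `]c, d]) < +oo)%E.
Proof.
move=> cd; have [_ _ _ r0 [x0 Hx0]] := bS.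
have Sx0 : S x0 by apply: Hx0 => i; rewrite subrr normr0 ltW.
have k0 i : 0 < widths (d - c) i by apply: widths_gt0; rewrite subr_gt0.
have [_ _ _ /(_ _ (kbox_rectangle k0 (x0, d) ltr01))[H _ _]] := aA.
apply: le_lt_trans H; apply: ge0_subset_integral => //.
- exact: measurable_slab bS _.
- exact: measurable_kbox.
- by apply/measurable_EFinP; exact: measurable_funTS.
- by move=> z _; rewrite lee_fin ltW.
- by apply: slab_subbox => //; rewrite ltW /=.
Qed.

(** Cauchy-Schwarz for the indicator of the smaller slab, on a box that contains
the larger one. *)
Lemma slab_doubling (c c' d' d : R) : c <= c' -> c' < d' -> d' <= d -> d - c <= 4 * (d' - c') ->
  (wmass a (slab S `]c, d]) <= doubling_const%:E * wmass a (slab S `]c', d']))%E.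
Proof.
move=> cc' cd' dd' dc.
have cd : c < d by rewrite (le_lt_trans cc')// (lt_le_trans cd').
have [_ _ _ r0 [x0 Hx0]] := bS.
have Sx0 : S x0 by apply: Hx0 => i; rewrite subrr normr0 ltW.
have k0 i : 0 < widths (d - c) i by apply: widths_gt0; rewrite subr_gt0.
set E := slab S `]c', d']; set G := slab S `]c, d].
pose B := kbox (widths (d - c)) 1 (x0, d).
have GB : G `<=` B by apply: slab_subbox => //; rewrite ltW /=.
have EG : E `<=` G.
  move=> z [Sz /=]; rewrite !in_itv /= => /andP[h1 h2]; split => //=; rewrite in_itv /=.
  by rewrite (le_lt_trans cc')//= (le_trans h2).
have EB := subset_trans EG GB.
have mB : measurable (B : set (mpt R n)) by exact: measurable_kbox.
have mE : measurable (E : set (mpt R n)) := measurable_slab bS _.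
have mG : measurable (G : set (mpt R n)) := measurable_slab bS _.
have mae (D : set (mpt R n)) : measurable_fun D (fun z : mpt R n => (a z)%:E).
  by apply/measurable_EFinP; exact: measurable_funTS.
have ae0 z : (0 <= (a z)%:E)%E by rewrite lee_fin ltW.
set IB := (\int[vol]_(z in B) ((a z)^-1)%:E)%E.
have VE : vol E = (sigma * (d' - c'))%:E by apply: (vol_slab_oc bS); exact: ltW.
have VB : (vol B <= ((2 ^+ n.+1 * (4 * kappa)) * (sigma * (d' - c')))%:E)%E.
  rewrite vol_kbox// mulr1 prod_widths lee_fin -!mulrA ler_wpM2l ?exprn_ge0//.
  apply: (@le_trans _ _ (kappa * sigma * (4 * (d' - c')))).
    have hn0 : 0 <= h ^+ n by rewrite exprn_ge0// ltW.
    have dc0 : 0 <= d - c by rewrite subr_ge0 ltW.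
    exact: ler_pM.
  by rewrite le_eqVlt; apply/orP; left; apply/eqP; ring.
have CS : (vol E ^+ 2 <= wmass a E * IB)%E.
  have := @weighted_cauchy_schwarz _ _ _ vol B (fun z => (\1_E z)%:E) a mB _ _ (measurable_funTS ma) a0
    (kbox_inv_bounds k0 aA (x0, d) ltr01).
  rewrite integral_indic// setIidl//.
  have -> : (\int[vol]_(z in B) ((\1_E z)%:E ^+ 2 * (a z)%:E) = wmass a E)%E.
    rewrite /wmass integral_mkcond [RHS]integral_mkcond; apply: eq_integral => z _.
    rewrite !patchE; case: ifPn => [Bz|/negP Bz]; rewrite ?indicE; case: (boolP (z \in E)) => Ez.
    - by rewrite -EFin_expe expr1n mul1e.
    - by rewrite -EFin_expe expr0n mul0e.
    - by exfalso; apply: Bz; apply/mem_set; apply: EB; exact/set_mem.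
    - by [].
  apply; first by apply/measurable_EFinP; apply: measurable_indic.
  by move=> z; rewrite lee_fin.
have IB0 : (0 <= IB)%E by apply: integral_ge0 => z _; rewrite lee_fin invr_ge0 ltW.
have [_ _ _ /(_ _ (kbox_rectangle k0 (x0, d) ltr01))[_ _ A2]] := aA.
have E0 : 0 < sigma * (d' - c') by rewrite mulr_gt0// subr_gt0.
rewrite -(@lee_pmul2r _ ((sigma * (d' - c')) ^+ 2)%:E)//; last by rewrite lte_fin exprn_gt0.
apply: (@le_trans _ _ (wmass a B * (wmass a E * IB))%E).
  apply: lee_pmul => //; first exact: wmass_ge0.
  - by rewrite lee_fin sqr_ge0.
  - exact: ge0_subset_integral.
  - by rewrite EFin_expe -VE.
rewrite muleCA -/(wmass a B); apply: (@le_trans _ _ (wmass a E * (A%:E * vol B ^+ 2))%E).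
  by apply: lee_wpmul2l; first exact: wmass_ge0.
rewrite muleAC [leRHS]muleC; apply: lee_wpmul2l; first exact: wmass_ge0.
apply: (@le_trans _ _ (A%:E * ((2 ^+ n.+1 * (4 * kappa)) * (sigma * (d' - c')))%:E ^+ 2)%E).
  by apply: lee_wpmul2l => //; rewrite !expe2; apply: lee_pmul.
rewrite -EFin_expe -!EFinM lee_fin /doubling_const.
by move: (2 ^+ n.+1 * (4 * kappa)) (sigma * (d' - c')) => x y; rewrite exprMn mulrA.
Qed.

Variables (y0 len : R).
Hypothesis len0 : 0 < len.
Let P := slab S `[y0, y0 + len].

Definition height (j : nat) : R := y0 + 2^-1 ^+ j * len.

Lemma heightS j : height j.+1 = y0 + 2^-1 ^+ j * len / 2.
Proof. by rewrite /height exprS; ring. Qed.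

Lemma halfX_gt0 j : 0 < 2^-1 ^+ j * len.
Proof. by rewrite mulr_gt0// exprn_gt0// invr_gt0. Qed.

Lemma height_gt j : y0 < height j.
Proof. by rewrite ltrDl halfX_gt0. Qed.

Lemma height_lt j : height j.+1 < height j.
Proof. by rewrite heightS /height; have := halfX_gt0 j; lra. Qed.

Lemma height_le j : height j <= y0 + len.
Proof.
by rewrite lerD2l ler_piMl ?(ltW len0)// exprn_ile1 ?invr_ge0 ?invf_le1 ?ler1n.
Qed.

(** The heights decrease geometrically to the bottom. The Poincare inequality is
used on unions of two consecutive layers, since their overlaps link the means. *)
Definition layer j := slab S `]height j.+1, height j].
Definition layers j := slab S `]height j.+2, height j].
Definition upper j := slab S `]height j, y0 + len].

Lemma layersE j : layers j = layer j.+1 `|` layer j.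
Proof.
have h1 := height_lt j; have h2 := height_lt j.+1.
apply/seteqP; split => [z [Sz] /=|z [] [Sz] /=]; rewrite in_itv /= => /andP[z1 z2].
- have [hz|hz] := leP z.2 (height j.+1); [left|right]; split => //=; rewrite in_itv /=.
    by rewrite z1.
  by rewrite hz.
- by split => //=; rewrite in_itv /= z1 (le_trans z2)// ltW.
- by split => //=; rewrite in_itv /= z2 (lt_trans h2).
Qed.

Lemma upperS j : upper j.+1 = upper j `|` layer j.
Proof.
have h1 := height_lt j; have h2 := height_le j.
apply/seteqP; split => [z [Sz] /=|z [] [Sz] /=]; rewrite in_itv /= => /andP[z1 z2].
- have [hz|hz] := leP z.2 (height j); [right|left]; split => //=; rewrite in_itv /=.
    by rewrite z1.
  by rewrite hz.
- by split => //=; rewrite in_itv /= z2 (lt_trans h1).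
- by split => //=; rewrite in_itv /= z1 (le_trans z2).
Qed.

Let mslab J : measurable (slab S J : set (mpt R n)) := measurable_slab bS J.

Lemma layer_sub_P j : layer j `<=` P.
Proof.
have h1 := height_gt j.+1; have h2 := height_le j.
move=> z [Sz] /=; rewrite in_itv /= => /andP[z1 z2]; split => //=; rewrite in_itv /=.
by rewrite (le_trans z2)// andbT ltW// (lt_trans h1).
Qed.

Lemma layers_sub_P j : layers j `<=` P.
Proof. by rewrite layersE subUset; split; exact: layer_sub_P. Qed.

Lemma upper_sub_P j : upper j `<=` P.
Proof.
have h1 := height_gt j.
move=> z [Sz] /=; rewrite in_itv /= => /andP[z1 z2]; split => //=; rewrite in_itv /=.
by rewrite z2 andbT ltW// (lt_trans h1).
Qed.

Variables (u : V -> R) (D : option 'I_n -> V -> R).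
Hypothesis mu : measurable_fun (P : set (mpt R n)) u.
Hypothesis mD : forall i, measurable_fun (P : set (mpt R n)) (D i).
Hypothesis uD : forall j i, has_weak_derivative (layers j) u (dir i) (D i).

(** On two consecutive layers the vertical width is at most three times the distance
to the bottom, hence the weight [3 (y - y0)]. *)
Definition hardy_grad (z : V) : R := wgrad (widths (3 * (z.2 - y0))) D z.

Lemma measurable_hardy_grad : measurable_fun (P : set (mpt R n)) hardy_grad.
Proof.
apply: measurable_sum => i; apply: measurable_funM; last exact: measurableT_comp.
case: i => [i|]; first exact: measurable_cst.
apply: measurable_funM => //; apply: measurable_funB => //.
by apply: measurable_funTS; exact: measurable_mpt2.
Qed.

Let C1 : R := A * (4 ^+ n.+1 * kappa) ^+ 2.
Lemma layers_poincare j :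
  (wint a (layers j) (fun z => (u z - mean (layers j) u)%R) <= C1%:E * wint a (layers j) hardy_grad)%E.
Proof.
have h1 := height_lt j; have h2 := height_lt j.+1; have h3 := height_gt j.+2.
have h13 : height j.+2 < height j by exact: lt_trans h1.
have k0 i : 0 < widths (height j - height j.+2) i by apply: widths_gt0; rewrite subr_gt0.
have bQ := slab_oc_body bS h13.
have Qk (z w : V) i : layers j z -> layers j w ->
    `|coord i w - coord i z| <= widths (height j - height j.+2) i.
  move=> [Sz /=]; rewrite in_itv /= => /andP[z1 z2] [Sw /=]; rewrite in_itv /= => /andP[w1 w2].
  case: i => [i|] /=; first exact: Sh.
  by rewrite ler_norml; lra.
have kk : \prod_i widths (height j - height j.+2) i <= kappa * fine (vol (layers j)).
  rewrite prod_widths (vol_slab_oc bS (ltW h13)) /= mulrA ler_wpM2r// subr_ge0 ltW//.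
have C10 : (0 <= C1%:E)%E by rewrite lee_fin mulr_ge0// sqr_ge0.
apply: le_trans (weighted_poincare k0 aA bQ Qk kk (uD j)) _.
apply: lee_wpmul2l => //.
have mQ : measurable (layers j : set (mpt R n)) := mslab _.
apply: (wint_le ma a0 mQ).
- by apply: measurable_funS (measurable_wgrad _ mD) => //; [exact: mslab|exact: layers_sub_P].
- by apply: measurable_funS measurable_hardy_grad => //; [exact: mslab|exact: layers_sub_P].
move=> z [Sz /=]; rewrite in_itv /= => /andP[z1 z2].
have w0 t i : 0 <= t -> 0 <= widths t i by case: i => [i|] // _; exact: ltW.
have z30 : 0 <= 3 * (z.2 - y0) by rewrite mulr_ge0// subr_ge0 ltW// (lt_trans h3).
rewrite !ger0_norm; last 2 first.
- by apply: wgrad_ge0 => i; exact: w0.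
- by apply: wgrad_ge0 => i; exact: ltW.
apply: ler_sum => i _; apply: ler_wpM2r => //; case: i => [//|] /=.
move: z1; rewrite !heightS /height !exprS; have := halfX_gt0 j; set t := 2^-1 ^+ j * len.
have -> : 2^-1 * 2^-1 ^+ j * len = t / 2 by rewrite /t; ring.
by lra.
Qed.

Let gam : R := doubling_const + 1.
Let gam0 : 0 < gam.
Proof. by rewrite ltr_wpDl// mulr_ge0// sqr_ge0. Qed.
Let m (E : set V) : R := fine (wmass a E).
Let below j := slab S `]y0, height j].

Lemma wmass_layer j : wmass a (layer j) = (m (layer j))%:E.
Proof. by rewrite fineK// ge0_fin_numE ?wmass_ge0//; apply: wmass_fin; exact: height_lt. Qed.

Lemma wmass_below j : wmass a (below j) = (m (below j))%:E.
Proof. by rewrite fineK// ge0_fin_numE ?wmass_ge0//; apply: wmass_fin; exact: height_gt. Qed.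

Lemma belowS j : m (below j) = m (layer j) + m (below j.+1).
Proof.
apply: EFin_inj; rewrite EFinD -(wmass_layer j) -(wmass_below j) -(wmass_below j.+1).
have h1 := height_lt j; have h2 := height_gt j.+1.
have -> : below j = layer j `|` below j.+1.
  apply/seteqP; split => [z [Sz] /=|z [] [Sz] /=]; rewrite in_itv /= => /andP[z1 z2].
  - have [hz|hz] := leP z.2 (height j.+1); [right|left]; split => //=; rewrite in_itv /=.
      by rewrite z1.
    by rewrite hz.
  - by split => //=; rewrite in_itv /= z2 (lt_trans h2).
  - by split => //=; rewrite in_itv /= z1 (le_trans z2)// ltW.
apply: ge0_integral_setU; [exact: mslab|exact: mslab| | |].
- by apply/measurable_EFinP; exact: measurable_funTS.
- by move=> z _; rewrite lee_fin ltW.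
apply/disj_setPS => z [[_ /=]]; rewrite in_itv /= => /andP[z1 _] [_ /=].
by rewrite in_itv /= => /andP[_ z2]; move: (lt_le_trans z1 z2); rewrite ltxx.
Qed.

Lemma below_ge0 j : 0 <= m (below j). Proof. by rewrite fine_ge0// wmass_ge0. Qed.

Lemma below_layer i j : height i - y0 <= 4 * (height j - height j.+1) ->
  y0 <= height j.+1 -> height j <= height i -> m (below i) <= gam * m (layer j).
Proof.
move=> h1 h2 h3; rewrite -lee_fin EFinM -wmass_below -wmass_layer.
apply: le_trans (slab_doubling h2 (height_lt j) h3 h1) _.
apply: lee_wpmul2r; first exact: wmass_ge0.
by rewrite lee_fin lerDl.
Qed.

Hypothesis gfin : (wint a P hardy_grad < +oo)%E.
Let Phi := fine (wint a P hardy_grad).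
Let lam j := fine (wint a (layer j) hardy_grad).

Lemma wint_grad_fin E : measurable (E : set (mpt R n)) -> E `<=` P ->
  wint a E hardy_grad = (fine (wint a E hardy_grad))%:E.
Proof.
move=> mE EP; rewrite fineK// ge0_fin_numE; last by apply: wint_ge0 => z; exact: ltW.
apply: le_lt_trans gfin; apply: (wint_subset ma a0) => //; first exact: mslab.
exact: measurable_hardy_grad.
Qed.

Lemma mgrad_sub E : measurable (E : set (mpt R n)) -> E `<=` P ->
  measurable_fun (E : set (mpt R n)) hardy_grad.
Proof. by move=> mE EP; apply: measurable_funS measurable_hardy_grad => //; exact: mslab. Qed.

Lemma layer_disj j (E : set V) : (forall z, E z -> z.2 <= height j.+1 \/ height j < z.2) ->
  [disjoint E & layer j].
Proof.
move=> H; apply/disj_setPS => z [Ez [_ /=]]; rewrite in_itv /= => /andP[z1 z2].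
by case: (H _ Ez) => hz; [move: (lt_le_trans z1 hz)|move: (lt_le_trans hz z2)]; rewrite ltxx.
Qed.

Lemma layers_grad j : (wint a (layers j) hardy_grad = (lam j.+1 + lam j)%:E)%E.
Proof.
rewrite layersE (wintU ma a0); [|exact: mslab|exact: mslab| |].
- by rewrite EFinD /lam -!wint_grad_fin//; try exact: mslab; exact: layer_sub_P.
- by rewrite -layersE; apply: mgrad_sub; [exact: mslab|exact: layers_sub_P].
- by apply: layer_disj => z [_ /=]; rewrite in_itv /= => /andP[_ ->]; left.
Qed.

Lemma sum_layers_grad J : (wint a (upper J) hardy_grad = (\sum_(j < J) lam j)%:E)%E.
Proof.
elim: J => [|J IH].
  rewrite big_ord0 (_ : upper 0 = set0) ?/wint ?integral_set0//.
  by apply/seteqP; split => // z [_ /=]; rewrite in_itv /= /height expr0 mul1r => /andP[z1 z2];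
    move: (lt_le_trans z1 z2); rewrite ltxx.
rewrite upperS (wintU ma a0); [|exact: mslab|exact: mslab| |].
- by rewrite IH big_ord_recr /= EFinD /lam -!wint_grad_fin//; try exact: mslab; exact: layer_sub_P.
- by rewrite -upperS; apply: mgrad_sub; [exact: mslab|exact: upper_sub_P].
- by apply: layer_disj => z [_ /=]; rewrite in_itv /= => /andP[z1 _]; right.
Qed.

Lemma lam_ge0 j : 0 <= lam j.
Proof. by apply: fine_ge0; apply: wint_ge0 => z; exact: ltW. Qed.

Section recursion.
Variables (c eps : nat -> R).
Hypothesis eps_ge0 : forall j, 0 <= eps j.
Hypothesis layers_eps : forall j,
  (wint a (layers j) (fun z => (u z - c j)%R) <= (eps j)%:E)%E.

(** On the common layer both means are close to [u]. *)
Lemma means_close i j E : (E = layer j) -> E `<=` layers i -> E `<=` layers i.+1 ->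
  (((c i - c i.+1) ^+ 2 * m (layer j))%:E <=
   2%:E * wint a (layers i) (fun z => u z - c i)%R +
   2%:E * wint a (layers i.+1) (fun z => u z - c i.+1)%R)%E.
Proof.
move=> EE E1 E2; have mE : measurable (E : set (mpt R n)) by rewrite EE; exact: mslab.
have EP := subset_trans E1 (@layers_sub_P i).
have mi (x : R) (F : set V) : measurable (F : set (mpt R n)) -> F `<=` P ->
    measurable_fun (F : set (mpt R n)) (fun z => u z - x).
  move=> mF FP; apply: measurable_funB => //; apply: measurable_funS mu => //; exact: mslab.
rewrite EFinM -wmass_layer -EE -(wint_cst ma a0)//.
apply: le_trans (@wint_parallelogram _ _ _ ma a0 E (fun z => u z - c i.+1) (fun z => - (u z - c i)) _ _ _ _ _ _) _ => //.
- exact: mi.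
- by apply: measurableT_comp => //; exact: mi.
- by move=> z _ /=; ring.
rewrite addeC; have l2 : (0 <= 2%:E :> \bar R)%E by rewrite lee_fin.
apply: leeD; apply: lee_wpmul2l => //.
- apply: (@le_trans _ _ (wint a E (fun z => u z - c i))).
    by apply: (wint_le ma a0) => [//|||z _]; [by apply: measurableT_comp => //; exact: mi|exact: mi|rewrite normrN].
  apply: (wint_subset ma a0) => //; first exact: mslab.
  by apply: mi; [exact: mslab|exact: layers_sub_P].
- apply: (wint_subset ma a0) => //; first exact: mslab.
  by apply: mi; [exact: mslab|exact: layers_sub_P].
Qed.

(** The second term on the left lets the estimate pass from one layer to the next:
it pays for the change of the mean. *)
Lemma hardy_induction J :
  (wint a (upper J) (fun z => (u z - c 0)%R) +
   (4 * (c J - c 0) ^+ 2 * m (below J))%:E <=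
   ((2 + 8 * gam * (1 + 2 * gam)) * \sum_(j < J) (eps j + eps j.+1))%:E)%E.
Proof.
elim: J => [|J IH].
  rewrite big_ord0 subrr expr0n /= !(mulr0, mul0r) adde0 (_ : upper 0 = set0) ?/wint ?integral_set0//.
  by apply/seteqP; split => // z [_ /=]; rewrite in_itv /= /height expr0 mul1r => /andP[z1 z2];
    move: (lt_le_trans z1 z2); rewrite ltxx.
have mi (x : R) (F : set V) : measurable (F : set (mpt R n)) -> F `<=` P ->
    measurable_fun (F : set (mpt R n)) (fun z => u z - x).
  move=> mF FP; apply: measurable_funB => //; apply: measurable_funS mu => //; exact: mslab.
have layJ : layer J `<=` layers J by rewrite layersE; right.
rewrite upperS (wintU ma a0); [|exact: mslab|exact: mslab| |]; last 2 first.
- by rewrite -upperS; apply: mi; [exact: mslab|exact: upper_sub_P].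
- by apply: layer_disj => z [_ /=]; rewrite in_itv /= => /andP[z1 _]; right.
have step : (wint a (layer J) (fun z => (u z - c 0)%R) <=
    (2 * eps J + 2 * (c J - c 0) ^+ 2 * m (layer J))%:E)%E.
  apply: le_trans (@wint_parallelogram _ _ _ ma a0 (layer J) (fun z => u z - c J) (cst (c J - c 0)) _ _ _ _ _ _) _ => //.
  - exact: mslab.
  - by apply: mi; [exact: mslab|exact: layer_sub_P].
  - by apply: mi; [exact: mslab|exact: layer_sub_P].
  - by move=> z _ /=; ring.
  rewrite (wint_cst ma a0); last exact: mslab.
  have -> : (2 * eps J + 2 * (c J - c 0) ^+ 2 * m (layer J))%:E =
      (2%:E * (eps J)%:E + 2%:E * (((c J - c 0) ^+ 2)%:E * (m (layer J))%:E))%E.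
    by rewrite -!EFinM -EFinD mulrA.
  rewrite wmass_layer; apply: leeD; last by [].
  apply: lee_wpmul2l => //; apply: le_trans (layers_eps J).
  apply: (wint_subset ma a0) => //; [exact: mslab|exact: mslab|].
  by apply: mi; [exact: mslab|exact: layers_sub_P].
rewrite big_ord_recr /= [X in (_ <= X%:E)%E]mulrDr EFinD.
have Wfin : (wint a (upper J) (fun z => (u z - c 0)%R) \is a fin_num)%E.
  rewrite ge0_fin_numE; last by apply: wint_ge0 => z; exact: ltW.
  apply: le_lt_trans (ltry ((2 + 8 * gam * (1 + 2 * gam)) * \sum_(j < J) (eps j + eps j.+1))).
  apply: le_trans IH; rewrite leeDl// lee_fin.
  by apply: mulr_ge0; [rewrite mulr_ge0 ?sqr_ge0|exact: below_ge0].
have Lfin : (wint a (layer J) (fun z => (u z - c 0)%R) \is a fin_num)%E.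
  rewrite ge0_fin_numE; last by apply: wint_ge0 => z; exact: ltW.
  by apply: le_lt_trans step _; rewrite ltry.
move: IH step; rewrite -(fineK Wfin) -(fineK Lfin) -!EFinD !lee_fin.
have hJ := height_lt J; have hJ1 := height_lt J.+1; have hJ2 := height_gt J.+1; have hJ3 := height_gt J.+2.
have := @hardy_step R gam (m (layer J)) (m (layer J.+1)) (m (below J.+1)) (c J - c 0) (c J.+1 - c J)
   (eps J) (eps J.+1) gam0 (below_ge0 _) _ _ (eps_ge0 _) (eps_ge0 _) _.
rewrite -belowS (_ : c J - c 0 + (c J.+1 - c J) = c J.+1 - c 0); last by ring.
set X := fine _; set Y := fine _.
move=> next IH step.
suff : 2 * eps J + 2 * (c J - c 0) ^+ 2 * m (layer J) + 4 * (c J.+1 - c 0) ^+ 2 * m (below J.+1) <=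
    (2 + 8 * gam * (1 + 2 * gam)) * (eps J + eps J.+1) + 4 * (c J - c 0) ^+ 2 * m (below J) by lra.
apply: next.
- apply: le_trans (_ : m (below J) <= _); first by rewrite [leRHS]belowS lerDr fine_ge0// wmass_ge0.
  apply: below_layer => //; last exact: ltW.
  by rewrite heightS /height; have := halfX_gt0 J; lra.
- apply: below_layer => //; last exact: ltW.
  by rewrite [height J.+2]heightS /height; have := halfX_gt0 J.+1; lra.
have l12 : layer J.+1 `<=` layers J by rewrite layersE; left.
have l22 : layer J.+1 `<=` layers J.+1 by rewrite layersE; right.
have := @means_close J J.+1 _ erefl l12 l22.
move=> h'; rewrite -lee_fin -sqrrN opprB; apply: le_trans h' _.
have -> : (2 * (eps J + eps J.+1))%:E = (2%:E * (eps J)%:E + 2%:E * (eps J.+1)%:E)%E.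
  by rewrite -!EFinM -EFinD mulrDr.
by apply: leeD; apply: lee_wpmul2l => //; exact: layers_eps.
Qed.

End recursion.

Lemma sum_lam k J : \sum_(j < J) lam (k + j) <= Phi.
Proof.
apply: (@le_trans _ _ (\sum_(j < k + J) lam j)).
  by rewrite big_split_ord /= lerDr sumr_ge0// => i _; exact: lam_ge0.
rewrite -lee_fin -sum_layers_grad /Phi -wint_grad_fin//; last exact: mslab.
apply: (wint_subset ma a0); [exact: mslab|exact: mslab|exact: measurable_hardy_grad|].
exact: upper_sub_P.
Qed.

Definition hardy_const : R := (2 + 8 * gam * (1 + 2 * gam)) * (C1 * 4).

(** The slabs [upper J] exhaust the prism except for its bottom, a null set. *)
Lemma wint_upper_lim (f : V -> R) (B : \bar R) : measurable_fun (P : set (mpt R n)) f ->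
  (forall J, (wint a (upper J) f <= B)%E) -> (wint a P f <= B)%E.
Proof.
move=> mf H; have mg := measurable_wint ma mf.
pose N := slab S `[y0, y0].
have N0 : vol N = 0%E by rewrite /N (vol_slab_cc bS)// subrr mulr0.
have PN : P `\` N = \bigcup_J upper J.
  apply/seteqP; split => [z [[Sz /=]]|z [J _] Uz].
    rewrite in_itv /= => /andP[z1 z2] Nz.
    have zy : 0 < (z.2 - y0) / len.
      rewrite divr_gt0// subr_gt0 lt_neqAle z1 andbT; apply/eqP => E; apply: Nz.
      by split => //=; rewrite in_itv /= -E lexx.
    have [J HJ] : exists J : nat, 2^-1 ^+ J < (z.2 - y0) / len.
      have h2 : `|2^-1 : R| < 1 by rewrite ger0_norm ?invr_ge0// invf_lt1// ltr1n.
      have /cvgr0_norm_lt/(_ _ zy)[J _ /(_ J (leqnn J))] := cvg_expr h2.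
      by rewrite ger0_norm ?exprn_ge0 ?invr_ge0// => HJ; exists J.
    exists J => //; split => //=; rewrite in_itv /= z2 andbT /height.
    by rewrite -ltrBrDl -ltr_pdivlMr.
  split; first exact: upper_sub_P Uz.
  case: Uz => _ /=; rewrite in_itv /= => /andP[z1 _] [_ /=]; rewrite in_itv /= => /andP[_ z3].
  by move: (lt_le_trans (lt_trans (height_gt J) z1) z3); rewrite ltxx.
have gP z : P z -> (0 <= (f z ^+ 2 * a z)%:E)%E by rewrite lee_fin mulr_ge0 ?sqr_ge0// ltW.
rewrite /wint (@ge0_negligible_integral _ _ _ vol P N _ (mslab _) (mslab _) mg gP N0) PN.
have nd : nondecreasing_seq upper.
  apply/nondecreasing_seqP => J; apply/subsetPset; rewrite upperS; exact: subsetUl.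
have mgU J : measurable_fun (upper J : set (mpt R n)) (fun z => (f z ^+ 2 * a z)%:E).
  by apply: measurable_funS mg => //; [exact: mslab|exact: upper_sub_P].
have g0 J z : upper J z -> (0 <= (f z ^+ 2 * a z)%:E)%E.
  by rewrite lee_fin mulr_ge0 ?sqr_ge0// ltW.
have := @ge0_nondecreasing_set_cvg_integral _ (mpt R n) R upper _ (vol : {measure set (mpt R n) -> \bar R}) nd (fun J => mslab _) mgU g0.
move=> cv; rewrite -(cvg_lim _ cv)//; apply: lime_le; first by apply/cvg_ex; eexists; exact: cv.
by apply: nearW => J; exact: H.
Qed.

(** On every pair of layers [u] is close to its mean. By doubling, all that lies below
a layer weighs at most a multiple of the layer, so the changes of the means add up
to a multiple of the right-hand side, and one mean serves for the whole prism. *)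
Theorem hardy_poincare : exists c : R,
  (wint a P (fun z => (u z - c)%R) <= hardy_const%:E * wint a P hardy_grad)%E.
Proof.
pose c j := mean (layers j) u; pose eps j := C1 * (lam j.+1 + lam j).
have C10 : 0 <= C1 by rewrite mulr_ge0// sqr_ge0.
have eps_ge0 j : 0 <= eps j by rewrite mulr_ge0// addr_ge0// lam_ge0.
have layers_eps j : (wint a (layers j) (fun z => (u z - c j)%R) <= (eps j)%:E)%E.
  by rewrite EFinM -layers_grad; exact: layers_poincare.
exists (c 0); apply: wint_upper_lim => [|J].
  by apply: measurable_funB.
apply: (@le_trans _ _ ((2 + 8 * gam * (1 + 2 * gam)) * \sum_(j < J) (eps j + eps j.+1))%:E).
  apply: le_trans (hardy_induction eps_ge0 layers_eps J); rewrite leeDl// lee_fin.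
  by apply: mulr_ge0; [rewrite mulr_ge0 ?sqr_ge0|exact: below_ge0].
rewrite (wint_grad_fin (mslab _))// -/Phi -EFinM lee_fin /hardy_const -[leRHS]mulrA.
apply: ler_wpM2l.
  by have g0 := ltW gam0; rewrite addr_ge0// !mulr_ge0// addr_ge0// mulr_ge0.
have -> : \sum_(j < J) (eps j + eps j.+1) =
    C1 * (\sum_(j < J) lam (0 + j) + \sum_(j < J) lam (1 + j) + \sum_(j < J) lam (1 + j) + \sum_(j < J) lam (2 + j)).
  rewrite -!big_split mulr_sumr; apply: eq_bigr => j _; rewrite /eps /= add0n add1n add2n; ring.
rewrite -[leRHS]mulrA; apply: ler_wpM2l => //.
have := sum_lam 0 J; have := sum_lam 1 J; have := sum_lam 2 J; lra.
Qed.

End hardy.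

(** * Traces by integration along segments *)

Section smooth_shift.
Context {R : realType} {n : nat}.
Notation V := (pt R n).

Lemma smooth_subc_derive (f : V -> R) (b : R) z e : smooth f ->
  is_derive z e (fun z => f z - b) ('D_e f z).
Proof.
move=> sf; apply/is_derive_dirP.
have -> : (fun s : R => f (s *: e + z) - b) = (fun s : R => f (z + s *: e)) - cst b.
  by apply/funext => s /=; rewrite [s *: e + z]addrC.
have H : is_derive (0 : R) (1 : R) (fun s : R => f (z + s *: e)) ('D_e f z).
  by have := smooth_line sf z e 0; rewrite scale0r addr0.
by have := is_deriveB H (is_derive_cst b (0 : R) (1 : R)); rewrite subr0.
Qed.

Lemma smooth_subc (f : V -> R) (b : R) : smooth f -> smooth (fun z => f z - b).
Proof.
move=> sf; pose S g := exists2 f, smooth f & exists b : R, g = (fun z : V => f z - b).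
apply: (@smooth_family _ _ S); last by exists f => //; exists b.
- move=> _ [g sg [c ->]] z; apply: cvgB; last exact: cvg_cst.
  exact: smooth_continuous.
- by move=> _ z e [g sg [c ->]]; have [] := smooth_subc_derive c z e sg.
- move=> _ e [g sg [c ->]]; exists ('D_e g); first exact: smooth_derive.
  by exists 0; apply/funext => z; rewrite subr0; have [_ ->] := smooth_subc_derive c z e sg.
Qed.

End smooth_shift.

(** A smooth function on a hypersurface is recovered from its values and some of its
derivatives in the body by integration along a family of segments: this is
[trace_formula]. [path_integral] expresses that the segments sweep the body. *)
Section abstract_trace.
Context {R : realType} {n : nat}.
Notation V := (pt R n).
Notation vol := (@vol R n).
Notation mu := (@lebesgue_measure R).
Notation mR := (measurableTypeR R).
Variables (I : finType) (e : I -> V) (P : set V).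
Variables (d : measure_display) (T : measurableType d)
  (nu : {sigma_finite_measure set T -> \bar R}) (E : set T).
Variables (psi : T -> V) (psi' : V -> T) (path : T -> R -> V).
Variables (q : R -> R) (b0 b1 c alpha : R) (beta : I -> V -> R) (B : I -> R).

Definition along (u : V -> R) (w : I -> V -> R) (z : V) : R :=
  alpha * u z + \sum_i beta i z * w i z.

Hypothesis bP : convex_body P.
Hypothesis mE : measurable E.
Hypothesis q0 : forall t, b0 <= t <= b1 -> 0 <= q t.
Hypothesis c0 : 0 <= c.
Hypothesis alpha0 : 0 <= alpha.
Hypothesis cq : continuous q.
Hypothesis cbeta : forall i, continuous (beta i).
Hypothesis betaB : forall i z, P z -> `|beta i z| <= B i.
Hypothesis mpath : measurable_fun setT (fun x : T * mR => path x.1 x.2 : mpt R n).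
Hypothesis cpath : forall s, continuous (path s).
Hypothesis psiK : forall s, psi' (psi s) = s.
Hypothesis ipsi : forall f, smooth f -> nu.-integrable E (EFin \o f \o psi).
Hypothesis path_integral : forall H : mpt R n -> \bar R, measurable_fun setT H ->
  (forall z, 0 <= H z)%E ->
  (\int[nu]_(s in E) \int[mu]_(t in `[b0, b1]) ((q t)%:E * H (path s t)) =
   c%:E * \int[vol]_(z in P) H z)%E.
Hypothesis trace_formula : forall f s, smooth f ->
  (\int[mu]_(t in `[b0, b1]) (q t * along f (fun i => 'D_(e i) f) (path s t))%:E =
   (f (psi s))%:E)%E.

Let mP : measurable (P : set (mpt R n)) := body_measurable bP.

Lemma measurable_along (u : V -> R) (w : I -> V -> R) (D : set (mpt R n)) :
  measurable_fun D u -> (forall i, measurable_fun D (w i)) -> measurable_fun D (along u w).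
Proof.
move=> mu_ mw; apply: measurable_funD; first exact: measurable_funM.
apply: measurable_sum => i; apply: measurable_funM => //.
by apply: measurable_funTS; apply: continuous_measurable_pt.
Qed.

Lemma alongB u u' w w' z : along u w z - along u' w' z =
  along (fun z => u z - u' z) (fun i z => w i z - w' i z) z.
Proof.
rewrite /along mulrBr opprD addrACA -sumrB; congr (_ + _).
by apply: eq_bigr => i _; rewrite mulrBr.
Qed.

Lemma along_le u w z : P z -> `|along u w z| <= alpha * `|u z| + \sum_i B i * `|w i z|.
Proof.
move=> Pz; apply: le_trans (ler_normD _ _) _; rewrite normrM (ger0_norm alpha0) lerD2l.
apply: le_trans (ler_norm_sum _ _ _) _; apply: ler_sum => i _.
by rewrite normrM ler_wpM2r// betaB.
Qed.

Lemma B_ge0 i : 0 <= B i.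
Proof.
have [z [r r0 rP]] := body_ball bP.
apply: le_trans (betaB i (rP z _)); first exact: normr_ge0.
by rewrite /= subrr normr0 ltW.
Qed.

Lemma measurable_path_fun (H : mpt R n -> \bar R) : measurable_fun setT H ->
  measurable_fun setT (fun x : T * mR => (q x.2)%:E * H (path x.1 x.2))%E.
Proof.
move=> mH; apply: emeasurable_funM; last exact: (measurableT_comp mH mpath).
apply/measurable_EFinP; apply: measurableT_comp; last exact: measurable_snd.
exact: continuous_measurable_fun.
Qed.

Lemma measurable_path_integral (H : mpt R n -> \bar R) : measurable_fun setT H ->
  (forall z, 0 <= H z)%E ->
  measurable_fun E (fun s => \int[mu]_(t in `[b0, b1]) ((q t)%:E * H (path s t)))%E.
Proof.
move=> mH H0.
apply: (measurable_integral_in _ (f := fun (s : T) (t : mR) => (q t)%:E * H (path s t))%E) => //.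
  by apply: measurable_funTS; exact: measurable_path_fun.
by move=> s t _; rewrite /= in_itv /= => /q0 qt; rewrite mule_ge0// lee_fin.
Qed.

Lemma measurable_abs_along u w : measurable_fun setT (u : mpt R n -> R) ->
  (forall i, measurable_fun setT (w i : mpt R n -> R)) ->
  measurable_fun E (fun s => \int[mu]_(t in `[b0, b1]) ((q t)%:E * `|along u w (path s t)|%:E))%E.
Proof.
move=> mu_ mw; apply: (measurable_path_integral (H := fun z => `|along u w z|%:E%E)) => //.
by apply/measurable_EFinP; apply: measurableT_comp => //; exact: measurable_along.
Qed.

Lemma measurable_path_fun_at (H : mpt R n -> \bar R) s : measurable_fun setT H ->
  measurable_fun setT (fun t : mR => (q t)%:E * H (path s t))%E.
Proof. by move=> mH; exact: (measurableT_comp (measurable_path_fun mH) (measurable_pair1 s)). Qed.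

Lemma smooth_along_integrable f s : smooth f ->
  mu.-integrable `[b0, b1] (fun t => (q t * along f (fun i => 'D_(e i) f) (path s t))%:E).
Proof.
move=> sf.
have cF : continuous (fun t : R => q t * along f (fun i => 'D_(e i) f) (path s t)).
  move=> t; apply: cvgM; first exact: cq.
  apply: (@continuous_comp _ _ _ (path s) (along f (fun i => 'D_(e i) f))); first exact: cpath.
  apply: cvgD; first by apply: cvgM; [exact: cvg_cst|exact: smooth_continuous].
  apply: cvg_big => [|i _]; first exact: add_continuous.
  apply: cvgM; first exact: cbeta.
  exact: (smooth_continuous (smooth_derive (e i) sf)).
apply: continuous_compact_integrable; first exact: segment_compact.
exact: continuous_subspaceT.
Qed.

Definition trace_of (u : V -> R) (w : I -> V -> R) (s : T) : R :=
  \int[mu]_(t in `[b0, b1]) (q t * along u w (path s t)).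

(** If the right-hand side is infinite there is nothing to prove; otherwise the
integrand of the trace differs from an integrable one by an integrable one. *)
Lemma trace_error f u w s : smooth f -> measurable_fun setT (u : mpt R n -> R) ->
  (forall i, measurable_fun setT (w i : mpt R n -> R)) ->
  (`|f (psi s) - trace_of u w s|%:E <=
   \int[mu]_(t in `[b0, b1]) ((q t)%:E *
     `|along (fun z => f z - u z)%R (fun i z => 'D_(e i) f z - w i z)%R (path s t)|%:E))%E.
Proof.
move=> sf mu_ mw.
set J := (\int[mu]_(t in _) _)%E.
have [->|Joo] := eqVneq J +oo%E; first by rewrite leey.
have mf : measurable_fun setT (f : mpt R n -> R).
  by apply: continuous_measurable_pt; exact: smooth_continuous.
have mD i : measurable_fun setT ('D_(e i) f : mpt R n -> R).
  by apply: continuous_measurable_pt; apply: smooth_continuous; exact: smooth_derive.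
pose g := along (fun z => f z - u z)%R (fun i z => 'D_(e i) f z - w i z)%R.
have mg : measurable_fun setT (fun z : mpt R n => (g z)%:E).
  by apply/measurable_EFinP; apply: measurable_along => [|i]; exact: measurable_funB.
have JE : J = (\int[mu]_(t in `[b0, b1]) `|(q t * g (path s t))%:E|)%E.
  apply: eq_integral => t; rewrite inE /= in_itv /= => /q0 qt.
  by rewrite /= normrM ger0_norm// EFinM.
have ig : mu.-integrable `[b0, b1] (fun t => (q t * g (path s t))%:E).
  apply/integrableP; split.
    by apply: measurable_funTS; under eq_fun do rewrite EFinM; exact: (measurable_path_fun_at s mg).
  by rewrite -JE ltey.
have iff := smooth_along_integrable s sf.
have m01 : measurable (`[b0, b1]%classic : set mR) by exact: measurable_itv.
have iu : mu.-integrable `[b0, b1] (fun t => (q t * along u w (path s t))%:E).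
  have := integrableB m01 iff ig; apply: eq_integrable => // t _.
  by rewrite -EFinB -mulrBr /g -alongB opprB addrC subrK.
have -> : f (psi s) - trace_of u w s = \int[mu]_(t in `[b0, b1]) (q t * g (path s t)).
  have -> : f (psi s) = \int[mu]_(t in `[b0, b1]) (q t * along f (fun i => 'D_(e i) f) (path s t)).
    by rewrite /Rintegral trace_formula.
  rewrite /trace_of -RintegralB//; apply: eq_Rintegral => t _.
  by rewrite -mulrBr /g alongB.
have := le_normr_Rintegral m01 ig; rewrite -lee_fin => H; apply: le_trans H _.
rewrite JE /Rintegral fineK//.
exact: (integrable_fin_num m01 (integrable_abse ig)).
Qed.

Lemma trace_error_integral f u w : smooth f -> measurable_fun setT (u : mpt R n -> R) ->
  (forall i, measurable_fun setT (w i : mpt R n -> R)) ->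
  (\int[nu]_(s in E) \int[mu]_(t in `[b0, b1]) ((q t)%:E *
     `|along (fun z => f z - u z)%R (fun i z => 'D_(e i) f z - w i z)%R (path s t)|%:E) <=
   c%:E * (alpha%:E * L1dist P f u + \sum_i (B i)%:E * L1dist P ('D_(e i) f) (w i)))%E.
Proof.
move=> sf mu_ mw.
have mf : measurable_fun setT (f : mpt R n -> R).
  by apply: continuous_measurable_pt; exact: smooth_continuous.
have mD i : measurable_fun setT ('D_(e i) f : mpt R n -> R).
  by apply: continuous_measurable_pt; apply: smooth_continuous; exact: smooth_derive.
pose g := along (fun z => f z - u z)%R (fun i z => 'D_(e i) f z - w i z)%R.
have mg : measurable_fun setT (fun z : mpt R n => `|g z|%:E).
  apply/measurable_EFinP; apply: measurableT_comp => //.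
  by apply: measurable_along => [|i]; exact: measurable_funB.
rewrite (path_integral mg)//; apply: lee_wpmul2l; first by rewrite lee_fin.
have m1 : measurable_fun P (fun z : mpt R n => `|f z - u z|%:E).
  by apply: measurable_funTS; exact: measurable_abs_dist.
have m2 i : measurable_fun P (fun z : mpt R n => `|'D_(e i) f z - w i z|%:E).
  by apply: measurable_funTS; exact: measurable_abs_dist.
have Bm i : measurable_fun P (fun z : mpt R n => (B i)%:E * `|'D_(e i) f z - w i z|%:E)%E.
  exact: measurable_funeM.
have B0 i : (0 <= (B i)%:E)%E by rewrite lee_fin B_ge0.
rewrite /L1dist -ge0_integralZl//.
have -> : (\sum_i (B i)%:E * \int[vol]_(z in P) `|'D_(e i) f z - w i z|%:E =
    \sum_i \int[vol]_(z in P) ((B i)%:E * `|'D_(e i) f z - w i z|%:E))%E.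
  apply: eq_bigr => i _; rewrite ge0_integralZl//; exact: m2.
rewrite -ge0_integral_sum//; last by move=> i z _; rewrite mule_ge0.
rewrite -ge0_integralD//; last 4 first.
- by move=> z _; rewrite mule_ge0 ?lee_fin.
- exact: measurable_funeM.
- by move=> z _; apply: sume_ge0 => i _; rewrite mule_ge0.
- exact: emeasurable_sum.
apply: ge0_le_integral => //.
- exact: measurable_funTS.
- by apply: emeasurable_funD; [exact: measurable_funeM|exact: emeasurable_sum].
move=> z Pz; have := along_le (fun z => f z - u z)%R (fun i z => 'D_(e i) f z - w i z)%R Pz.
rewrite -lee_fin => H; apply: le_trans H _; rewrite EFinD EFinM -sumEFin.
by under eq_bigr do rewrite EFinM.
Qed.

Lemma smooth_trace_bound f : smooth f ->
  (\int[nu]_(s in E) `|f (psi s)|%:E <=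
   c%:E * (alpha%:E * L1dist P f (cst 0%R) + \sum_i (B i)%:E * L1dist P ('D_(e i) f) (cst 0%R)))%E.
Proof.
move=> sf.
have m0 : measurable_fun setT (cst 0%R : mpt R n -> R) by exact: measurable_cst.
apply: le_trans (@trace_error_integral _ (cst 0%R) (fun _ => cst 0%R) sf m0 (fun _ => m0)).
have mfs : measurable_fun E (f \o psi) by apply/measurable_EFinP; exact: measurable_int (ipsi sf).
apply: ge0_le_integral => //.
- by apply/measurable_EFinP; apply: measurableT_comp.
- apply: measurable_abs_along => [|i]; apply: measurable_funB => //.
    by apply: continuous_measurable_pt; exact: smooth_continuous.
  by apply: continuous_measurable_pt; apply: smooth_continuous; exact: smooth_derive.
move=> s _; have := @trace_error _ (cst 0%R) (fun _ => cst 0%R) s sf m0 (fun _ => m0).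
have -> : trace_of (cst 0%R) (fun _ => cst 0%R) s = 0.
  transitivity (\int[mu]_(t in `[b0, b1]) (0 : R)); last by rewrite /Rintegral integral0_eq.
  apply: eq_Rintegral => t _.
  by rewrite /along mulr0 big1 ?addr0 ?mulr0// => i _; rewrite mulr0.
by rewrite subr0.
Qed.

Lemma trace_bound f (b : R) : smooth f ->
  (\int[nu]_(s in E) `|f (psi s) - b|%:E <=
   c%:E * (alpha%:E * L1dist P f (cst b) + \sum_i (B i)%:E * L1dist P ('D_(e i) f) (cst 0%R)))%E.
Proof.
move=> sf; apply: le_trans (smooth_trace_bound (smooth_subc b sf)) _.
apply: lee_wpmul2l; first by rewrite lee_fin.
apply: leeD.
  apply: lee_wpmul2l; first by rewrite lee_fin.
  by rewrite le_eqVlt; apply/orP; left; apply/eqP; apply: L1dist_eq => z _ /=; rewrite subr0.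
apply: lee_sum => i _; apply: lee_wpmul2l; first by rewrite lee_fin B_ge0.
suff -> : 'D_(e i) (fun z => f z - b) = 'D_(e i) f by [].
by apply/funext => z; have [_ ->] := smooth_subc_derive b z (e i) sf.
Qed.

Lemma measurable_trace_of u w : measurable_fun setT (u : mpt R n -> R) ->
  (forall i, measurable_fun setT (w i : mpt R n -> R)) -> measurable_fun E (trace_of u w).
Proof.
move=> mu_ mw.
pose F (x : T * mR) : \bar R := (q x.2 * along u w (path x.1 x.2))%:E.
have mF : measurable_fun setT F.
  have -> : F = (fun x => (q x.2)%:E * (along u w (path x.1 x.2))%:E)%E.
    by apply/funext => x; rewrite /F EFinM.
  apply: (measurable_path_fun (H := fun z => (along u w z)%:E)).
  by apply/measurable_EFinP; exact: measurable_along.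
have m01 : measurable (`[b0, b1]%classic : set mR) by exact: measurable_itv.
apply: measurableT_comp; first exact: fine_measurable.
have part (G : T * mR -> \bar R) : measurable_fun setT G -> (forall x, 0 <= G x)%E ->
    measurable_fun E (fun s => \int[mu]_(t in `[b0, b1]) G (s, t))%E.
  move=> mG G0; apply: (measurable_integral_in _ (f := fun s t => G (s, t))) => //.
  by apply: measurable_funTS; rewrite (_ : (fun _ => _) = G)//; apply/funext => -[].
rewrite (_ : (fun s => _) = (fun s => (\int[mu]_(t in `[b0, b1]) F^\+ (s, t)) -
   \int[mu]_(t in `[b0, b1]) F^\- (s, t)))%E; last first.
  by apply/funext => s; rewrite integralE; congr (_ - _)%E; apply: eq_integral => t _; rewrite /F ?funeposE ?funenegE.
by apply: emeasurable_funB; apply: part => //; [exact: measurable_funepos|exact: measurable_funeneg].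
Qed.

Lemma cvg_weighted (x : nat -> \bar R) (y : I -> nat -> \bar R) :
  (forall k, 0 <= x k)%E -> (forall i k, 0 <= y i k)%E ->
  x @ \oo --> 0%E -> (forall i, y i @ \oo --> 0%E) ->
  (c%:E * (alpha%:E * x k + \sum_i (B i)%:E * y i k) @[k --> \oo] --> 0)%E.
Proof.
move=> x0 y0 cx cy.
rewrite [X in _ --> X](_ : _ = c%:E * 0)%E; last by rewrite mule0.
apply: cvgeZl => //; rewrite [X in _ --> X](_ : _ = 0 + 0)%E; last by rewrite adde0.
apply: cvgeD => //.
  by rewrite [X in _ --> X](_ : _ = alpha%:E * 0)%E; [apply: cvgeZl|rewrite mule0].
have H : (\sum_i (B i)%:E * y i k @[k --> \oo] --> \sum_(i : I) 0)%E.
  apply: cvg_nnesum => i _; first by apply: nearW => k; rewrite mule_ge0// lee_fin B_ge0.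
  by rewrite [X in _ --> X](_ : _ = (B i)%:E * 0)%E; [apply: cvgeZl|rewrite mule0].
by rewrite big1 in H.
Qed.

Lemma ecvg_squeeze (x y : nat -> \bar R) : (forall k, 0 <= x k <= y k)%E ->
  y @ \oo --> 0%E -> x @ \oo --> 0%E.
Proof.
move=> xy cy; apply: (squeeze_cvge (f := cst 0%E) _ _ cy); last exact: cvg_cst.
by apply: nearW.
Qed.

(** The integral along the segments makes sense for [u] and its weak derivatives,
and by [trace_error_integral] it is the limit of the traces of smooth
approximations. *)
Theorem trace_exists u w : vol.-integrable P (EFin \o u) ->
  (forall i, has_weak_derivative P u (e i) (w i)) ->
  exists g, has_trace P u e w nu E psi g.
Proof.
move=> iu uw.
have mpatch (f : V -> R) : vol.-integrable P (EFin \o f) -> measurable_fun setT (f \_ P : mpt R n -> R).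
  move=> fi; apply/(measurable_restrictT _ mP); apply/measurable_EFinP; exact: measurable_int fi.
pose u' := u \_ P; pose w' i := w i \_ P.
have mu' : measurable_fun setT (u' : mpt R n -> R) by exact: mpatch.
have mw' i : measurable_fun setT (w' i : mpt R n -> R) by apply: mpatch; have [] := uw i.
pose G := trace_of u' w'.
have [u_ [su uu uwu]] := smooth_density bP iu uw.
have errle k : (\int[nu]_(s in E) `|u_ k (psi s) - G s|%:E <=
    c%:E * (alpha%:E * L1dist P (u_ k) u + \sum_i (B i)%:E * L1dist P ('D_(e i) (u_ k)) (w i)))%E /\
    measurable_fun E G.
  have mG : measurable_fun E G.
    exact: measurable_trace_of.
  split => //.
  have -> : L1dist P (u_ k) u = L1dist P (u_ k) u'.
    by apply: L1dist_eq => z /mem_set Pz; rewrite /u' patchE Pz.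
  have -> : (\sum_i (B i)%:E * L1dist P ('D_(e i) (u_ k)) (w i) =
      \sum_i (B i)%:E * L1dist P ('D_(e i) (u_ k)) (w' i))%E.
    apply: eq_bigr => i _; congr (_ * _)%E.
    by apply: L1dist_eq => z /mem_set Pz; rewrite /w' patchE Pz.
  apply: le_trans (trace_error_integral (su k) mu' mw').
  have mfs : measurable_fun E (u_ k \o psi) by apply/measurable_EFinP; exact: measurable_int (ipsi (su k)).
  apply: ge0_le_integral => //.
  - by apply/measurable_EFinP; apply: measurableT_comp => //; exact: measurable_funB.
  - apply: measurable_abs_along => [|i]; apply: measurable_funB => //.
      by apply: continuous_measurable_pt; apply: smooth_continuous.
    by apply: continuous_measurable_pt; apply: smooth_continuous; exact: smooth_derive.
  by move=> s _; exact: trace_error.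
have cv : (\int[nu]_(s in E) `|u_ k (psi s) - G s|%:E @[k --> \oo] --> 0)%E.
  apply: (ecvg_squeeze _ (cvg_weighted (fun k => L1dist_ge0 _ _ _) (fun i k => L1dist_ge0 _ _ _) uu uwu)).
  by move=> k; have [-> _] := errle k; rewrite andbT integral_ge0.
have [_ mG] := errle 0%N.
exists (G \o psi'); split.
  have /ecvg0P := cv => /(_ (fun k => integral_ge0 _ (fun _ _ => lee_tofin (normr_ge0 _))) _ ltr01)[N _ /(_ N (leqnn N)) h].
  have i1 : nu.-integrable E (EFin \o (fun s => u_ N (psi s) - G s)).
    apply/integrableP; split.
      apply/measurable_EFinP; apply: measurable_funB => //.
      by apply/measurable_EFinP; exact: measurable_int (ipsi (su N)).
    by apply: le_lt_trans h _; rewrite ltry.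
  have := integrableB mE (ipsi (su N)) i1; apply: eq_integrable => // s _.
  by rewrite /= psiK -EFinB opprB addrC subrK.
exists u_; split; [exact: su|exact: uu|exact: uwu|].
by under eq_fun => k do under eq_integral => s _ do rewrite /= psiK.
Qed.

(** Pass to the limit in [trace_bound] along the smooth functions that define the
trace. *)
Theorem trace_inequality u w g (b : R) : vol.-integrable P (EFin \o u) ->
  (forall i, vol.-integrable P (EFin \o w i)) -> has_trace P u e w nu E psi g ->
  (\int[nu]_(s in E) `|g (psi s) - b|%:E <=
   c%:E * (alpha%:E * \int[vol]_(z in P) `|u z - b|%:E +
     \sum_i (B i)%:E * \int[vol]_(z in P) `|w i z|%:E))%E.
Proof.
move=> iu iw [ig [u_ [su uu uwu gg]]].
have mu_ : measurable_fun (P : set (mpt R n)) u by apply/measurable_EFinP; exact: measurable_int iu.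
have mw i : measurable_fun (P : set (mpt R n)) (w i) by apply/measurable_EFinP; exact: measurable_int (iw i).
have mgs : measurable_fun E (g \o psi) by apply/measurable_EFinP; exact: measurable_int ig.
pose err k := (\int[nu]_(s in E) `|u_ k (psi s) - g (psi s)|%:E +
  c%:E * (alpha%:E * L1dist P (u_ k) u + \sum_i (B i)%:E * L1dist P ('D_(e i) (u_ k)) (w i)))%E.
have cerr : err k @[k --> \oo] --> 0%E.
  rewrite -[X in _ --> X]adde0; apply: cvgeD => //.
  exact: (cvg_weighted (fun k => L1dist_ge0 _ _ _) (fun i k => L1dist_ge0 _ _ _) uu uwu).
apply/lee_addgt0Pr => eps eps0.
have err0 k : (0 <= err k)%E.
  rewrite adde_ge0 ?integral_ge0// mule_ge0 ?lee_fin// adde_ge0 ?mule_ge0 ?lee_fin ?L1dist_ge0//.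
  by apply: sume_ge0 => i _; rewrite mule_ge0 ?lee_fin ?B_ge0 ?L1dist_ge0.
have /ecvg0P := cerr => /(_ err0 _ eps0)[N _ /(_ N (leqnn N)) h].
apply: le_trans (leeD2l _ h); rewrite /err in h *.
have mun : measurable_fun setT (u_ N : mpt R n -> R).
  by apply: continuous_measurable_pt; exact: smooth_continuous.
have mDn i : measurable_fun setT ('D_(e i) (u_ N) : mpt R n -> R).
  by apply: continuous_measurable_pt; apply: smooth_continuous; exact: smooth_derive.
have mfs : measurable_fun E (u_ N \o psi) by apply/measurable_EFinP; exact: measurable_int (ipsi (su N)).
apply: (@le_trans _ _ (\int[nu]_(s in E) `|u_ N (psi s) - g (psi s)|%:E +
   \int[nu]_(s in E) `|u_ N (psi s) - b|%:E)%E).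
  rewrite -ge0_integralD//; last 2 first.
  - by apply/measurable_EFinP; apply: measurableT_comp => //; exact: measurable_funB.
  - by apply/measurable_EFinP; apply: measurableT_comp => //; exact: measurable_funB.
  apply: ge0_le_integral => //.
  - by apply/measurable_EFinP; apply: measurableT_comp => //; exact: measurable_funB.
  - by apply: emeasurable_funD; apply/measurable_EFinP; apply: measurableT_comp => //; exact: measurable_funB.
  move=> s _; rewrite -EFinD lee_fin -(normrN (u_ N (psi s) - _)) opprB.
  by rewrite -(subrKA (u_ N (psi s))); exact: ler_normD.
rewrite [leRHS]addeCA; apply: leeD => //; apply: le_trans (trace_bound b (su N)) _.
have S0 (z : I -> V -> R) (z' : I -> V -> R) : (0 <= \sum_i (B i)%:E * L1dist P (z i) (z' i))%E.
  by apply: sume_ge0 => i _; rewrite mule_ge0 ?lee_fin ?B_ge0 ?L1dist_ge0.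
rewrite -ge0_muleDr; last 2 first.
- rewrite adde_ge0 ?mule_ge0 ?lee_fin ?integral_ge0//.
  by apply: sume_ge0 => i _; rewrite mule_ge0 ?lee_fin ?B_ge0 ?integral_ge0.
- by rewrite adde_ge0 ?mule_ge0 ?lee_fin ?L1dist_ge0.
apply: lee_wpmul2l; rewrite ?lee_fin//.
rewrite addeACA; apply: leeD.
  rewrite -ge0_muleDr ?integral_ge0 ?L1dist_ge0//; apply: lee_wpmul2l; rewrite ?lee_fin// addeC.
  by apply: L1dist_triangle => //; exact: measurable_funTS.
rewrite -big_split; apply: lee_sum => i _ /=.
rewrite -ge0_muleDr ?integral_ge0 ?L1dist_ge0//; apply: lee_wpmul2l; rewrite ?lee_fin ?B_ge0// addeC.
have := @L1dist_triangle _ _ P bP ('D_(e i) (u_ N)) (w i) (cst 0).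
have -> : (L1dist P (w i) (cst 0%R) = \int[vol]_(z in P) `|w i z|%:E)%E.
  by apply: eq_integral => z _; rewrite subr0.
by apply => //; exact: measurable_funTS.
Qed.

End abstract_trace.

(** * Size and shape of a simplex *)

Section euclidean_norm.
Context {R : realType} {n : nat}.
Implicit Types x z nu : 'rV[R]_n.

Lemma enorm_rV x : enorm x = Num.sqrt (\sum_i x ord0 i ^+ 2).
Proof. by rewrite /enorm big_ord1. Qed.

Lemma enorm_ge0 k l (M : 'M[R]_(k, l)) : 0 <= enorm M.
Proof. exact: sqrtr_ge0. Qed.

Lemma enorm_coord k l (M : 'M[R]_(k, l)) i j : `|M i j| <= enorm M.
Proof.
rewrite -sqrtr_sqr; apply: ler_wsqrtr.
rewrite (bigD1 i)//= (bigD1 j)//= -addrA lerDl addr_ge0// ?sumr_ge0// => *; rewrite ?sqr_ge0//.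
by apply: sumr_ge0 => *; rewrite sqr_ge0.
Qed.

Lemma enorm_le_sum k l (M : 'M[R]_(k, l)) : enorm M <= \sum_i \sum_j `|M i j|.
Proof.
have s0 : 0 <= \sum_i \sum_j `|M i j| by apply: sumr_ge0 => i _; apply: sumr_ge0.
rewrite -[leRHS]ger0_norm// -sqrtr_sqr; apply: ler_wsqrtr.
rewrite expr2 mulr_suml; apply: ler_sum => i _; rewrite mulr_suml; apply: ler_sum => j _.
rewrite -real_normK ?num_real// expr2 ler_wpM2l//.
rewrite (bigD1 i)//= (bigD1 j)//= -addrA lerDl addr_ge0// sumr_ge0// => *.
exact: sumr_ge0.
Qed.

Lemma enormZ a x : enorm (a *: x) = `|a| * enorm x.
Proof.
rewrite !enorm_rV; under eq_bigr do rewrite mxE exprMn.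
by rewrite -mulr_sumr sqrtrM ?sqr_ge0// sqrtr_sqr.
Qed.

Lemma dotDl x z nu : dot (x + z) nu = dot x nu + dot z nu.
Proof. by rewrite /dot -big_split; apply: eq_bigr => i _; rewrite mxE mulrDl. Qed.

Lemma dotZl a x nu : dot (a *: x) nu = a * dot x nu.
Proof. by rewrite /dot mulr_sumr; apply: eq_bigr => i _; rewrite mxE mulrA. Qed.

Lemma dotNl x nu : dot (- x) nu = - dot x nu.
Proof. by rewrite -scaleN1r dotZl mulN1r. Qed.

Lemma dotBl x z nu : dot (x - z) nu = dot x nu - dot z nu.
Proof. by rewrite dotDl dotNl. Qed.

Lemma dot_sumr (I : finType) (a : I -> R) (F : I -> 'rV[R]_n) nu :
  dot (\sum_i a i *: F i) nu = \sum_i a i * dot (F i) nu.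
Proof.
apply: (big_ind2 (fun x y => dot x nu = y)) => [|x y z w <- <-|i _].
- by rewrite /dot big1// => i _; rewrite mxE mul0r.
- exact: dotDl.
- exact: dotZl.
Qed.

Lemma dotC x z : dot x z = dot z x.
Proof. by rewrite /dot; apply: eq_bigr => i _; rewrite mulrC. Qed.

Lemma dot_unit nu : enorm nu = 1 -> dot nu nu = 1.
Proof.
rewrite enorm_rV => /(congr1 (fun y : R => y ^+ 2)); rewrite sqr_sqrtr ?expr1n.
  by move=> <-; rewrite /dot; apply: eq_bigr => i _; rewrite expr2.
by apply: sumr_ge0 => i _; rewrite sqr_ge0.
Qed.

Lemma dot_le_sum x nu : enorm nu = 1 -> `|dot x nu| <= \sum_i `|x ord0 i|.
Proof.
move=> nu1; apply: le_trans (ler_norm_sum _ _ _) _; apply: ler_sum => i _.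
by rewrite normrM ler_piMr// -nu1 enorm_coord.
Qed.

End euclidean_norm.

Section simplex_size.
Context {R : realType} {m : nat}.
Notation n := m.+1.
Variable v : 'I_n.+1 -> 'rV[R]_n.
Hypothesis av : affinely_independent v.
Let K := simplex v.

Lemma simplex_vertex i : K (v i).
Proof.
exists (fun k => (k == i)%:R); first split => [k|]; rewrite ?ler0n//.
  by rewrite (bigD1 i)//= eqxx big1 ?addr0// => k /negbTE ->.
by rewrite (bigD1 i)//= eqxx scale1r big1 ?addr0// => k /negbTE ->; rewrite scale0r.
Qed.

Lemma simplex_convex x z t : K x -> K z -> 0 <= t <= 1 -> K ((1 - t) *: x + t *: z).
Proof.
move=> [l [l0 l1] ->] [l' [l0' l1'] ->] /andP[t0 t1].
exists (fun k => (1 - t) * l k + t * l' k).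
  split; first by move=> k; rewrite addr_ge0// mulr_ge0// subr_ge0.
  by rewrite big_split /= -!mulr_sumr l1 l1' !mulr1 subrK.
rewrite !scaler_sumr -big_split /=; apply: eq_bigr => k _.
by rewrite [RHS]scalerDl !scalerA.
Qed.

Definition vertex_bound : R := \sum_k \sum_i `|v k ord0 i|.

Lemma simplex_bounded x : K x -> forall i, `|x ord0 i| <= vertex_bound.
Proof.
move=> [l [l0 l1] ->] i; rewrite summxE; apply: le_trans (ler_norm_sum _ _ _) _.
apply: ler_sum => k _; rewrite mxE normrM.
apply: (@le_trans _ _ `|v k ord0 i|).
  rewrite ler_piMl// ger0_norm// -l1 (bigD1 k)//= lerDl sumr_ge0// => *; exact: l0.
by rewrite (bigD1 i)//= lerDl sumr_ge0.
Qed.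

Lemma enorm_diff_bounded x z : K x -> K z -> enorm (x - z) <= n%:R * (2 * vertex_bound).
Proof.
move=> Kx Kz; apply: le_trans (enorm_le_sum _) _; rewrite big_ord1.
apply: (@le_trans _ _ (\sum_(j < n) (2 * vertex_bound))); last first.
  by rewrite sumr_const card_ord -[_ *+ n]mulr_natl.
apply: ler_sum => j _; rewrite !mxE; apply: le_trans (ler_normB _ _) _.
by rewrite mulr2n mulrDl mul1r lerD// simplex_bounded.
Qed.

Lemma diameter_ge x z : K x -> K z -> enorm (x - z) <= diameter K.
Proof.
move=> Kx Kz; apply: ub_le_sup.
  by exists (n%:R * (2 * vertex_bound)) => _ [x' Kx' [z' Kz' <-]]; exact: enorm_diff_bounded.
by exists x => //; exists z.
Qed.

(** Barycentric coordinates depend continuously on the point, so the point whose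
coordinates are all positive is interior. *)
Lemma simplex_cube : exists2 r : R, 0 < r & exists x0 : 'rV[R]_n,
  forall x : 'rV[R]_n, (forall i, `|x ord0 i - x0 ord0 i| <= r) -> K x.
Proof.
pose M := invmx (edges_at v ord0).
pose C := 1 + \sum_i \sum_j `|M i j|.
have S0 : 0 <= \sum_i \sum_j `|M i j| by apply: sumr_ge0 => i _; exact: sumr_ge0.
have C0 : 0 < C by rewrite ltr_wpDr.
pose dl : R := (2 * n%:R)^-1.
have dl0 : 0 < dl by rewrite invr_gt0 mulr_gt0// ltr0n.
pose x0 := v ord0 + const_mx dl *m edges_at v ord0.
exists (dl / C); first by rewrite divr_gt0.
exists x0 => x hx.
have [_] := simplexE ord0 x av; apply.
have -> : (x - v ord0) *m M = const_mx dl + (x - x0) *m M.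
  have -> : x - v ord0 = (x - x0) + const_mx dl *m edges_at v ord0.
    by rewrite /x0 opprD addrA subrK.
  by rewrite mulmxDl mulmxK ?edges_at_unit// addrC.
have hx' i : `|(x - x0) ord0 i| <= dl / C.
  by have := hx i; rewrite [(x - x0) _ _]mxE [(- x0) _ _]mxE.
have small j : `|((x - x0) *m M) ord0 j| <= dl.
  rewrite mxE; apply: le_trans (ler_norm_sum _ _ _) _.
  apply: (@le_trans _ _ (\sum_i dl / C * `|M i j|)).
    by apply: ler_sum => i _; rewrite normrM ler_wpM2r.
  rewrite -mulr_sumr mulrAC ler_pdivrMr// ler_wpM2l ?(ltW dl0)// /C.
  apply: (@le_trans _ _ (\sum_i \sum_j `|M i j|)); last by rewrite lerDr.
  by apply: ler_sum => i _; rewrite (bigD1 j)//= lerDl sumr_ge0.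
split=> [j|].
  by rewrite mxE [const_mx dl ord0 j]mxE; have := small j; rewrite ler_norml; lra.
apply: (@le_trans _ _ (\sum_(i < n) (2 * dl))).
  apply: ler_sum => j _; rewrite mxE [const_mx dl ord0 j]mxE.
  by have := small j; rewrite ler_norml; lra.
rewrite sumr_const card_ord -[_ *+ n]mulr_natl /dl.
have : (n%:R : R) != 0 by rewrite pnatr_eq0.
by move: (n%:R) => N N0; rewrite le_eqVlt; apply/orP; left; apply/eqP; field.
Qed.

Lemma simplex_ball : exists2 r : R, 0 < r & exists c : 'rV[R]_n, [set x | enorm (x - c) <= r] `<=` K.
Proof.
have [r r0 [c H]] := simplex_cube; exists r => //; exists c => x /= hx; apply: H => i.
by have := enorm_coord (x - c) ord0 i; rewrite !mxE => /le_trans; exact.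
Qed.

Lemma delta_enorm : enorm (delta_mx ord0 ord0 : 'rV[R]_n) = 1.
Proof.
rewrite enorm_rV (bigD1 ord0)//= big1 => [|j j0]; rewrite mxE ?eqxx /= ?expr1n ?addr0 ?sqrtr1//.
by rewrite (negbTE j0) expr0n.
Qed.

Lemma ball_le_diameter (r : R) c : 0 < r -> [set x | enorm (x - c) <= r] `<=` K -> 2 * r <= diameter K.
Proof.
move=> r0 H; pose nu : 'rV[R]_n := delta_mx ord0 ord0.
have Kp : K (c + r *: nu) by apply: H; rewrite /= addrC addKr enormZ delta_enorm mulr1 gtr0_norm.
have Km : K (c - r *: nu).
  by apply: H; rewrite /= addrC addKr -scaleNr enormZ delta_enorm mulr1 normrN gtr0_norm.
have := diameter_ge Kp Km.
have -> : c + r *: nu - (c - r *: nu) = (2 * r) *: nu by apply/rowP => j; rewrite !mxE; ring.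
by rewrite enormZ delta_enorm mulr1 gtr0_norm// mulr_gt0.
Qed.

Lemma diameter_gt0 : 0 < diameter K.
Proof.
by have [r r0 [c H]] := simplex_ball; rewrite (lt_le_trans _ (ball_le_diameter r0 H))// mulr_gt0.
Qed.

(** The supremum in [inner_diameter] need not be attained; a ball of more than half
the optimal diameter gives the factor 4. *)
Lemma inscribed_ball (eta : R) : diameter K / inner_diameter K <= eta ->
  exists2 r : R, 0 < r /\ diameter K <= 4 * eta * r &
    exists c : 'rV[R]_n, [set x | enorm (x - c) <= r] `<=` K.
Proof.
move=> he; set rho := inner_diameter K in he.
have [r0 r00 [c0 H0]] := simplex_ball.
set S := [set 2 * r | r in [set r | 0 < r /\
    exists c : 'rV[R]_n, [set x | enorm (x - c) <= r] `<=` K]].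
have S0 : S (2 * r0) by exists r0 => //; split => //; exists c0.
have hasS : has_sup S.
  split; first by exists (2 * r0).
  by exists (diameter K) => _ [r [r0' [c Hc]] <-]; exact: (ball_le_diameter r0' Hc).
have rho0 : 0 < rho.
  rewrite (lt_le_trans _ (ub_le_sup hasS.2 S0))// mulr_gt0//.
have [_ [r [rp [c Hc]] <-] hr] := sup_adherent (divr_gt0 rho0 (ltr0n _ 2)) hasS.
exists r; last by exists c.
split => //; move: (he); rewrite ler_pdivrMr// => /le_trans; apply.
have eta0 : 0 <= eta.
  by apply: le_trans he; rewrite divr_ge0 ?ltW// diameter_gt0.
rewrite -mulrA mulrCA ler_wpM2l//.
move: hr; rewrite -/(inner_diameter K) -/rho; lra.
Qed.

Definition shape_const (eta : R) : R := (2 * eta * n%:R) ^+ n.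

(** The inscribed ball contains a cube of comparable size. *)
Lemma simplex_volume (eta : R) : 0 < eta -> diameter K / inner_diameter K <= eta ->
  diameter K ^+ n <= shape_const eta * fine (lebesgue_rV n K).
Proof.
move=> e0 he; have [r [r0 hr] [c Hc]] := inscribed_ball he.
have mK : measurable K by exact: measurable_simplex.
have n0 : 0 < n%:R :> R by rewrite ltr0n.
pose s := r / n%:R; have s0 : 0 < s by rewrite divr_gt0.
have cube_K : rbox (c - const_mx s) (c + const_mx s) `<=` K.
  move=> x hx; apply: Hc => /=; apply: le_trans (enorm_le_sum _) _; rewrite big_ord1.
  apply: (@le_trans _ _ (\sum_(j < n) s)).
    by apply: ler_sum => j _; have := hx j; rewrite !mxE ler_norml; lra.
  by rewrite sumr_const card_ord -mulr_natl /s mulrC divfK// gt_eqF.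
have : (((2 * s) ^+ n)%:E <= lebesgue_rV n K)%E.
  have -> : ((2 * s) ^+ n)%:E = lebesgue_rV n (rbox (c - const_mx s) (c + const_mx s)).
    rewrite lebesgue_rbox; last by move=> i; rewrite !mxE; lra.
    congr EFin; transitivity (\prod_(i < n) (2 * s)); first by rewrite prodr_const card_ord.
    by apply: eq_bigr => i _; rewrite !mxE; ring.
  apply: le_measure; rewrite ?inE//; exact: measurable_rbox.
have [q q0 [x0 H]] := simplex_cube.
have bK : convex_base K vertex_bound q.
  by split => //; [exact: simplex_bounded|exact: simplex_convex|exists x0].
rewrite -[X in (_ <= X)%E]fineK; last by rewrite ge0_fin_numE// (base_fin bK).
rewrite lee_fin => le1.
apply: (@le_trans _ _ ((4 * eta * r) ^+ n)).
  by rewrite lerXn2r// nnegrE ?ltW ?diameter_gt0// !mulr_gt0.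
apply: (@le_trans _ _ (shape_const eta * (2 * s) ^+ n)).
  rewrite /shape_const -exprMn le_eqVlt; apply/orP; left; apply/eqP; congr (_ ^+ _).
  by rewrite /s; move: n0; move: (n%:R : R) => N N0; field; rewrite gt_eqF.
by rewrite ler_wpM2l// exprn_ge0// !mulr_ge0// ltW.
Qed.

End simplex_size.

(** * Faces of a simplex and Raviart-Thomas fields *)

Section faces.
Context {R : realType} {m : nat}.
Notation n := m.+1.
Variable v : 'I_n.+1 -> 'rV[R]_n.
Hypothesis av : affinely_independent v.

Lemma face_row_free i : row_free (edges (face v i)).
Proof.
pose D : 'M[R]_(m, n) := \matrix_(k, j) ((j == lift ord0 k)%:R - (j == ord0)%:R).
have -> : edges (face v i) = D *m edges_at v i.
  apply/row_matrixP => k; rewrite row_mul rowK mulmx_sum_row.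
  under eq_bigr => j _ do rewrite mxE mxE rowK scalerBl.
  rewrite big_split /= sumrN (bigD1 (lift ord0 k))//= eqxx scale1r big1 ?addr0; last first.
    by move=> j /negbTE ->; rewrite scale0r.
  rewrite (bigD1 ord0)//= ?eqxx scale1r big1 ?addr0; last by move=> j /negbTE ->; rewrite scale0r.
  by rewrite /face /= opprB addrA subrK.
apply/row_freeP; exists (invmx (edges_at v i) *m \matrix_(j, k) (j == lift ord0 k)%:R).
rewrite mulmxA mulmxK ?edges_at_unit//; apply/matrixP => k k'; rewrite !mxE.
under eq_bigr => j _ do rewrite !mxE.
rewrite (bigD1 (lift ord0 k'))//= eqxx mulr1 big1 ?addr0; last first.
  by move=> j /negbTE ->; rewrite mulr0.
by rewrite (inj_eq lift_inj) eq_sym subr0.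
Qed.

Section normal.
Variables (i : 'I_n.+1) (nu : 'rV[R]_n).
Hypothesis nuP : unit_normal (face v i) nu.

(** The signed distance from the vertex [v i] to the opposite face. *)
Definition face_height : R := dot (face v i ord0 - v i) nu.

Lemma dot_face j : dot (face v i j - face v i ord0) nu = 0.
Proof.
case: (unliftP ord0 j) => [k ->|->]; last by rewrite subrr /dot big1// => k _; rewrite mxE mul0r.
by have [_ /(_ k)] := nuP; rewrite rowK.
Qed.

Lemma dot_vertex k : k != i -> dot (v k - v i) nu = face_height.
Proof.
case: (unliftP i k) => [j -> _|->]; last by rewrite eqxx.
by rewrite -[v (lift i j)](subrK (face v i ord0)) -addrA dotDl dot_face add0r.
Qed.

Lemma dot_face_param (s : pt R m) : dot ((face_param (face v i) s).1 - face v i ord0) nu = 0.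
Proof.
rewrite /face_param /= addrC addKr mulmx_sum_row dot_sumr big1// => k _.
by have [_ ->] := nuP; rewrite mulr0.
Qed.

Lemma dot_face_vertex (s : pt R m) k :
  dot ((face_param (face v i) s).1 - v k) nu = if k == i then face_height else 0.
Proof.
rewrite -(subrKA (face v i ord0)) dotDl dot_face_param add0r.
case: eqVneq => [->//|/dot_vertex H].
by rewrite -(subrKA (v i)) dotDl -/face_height -opprB dotNl H subrr.
Qed.

(** The ball has a diameter in the direction of the normal, and the simplex lies
between two hyperplanes orthogonal to it at the distance of the height. *)
Lemma face_height_ge (r : R) (c : 'rV[R]_n) : 0 < r ->
  [set x | enorm (x - c) <= r] `<=` simplex v -> 2 * r <= `|face_height|.
Proof.
move=> r0 H; have [nu1 _] := nuP.
have Kp : simplex v (c + r *: nu) by apply: H; rewrite /= addrC addKr enormZ nu1 mulr1 gtr0_norm.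
have Km : simplex v (c - r *: nu).
  by apply: H; rewrite /= addrC addKr -scaleNr enormZ nu1 mulr1 normrN gtr0_norm.
have bary x : simplex v x -> exists2 l : R, 0 <= l <= 1 & dot (x - v i) nu = (1 - l) * face_height.
  move=> [l [l0 l1] ->]; exists (l i).
    by rewrite l0 -l1 (bigD1 i)//= lerDl sumr_ge0.
  have -> : \sum_k l k *: v k - v i = \sum_k l k *: (v k - v i).
    under [RHS]eq_bigr do rewrite scalerBr.
    by rewrite sumrB -scaler_suml l1 scale1r.
  rewrite dot_sumr (bigD1 i)//= subrr {1}/dot big1 ?mulr0 ?add0r; last by move=> k _; rewrite mxE mul0r.
  under eq_bigr => k ki do rewrite dot_vertex//.
  rewrite -mulr_suml; congr (_ * _).
  by apply/esym/eqP; rewrite subr_eq -l1 (bigD1 i)//= addrC.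
have [lp lp1 Ep] := bary _ Kp; have [lm lm1 Em] := bary _ Km.
have : dot ((c + r *: nu - v i) - (c - r *: nu - v i)) nu = 2 * r.
  have -> : c + r *: nu - v i - (c - r *: nu - v i) = (2 * r) *: nu by apply/rowP => j; rewrite !mxE; ring.
  by rewrite dotZl dot_unit// mulr1.
rewrite dotBl Ep Em -mulrBl => <-.
apply: le_trans (ler_norm _) _; rewrite normrM ler_piMl// ler_norml.
by move: lp1 lm1 => /andP[? ?] /andP[? ?]; lra.
Qed.

End normal.

Lemma unit_normal_exists i : exists nu, unit_normal (face v i) nu.
Proof.
set E := edges (face v i).
have rk : \rank (kermx E^T) = 1%N.
  by rewrite mxrank_ker mxrank_tr; move: (face_row_free i); rewrite /row_free -/E => /eqP ->; rewrite subSnn.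
have : kermx E^T != 0 by rewrite -mxrank_eq0 rk.
move=> /rowV0Pn[nu /sub_kermxP nuE nu0].
have e0 : 0 < enorm nu.
  rewrite lt_neqAle enorm_ge0 andbT eq_sym; apply: contra_neq nu0 => e0.
  by apply/rowP => j; have := enorm_coord nu ord0 j; rewrite e0 normr_le0 mxE => /eqP.
exists ((enorm nu)^-1 *: nu); split.
  by rewrite enormZ ger0_norm ?invr_ge0 ?enorm_ge0// mulVf// gt_eqF.
move=> k; rewrite dotC dotZl.
have := congr1 (fun M : 'rV[R]_m => M ord0 k) nuE; rewrite !mxE => nuk.
rewrite [dot _ _](_ : _ = 0) ?mulr0// -[RHS]nuk; apply: eq_bigr => j _.
by rewrite !mxE.
Qed.

(** Together with the normal, the edges of the face form an invertible square
matrix, whose Gram matrix is block diagonal. *)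
Lemma gram_det i nu : unit_normal (face v i) nu -> 0 < \det (edges (face v i) *m (edges (face v i))^T).
Proof.
move=> [nu1 nuE]; set E := edges (face v i).
have Enu : E *m nu^T = 0.
  apply/colP => k; rewrite mxE [RHS]mxE; transitivity (dot (row k E) nu); last exact: nuE.
  by apply: eq_bigr => j _; rewrite !mxE.
pose N : 'M[R]_(1 + m) := col_mx nu E.
have NN : N *m N^T = block_mx 1%:M 0 0 (E *m E^T).
  rewrite /N tr_col_mx mul_col_row Enu; congr block_mx.
    apply/matrixP => a b; rewrite !ord1 !mxE eqxx mulr1n -(dot_unit nu1).
    by apply: eq_bigr => j _; rewrite !mxE.
  by apply: trmx_inj; rewrite trmx_mul trmxK Enu trmx0.
have dE : \det (E *m E^T) = \det N ^+ 2.
  by rewrite expr2 -{2}(det_tr N) -det_mulmx NN det_ublock det1 mul1r.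
rewrite dE lt_neqAle sqr_ge0 andbT eq_sym -dE.
have uE : E *m E^T \in unitmx.
  rewrite -row_free_unit -kermx_eq0; apply/eqP/row_matrixP => k; rewrite row0.
  set x := row k _; have xE : x *m (E *m E^T) = 0 by apply/eqP; rewrite -sub_kermx row_sub.
  have xE0 : x *m E = 0.
    have : (x *m E) *m (x *m E)^T = 0 by rewrite trmx_mul mulmxA -(mulmxA x E) xE mul0mx.
    move=> /(congr1 (fun M : 'M[R]_1 => M ord0 ord0)); rewrite mxE [RHS]mxE => S.
    have F0 j : 0 <= (x *m E) ord0 j * (x *m E)^T j ord0 by rewrite [_^T _ _]mxE -expr2 sqr_ge0.
    apply/rowP => j; rewrite [RHS]mxE.
    have /(_ j isT) := psumr_eq0P (fun j _ => F0 j) S; rewrite [_^T _ _]mxE -expr2 => /eqP.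
    by rewrite sqrf_eq0 => /eqP.
  have := congr1 (mulmx^~ (pinvmx E)) xE0; rewrite mul0mx mulmxKp//; exact: face_row_free.
by rewrite -unitfE -unitmxE.
Qed.

Lemma face_jacobian_gt0 i nu : unit_normal (face v i) nu -> 0 < face_jacobian (face v i).
Proof. by move=> nuP; rewrite sqrtr_gt0; exact: (gram_det nuP). Qed.

Lemma barycentric_solve (b : R) (w : 'rV[R]_n) : exists c : 'I_n.+1 -> R,
  \sum_k c k = b /\ \sum_k c k *: v k = w.
Proof.
pose t := (w - b *: v ord0) *m invmx (edges_at v ord0).
pose c k := if unlift ord0 k is Some j then t ord0 j else b - \sum_j t ord0 j.
have cb : \sum_k c k = b.
  rewrite (bigD1_ord ord0)//= /c unlift_none.
  by under [X in _ + X]eq_bigr do rewrite liftK; rewrite subrK.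
exists c; split => //.
rewrite (bigD1_ord ord0)//= /c unlift_none.
under eq_bigr => j _ do rewrite liftK.
have tE : t *m edges_at v ord0 = w - b *: v ord0 by rewrite /t mulmxKV// edges_at_unit.
have : \sum_j t ord0 j *: (v (lift ord0 j) - v ord0) = w - b *: v ord0.
  by rewrite -tE mulmx_sum_row; apply: eq_bigr => j _; rewrite rowK.
have -> : \sum_j t ord0 j *: (v (lift ord0 j) - v ord0) =
    \sum_j t ord0 j *: v (lift ord0 j) - (\sum_j t ord0 j) *: v ord0.
  by rewrite scaler_suml -sumrB; apply: eq_bigr => j _; rewrite scalerBr.
move=> /(canRL (subrK _)) ->; rewrite scalerBl addrC.
by rewrite addrA (addrAC _ ((\sum_j t ord0 j) *: v ord0)) subrK addrK.
Qed.

(** A Raviart-Thomas field is a combination of the fields [x - v k], each of which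
has a flux through one face only. *)
Lemma rt_basis (A w : 'rV[R]_n) (b : R) : exists c : 'I_n.+1 -> R,
  forall x, A + b *: x - w = \sum_k c k *: (x - v k).
Proof.
have [c [cb cw]] := barycentric_solve b (w - A); exists c => x.
under [RHS]eq_bigr do rewrite scalerBr.
by rewrite sumrB -scaler_suml cb cw opprB addrA (addrC A).
Qed.

Lemma rt_flux i nu (c : 'I_n.+1 -> R) (s : pt R m) : unit_normal (face v i) nu ->
  dot (\sum_k c k *: ((face_param (face v i) s).1 - v k)) nu = c i * face_height i nu.
Proof.
move=> nuP; rewrite dot_sumr (bigD1 i)//= dot_face_vertex// eqxx big1 ?addr0// => k ki.
by rewrite dot_face_vertex// (negbTE ki) mulr0.
Qed.

(** All edges from the vertex [v i] have the same component along the normal of the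
opposite face. *)
Lemma normal_combination i nu (w : 'rV[R]_n) : unit_normal (face v i) nu ->
  dot w nu = (\sum_j (w *m invmx (edges_at v i)) ord0 j) * face_height i nu.
Proof.
move=> nuP; rewrite -{1}(mulmxKV (edges_at_unit i av) w).
rewrite mulmx_sum_row dot_sumr mulr_suml; apply: eq_bigr => j _.
by rewrite rowK dot_vertex// eq_sym neq_lift.
Qed.

End faces.

Section unit_simplex_base.
Context {R : realType} {m : nat}.

Lemma unit_simplex_base : exists r : R, convex_base (@unit_simplex R m) 1 r.
Proof.
pose dl : R := (2 * m.+1%:R)^-1.
have dl0 : 0 < dl by rewrite invr_gt0 mulr_gt0// ltr0n.
exists dl; split => //.
- exact: measurable_unit_simplex.
- move=> x [x0 x1] i; rewrite ger0_norm//; apply: le_trans x1.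
  by rewrite (bigD1 i)//= lerDl sumr_ge0.
- move=> x w t [x0 x1] [w0 w1] /andP[t0 t1]; split.
    by move=> i; rewrite !mxE addr_ge0// mulr_ge0// subr_ge0.
  under eq_bigr do rewrite !mxE.
  rewrite big_split /= -!mulr_sumr.
  apply: (@le_trans _ _ ((1 - t) * 1 + t * 1)); last by lra.
  by rewrite lerD// ler_wpM2l// subr_ge0.
- exists (const_mx dl) => x hx; split=> [j|].
    by have := hx j; rewrite mxE ler_norml; lra.
  apply: (@le_trans _ _ (\sum_(i < m) (2 * dl))).
    by apply: ler_sum => j _; have := hx j; rewrite mxE ler_norml; lra.
  have -> : 2 * dl = m.+1%:R^-1 by rewrite /dl invfM mulrA mulfV ?mul1r// pnatr_eq0.
  rewrite sumr_const card_ord -[_ *+ m]mulr_natl.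
  by rewrite ler_pdivrMr ?ltr0n// mul1r ler_nat.
Qed.

End unit_simplex_base.

(** * Traces on the faces of a prism *)

Lemma is_derive_pow {R : realType} (t : R) k :
  is_derive t (1 : R) (fun t : R => t ^+ k.+1) (k.+1%:R * t ^+ k).
Proof.
have := is_deriveX k.+1 (is_derive_id t (1 : R)).
rewrite /GRing.scale /= mulr1 (_ : id ^+ k.+1 = fun t : R => t ^+ k.+1)//.
by apply/funext => x; elim: (k.+1) => [|j IH]; rewrite ?expr0// [in RHS]exprS -IH exprS.
Qed.

Section prism_traces.
Context {R : realType} {m : nat}.
Notation n := m.+1.
Notation V := (pt R n).
Notation vol := (@vol R n).
Notation mu := (@lebesgue_measure R).
Notation mR := (measurableTypeR R).
Variables (v : 'I_n.+1 -> 'rV[R]_n) (y0 y1 : R).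
Hypothesis av : affinely_independent v.
Hypothesis y01 : y0 < y1.
Let K := simplex v.
Let P := prism v y0 y1.
Let h := diameter K.
Let E : set (mpt R m) := @unit_simplex R m `*` `[y0, y1].

Lemma simplex_base : exists r, convex_base (simplex v) (vertex_bound v) r.
Proof.
have [r r0 [x0 H]] := simplex_cube av; exists r; split => //.
- exact: measurable_simplex.
- exact: simplex_bounded.
- exact: simplex_convex.
- by exists x0.
Qed.

Lemma prism_body : convex_body P.
Proof. by have [r bK] := simplex_base; exact: (slab_cc_body bK y01). Qed.

Lemma simplex_width x w i : K x -> K w -> `|w ord0 i - x ord0 i| <= h.
Proof.
move=> Kx Kw; apply: le_trans (diameter_ge Kw Kx).
by have := enorm_coord (w - x) ord0 i; rewrite !mxE.
Qed.

Lemma vol_prism : vol P = (fine (lebesgue_rV n K) * (y1 - y0))%:E.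
Proof. by have [r bK] := simplex_base; exact: (vol_slab_cc bK (ltW y01)). Qed.

Lemma face_simplex_gt0 : 0 < fine (@Defs.vol R m E).
Proof. by have [r bS] := @unit_simplex_base R m; apply: body_fine_gt0 (slab_cc_body bS y01). Qed.

Lemma face_simplex_body : convex_body E.
Proof. by have [r bS] := @unit_simplex_base R m; exact: (slab_cc_body bS y01). Qed.

Section lateral.
Variable i : 'I_n.+1.

Definition ray_path (s : pt R m) (t : R) : V := (ray v i s.1 t, s.2).
Let psi : pt R m -> V := face_param (face v i).
Let psi' (z : V) : pt R m := ((z.1 - face v i ord0) *m pinvmx (edges (face v i)), z.2).
Let e (s : pt R m) : V := ((face_param (face v i) (s.1, 0)).1 - v i, 0).

Lemma ray_pathE s t : ray_path s t = (v i, s.2) + t *: e s.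
Proof. by rewrite /ray_path /ray /e; congr pair; rewrite /= [_ *: 0]mulr0 addr0. Qed.

Lemma ray_path1 s : ray_path s 1 = psi s.
Proof. by rewrite /ray_path /ray /psi /face_param /= scale1r addrC subrK. Qed.

Lemma face_in_prism s : E s -> P (psi s).
Proof.
move=> [[s0 s1] sy]; rewrite -ray_path1; split => //=.
apply/(simplex_from_vertex _ i); exists (rV_cons (1 * (1 - rsum s.1), 1 *: s.1)); last by rewrite ray_cons.
rewrite mul1r scale1r; split => [j|].
  by rewrite mxE; case: unliftP => [k _|_] //=; rewrite subr_ge0.
rewrite big_ord_recl mxE unlift_none /=.
under eq_bigr => j _ do rewrite mxE liftK /=.
by rewrite subrK.
Qed.

Lemma measurable_ray_path :
  measurable_fun setT (fun x : mpt R m * mR => ray_path x.1 x.2 : mpt R n).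
Proof.
apply: measurable_fun_pair => /=; last by apply: measurableT_comp; [exact: measurable_snd|exact: measurable_fst].
have ms : measurable_fun setT (fun x : mpt R m * mR => (x.1.1, x.2) : 'rV[R]_m * mR).
  apply: measurable_fun_pair; last exact: measurable_snd.
  by apply: measurableT_comp; [exact: measurable_fst|exact: measurable_fst].
exact: (measurableT_comp (measurable_ray v i) ms).
Qed.

Lemma ray_derive f s t : smooth f ->
  'D_(e s) f (ray_path s t) * t =
  \sum_j ((ray_path s t).1 ord0 j - v i ord0 j) * 'D_(e_x j) f (ray_path s t).
Proof.
move=> sf; rewrite (derive_basis sf) /e /= mul0r addr0 mulr_suml; apply: eq_bigr => j _.
rewrite [in RHS]/ray_path /ray /= !mxE; ring.
Qed.

(** Integrate the derivative of [t ^ (m + 1) f] along the segment from the vertex. *)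
Lemma ray_trace_formula f s : smooth f ->
  (\int[mu]_(t in `[0%R, 1%R])
     (t ^+ m * (m.+1%:R * f (ray_path s t) +
      \sum_j ((ray_path s t).1 ord0 j - v i ord0 j) * 'D_(e_x j) f (ray_path s t)))%:E =
   (f (psi s))%:E)%E.
Proof.
move=> sf.
pose G t := t ^+ m.+1 * f ((v i, s.2) + t *: e s).
pose g t := m.+1%:R * t ^+ m * f ((v i, s.2) + t *: e s) + t ^+ m.+1 * 'D_(e s) f ((v i, s.2) + t *: e s).
have dG t : is_derive t (1 : R) G (g t).
  have := is_deriveM (is_derive_pow t m) (smooth_line sf (v i, s.2) (e s) t).
  by rewrite /GRing.scale /= addrC [f _ * (_ * _)]mulrC.
have cg : continuous g.
  have ce k : continuous (fun t : R => t ^+ k) by exact: exprn_continuous.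
  move=> t; apply: cvgD; apply: cvgM.
  - by apply: cvgM; [exact: cvg_cst|exact: ce].
  - exact: smooth_line_continuous.
  - exact: ce.
  - exact: (@smooth_line_continuous _ _ _ (smooth_derive (e s) sf)).
have := FTC_is_derive ltr01 dG cg.
rewrite {1 2}/G expr1n mul1r expr0n /= mul0r subr0 -ray_pathE ray_path1 => <-.
apply: eq_integral => t _; congr EFin; rewrite /g -ray_pathE -ray_derive// exprS; ring.
Qed.

(** The constant of [integral_prism_cone] is determined by the function 1. *)
Lemma ray_const : exists2 c : R, c = fine (@Defs.vol R m E) / (m.+1%:R * fine (vol P)) &
  forall H : mpt R n -> \bar R, measurable_fun setT H -> (forall z, 0 <= H z)%E ->
  (\int[@Defs.vol R m]_(s in E) \int[mu]_(t in `[0%R, 1%R]) ((t ^+ m)%:E * H (ray_path s t)) =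
   c%:E * \int[vol]_(z in P) H z)%E.
Proof.
have [c c0 cE] := integral_prism_cone y0 y1 av i; exists c => //.
have := cE (cst 1%E) (measurable_cst _) (fun _ => lee01).
have -> : (\int[@Defs.vol R m]_(s in unit_simplex (k:=m) `*` `[y0, y1]) \int[mu]_(t in `[0%R, 1%R]) ((t ^+ m)%:E * cst 1 (ray v i s.1 t, s.2)) =
    (m.+1%:R^-1)%:E * @Defs.vol R m E)%E.
  have I t : is_derive t (1 : R) (fun t : R => m.+1%:R^-1 * t ^+ m.+1) (t ^+ m).
    have := is_deriveZ m.+1%:R^-1 (is_derive_pow t m).
    by rewrite /GRing.scale /= mulrA mulVf ?pnatr_eq0// mul1r.
  have := FTC_is_derive ltr01 I (@exprn_continuous R m).
  rewrite expr1n expr0n mulr1 mulr0 subr0 => IE.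
  rewrite -integral_cst; last by apply: body_measurable; exact: face_simplex_body.
  apply: eq_integral => s _; rewrite -IE; apply: eq_integral => t _.
  by rewrite mule1.
rewrite integral_cst; last exact: body_measurable prism_body.
rewrite mul1e => Hv.
have {Hv} [H] : ((m.+1%:R^-1 * fine (@Defs.vol R m E))%:E = (c * fine (vol P))%:E)%E.
  by rewrite !EFinM !body_fineK//; [exact: prism_body|exact: face_simplex_body].
have V0 := body_fine_gt0 prism_body.
by rewrite invfM mulrA [X in X / _]mulrC H mulfK// gt_eqF.
Qed.

Lemma smooth_integrable_face f : smooth f -> (@Defs.vol R m).-integrable E (EFin \o f \o psi).
Proof.
move=> sf; have mE := body_measurable face_simplex_body.
have cf := smooth_continuous sf.
have [M HM] := continuous_bounded_body prism_body cf.
apply: (@le_integrable _ _ R _ _ mE _ (EFin \o cst M)).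
- apply/measurable_EFinP; apply: measurable_funTS.
  apply: (measurableT_comp (continuous_measurable_pt cf)).
  rewrite (_ : psi = (fun s => ray_path s 1)); last by apply/funext => s; rewrite ray_path1.
  exact: (measurableT_comp measurable_ray_path (measurable_pair2 (1 : mR))).
- move=> s Es /=; rewrite lee_fin; apply: le_trans (ler_norm M).
  by apply: HM; exact: face_in_prism.
- exact: integrable_cst_body face_simplex_body.
Qed.

Let alpha0 : 0 <= (m.+1%:R : R). Proof. exact: ler0n. Qed.
Let q0 (t : R) : 0 <= t <= 1 -> 0 <= t ^+ m. Proof. by case/andP => t0 _; rewrite exprn_ge0. Qed.
Let beta (j : 'I_n) (z : V) : R := z.1 ord0 j - v i ord0 j.

Let cbeta j : continuous (beta j).
Proof. by move=> z; apply: cvgB; [exact: continuous_coord1|exact: cvg_cst]. Qed.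

Let betaB j z : P z -> `|beta j z| <= h.
Proof. by move=> [Kz _]; apply: simplex_width => //; exact: simplex_vertex. Qed.

Let psiK s : psi' (psi s) = s.
Proof.
by case: s => x y; rewrite /psi' /psi /face_param /= addrC addKr mulmxKp// face_row_free.
Qed.

Let cpath s : continuous (ray_path s).
Proof.
rewrite (_ : ray_path s = fun t => (v i, s.2) + t *: e s); last by apply/funext => t; exact: ray_pathE.
exact: line_continuous.
Qed.

Let c0 : 0 <= fine (@Defs.vol R m E) / (m.+1%:R * fine (vol P)).
Proof.
by rewrite divr_ge0 ?(ltW face_simplex_gt0)// mulr_ge0// ltW// body_fine_gt0//; exact: prism_body.
Qed.

Theorem lateral_trace_exists (u : V -> R) (w : 'I_n -> V -> R) : vol.-integrable P (EFin \o u) ->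
  (forall j, has_weak_derivative P u (e_x j) (w j)) ->
  exists g, has_trace P u (@e_x R n) w (@Defs.vol R m) E psi g.
Proof.
have [c cE cH] := ray_const; have c0' := c0; rewrite -cE in c0'.
exact: (@trace_exists _ _ _ _ P _ _ (@Defs.vol R m) E psi psi' ray_path (fun t => t ^+ m) 0 1 c m.+1%:R
  beta (fun=> h) prism_body (body_measurable face_simplex_body) q0 c0' alpha0 (@exprn_continuous R m) cbeta
  betaB measurable_ray_path cpath psiK smooth_integrable_face cH ray_trace_formula).
Qed.

Theorem lateral_trace_inequality (u : V -> R) (w : 'I_n -> V -> R) g (b : R) :
  vol.-integrable P (EFin \o u) -> (forall j, vol.-integrable P (EFin \o w j)) ->
  has_trace P u (@e_x R n) w (@Defs.vol R m) E psi g ->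
  (\int[@Defs.vol R m]_(s in E) `|g (psi s) - b|%:E <=
   (fine (@Defs.vol R m E) / (m.+1%:R * fine (vol P)))%:E *
   (m.+1%:R%:E * \int[vol]_(z in P) `|u z - b|%:E +
     \sum_j h%:E * \int[vol]_(z in P) `|w j z|%:E))%E.
Proof.
have [c cE cH] := ray_const; have c0' := c0; rewrite -cE in c0' *.
exact: (@trace_inequality _ _ _ _ P _ _ (@Defs.vol R m) E psi ray_path (fun t => t ^+ m) 0 1 c m.+1%:R
  beta (fun=> h) prism_body (body_measurable face_simplex_body) q0 c0' alpha0 (@exprn_continuous R m) cbeta
  betaB measurable_ray_path cpath smooth_integrable_face cH ray_trace_formula).
Qed.

End lateral.

Section horizontal.
Variables (y yo : R).
Hypothesis yE : (y = y1 /\ yo = y0) \/ (y = y0 /\ yo = y1).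
Let len := y1 - y0.
Let path (x : 'rV[R]_n) (t : R) : V := (x, t).

Let len0 : 0 < len. Proof. by rewrite subr_gt0. Qed.
Let mK : measurable K. Proof. exact: measurable_simplex. Qed.

Lemma horizontal_path_integral (H : mpt R n -> \bar R) : measurable_fun setT H -> (forall z, 0 <= H z)%E ->
  (\int[lebesgue_rV n]_(x in K) \int[mu]_(t in `[y0, y1]) ((len^-1)%:E * H (path x t)) =
   (len^-1)%:E * \int[vol]_(z in P) H z)%E.
Proof.
move=> mH H0; have l0 : 0 <= len^-1 by rewrite invr_ge0 ltW.
have mf : measurable_fun (P : set (mpt R n)) (fun z : mpt R n => (len^-1)%:E * H z)%E.
  by apply: measurable_funTS; exact: measurable_funeM.
transitivity (\int[vol]_(z in P) ((len^-1)%:E * H z))%E.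
  rewrite [RHS]integral_prod_in//.
  by move=> z _; rewrite mule_ge0// lee_fin.
rewrite ge0_integralZl//.
- exact: body_measurable prism_body.
- exact: measurable_funTS.
Qed.

(** Integrate the derivative of [(t - yo) f] along the vertical segment. *)
Lemma horizontal_formula f x : smooth f ->
  (\int[mu]_(t in `[y0, y1])
     (len^-1 * (1 * f (path x t) + \sum_(i : unit) ((path x t).2 - yo) * 'D_(e_y n) f (path x t)))%:E =
   (f (x, y))%:E)%E.
Proof.
move=> sf.
have pE t : path x t = (x, 0) + t *: e_y n.
  by congr pair; rewrite /= ?scaler0 ?addr0// add0r /GRing.scale /= mulr1.
pose G t := len^-1 * ((t - yo) * f ((x, 0) + t *: e_y n)).
pose g t := len^-1 * (f ((x, 0) + t *: e_y n) + (t - yo) * 'D_(e_y n) f ((x, 0) + t *: e_y n)).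
have dG t : is_derive t (1 : R) G (g t).
  have d1 : is_derive t (1 : R) (fun t : R => t - yo) 1.
    by have := is_deriveB (is_derive_id t (1 : R)) (is_derive_cst yo t (1 : R)); rewrite subr0.
  have := is_deriveZ len^-1 (is_deriveM d1 (smooth_line sf (x, 0) (e_y n) t)).
  by rewrite /GRing.scale /= mulr1 addrC.
have cg : continuous g.
  move=> t; apply: cvgM; first exact: cvg_cst.
  apply: cvgD; first exact: smooth_line_continuous.
  apply: cvgM; last exact: (@smooth_line_continuous _ _ _ (smooth_derive (e_y n) sf)).
  by apply: cvgB; [exact: cvg_id|exact: cvg_cst].
have := FTC_is_derive y01 dG cg.
have -> : G y1 - G y0 = f (x, y).
  rewrite /G -!pE /path; have l0 := lt0r_neq0 len0.
  case: yE => -[-> ->]; rewrite subrr mul0r mulr0 ?subr0 ?sub0r.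
    by rewrite mulrA mulVf// mul1r.
  by rewrite -(opprB y1 y0) mulNr mulrN opprK mulrA mulVf// mul1r.
move=> <-; apply: eq_integral => t _; congr EFin; rewrite /g -pE.
by rewrite (bigD1 tt)//= big1 ?addr0 ?mul1r// => -[].
Qed.

Lemma smooth_integrable_horizontal f : smooth f ->
  (lebesgue_rV n).-integrable K (EFin \o f \o (fun x => (x, y))).
Proof.
move=> sf; have cf := smooth_continuous sf.
have [M HM] := continuous_bounded_body prism_body cf.
have Ky x : K x -> P (x, y).
  by move=> Kx; split => //=; rewrite in_itv/=; case: yE => -[-> _]; rewrite lexx ltW.
apply: (@le_integrable _ _ R _ _ mK _ (EFin \o cst M)).
- apply/measurable_EFinP; apply: measurable_funTS.
  exact: (measurableT_comp (continuous_measurable_pt cf) (measurable_pair2 (y : mR))).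
- by move=> x Kx /=; rewrite lee_fin; apply: le_trans (ler_norm M); apply: HM; exact: Ky.
- have [r bK] := simplex_base.
  apply/integrableP; split; first by apply/measurable_EFinP; exact: measurable_cst.
  under eq_integral do rewrite /=.
  rewrite (integral_cst (lebesgue_rV n) mK `|M|%:E) lte_mul_pinfty ?lee_fin//; exact: base_fin bK.
Qed.

Let q0 (t : R) : y0 <= t <= y1 -> 0 <= len^-1. Proof. by move=> _; rewrite invr_ge0 ltW. Qed.
Let cq : continuous (fun _ : R => len^-1). Proof. by move=> t; exact: cvg_cst. Qed.
Let beta (i : unit) (z : V) : R := z.2 - yo.
Let cbeta i : continuous (beta i).
Proof. by move=> z; apply: cvgB; [exact: continuous_coord2|exact: cvg_cst]. Qed.
Let betaB i z : P z -> `|beta i z| <= len.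
Proof.
move=> [_ /=]; rewrite in_itv /= => /andP[z0 z1]; rewrite /beta /len ler_norml.
by case: yE => -[_ ->]; apply/andP; split; lra.
Qed.
Let mpath : measurable_fun setT (fun x : 'rV[R]_n * mR => path x.1 x.2 : mpt R n).
Proof. by rewrite (_ : (fun _ => _) = id)//; apply/funext => -[]. Qed.
Let cpath x : continuous (path x).
Proof.
rewrite (_ : path x = fun t => (x, 0) + t *: e_y n); first exact: line_continuous.
by apply/funext => t; congr pair; rewrite /= ?scaler0 ?addr0// add0r /GRing.scale /= mulr1.
Qed.

Theorem horizontal_trace_exists (u w : V -> R) : vol.-integrable P (EFin \o u) ->
  has_weak_derivative P u (e_y n) w ->
  exists g, has_trace P u (fun _ : unit => e_y n) (fun _ => w) (lebesgue_rV n) K (fun x => (x, y)) g.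
Proof.
move=> iu uw.
exact: (@trace_exists _ _ _ (fun _ : unit => e_y n) P _ _ (lebesgue_rV n) K (fun x => (x, y)) fst path
  (fun=> len^-1) y0 y1 len^-1 1
  beta (fun=> len) prism_body mK q0 (q0 (ltac:(by rewrite lexx ltW) : y0 <= y0 <= y1)) ler01 cq cbeta
  betaB mpath cpath (fun=> erefl) smooth_integrable_horizontal horizontal_path_integral horizontal_formula
  u (fun=> w) iu (fun=> uw)).
Qed.

Theorem horizontal_trace_inequality (u w g : V -> R) (b : R) :
  vol.-integrable P (EFin \o u) -> vol.-integrable P (EFin \o w) ->
  has_trace P u (fun _ : unit => e_y n) (fun _ => w) (lebesgue_rV n) K (fun x => (x, y)) g ->
  (\int[lebesgue_rV n]_(x in K) `|g (x, y) - b|%:E <=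
   (len^-1)%:E * (\int[vol]_(z in P) `|u z - b|%:E + len%:E * \int[vol]_(z in P) `|w z|%:E))%E.
Proof.
move=> iu iw tg.
have := @trace_inequality _ _ _ (fun _ : unit => e_y n) P _ _ (lebesgue_rV n) K (fun x => (x, y)) path
  (fun=> len^-1) y0 y1 len^-1 1
  beta (fun=> len) prism_body mK q0 (q0 (ltac:(by rewrite lexx ltW) : y0 <= y0 <= y1)) ler01 cq cbeta
  betaB mpath cpath smooth_integrable_horizontal horizontal_path_integral horizontal_formula
  u (fun=> w) g b iu (fun=> iw) tg.
by rewrite mul1e (bigD1 tt)//= big1 ?adde0// => -[].
Qed.

End horizontal.

End prism_traces.

(** * Replacing the weight by a positive one *)

Section strong_A2_weight.
Context {R : realType} {n : nat}.
Notation V := (pt R n).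
Notation vol := (@vol R n).
Variable a : V -> R.
Hypothesis sa : strong_A2 a.

Let a_ge0 z : 0 <= a z. Proof. by case: sa. Qed.

Let cube (k : nat) : set V := box (\row_i (- k.+1%:R)) (\row_i k.+1%:R) (- k.+1%:R) k.+1%:R.

Let cube_rectangle k : is_rectangle (cube k).
Proof.
have k0 : 0 < (k.+1%:R : R) by rewrite ltr0n.
do 4 eexists; split; last reflexivity; last by lra.
by move=> i; rewrite !mxE; lra.
Qed.

Let mcube k : measurable (cube k : set (mpt R n)). Proof. exact: measurable_box. Qed.

Let cubeP k z : cube k z <-> `|z| <= k.+1%:R.
Proof.
have k0 : 0 <= (k.+1%:R : R) by rewrite ler0n.
apply: iff_trans (iff_sym (normpt_leP z k0)).
split=> -[h1]; rewrite -?ler_norml => h2; split; rewrite -?ler_norml//.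
  by move=> i; have := h1 i; rewrite !mxE ler_norml.
by move=> i; have := h1 i; rewrite !mxE ler_norml.
Qed.

Lemma cube_cover : \bigcup_k cube k = setT.
Proof.
apply/seteqP; split => // z _; exists (Num.truncn `|z|) => //; apply/cubeP.
by rewrite ltW// truncnS_gt.
Qed.

Lemma compact_cube k : compact (cube k).
Proof.
rewrite (_ : cube k = [set z | `|z| <= k.+1%:R]); last by apply/seteqP; split => z /cubeP.
apply: (@compact_pt _ _ _ k.+1%:R) => //.
apply: (@closed_comp _ _ (fun z : V => `|z|%R) [set t | (t <= k.+1%:R)%R]); last exact: closed_le.
by move=> z _; exact: norm_continuous.
Qed.

(** The weight is integrable on each of the cubes, which are compact and cover the
space. *)
Lemma measurable_weight : measurable_fun setT (a : mpt R n -> R).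
Proof.
have [_ la _ _] := sa.
rewrite -cube_cover; apply/measurable_fun_bigcup => // k.
by have /measurable_int/measurable_EFinP := la _ (compact_cube (k := k)) (@subsetT _ _).
Qed.

Definition positive_weight (z : V) : R := if a z == 0 then 1 else a z.
Let a' := positive_weight.

Lemma positive_weight_gt0 z : 0 < a' z.
Proof. by rewrite /a' /positive_weight; case: eqVneq => // h; rewrite lt0r h a_ge0. Qed.

Lemma measurable_positive_weight : measurable_fun setT (a' : mpt R n -> R).
Proof.
apply: measurable_fun_ifT => //; last exact: measurable_weight.
by apply: measurable_fun_eqr; [exact: measurable_weight|exact: measurable_cst].
Qed.

Lemma measurable_weight_inv : measurable_fun setT (fun z : mpt R n => ((a z)%:E^-1)%E).
Proof.
rewrite (_ : (fun z => _) = (fun z : mpt R n => if a z == 0 then +oo%E else ((a' z)^-1)%:E)); last first.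
  by apply/funext => z; rewrite inver /a' /positive_weight; case: eqP.
apply: measurable_fun_ifT => //.
  by apply: measurable_fun_eqr; [exact: measurable_weight|exact: measurable_cst].
exact: (measurable_inv_gt0 measurable_positive_weight positive_weight_gt0).
Qed.

(** The inverse is infinite where the weight vanishes, but integrable on each cube. *)
Lemma weight_ae_gt0 : {ae vol, forall z, 0 < a z}.
Proof.
have [_ _ ai _] := sa.
have H k : {ae vol, forall z, cube k z -> ((a z)%:E^-1)%E \is a fin_num}.
  apply: integrable_ae => //; apply/integrableP; split.
    by apply: measurable_funTS; exact: measurable_weight_inv.
  under eq_integral => z _ do rewrite gee0_abs ?inve_ge0 ?lee_fin//.
  exact: (ai _ (cube_rectangle k)).
have [N [mN N0 sub]] := ae_foralln H.
exists N; split => // z /= nz; apply: sub => /= h; apply: nz.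
have [k _ zk] : (\bigcup_k cube k) z by rewrite cube_cover.
have := h k zk; rewrite inver lt0r a_ge0 andbT.
by case: eqVneq.
Qed.

Lemma integral_weight (D : set V) (F : R -> V -> \bar R) (G : R -> V -> \bar R) :
  measurable (D : set (mpt R n)) ->
  measurable_fun D (fun z : mpt R n => F (a z) z) -> measurable_fun D (fun z : mpt R n => G (a' z) z) ->
  (forall t z, 0 < t -> F t z = G t z) ->
  (forall t z, 0 <= t -> (0 <= F t z)%E) -> (forall t z, 0 <= t -> (0 <= G t z)%E) ->
  (\int[vol]_(z in D) F (a z) z = \int[vol]_(z in D) G (a' z) z)%E.
Proof.
move=> mD mF mG FG F0 G0; apply: ge0_ae_eq_integral => //.
- by move=> z _; exact: F0.
- by move=> z _; apply: G0; exact: ltW (positive_weight_gt0 z).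
have [N [mN N0 sub]] := weight_ae_gt0.
exists N; split => // z /= nz; apply: sub => /= az; apply: nz => _.
by rewrite FG// /a' /positive_weight gt_eqF.
Qed.

Lemma positive_weight_A2 : exists A, positive_A2 a' A.
Proof.
have [_ la ai] := sa; set s := ereal_sup _ => soo.
have ma' := measurable_positive_weight.
have sub S : is_rectangle S ->
    (average S (fun z => (a z)%:E) * average S (fun z => (a z)%:E^-1) <= s)%E.
  by move=> rS; apply: ereal_sup_ubound; exists S.
have s0 : (0 <= s)%E.
  apply: le_trans (sub _ (cube_rectangle 0)).
  by rewrite mule_ge0// mule_ge0 ?inve_ge0 ?measure_ge0// integral_ge0// => z _; rewrite ?inve_ge0 lee_fin.
have sE : s = (fine s)%:E by rewrite fineK// ge0_fin_numE.
exists (fine s); split => //.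
- exact: fine_ge0.
- exact: positive_weight_gt0.
move=> S rS; have mS : measurable (S : set (mpt R n)).
  by have [l [u [c [d [_ _ ->]]]]] := rS; exact: measurable_box.
have mae : measurable_fun S (fun z : mpt R n => (a' z)%:E).
  by apply/measurable_EFinP; exact: measurable_funTS.
have mai : measurable_fun S (fun z : mpt R n => ((a' z)^-1)%:E).
  exact: (measurable_funTS (measurable_inv_gt0 ma' positive_weight_gt0)).
have E1 : (\int[vol]_(z in S) (a' z)%:E = \int[vol]_(z in S) (a z)%:E)%E.
  apply/esym; apply: (@integral_weight _ (fun t _ => t%:E) (fun t _ => t%:E)) => //.
  by apply/measurable_EFinP; apply: measurable_funTS; exact: measurable_weight.
have E2 : (\int[vol]_(z in S) ((a' z)^-1)%:E = \int[vol]_(z in S) ((a z)%:E^-1))%E.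
  apply/esym; apply: (@integral_weight _ (fun t _ => t%:E^-1)%E (fun t _ => (t^-1)%:E)) => //.
  - by apply: measurable_funTS; exact: measurable_weight_inv.
  - by move=> t z t0; rewrite inver gt_eqF.
  - by move=> t z t0; rewrite inve_ge0 lee_fin.
  - by move=> t z t0; rewrite lee_fin invr_ge0.
have aS : (\int[vol]_(z in S) (a z)%:E < +oo)%E.
  have [k Sk] : exists k, S `<=` cube k.
    have [l [u [c [d [_ _ ->]]]]] := rS.
    exists (Num.truncn (\sum_i (`|l ord0 i| + `|u ord0 i|) + `|c| + `|d|)) => z [zi zy].
    set B := \sum_i _ + _ + _; have hB : B < (Num.truncn B).+1%:R by exact: truncnS_gt.
    have Si i : `|l ord0 i| + `|u ord0 i| <= \sum_i (`|l ord0 i| + `|u ord0 i|).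
      by rewrite (bigD1 i)//= lerDl sumr_ge0// => *; rewrite addr_ge0.
    have S0 : 0 <= \sum_i (`|l ord0 i| + `|u ord0 i|) by rewrite sumr_ge0// => *; rewrite addr_ge0.
    have c0 := normr_ge0 c; have d0 := normr_ge0 d.
    split => [i|].
      rewrite !mxE; have := zi i; have := Si i.
      have := ler_norm (- l ord0 i); have := ler_norm (u ord0 i); rewrite normrN.
      have := normr_ge0 (l ord0 i); have := normr_ge0 (u ord0 i).
      by rewrite /B in hB *; lra.
    have := ler_norm (- c); have := ler_norm d; rewrite normrN.
    by rewrite /B in hB *; lra.
  have /integrableP[_] := la _ (compact_cube (k := k)) (@subsetT _ _).
  apply: le_lt_trans; apply: (@le_trans _ _ (\int[vol]_(z in S) `|(EFin \o a) z|)%E).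
    by rewrite le_eqVlt; apply/orP; left; apply/eqP; apply: eq_integral => z _ /=; rewrite ger0_norm.
  apply: ge0_subset_integral => //.
  by apply: measurableT_comp => //; apply/measurable_EFinP; apply: measurable_funTS; exact: measurable_weight.
have aiS := ai _ rS.
split; first by rewrite E1.
  by rewrite E2.
rewrite E1 E2.
have [l [u [c [d [lu cd SE]]]]] := rS.
have := sub _ rS; rewrite /average.
have vS : vol S = (\prod_i (u ord0 i - l ord0 i) * (d - c))%:E.
  by rewrite SE vol_box//; [move=> i; exact: ltW|exact: ltW].
set w := (_ * _)%R in vS; have w0 : 0 < w.
  by rewrite mulr_gt0 ?subr_gt0// prodr_gt0// => i _; rewrite subr_gt0.
rewrite vS inver gt_eqF// [in X in X -> _]sE.
have i0 : (0 <= \int[vol]_(z in S) (a z)%:E)%E by apply: integral_ge0 => z _; rewrite lee_fin.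
have j0 : (0 <= \int[vol]_(z in S) ((a z)%:E^-1))%E by apply: integral_ge0 => z _; rewrite inve_ge0 lee_fin.
rewrite -(@fineK _ (\int[vol]_(z in S) (a z)%:E)%E) ?ge0_fin_numE//.
rewrite -(@fineK _ (\int[vol]_(z in S) (a z)%:E^-1)%E) ?ge0_fin_numE//.
rewrite expe2 -!EFinM !lee_fin mulrACA -expr2 exprVn.
by rewrite ler_pdivrMr// exprn_gt0.
Qed.

Lemma wint_positive_weight (D : set V) (f : V -> R) : measurable (D : set (mpt R n)) ->
  measurable_fun (D : set (mpt R n)) f -> wint a D f = wint a' D f.
Proof.
move=> mD mf; apply: (@integral_weight D (fun t z => (f z ^+ 2 * t)%:E) (fun t z => (f z ^+ 2 * t)%:E)) => //.
- apply/measurable_EFinP; apply: measurable_funM; first exact: measurable_funX.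
  by apply: measurable_funTS; exact: measurable_weight.
- apply/measurable_EFinP; apply: measurable_funM; first exact: measurable_funX.
  by apply: measurable_funTS; exact: measurable_positive_weight.
- by move=> t z t0; rewrite lee_fin mulr_ge0 ?sqr_ge0.
- by move=> t z t0; rewrite lee_fin mulr_ge0 ?sqr_ge0.
Qed.

End strong_A2_weight.

(** * Weighted norms on a prism *)

Section weighted_norm.
Context {R : realType} {n : nat}.
Notation V := (pt R n).
Notation vol := (@vol R n).
Variables (a : V -> R).
Hypothesis ma : measurable_fun setT (a : mpt R n -> R).
Hypothesis a0 : forall z, 0 < a z.
Variable P : set V.
Hypothesis mP : measurable (P : set (mpt R n)).
Let mf (f : V -> R) := measurable_fun (P : set (mpt R n)) f.

Lemma L2normE f : L2norm a P f = sqrte (wint a P f).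
Proof. by rewrite /L2norm poweR12_sqrt//; apply: wint_ge0 => z; exact: ltW. Qed.

Lemma L2norm_ge0 f : (0 <= L2norm a P f)%E.
Proof. exact: poweR_ge0. Qed.

Lemma wint_L2norm f : (wint a P f = L2norm a P f ^+ 2)%E.
Proof. by rewrite L2normE sqr_sqrte//; apply: wint_ge0 => z; exact: ltW. Qed.

Lemma wint_lty f : (wint a P f < +oo)%E = (L2norm a P f < +oo)%E.
Proof.
rewrite wint_L2norm; move: (L2norm_ge0 f); case: (L2norm a P f) => [r| |]//= _.
by rewrite -EFinM !ltry.
Qed.

Lemma wint_L2norm_le (c : R) f g : 0 <= c -> (wint a P f <= c%:E * wint a P g)%E ->
  (L2norm a P f <= (Num.sqrt c)%:E * L2norm a P g)%E.
Proof.
move=> c0 fg; have g0 : (0 <= wint a P g)%E by apply: wint_ge0 => z; exact: ltW.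
rewrite !L2normE (_ : (Num.sqrt c)%:E = sqrte c%:E)// -sqrteM ?lee_fin// lee_sqrt//.
by rewrite mule_ge0// lee_fin.
Qed.

Lemma L2norm_le f g : mf f -> mf g -> (forall z, P z -> `|f z| <= `|g z|) ->
  (L2norm a P f <= L2norm a P g)%E.
Proof.
move=> mf' mg fg; rewrite !L2normE lee_sqrt; last by apply: wint_ge0 => z; exact: ltW.
exact: wint_le.
Qed.

Lemma L2normZ c f : mf f -> (L2norm a P (fun z => (c * f z)%R) = `|c|%:E * L2norm a P f)%E.
Proof.
move=> mf'; rewrite !L2normE (_ : wint a P _ = ((c ^+ 2)%:E * wint a P f)%E).
  rewrite sqrteM ?lee_fin ?sqr_ge0//.
  by rewrite /= sqrtr_sqr.
rewrite /wint -ge0_integralZl ?lee_fin ?sqr_ge0//.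
- by apply: eq_integral => z _; rewrite exprMn -mulrA EFinM.
- exact: measurable_wint.
- by move=> z _; rewrite lee_fin mulr_ge0 ?sqr_ge0// ltW.
Qed.

Lemma L2norm_Lnorm f : mf f ->
  (L2norm a P f = 'N[vol]_2%:E[EFin \o ((fun z => f z * Num.sqrt (a z))%R \_ P)])%E.
Proof.
move=> mf'; rewrite unlock /L2norm; congr (_ `^ _)%E.
rewrite [LHS]integral_mkcond.  apply: eq_integral => z _; rewrite /= !patchE.
case: ifP => _; last by rewrite normr0 powR0// pnatr_eq0.
by rewrite powR_mulrn ?normr_ge0// real_normK ?num_real// exprMn sqr_sqrtr// ltW.
Qed.

Lemma measurable_weighted f : mf f ->
  measurable_fun setT ((fun z : mpt R n => f z * Num.sqrt (a z))%R \_ P).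
Proof.
move=> mf'; apply/(measurable_restrictT _ mP); apply: measurable_funM => //.
apply: measurable_funTS; apply: (@measurableT_comp _ _ _ _ _ _ (@Num.sqrt R)) => //.
by apply: continuous_measurable_fun; exact: sqrt_continuous.
Qed.

(** Minkowski's inequality for [f * sqrt a] and [g * sqrt a]. *)
Lemma L2normD f g : mf f -> mf g ->
  (L2norm a P (fun z => (f z + g z)%R) <= L2norm a P f + L2norm a P g)%E.
Proof.
move=> mf' mg; rewrite !L2norm_Lnorm//; last exact: measurable_funD.
have := minkowski_EFin vol (measurable_weighted mf') (measurable_weighted mg) (ler1n R 2 : 1 <= 2%:R).
apply: le_trans; rewrite le_eqVlt; apply/orP; left; apply/eqP; congr Lnorm.
by apply/funext => z /=; rewrite !patchE; case: ifP => _; rewrite ?addr0// mulrDl.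
Qed.

Lemma L2norm0 : L2norm a P (fun=> 0) = 0%E.
Proof.
rewrite L2normE /wint integral0_eq ?sqrte0// => z _.
by rewrite expr0n mul0r.
Qed.

Lemma L2norm_sum (I : finType) (f : I -> V -> R) : (forall i, mf (f i)) ->
  (L2norm a P (fun z => (\sum_i f i z)%R) <= \sum_i L2norm a P (f i))%E.
Proof.
move=> mf'; rewrite -big_enum /=.
under eq_fun do rewrite -big_enum /=.
elim: (enum I) => [|i s IH].
  by rewrite big_nil; under eq_fun do rewrite big_nil; rewrite L2norm0.
rewrite big_cons; under eq_fun do rewrite big_cons.
apply: le_trans (L2normD (mf' i) _) _; first exact: measurable_sum.
exact: leeD.
Qed.

Lemma measurable_enorm k l (M : V -> 'M[R]_(k, l)) : (forall i j, mf (fun z => M z i j)) ->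
  mf (fun z => enorm (M z)).
Proof.
move=> mM; apply: (@measurableT_comp _ _ _ _ _ _ (@Num.sqrt R)) => //.
  by apply: continuous_measurable_fun; exact: sqrt_continuous.
apply: measurable_sum => i; apply: measurable_sum => j.
by apply: measurable_funX; exact: mM.
Qed.

End weighted_norm.

Section prism_weight.
Context {R : realType} {m : nat}.
Notation n := m.+1.
Notation V := (pt R n).
Notation vol := (@vol R n).
Variables (v : 'I_n.+1 -> 'rV[R]_n) (y0 y1 eta : R) (a : V -> R) (A : R).
Hypothesis av : affinely_independent v.
Hypothesis y01 : y0 < y1.
Hypothesis eta0 : 0 < eta.
Let K := simplex v.
Let P := prism v y0 y1.
Let h := diameter K.
Let len := y1 - y0.
Let vP := fine (vol P).
Hypothesis shape : h / inner_diameter K <= eta.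
Hypothesis aA : positive_A2 a A.

Let A0 : 0 <= A. Proof. by case: aA. Qed.
Let ma : measurable_fun setT (a : mpt R n -> R). Proof. by case: aA. Qed.
Let a0 z : 0 < a z. Proof. by case: aA => _ _ H _; exact: H. Qed.
Let bP : convex_body P := prism_body av y01.
Let mP : measurable (P : set (mpt R n)) := body_measurable bP.
Let vP0 : 0 < vP := body_fine_gt0 bP.
Let h0 : 0 < h := diameter_gt0 av.
Let len0 : 0 < len. Proof. by rewrite subr_gt0. Qed.

Lemma prism_widths_gt0 i : 0 < widths (n := n) h len i.
Proof. exact: widths_gt0. Qed.

Lemma prism_width z w i : P z -> P w -> `|coord i w - coord i z| <= widths h len i.
Proof.
move=> [Kz zy] [Kw wy]; case: i => [i|] /=; first exact: simplex_width.
by move: zy wy; rewrite /= !in_itv /= => /andP[? ?] /andP[? ?]; rewrite ler_norml /len; lra.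
Qed.

Lemma prism_fill : \prod_i widths (n := n) h len i <= shape_const (m := m) eta * vP.
Proof.
rewrite prod_widths /vP vol_prism//= mulrA ler_pM2r//; exact: simplex_volume.
Qed.

Lemma prism_in_kbox : exists z, P `<=` kbox (widths h len) 1 z.
Proof.
have Pz : P (v ord0, y0) by split; [exact: simplex_vertex|rewrite /= in_itv /= lexx ltW].
by exists (v ord0, y0) => w Pw i; rewrite mul1r; exact: prism_width.
Qed.

Lemma shape_const_ge0 : 0 <= shape_const (m := m) eta.
Proof. by rewrite /shape_const exprn_ge0// !mulr_ge0 ?ler0n ?(ltW eta0). Qed.

Definition prism_weight_const : R := A * (2 ^+ n.+1 * shape_const (m := m) eta) ^+ 2.

Lemma prism_weight_const_ge0 : 0 <= prism_weight_const.
Proof. by rewrite mulr_ge0// sqr_ge0. Qed.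

Lemma measurable_weight_inverse : measurable_fun setT (fun z : mpt R n => ((a z)^-1)%:E).
Proof. exact: measurable_inv_gt0. Qed.

(** The prism lies in a box with the same widths, and by the shape condition it fills a
fixed part of it. *)
Lemma prism_weight_bounds :
  [/\ (\int[vol]_(z in P) (a z)%:E < +oo)%E, (0 < \int[vol]_(z in P) ((a z)^-1)%:E < +oo)%E &
    (\int[vol]_(z in P) (a z)%:E * \int[vol]_(z in P) ((a z)^-1)%:E <=
     (prism_weight_const * vP ^+ 2)%:E)%E].
Proof.
have [z Pz] := prism_in_kbox; set B := kbox _ _ _ in Pz.
have mB : measurable (B : set (mpt R n)) by exact: measurable_kbox.
have [_ _ _ /(_ _ (kbox_rectangle prism_widths_gt0 z ltr01))[aB aiB _]] := aA.
have mai := measurable_weight_inverse.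
have mae : measurable_fun setT (fun z : mpt R n => (a z)%:E) by exact/measurable_EFinP.
have ae0 x : (0 <= (a x)%:E)%E by rewrite lee_fin ltW.
have ai0 x : (0 <= ((a x)^-1)%:E)%E by rewrite lee_fin invr_ge0 ltW.
have aPB : (\int[vol]_(z in P) (a z)%:E <= \int[vol]_(z in B) (a z)%:E)%E.
  by apply: ge0_subset_integral => //; exact: measurable_funTS.
have aiPB : (\int[vol]_(z in P) ((a z)^-1)%:E <= \int[vol]_(z in B) ((a z)^-1)%:E)%E.
  by apply: ge0_subset_integral => //; exact: measurable_funTS.
split.
- exact: le_lt_trans aPB aB.
- apply/andP; split; last exact: le_lt_trans aiPB aiB.
  rewrite lt_neqAle integral_ge0 ?andbT//; apply/eqP => E0.
  have : (\int[vol]_(z in P) `|((a z)^-1)%:E| = 0)%E.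
    by rewrite [RHS]E0; apply: eq_integral => w _; rewrite gee0_abs.
  move=> /(ae_eq_integral_abs _ mP (measurable_funTS mai))[N [mN N0 sub]].
  have : (vol P <= vol N)%E.
    apply: le_measure; rewrite ?inE// => w Kw; apply: sub => /= /(_ Kw) [] /eqP.
    by rewrite invr_eq0 gt_eqF.
  by rewrite N0 leNgt (body_gt0 bP).
- apply: (@le_trans _ _ (\int[vol]_(z in B) (a z)%:E * \int[vol]_(z in B) ((a z)^-1)%:E)%E).
    by apply: lee_pmul => //; apply: integral_ge0 => w _.
  apply: le_trans (kbox_A2 prism_widths_gt0 aA z ltr01) _.
  rewrite lee_fin mulr1 /prism_weight_const -mulrA ler_wpM2l// -exprMn ler_sqr ?nnegrE; last 2 first.
  - by rewrite mulr_ge0 ?exprn_ge0// prodr_ge0// => i _; exact: ltW (prism_widths_gt0 i).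
  - apply: mulr_ge0; last exact: ltW.
    by apply: mulr_ge0; [exact: exprn_ge0|exact: shape_const_ge0].
  by rewrite -[leRHS]mulrA; apply: ler_wpM2l; [exact: exprn_ge0|exact: prism_fill].
Qed.

(** On a set of finite mass for [a^-1], [2 |f| <= f ^ 2 a + a^-1]. *)
Lemma L2_integrable (E : set V) (f : V -> R) : measurable (E : set (mpt R n)) -> E `<=` P ->
  measurable_fun (E : set (mpt R n)) f -> (wint a E f < +oo)%E -> vol.-integrable E (EFin \o f).
Proof.
move=> mE EP mf fin; have [_ /andP[_ iP] _] := prism_weight_bounds.
apply/integrableP; split; first exact/measurable_EFinP.
have ai0 x : (0 <= ((a x)^-1)%:E)%E by rewrite lee_fin invr_ge0 ltW.
have f20 x : (0 <= (f x ^+ 2 * a x)%:E)%E by rewrite lee_fin mulr_ge0 ?sqr_ge0// ltW.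
have mai : measurable_fun (E : set (mpt R n)) (fun z => ((a z)^-1)%:E).
  exact: (measurable_funTS measurable_weight_inverse).
have m2 : measurable_fun (E : set (mpt R n)) (fun z => (f z ^+ 2 * a z)%:E) by exact: measurable_wint.
apply: (@le_lt_trans _ _ (\int[vol]_(z in E) ((f z ^+ 2 * a z)%:E + ((a z)^-1)%:E))%E).
  apply: ge0_le_integral => //.
  - by apply/measurable_EFinP; apply: measurableT_comp.
  - exact: emeasurable_funD.
  move=> z _; rewrite lee_fin; have [b b1 a1] : exists2 b, 0 < b & a z = b ^+ 2.
    by exists (Num.sqrt (a z)); rewrite ?sqrtr_gt0// sqr_sqrtr// ltW.
  rewrite a1 -exprMn -exprVn -(real_normK (num_real (f z * b))).
  have -> : `|f z| = `|f z * b| * b^-1 by rewrite normrM (gtr0_norm b1) mulfK// gt_eqF.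
  have x0 := normr_ge0 (f z * b); have i0 : 0 < b^-1 by rewrite invr_gt0.
  move: (`|f z * b|) (b^-1) x0 i0 => x w; nra.
rewrite ge0_integralD// lte_add_pinfty//.
apply: le_lt_trans iP; apply: ge0_subset_integral => //.
exact: (measurable_funTS measurable_weight_inverse).
Qed.

(** Cauchy-Schwarz, and the A_2 bound on the product of the masses of the weight
and its inverse. *)
Lemma L2norm_average (t : R) (f : V -> R) : measurable_fun (P : set (mpt R n)) f ->
  ((`|t| * vP)%:E <= \int[vol]_(z in P) `|f z|%:E)%E ->
  (L2norm a P (fun=> t) <= (Num.sqrt prism_weight_const)%:E * L2norm a P f)%E.
Proof.
move=> mf tf; apply: wint_L2norm_le => //; first exact: prism_weight_const_ge0.
have [aP aiP aai] := prism_weight_bounds; have /andP[ai0 aioo] := aiP.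
have f20 : (0 <= wint a P f)%E by apply: wint_ge0 => z; exact: ltW.
have i0 : (0 <= \int[vol]_(z in P) (a z)%:E)%E by apply: integral_ge0 => z _; rewrite lee_fin ltW.
have CS := @weighted_cauchy_schwarz _ _ _ (vol : {measure set (mpt R n) -> \bar R}) P
  (fun z => `|f z|%:E) a mP _ _ (measurable_funTS ma) a0 aiP.
have {}CS : ((\int[vol]_(z in P) `|f z|%:E) ^+ 2 <= wint a P f * \int[vol]_(z in P) ((a z)^-1)%:E)%E.
  apply: le_trans (CS _ _) _ => //.
    by apply/measurable_EFinP; apply: measurableT_comp.
  rewrite le_eqVlt; apply/orP; left; apply/eqP; congr (_ * _)%E.
  by apply: eq_integral => z _; rewrite -EFin_expe real_normK ?num_real.
have {CS} : (((`|t| * vP) ^+ 2)%:E <= wint a P f * \int[vol]_(z in P) ((a z)^-1)%:E)%E.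
  apply: le_trans CS; rewrite EFin_expe lee_sqr//.
  - by rewrite lee_fin mulr_ge0// ltW.
  - by apply: integral_ge0.
rewrite (wint_cst ma a0)// /wmass; move: aai ai0 aioo i0 aP f20.
have c0 := prism_weight_const_ge0.
move: (\int[vol]_(z in P) (a z)%:E)%E (\int[vol]_(z in P) ((a z)^-1)%:E)%E => [M| |] [I| |]//.
rewrite -EFinM !lte_fin !lee_fin => MI I0 _ M0 _ f20.
case: (wint a P f) f20 => [F| |]//; last first.
  move=> _ _; case: (ltrgt0P prism_weight_const) c0 => // [c0|cE] _; first by rewrite [leRHS]muleC gt0_mulye ?lte_fin// leey.
  rewrite cE mul0e -EFinM lee_fin.
  move: MI; rewrite cE mul0r pmulr_lle0// => M0'.
  by rewrite mulr_ge0_le0// sqr_ge0.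
rewrite -!EFinM !lee_fin => F0 tF.
have v2 : 0 < vP ^+ 2 by rewrite exprn_gt0.
rewrite -(ler_pM2r v2) -(real_normK (num_real t)).
apply: (@le_trans _ _ (F * I * M)); first by rewrite mulrAC -exprMn ler_wpM2r.
by rewrite -mulrA [I * M]mulrC [prism_weight_const * F]mulrC -mulrA ler_wpM2l.
Qed.

End prism_weight.

(** * Interpolation in the vertical variable *)

Section ereal_bounds.
Context {R : realType}.
Local Open Scope ereal_scope.

Lemma sum_le_const (I : finType) (F : I -> \bar R) (x : \bar R) : 0 <= x ->
  (forall i, F i <= x) -> \sum_i F i <= #|I|%:R%:E * x.
Proof.
move=> x0 Fx; rewrite cardE -big_enum /=; elim: (enum I) => [|i s IH].
  by rewrite big_nil mul0e.
rewrite big_cons /= mulrS EFinD ge0_muleDl ?lee_fin// mul1e; exact: leeD.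
Qed.

Lemma scaled_sum_lty (c d : R) (x y : \bar R) : (0 < c)%R -> (0 < d)%R -> 0 <= x -> 0 <= y ->
  c%:E * x + d%:E * y < +oo -> x < +oo /\ y < +oo.
Proof.
move=> c0 d0; case: x => [x| |]//; case: y => [y| |]// _ _; rewrite ?ltry//.
- by rewrite [d%:E * _]muleC gt0_mulye ?lte_fin// -EFinM.
- by rewrite muleC gt0_mulye ?lte_fin// -EFinM.
- by rewrite muleC gt0_mulye ?lte_fin// [d%:E * _]muleC gt0_mulye ?lte_fin.
Qed.

End ereal_bounds.

Section vertical_component.
Context {R : realType} {m : nat}.
Notation n := m.+1.
Notation V := (pt R n).
Notation vol := (@vol R n).
Variables (v : 'I_n.+1 -> 'rV[R]_n) (y0 y1 eta : R) (a : V -> R) (A : R).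
Hypothesis av : affinely_independent v.
Hypothesis y01 : y0 < y1.
Hypothesis eta0 : 0 < eta.
Let K := simplex v.
Let P := prism v y0 y1.
Let h := diameter K.
Let len := y1 - y0.
Let vP := fine (vol P).
Hypothesis shape : h / inner_diameter K <= eta.
Hypothesis aA : positive_A2 a A.
Let B := prism_weight_const (m := m) eta A.

Let A0 : 0 <= A. Proof. by case: aA. Qed.
Let ma : measurable_fun setT (a : mpt R n -> R). Proof. by case: aA. Qed.
Let a0 z : 0 < a z. Proof. by case: aA => _ _ H _; exact: H. Qed.
Let bP : convex_body P := prism_body av y01.
Let mP : measurable (P : set (mpt R n)) := body_measurable bP.
Let vP0 : 0 < vP := body_fine_gt0 bP.
Let h0 : 0 < h := diameter_gt0 av.
Let len0 : 0 < len. Proof. by rewrite subr_gt0. Qed.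
Let mK : measurable K. Proof. exact: measurable_simplex. Qed.
Let mf (f : V -> R) := measurable_fun (P : set (mpt R n)) f.

Let mabs (f : V -> R) : mf f -> mf (fun z => `|f z|).
Proof. by move=> mf'; exact: measurableT_comp. Qed.

Variables (s Dy : V -> R) (Dx : V -> 'rV[R]_n).
Hypothesis ms : mf s.
Hypothesis sfin : (L2norm a P s < +oo)%E.
Hypothesis sDx : forall j, weak_derivative P s (e_x j) (fun z => Dx z ord0 j).
Hypothesis sDy : weak_derivative P s (e_y n) Dy.
Let rhs := (len%:E * L2norm a P Dy + h%:E * L2norm a P (fun z => enorm (Dx z)))%E.
Hypothesis rfin : (rhs < +oo)%E.

Let mDx j : mf (fun z => Dx z ord0 j). Proof. by case: (sDx j). Qed.
Let mDy : mf Dy. Proof. by case: sDy. Qed.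
Let mE : mf (fun z => enorm (Dx z)).
Proof. by apply: measurable_enorm => i j; rewrite ord1; exact: mDx. Qed.

Let Dfin : (L2norm a P Dy < +oo)%E /\ (L2norm a P (fun z => enorm (Dx z)) < +oo)%E.
Proof. by apply: scaled_sum_lty len0 h0 _ _ rfin; exact: L2norm_ge0. Qed.

Let rhs0 : (0 <= rhs)%E.
Proof. by rewrite adde_ge0// mule_ge0 ?lee_fin ?L2norm_ge0// ltW. Qed.

Lemma Dx_norm_le j : (L2norm a P (fun z => Dx z ord0 j) <= L2norm a P (fun z => enorm (Dx z)))%E.
Proof.
apply: (L2norm_le ma a0 mP (mDx j) mE) => z _; rewrite [leRHS]ger0_norm ?enorm_ge0//; exact: enorm_coord.
Qed.

Let integrableP_L2 (f : V -> R) : mf f -> (L2norm a P f < +oo)%E -> vol.-integrable P (EFin \o f).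
Proof. by move=> mf' ff; apply: (L2_integrable av y01 eta0 shape aA) => //; rewrite wint_lty. Qed.

Let is_ : vol.-integrable P (EFin \o s). Proof. exact: integrableP_L2. Qed.
Let iDx j : vol.-integrable P (EFin \o (fun z => Dx z ord0 j)).
Proof. by apply: integrableP_L2 => //; apply: le_lt_trans (Dx_norm_le j) _; case: Dfin. Qed.
Let iDy : vol.-integrable P (EFin \o Dy).
Proof. by apply: integrableP_L2 => //; case: Dfin. Qed.

Let D (i : option 'I_n) : V -> R := if i is Some j then fun z => Dx z ord0 j else Dy.
Let mD i : mf (D i). Proof. by case: i. Qed.
Let sD i : has_weak_derivative P s (dir i) (D i).
Proof. case: i => [j|]; first exact: (weak_derivative_sub bP (@subset_refl _ P) (sDx j) is_ (iDx j)).
exact: (weak_derivative_sub bP (@subset_refl _ P) sDy is_ iDy). Qed.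

Lemma wgrad_norm_le : (L2norm a P (wgrad (widths h len) D) <= n%:R%:E * rhs)%E.
Proof.
have k0 i := prism_widths_gt0 av y01 i.
have mk i : mf (fun z => widths h len i * `|D i z|).
  by apply: measurable_funM => //; exact: mabs.
apply: le_trans (L2norm_sum ma a0 mP mk) _.
have kE i : L2norm a P (fun z => widths h len i * `|D i z|) = ((widths h len i)%:E * L2norm a P (D i))%E.
  rewrite (L2normZ ma a0 mP)//; last exact: mabs.
  rewrite gtr0_norm//; congr (_ * _)%E.
  by rewrite !(L2normE a0); congr sqrte; apply: eq_integral => z _; rewrite real_normK ?num_real.
rewrite (eq_bigr _ (fun i _ => kE i)) big_option /=.
rewrite /rhs ge0_muleDr; last 2 first.
- by rewrite mule_ge0 ?lee_fin ?L2norm_ge0// ltW.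
- by rewrite mule_ge0 ?lee_fin ?L2norm_ge0// ltW.
rewrite addeC; apply: leeD.
  rewrite -[leLHS]mul1e; apply: lee_wpmul2r; last by rewrite lee_fin ler1n.
  by rewrite mule_ge0 ?lee_fin ?L2norm_ge0// ltW.
rewrite -[X in (X%:R)%:E](card_ord n); apply: sum_le_const.
  by rewrite mule_ge0 ?lee_fin ?L2norm_ge0// ltW.
by move=> j; apply: lee_wpmul2l; [rewrite lee_fin ltW|exact: Dx_norm_le].
Qed.

Let b := mean P s.
Let C1 := Num.sqrt (A * (4 ^+ n.+1 * shape_const (m := m) eta) ^+ 2).

Lemma vertical_mean_le : (L2norm a P (fun z => (s z - b)%R) <= (C1 * n%:R)%:E * rhs)%E.
Proof.
apply: (@le_trans _ _ (C1%:E * L2norm a P (wgrad (widths h len) D))%E).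
  apply: (wint_L2norm_le a0); first by rewrite mulr_ge0// sqr_ge0.
  exact: (weighted_poincare (prism_widths_gt0 av y01) aA bP (prism_width (v := v) (y0 := y0) (y1 := y1))
    (prism_fill av y01 eta0 shape) sD).
rewrite EFinM -muleA; apply: lee_wpmul2l; first by rewrite lee_fin sqrtr_ge0.
exact: wgrad_norm_le.
Qed.

Let F (z : V) : R := `|s z - b| + len * `|Dy z|.
Let mF : mf F.
Proof.
apply: measurable_funD; first by apply: measurableT_comp => //; exact: measurable_funB.
by apply: measurable_funM => //; exact: measurableT_comp.
Qed.

(** The interpolation condition makes [q] the mean of the trace, whose distance to [b]
is controlled by the trace inequality. *)
Lemma average_trace_le (y yo q : R) (g : V -> R) : (y = y1 /\ yo = y0) \/ (y = y0 /\ yo = y1) ->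
  has_trace P s (fun _ : unit => e_y n) (fun _ => Dy) (lebesgue_rV n) K (fun x => (x, y)) g ->
  \int[lebesgue_rV n]_(x in K) q = \int[lebesgue_rV n]_(x in K) g (x, y) ->
  ((`|q - b| * vP)%:E <= \int[vol]_(z in P) (F z)%:E)%E.
Proof.
move=> yE tg qg; have [r bK] := simplex_base av.
have N0 : 0 < fine (lebesgue_rV n K) := sigma_gt0 bK.
have Nfin : lebesgue_rV n K \is a fin_num by rewrite ge0_fin_numE// (base_fin bK).
have icst (c : R) : (lebesgue_rV n).-integrable K (EFin \o cst c).
  apply/integrableP; split; first by apply/measurable_EFinP; exact: measurable_cst.
  rewrite (integral_cst (lebesgue_rV n) mK `|c|%:E) lte_mul_pinfty ?lee_fin//; exact: base_fin bK.
have ig : (lebesgue_rV n).-integrable K (EFin \o (fun x => g (x, y))) by case: tg.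
have cstE (c : R) : \int[lebesgue_rV n]_(x in K) c = c * fine (lebesgue_rV n K).
  by rewrite Rintegral_cst.
have E1 : (q - b) * fine (lebesgue_rV n K) = \int[lebesgue_rV n]_(x in K) (g (x, y) - b).
  transitivity (\int[lebesgue_rV n]_(x in K) g (x, y) - \int[lebesgue_rV n]_(x in K) b).
    by rewrite -qg !cstE mulrBl.
  by rewrite -(RintegralB mK ig (icst b)).
have E2 : ((`|q - b| * fine (lebesgue_rV n K))%:E <= \int[lebesgue_rV n]_(x in K) `|g (x, y) - b|%:E)%E.
  have igb : (lebesgue_rV n).-integrable K (EFin \o (fun x => g (x, y) - b)).
    by have := integrableB mK ig (icst b).
  rewrite -[X in _ * X](ger0_norm (ltW N0)) -normrM E1.
  have := le_normr_Rintegral mK igb; rewrite -lee_fin /Rintegral => /le_trans; apply.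
  rewrite fineK//; last by apply: integrable_fin_num => //; exact: (integrable_norm igb).
have := horizontal_trace_inequality av y01 yE b is_ iDy tg.
move=> /(le_trans E2); rewrite -/P -/len => E3.
have -> : (\int[vol]_(z in P) (F z)%:E = \int[vol]_(z in P) `|s z - b|%:E + len%:E * \int[vol]_(z in P) `|Dy z|%:E)%E.
  rewrite -ge0_integralZl//.
  - rewrite -ge0_integralD//.
    + by apply/measurable_EFinP; apply: measurableT_comp => //; exact: measurable_funB.
    + by move=> z _; rewrite mule_ge0 ?lee_fin// ltW.
    + by apply: measurable_funeM; apply/measurable_EFinP; exact: measurableT_comp.
  - by apply/measurable_EFinP; exact: measurableT_comp.
  - by rewrite lee_fin ltW.
move: E3; set I := (_ + _)%E => E3.
rewrite /vP (vol_prism av y01) /= mulrA EFinM muleC.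
apply: le_trans (lee_wpmul2l _ E3) _; first by rewrite lee_fin ltW.
by rewrite muleA -EFinM mulfV ?mul1e// gt_eqF.
Qed.

Definition vertical_const : R := C1 * n%:R + Num.sqrt B * 2 * (C1 * n%:R + 1).

(** The interpolate is affine, so its distance to the mean [b] of [s] is bounded by its
values at the end points, and [L2norm_average] turns a bound on a constant into a
bound on its weighted norm. *)
Theorem vertical_interpolation_error q : is_Pi_y v y0 y1 s Dy q ->
  (L2norm a P (fun z => (s z - q z.2)%R) <= vertical_const%:E * rhs)%E.
Proof.
move=> [[A1 [c qE]] H].
have [g0 t0 e0] := H y0 (mem_head _ _).
have [g1 t1 e1] := H y1 (mem_last _ [:: y1]).
have q0 := average_trace_le (or_intror (conj erefl erefl)) t0 e0.
have q1 := average_trace_le (or_introl (conj erefl erefl)) t1 e1.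
pose t := `|q y0 - b| + `|q y1 - b|.
have t_ge0 : 0 <= t by rewrite addr_ge0.
have qt z : P z -> `|b - q z.2| <= `|t|.
  move=> [_ /=]; rewrite in_itv /= => /andP[z0 z1]; rewrite (ger0_norm t_ge0) distrC.
  pose th := (z.2 - y0) / len.
  have th0 : 0 <= th by rewrite divr_ge0 ?subr_ge0// ltW.
  have th1 : th <= 1 by rewrite ler_pdivrMr// mul1r /len lerB.
  have -> : q z.2 - b = (1 - th) * (q y0 - b) + th * (q y1 - b).
    rewrite !qE /th; have l0 := lt0r_neq0 len0; rewrite /len in l0 *; field.
    by [].
  apply: le_trans (ler_normD _ _) _; rewrite (normrM (1 - th)) (normrM th) (ger0_norm th0) ger0_norm ?subr_ge0//.
  by apply: lerD; rewrite ler_piMl//; lra.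
have FE z : `|2 * F z| = 2 * F z by rewrite ger0_norm// mulr_ge0// addr_ge0// mulr_ge0// ltW.
have m2F : mf (fun z => 2 * F z) by exact: measurable_funM.
have tF : ((`|t| * vP)%:E <= \int[vol]_(z in P) `|2 * F z|%:E)%E.
  under eq_integral do rewrite FE EFinM.
  rewrite ge0_integralZl//; last 2 first.
  - exact/measurable_EFinP.
  - by move=> z _; rewrite lee_fin -(pmulr_rge0 _ (ltr0n R 2 : 0 < 2%:R)) -FE.
  rewrite (ger0_norm t_ge0) mulrDl EFinD (_ : 2%:E = 1%:E + 1%:E)%E; last by rewrite -EFinD.
  rewrite ge0_muleDl// mul1e; exact: leeD.
have bq : (L2norm a P (fun z => (b - q z.2)%R) <= (Num.sqrt B * 2 * (C1 * n%:R + 1))%:E * rhs)%E.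
  have mq : mf (fun z => b - q z.2).
    apply: measurable_funB => //; rewrite (_ : (fun z => q z.2) = (fun z => A1 + c * z.2)); last by apply/funext.
    apply: measurable_funD => //; apply: measurable_funM => //.
    by apply: measurable_funTS; exact: measurable_mpt2.
  apply: (@le_trans _ _ (L2norm a P (fun=> t))).
    by apply: (L2norm_le ma a0).
  apply: le_trans (L2norm_average av y01 eta0 shape aA m2F tF) _.
  rewrite -/B (L2normZ ma a0 mP)// ger0_norm// !EFinM -!muleA.
  apply: lee_wpmul2l; first by rewrite lee_fin sqrtr_ge0.
  apply: lee_wpmul2l => //.
  rewrite EFinD ge0_muleDl ?lee_fin ?mulr_ge0 ?sqrtr_ge0 ?ler0n// mul1e.
  have m1 : mf (fun z => `|s z - b|) by apply: measurableT_comp => //; exact: measurable_funB.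
  have m2 : mf (fun z => len * `|Dy z|) by apply: measurable_funM => //; exact: measurableT_comp.
  apply: le_trans (L2normD ma a0 mP m1 m2) _; apply: leeD.
    apply: le_trans vertical_mean_le; apply: (L2norm_le ma a0) => //; first exact: measurable_funB.
    by move=> z _; rewrite normr_id.
  rewrite (L2normZ ma a0 mP); last exact: measurableT_comp.
  rewrite (gtr0_norm len0) /rhs; apply: (@le_trans _ _ (len%:E * L2norm a P Dy)%E).
    apply: lee_wpmul2l; first by rewrite lee_fin ltW.
    apply: (L2norm_le ma a0) => //; first exact: measurableT_comp.
    by move=> z _; rewrite normr_id.
  by rewrite leeDl// mule_ge0 ?lee_fin ?L2norm_ge0// ltW.
rewrite /vertical_const EFinD ge0_muleDl ?lee_fin ?mulr_ge0 ?sqrtr_ge0 ?ler0n//; last first.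
  by rewrite addr_ge0// mulr_ge0 ?sqrtr_ge0 ?ler0n.
apply: le_trans (leeD vertical_mean_le bq).
rewrite (_ : (fun z => s z - q z.2) = (fun z => (s z - b) + (b - q z.2))); last by apply/funext => z; ring.
apply: (L2normD ma a0 mP); first exact: measurable_funB.
apply: measurable_funB => //; rewrite (_ : (fun z => q z.2) = (fun z => A1 + c * z.2)); last by apply/funext.
apply: measurable_funD => //; apply: measurable_funM => //.
by apply: measurable_funTS; exact: measurable_mpt2.
Qed.

Theorem vertical_interpolation_exists : exists q, is_Pi_y v y0 y1 s Dy q.
Proof.
have [g0 t0] := horizontal_trace_exists av y01 (or_intror (conj erefl erefl)) is_ (sD None).
have [g1 t1] := horizontal_trace_exists av y01 (or_introl (conj erefl erefl)) is_ (sD None).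
have [r bK] := simplex_base av.
have N0 : 0 < fine (lebesgue_rV n K) := sigma_gt0 bK.
pose N := fine (lebesgue_rV n K).
pose Q (g : V -> R) y := \int[lebesgue_rV n]_(x in K) g (x, y) / N.
have cstE (c : R) : \int[lebesgue_rV n]_(x in K) c = c * N by rewrite Rintegral_cst.
pose c := (Q g1 y1 - Q g0 y0) / len.
exists (fun y => (Q g0 y0 - c * y0) + c * y); split; first by do 2 eexists.
move=> y; rewrite !inE => /orP[/eqP->|/eqP->].
  by exists g0 => //; rewrite cstE subrK divfK// gt_eqF.
exists g1 => //; rewrite cstE.
have -> : Q g0 y0 - c * y0 + c * y1 = Q g0 y0 + c * len by rewrite /len; ring.
by rewrite /c divfK ?gt_eqF// addrC subrK divfK// gt_eqF.
Qed.

End vertical_component.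

(** * Interpolation in the horizontal variables *)

Section horizontal_components.
Context {R : realType} {m : nat}.
Notation n := m.+1.
Notation V := (pt R n).
Notation vol := (@vol R n).
Variables (v : 'I_n.+1 -> 'rV[R]_n) (y0 y1 eta : R) (a : V -> R) (A : R).
Hypothesis av : affinely_independent v.
Hypothesis y01 : y0 < y1.
Hypothesis eta0 : 0 < eta.
Let K := simplex v.
Let P := prism v y0 y1.
Let h := diameter K.
Let len := y1 - y0.
Let vP := fine (vol P).
Hypothesis shape : h / inner_diameter K <= eta.
Hypothesis aA : positive_A2 a A.
Let B := prism_weight_const (m := m) eta A.
Let kappa := shape_const (m := m) eta.

Let A0 : 0 <= A. Proof. by case: aA. Qed.
Let ma : measurable_fun setT (a : mpt R n -> R). Proof. by case: aA. Qed.
Let a0 z : 0 < a z. Proof. by case: aA => _ _ H _; exact: H. Qed.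
Let bP : convex_body P := prism_body av y01.
Let mP : measurable (P : set (mpt R n)) := body_measurable bP.
Let vP0 : 0 < vP := body_fine_gt0 bP.
Let h0 : 0 < h := diameter_gt0 av.
Let len0 : 0 < len. Proof. by rewrite subr_gt0. Qed.
Let mf (f : V -> R) := measurable_fun (P : set (mpt R n)) f.
Let mabs (f : V -> R) : mf f -> mf (fun z => `|f z|).
Proof. by move=> mf'; exact: measurableT_comp. Qed.

Variables (tau Dy : V -> 'rV[R]_n) (Dx : V -> 'M[R]_n).
Hypothesis mtau : forall j, mf (fun z => tau z ord0 j).
Hypothesis tfin : forall j, (L2norm a P (fun z => tau z ord0 j) < +oo)%E.
Hypothesis tDx : forall i j, weak_derivative P (fun z => tau z ord0 i) (e_x j) (fun z => Dx z i j).
Hypothesis tDy : forall i, weak_derivative P (fun z => tau z ord0 i) (e_y n) (fun z => Dy z ord0 i).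
Let wDy (z : V) : R := (z.2 - y0) * enorm (Dy z).
Let rhs := (L2norm a P wDy + h%:E * L2norm a P (fun z => enorm (Dx z)))%E.
Hypothesis rfin : (rhs < +oo)%E.

Let mDx i j : mf (fun z => Dx z i j). Proof. by case: (tDx i j). Qed.
Let mDy j : mf (fun z => Dy z ord0 j). Proof. by case: (tDy j). Qed.
Let mE : mf (fun z => enorm (Dx z)).
Proof. by apply: measurable_enorm => i j; exact: mDx. Qed.
Let my : mf (fun z => z.2 - y0).
Proof. by apply: measurable_funB => //; apply: measurable_funTS; exact: measurable_mpt2. Qed.
Let mwDy : mf wDy.
Proof.
by apply: measurable_funM => //; apply: measurable_enorm => i j; rewrite ord1; exact: mDy.
Qed.
Let y_ge0 z : P z -> 0 <= z.2 - y0.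
Proof. by move=> [_ /=]; rewrite in_itv /= subr_ge0 => /andP[]. Qed.

Let Dfin : (L2norm a P wDy < +oo)%E /\ (L2norm a P (fun z => enorm (Dx z)) < +oo)%E.
Proof. by apply: (@scaled_sum_lty R 1 h); rewrite ?mul1e ?L2norm_ge0. Qed.

Let rhs0 : (0 <= rhs)%E.
Proof. by rewrite adde_ge0 ?L2norm_ge0// mule_ge0 ?lee_fin ?L2norm_ge0// ltW. Qed.
Let y_rhs : (L2norm a P wDy <= rhs)%E.
Proof. by rewrite leeDl// mule_ge0 ?lee_fin ?L2norm_ge0// ltW. Qed.
Let x_rhs i j : (h%:E * L2norm a P (fun z => Dx z i j) <= rhs)%E.
Proof.
apply: (@le_trans _ _ (h%:E * L2norm a P (fun z => enorm (Dx z)))%E); last first.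
  by rewrite leeDr// L2norm_ge0.
apply: lee_wpmul2l; first by rewrite lee_fin ltW.
apply: (L2norm_le ma a0 mP (mDx i j) mE) => z _.
rewrite [leRHS]ger0_norm ?enorm_ge0//; exact: enorm_coord.
Qed.

Let integrable_L2 (E : set V) (f : V -> R) : measurable (E : set (mpt R n)) -> E `<=` P ->
  mf f -> (wint a E f < +oo)%E -> vol.-integrable E (EFin \o f).
Proof.
move=> mE' EP mf' ff; apply: (L2_integrable av y01 eta0 shape aA) => //.
exact: measurable_funS mP EP mf'.
Qed.

Let it j : vol.-integrable P (EFin \o (fun z => tau z ord0 j)).
Proof. by apply: integrable_L2 => //; rewrite wint_lty. Qed.
Let iDx i j : vol.-integrable P (EFin \o (fun z => Dx z i j)).
Proof.
apply: integrable_L2 => //; rewrite wint_lty//.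
have := le_lt_trans (x_rhs i j) rfin.
move: (L2norm_ge0 a P (fun z => Dx z i j)); case: (L2norm _ _ _) => [r| |]// _; rewrite ?ltry//.
by rewrite muleC gt0_mulye ?lte_fin.
Qed.

Lemma y0lenE : y0 + len = y1. Proof. by rewrite /len addrC subrK. Qed.

Let layerP k : layers K y0 len k `<=` P.
Proof. by have := layers_sub_P (S := K) (y0 := y0) len0 (j := k); rewrite y0lenE. Qed.

(** Away from the bottom of the prism the weight [y - y0] is bounded below. *)
Let iDy k j : vol.-integrable (layers K y0 len k) (EFin \o (fun z => Dy z ord0 j)).
Proof.
have [r bK] := simplex_base av.
have mL : measurable (layers K y0 len k : set (mpt R n)) by exact: (measurable_slab bK).
apply: (integrable_L2 mL (layerP (k := k)) (mDy j)).
pose dl := height y0 len k.+2 - y0.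
have dl0 : 0 < dl by rewrite subr_gt0 height_gt.
apply: (@le_lt_trans _ _ (wint a (layers K y0 len k) (fun z => dl^-1 * wDy z))).
  apply: (wint_le ma a0) => //.
  - by apply: measurable_funS (mDy j) => //; exact: layerP.
  - by apply: measurable_funM => //; apply: measurable_funS mwDy => //; exact: layerP.
  move=> z [_ /=]; rewrite in_itv /= => /andP[z1 _].
  have dz : dl <= z.2 - y0 by rewrite lerB// ltW.
  rewrite [leRHS]ger0_norm; last first.
    by rewrite mulr_ge0 ?invr_ge0 ?(ltW dl0)// mulr_ge0 ?enorm_ge0// (le_trans _ dz)// ltW.
  rewrite -ler_pdivrMl ?invr_gt0// invrK /wDy.
  apply: ler_pM => //; [exact: ltW|exact: enorm_coord].
have mw : mf (fun z => dl^-1 * wDy z) by exact: measurable_funM.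
apply: le_lt_trans (wint_subset ma a0 mL mP mw (layerP (k := k))) _.
rewrite wint_lty// (L2normZ ma a0 mP dl^-1 mwDy) lte_mul_pinfty ?lee_fin//.
by case: Dfin.
Qed.

Let D j (i : option 'I_n) : V -> R := if i is Some k then fun z => Dx z j k else fun z => Dy z ord0 j.
Let mD j i : mf (D j i). Proof. by case: i => [i|]; [exact: mDx|exact: mDy]. Qed.

Let tD j k i : has_weak_derivative (layers K y0 len k) (fun z => tau z ord0 j) (dir i) (D j i).
Proof.
have [r bK] := simplex_base av.
have hk : height y0 len k.+2 < height y0 len k.
  by apply: lt_trans (height_lt y0 len0 k.+1) (height_lt y0 len0 k).
have bL : convex_body (layers K y0 len k) := slab_oc_body bK hk.
have mL := body_measurable bL; have LP := layerP (k := k).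
have itL := integrableS mP mL LP (it j).
case: i => [i|]; first exact: (weak_derivative_sub bL LP (tDx j i) itL (integrableS mP mL LP (iDx j i))).
exact: (weak_derivative_sub bL LP (tDy j) itL (iDy k j)).
Qed.

Let tDP j i : has_weak_derivative P (fun z => tau z ord0 j) (e_x i) (fun z => Dx z j i).
Proof. exact: (weak_derivative_sub bP (@subset_refl _ P) (tDx j i) (it j) (iDx j i)). Qed.

Lemma hardy_grad_norm_le j : (L2norm a P (hardy_grad h y0 (D j)) <= (n%:R + 3)%:E * rhs)%E.
Proof.
have m3 : mf (fun z => 3 * (z.2 - y0)) by exact: measurable_funM.
have mk i : mf (fun z => widths h (3 * (z.2 - y0)) i * `|D j i z|).
  apply: measurable_funM; last exact: (mabs (mD j i)).
  by case: i => [i|] /=; [exact: measurable_cst|exact: m3].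
apply: le_trans (L2norm_sum ma a0 mP mk) _.
rewrite big_option /= EFinD ge0_muleDl ?lee_fin//; apply: leeD.
  rewrite -[X in (X%:R)%:E](card_ord n); apply: sum_le_const => // i.
  rewrite (L2normZ ma a0 mP) ?gtr0_norm//; last exact: (mabs (mDx j i)).
  apply: le_trans (x_rhs j i); apply: lee_wpmul2l; first by rewrite lee_fin ltW.
  by apply: (L2norm_le ma a0 mP (mabs (mDx j i)) (mDx j i)) => z _; rewrite normr_id.
apply: (@le_trans _ _ (3%:E * L2norm a P wDy)%E); last first.
  by apply: lee_wpmul2l => //; rewrite lee_fin.
rewrite -[X in (X%:E * _)%E](ger0_norm (ler0n R 3)) -(L2normZ ma a0 mP)//.
apply: (L2norm_le ma a0 mP (mk None)); first exact: measurable_funM.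
move=> z Pz /=; have := y_ge0 Pz; set w := z.2 - y0 => w0.
rewrite /wDy -/w !normrM normr_id -!mulrA; do 2!apply: ler_wpM2l => //.
by rewrite [leRHS]ger0_norm ?enorm_ge0//; exact: enorm_coord.
Qed.

Let C1 := Num.sqrt (hardy_const (n := n) kappa A) * (n%:R + 3).
Let C1_ge0 : 0 <= C1.
Proof. by rewrite mulr_ge0 ?sqrtr_ge0// addr_ge0. Qed.

Lemma hardy_const_ge0 : 0 <= hardy_const (n := n) kappa A.
Proof.
have k0 := shape_const_ge0 (m := m) eta0.
have d0 : 0 <= doubling_const (n := n) kappa A by rewrite /doubling_const mulr_ge0// sqr_ge0.
have c0 : 0 <= A * (4 ^+ n.+1 * kappa) ^+ 2 by rewrite mulr_ge0// sqr_ge0.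
rewrite /hardy_const /=; apply: mulr_ge0; last exact: mulr_ge0.
move: (doubling_const _ _) d0 => d d0; nra.
Qed.

(** The vertical derivative need not be integrable near the bottom: only its product
with [y - y0] is controlled, which is what [hardy_poincare] asks for. *)
Lemma horizontal_mean j : exists c : R,
  (L2norm a P (fun z => (tau z ord0 j - c)%R) <= C1%:E * rhs)%E.
Proof.
have [r bK] := simplex_base av.
have gfin : (wint a P (hardy_grad h y0 (D j)) < +oo)%E.
  rewrite wint_lty//; apply: le_lt_trans (hardy_grad_norm_le j) _.
  by rewrite lte_mul_pinfty// lee_fin addr_ge0.
have PE : P = slab K `[y0, y0 + len] by rewrite y0lenE.
have := @hardy_poincare R n K _ r h kappa a A bK h0 (simplex_width (v := v)) (simplex_volume av eta0 shape) aA
  y0 len len0 (fun z => tau z ord0 j) (D j).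
rewrite -PE => H; have [c Hc] := H (mtau j) (mD j) (tD j) gfin.
exists c; apply: le_trans (wint_L2norm_le a0 hardy_const_ge0 Hc) _.
rewrite /C1 EFinM -muleA; apply: lee_wpmul2l; first by rewrite lee_fin sqrtr_ge0.
exact: hardy_grad_norm_le.
Qed.

Let E : set (mpt R m) := @unit_simplex R m `*` `[y0, y1].
Let vE := fine (@Defs.vol R m E).
Let vE0 : 0 < vE := face_simplex_gt0 y01.
Let mEf : measurable E := body_measurable (face_simplex_body y01).
Let psi i := face_param (face v i).
Let is_trace i (g : V -> 'rV[R]_n) := forall j, has_trace P (fun z => tau z ord0 j)
  (@e_x R n) (fun k z => Dx z j k) (@Defs.vol R m) E (psi i) (fun z => g z ord0 j).

Let icstE (c : R) : (@Defs.vol R m).-integrable E (EFin \o cst c).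
Proof. exact: integrable_cst_body (face_simplex_body y01). Qed.
Let cstE (c : R) : \int[@Defs.vol R m]_(s in E) c = c * vE.
Proof. by rewrite Rintegral_cst. Qed.

(** The coefficient of [x - v i] is prescribed by the flux through the face opposite to
[v i] alone. By [normal_combination] it does not depend on the choice of the
normal. *)
Lemma horizontal_interpolation_exists : exists q, is_Pi_K v y0 y1 tau Dx q.
Proof.
have /choice[G tG] : forall i, exists g, is_trace i g.
  move=> i; have /choice[g gP] := fun j => lateral_trace_exists av y01 i (it j) (tDP j).
  exists (fun z => \row_j g j z) => j.
  by rewrite (_ : (fun z => (\row_k g k z) ord0 j) = g j)//; apply/funext => z; rewrite mxE.
pose phi i s := \sum_j (G i (psi i s) *m invmx (edges_at v i)) ord0 j.
pose gam i := (\int[@Defs.vol R m]_(s in E) phi i s) / vE.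
have iphi i : (@Defs.vol R m).-integrable E (EFin \o phi i).
  rewrite (_ : EFin \o phi i = fun s => (\sum_j \sum_k
      ((invmx (edges_at v i) k j)%:E * (G i (psi i s) ord0 k)%:E))%E); last first.
    apply/funext => s /=; rewrite /phi -sumEFin; apply: eq_bigr => j _.
    by rewrite mxE -sumEFin; apply: eq_bigr => k _; rewrite -EFinM mulrC.
  apply: integrable_sum => // j _; apply: integrable_sum => // k _.
  by apply: integrableZl => //; case: (tG i k).
exists (fun x => (- \sum_k gam k *: v k) + (\sum_k gam k) *: x); split; first by do 2 eexists.
have qE x : (- \sum_k gam k *: v k) + (\sum_k gam k) *: x = \sum_k gam k *: (x - v k).
  under [RHS]eq_bigr do rewrite scalerBr.
  by rewrite sumrB scaler_suml addrC.
move=> i nu nuP; exists (G i); first exact: tG.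
rewrite /lateral_integral; congr (_ * _).
transitivity (\int[@Defs.vol R m]_(s in E) (gam i * face_height v i nu)).
  by apply: eq_Rintegral => s _; rewrite qE (rt_flux gam s nuP).
transitivity (\int[@Defs.vol R m]_(s in E) (phi i s * face_height v i nu)); last first.
  by apply: eq_Rintegral => s _; rewrite (normal_combination av _ nuP).
by rewrite RintegralZr// cstE mulrAC divfK// gt_eqF.
Qed.

Section estimate.
Variables (q : 'rV[R]_n -> 'rV[R]_n) (c : 'rV[R]_n).
Hypothesis qP : is_Pi_K v y0 y1 tau Dx q.
Hypothesis tc : forall j, (L2norm a P (fun z => (tau z ord0 j - c ord0 j)%R) <= C1%:E * rhs)%E.

Let Fj j (z : V) : R := `|tau z ord0 j - c ord0 j| + \sum_k h * `|Dx z j k|.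
Let F (z : V) : R := \sum_j Fj j z.
Let Fj0 j z : 0 <= Fj j z.
Proof. by rewrite addr_ge0// sumr_ge0// => k _; rewrite mulr_ge0// ltW. Qed.
Let F0 z : 0 <= F z. Proof. by rewrite sumr_ge0. Qed.
Let mtc j : mf (fun z => tau z ord0 j - c ord0 j).
Proof. by apply: measurable_funB; [exact: mtau|exact: measurable_cst]. Qed.
Let mhD j k : mf (fun z => h * `|Dx z j k|). Proof. by apply: measurable_funM => //; exact: (mabs (mDx j k)). Qed.
Let mFj j : mf (Fj j).
Proof. by apply: measurable_funD; [exact: (mabs (mtc j))|apply: measurable_sum => k; exact: mhD]. Qed.
Let mF : mf F. Proof. by apply: measurable_sum => j; exact: mFj. Qed.

Let integral_Fj j : (\int[vol]_(z in P) (Fj j z)%:E =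
  \int[vol]_(z in P) `|tau z ord0 j - c ord0 j|%:E + \sum_k h%:E * \int[vol]_(z in P) `|Dx z j k|%:E)%E.
Proof.
transitivity (\int[vol]_(z in P) (`|tau z ord0 j - c ord0 j|%:E + \sum_k (h * `|Dx z j k|)%:E))%E.
  by apply: eq_integral => z _; rewrite /Fj EFinD sumEFin.
have h0' := ltW h0.
have m1 : measurable_fun (P : set (mpt R n)) (fun z => `|tau z ord0 j - c ord0 j|%:E).
  by apply/measurable_EFinP; exact: (mabs (mtc j)).
have m2 k : measurable_fun (P : set (mpt R n)) (fun z => (h * `|Dx z j k|)%:E).
  by apply/measurable_EFinP; exact: mhD.
have p2 k z : (0 <= (h * `|Dx z j k|)%:E)%E by rewrite lee_fin mulr_ge0.
have p1 z : P z -> (0 <= `|tau z ord0 j - c ord0 j|%:E)%E by rewrite lee_fin.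
have p3 z : P z -> (0 <= \sum_k (h * `|Dx z j k|)%:E)%E by move=> _; apply: sume_ge0 => k _; exact: p2.
rewrite (@ge0_integralD _ _ R vol _ mP _ _ p1 m1 p3 (emeasurable_sum _ m2)).
congr (_ + _)%E; rewrite (@ge0_integral_sum _ _ R vol _ mP _ _ m2 (fun k z _ => p2 k z)).
apply: eq_bigr => k _; under eq_integral do rewrite EFinM.
by rewrite ge0_integralZl//; apply/measurable_EFinP; exact: (mabs (mDx j k)).
Qed.

Let integral_F : (\int[vol]_(z in P) (F z)%:E = \sum_j \int[vol]_(z in P) (Fj j z)%:E)%E.
Proof.
under eq_integral do rewrite -sumEFin.
have m1 j : measurable_fun (P : set (mpt R n)) (fun z => (Fj j z)%:E) by apply/measurable_EFinP; exact: mFj.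
by rewrite (@ge0_integral_sum _ _ R vol _ mP _ _ m1)// => j z _; rewrite lee_fin.
Qed.

(** By the flux condition, [gam i] times the height is the mean over the face of the
normal component of [g - c]; the Jacobian of the parametrisation cancels, and the
trace inequality bounds the mean. *)
Lemma face_coefficient_le (gam : 'I_n.+1 -> R) i nu : unit_normal (face v i) nu ->
  (forall x, q x - c = \sum_k gam k *: (x - v k)) ->
  ((`|gam i * face_height v i nu| * vP)%:E <= \int[vol]_(z in P) (F z)%:E)%E.
Proof.
move=> nuP qE; have [_ /(_ i nu nuP)[g tg Eq]] := qP.
have J0 : face_jacobian (face v i) != 0 by rewrite gt_eqF// (face_jacobian_gt0 av nuP).
have {Eq} := mulfI J0 Eq; rewrite -/E => Eq.
have ig j : (@Defs.vol R m).-integrable E (EFin \o (fun s => g (psi i s) ord0 j)) by case: (tg j).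
have idot : (@Defs.vol R m).-integrable E (EFin \o (fun s => dot (g (psi i s)) nu)).
  rewrite (_ : EFin \o _ = fun s => (\sum_j ((nu ord0 j)%:E * (g (psi i s) ord0 j)%:E))%E); last first.
    by apply/funext => s /=; rewrite /dot -sumEFin; apply: eq_bigr => j _; rewrite -EFinM mulrC.
  by apply: integrable_sum => // j _; apply: integrableZl => //; exact: ig.
have igc j : (@Defs.vol R m).-integrable E (EFin \o (fun s => g (psi i s) ord0 j - c ord0 j)).
  by have := integrableB mEf (ig j) (icstE (c ord0 j)).
have idc : (@Defs.vol R m).-integrable E (EFin \o (fun s => dot (g (psi i s) - c) nu)).
  rewrite (_ : (fun s => _) = fun s => dot (g (psi i s)) nu - dot c nu); last by apply/funext => s; rewrite dotBl.
  by have := integrableB mEf idot (icstE (dot c nu)).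
have iq : (@Defs.vol R m).-integrable E (EFin \o (fun s => dot (q (psi i s).1) nu)).
  rewrite (_ : (fun s => dot (q (psi i s).1) nu) = cst (gam i * face_height v i nu + dot c nu)) //.
  by apply/funext => s /=; rewrite -(rt_flux gam s nuP) -qE -dotDl subrK.
have E1 : gam i * face_height v i nu * vE = \int[@Defs.vol R m]_(s in E) dot (g (psi i s) - c) nu.
  rewrite -cstE; transitivity (\int[@Defs.vol R m]_(s in E) (dot (q (psi i s).1) nu - dot c nu)).
    by apply: eq_Rintegral => s _; rewrite -dotBl qE (rt_flux gam s nuP).
  transitivity (\int[@Defs.vol R m]_(s in E) dot (q (psi i s).1) nu - \int[@Defs.vol R m]_(s in E) dot c nu).
    by rewrite (RintegralB mEf iq (icstE (dot c nu))).
  rewrite [X in X - _]Eq -(RintegralB mEf idot (icstE (dot c nu))).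
  by apply: eq_Rintegral => s _; rewrite dotBl.
have E2 : ((`|gam i * face_height v i nu| * vE)%:E <=
    \sum_j \int[@Defs.vol R m]_(s in E) `|g (psi i s) ord0 j - c ord0 j|%:E)%E.
  rewrite -[X in _ * X](ger0_norm (ltW vE0)) -normrM E1.
  have := le_normr_Rintegral mEf idc; rewrite -lee_fin /Rintegral => /le_trans; apply.
  rewrite fineK//; last by apply: integrable_fin_num => //; exact: (integrable_norm idc).
  have mgc j : measurable_fun E (fun s => `|g (psi i s) ord0 j - c ord0 j|%:E).
    by have /measurable_int/measurable_EFinP mm := igc j; apply/measurable_EFinP; exact: measurableT_comp.
  rewrite -ge0_integral_sum//; apply: ge0_le_integral => //.
  - by have /measurable_int/measurable_EFinP mm := idc; apply/measurable_EFinP; exact: measurableT_comp.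
  - exact: emeasurable_sum.
  move=> s _; rewrite sumEFin lee_fin; have [nu1 _] := nuP.
  apply: le_trans (dot_le_sum _ nu1) _; apply: ler_sum => j _.
  by rewrite !mxE.
have n1 : 1 <= (n%:R : R) by rewrite ler1n.
have E3 : ((`|gam i * face_height v i nu| * vE)%:E <= (vE / vP)%:E * \int[vol]_(z in P) (F z)%:E)%E.
  apply: le_trans E2 _; rewrite integral_F ge0_sume_distrr; last first.
    by move=> j _; apply: integral_ge0 => z _; rewrite lee_fin.
  apply: lee_sum => j _.
  apply: le_trans (lateral_trace_inequality av y01 (c ord0 j) (it j) (iDx j) (tg j)) _.
  rewrite -/P -/E -/vE -/vP.
  rewrite (_ : vE / (n%:R * vP) = vE / vP * n%:R^-1); last by rewrite invfM mulrCA mulrC.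
  rewrite EFinM -muleA; apply: lee_wpmul2l; first by rewrite lee_fin divr_ge0// ltW.
  rewrite integral_Fj ge0_muleDr; last 2 first.
  - by rewrite mule_ge0 ?lee_fin// integral_ge0.
  - by apply: sume_ge0 => k _; rewrite mule_ge0 ?lee_fin ?(ltW h0)// integral_ge0.
  apply: leeD; first by rewrite muleA -EFinM mulVf ?mul1e// gt_eqF// ltr0n.
  rewrite -[leRHS]mul1e; apply: lee_wpmul2r; last by rewrite lee_fin invf_le1 ?ltr0n.
  by apply: sume_ge0 => k _; rewrite mule_ge0 ?lee_fin ?(ltW h0)// integral_ge0.
have w0 : (0 <= (vP / vE)%:E)%E by rewrite lee_fin; apply: divr_ge0; exact: ltW.
have := lee_wpmul2l w0 E3; rewrite muleA -!EFinM.
rewrite (_ : vP / vE * (vE / vP) = 1) ?mul1e; last by rewrite mulrA divfK ?mulfV// gt_eqF.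
by rewrite [vP / vE * _]mulrC -mulrA [vE * _]mulrC divfK// gt_eqF.
Qed.

Let Cf := 2 * eta * n.+1%:R.

(** The heights are at least the diameter [2 r] of the inscribed ball, and
[h <= 4 eta r]. *)
Lemma horizontal_average_le : exists2 t : R, (forall z j, P z -> `|c ord0 j - q z.1 ord0 j| <= `|t|) &
  ((`|t| * vP)%:E <= \int[vol]_(z in P) `|Cf * F z|%:E)%E.
Proof.
have [[A1 [be qE]] _] := qP.
have [gam gE] := rt_basis av A1 c be.
have {}gE x : q x - c = \sum_k gam k *: (x - v k) by rewrite qE gE.
have [r [r0 hr] [x0 Hx0]] := inscribed_ball av shape.
pose t := h * \sum_k `|gam k|.
have t0 : 0 <= t by rewrite mulr_ge0 ?sumr_ge0// ltW.
exists t.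
  move=> z j [Kz _]; rewrite distrC (ger0_norm t0).
  have -> : q z.1 ord0 j - c ord0 j = (q z.1 - c) ord0 j by rewrite !mxE.
  rewrite gE summxE; apply: le_trans (ler_norm_sum _ _ _) _.
  rewrite /t mulr_sumr; apply: ler_sum => k _; rewrite !mxE normrM mulrC ler_wpM2r//.
  by apply: simplex_width => //; exact: simplex_vertex.
have CfF z : `|Cf * F z| = Cf * F z.
  by rewrite ger0_norm// mulr_ge0// !mulr_ge0// ltW.
under eq_integral do rewrite CfF EFinM.
rewrite ge0_integralZl//; last 3 first.
- exact/measurable_EFinP.
- by move=> z _; rewrite lee_fin.
- by rewrite lee_fin !mulr_ge0// ltW.
rewrite (ger0_norm t0) /t.
have G k : ((2 * r * `|gam k| * vP)%:E <= \int[vol]_(z in P) (F z)%:E)%E.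
  have [nu nuP] := unit_normal_exists av k.
  apply: le_trans (face_coefficient_le nuP gE); rewrite lee_fin ler_wpM2r ?(ltW vP0)//.
  by rewrite normrM [leLHS]mulrC; apply: ler_wpM2l => //; exact: (face_height_ge nuP r0 Hx0).
apply: (@le_trans _ _ (\sum_k (2 * eta)%:E * (2 * r * `|gam k| * vP)%:E)%E).
  rewrite (eq_bigr (fun k => (2 * eta * (2 * r * `|gam k| * vP))%:E)); last by move=> k _; rewrite EFinM.
  rewrite sumEFin lee_fin mulr_sumr mulr_suml; apply: ler_sum => k _.
  rewrite !mulrA ler_wpM2r ?(ltW vP0)// ler_wpM2r//; apply: le_trans hr _.
  by rewrite le_eqVlt; apply/orP; left; apply/eqP; ring.
have CE I : (Cf%:E * I = n.+1%:R%:E * ((2 * eta)%:E * I))%E by rewrite muleA -EFinM /Cf [2 * eta * _]mulrC.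
rewrite CE -[X in (X%:R)%:E](card_ord n.+1).
apply: sum_le_const.
- by rewrite mule_ge0 ?lee_fin ?mulr_ge0 ?(ltW eta0)// integral_ge0// => z _; rewrite lee_fin.
- by move=> k; apply: lee_wpmul2l => //; rewrite lee_fin mulr_ge0// ltW.
Qed.

Lemma defect_norm_le : (L2norm a P F <= (n%:R * (C1 + n%:R))%:E * rhs)%E.
Proof.
apply: le_trans (L2norm_sum ma a0 mP mFj) _.
rewrite EFinM -muleA -[X in (X%:R)%:E](card_ord n); apply: sum_le_const.
  by rewrite mule_ge0// lee_fin addr_ge0.
move=> j; apply: le_trans (L2normD ma a0 mP (mabs (mtc j)) (measurable_sum _ (mhD j))) _.
rewrite EFinD ge0_muleDl ?lee_fin//; apply: leeD.
  apply: le_trans (tc j); apply: (L2norm_le ma a0 mP (mabs (mtc j)) (mtc j)) => z _.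
  by rewrite normr_id.
apply: le_trans (L2norm_sum ma a0 mP (mhD j)) _.
rewrite -[X in (X%:R)%:E](card_ord n); apply: sum_le_const => // k.
rewrite (L2normZ ma a0 mP h (mabs (mDx j k))) gtr0_norm//.
apply: le_trans (x_rhs j k); apply: lee_wpmul2l; first by rewrite lee_fin ltW.
by apply: (L2norm_le ma a0 mP (mabs (mDx j k)) (mDx j k)) => z _; rewrite normr_id.
Qed.

Definition horizontal_const : R := n%:R * (C1 + Num.sqrt B * (Cf * (n%:R * (C1 + n%:R)))).

Lemma horizontal_estimate :
  (L2norm a P (fun z => enorm (tau z - q z.1)) <= horizontal_const%:E * rhs)%E.
Proof.
have [[A1 [be qE]] _] := qP.
have [t qt tF] := horizontal_average_le.
have Cf0 : 0 <= Cf by rewrite !mulr_ge0// ltW.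
have mCF : mf (fun z => Cf * F z) by exact: measurable_funM.
have mq j : mf (fun z => q z.1 ord0 j).
  rewrite (_ : (fun z : V => q z.1 ord0 j) = fun z => A1 ord0 j + be * z.1 ord0 j); last first.
    by apply/funext => z; rewrite qE !mxE.
  apply: measurable_funD => //; apply: measurable_funM => //.
  by apply: measurable_funTS; exact: measurable_mpt1.
have mcq j : mf (fun z => c ord0 j - q z.1 ord0 j).
  by apply: measurable_funB; [exact: measurable_cst|exact: mq].
have mtq j : mf (fun z => tau z ord0 j - q z.1 ord0 j).
  by apply: measurable_funB; [exact: mtau|exact: mq].
have cq j : (L2norm a P (fun z => (c ord0 j - q z.1 ord0 j)%R) <=
    (Num.sqrt B * (Cf * (n%:R * (C1 + n%:R))))%:E * rhs)%E.
  apply: (@le_trans _ _ (L2norm a P (fun=> t))).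
    by apply: (L2norm_le ma a0 mP (mcq j)) => // z Pz; exact: qt.
  apply: le_trans (L2norm_average av y01 eta0 shape aA mCF tF) _.
  rewrite -/B EFinM -muleA; apply: lee_wpmul2l; first by rewrite lee_fin sqrtr_ge0.
  rewrite (L2normZ ma a0 mP Cf mF) ger0_norm//.
  rewrite [X in (_ <= X * _)%E]EFinM -[leRHS]muleA; apply: lee_wpmul2l => //.
  exact: defect_norm_le.
have tq j : (L2norm a P (fun z => `|tau z ord0 j - q z.1 ord0 j|%R) <=
    (C1 + Num.sqrt B * (Cf * (n%:R * (C1 + n%:R))))%:E * rhs)%E.
  apply: (@le_trans _ _ (L2norm a P (fun z => (tau z ord0 j - c ord0 j) + (c ord0 j - q z.1 ord0 j))%R)).
    apply: (L2norm_le ma a0 mP (mabs (mtq j))); first exact: (measurable_funD (mtc j) (mcq j)).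
    by move=> z _; rewrite normr_id addrA subrK.
  apply: le_trans (L2normD ma a0 mP (mtc j) (mcq j)) _.
  rewrite EFinD ge0_muleDl ?lee_fin//; first exact: leeD.
  by rewrite mulr_ge0 ?sqrtr_ge0// mulr_ge0// mulr_ge0// addr_ge0.
apply: (@le_trans _ _ (L2norm a P (fun z => \sum_j `|tau z ord0 j - q z.1 ord0 j|)%R)).
  apply: (L2norm_le ma a0 mP).
  - apply: measurable_enorm => i j; rewrite ord1.
    rewrite (_ : (fun z => _) = fun z => tau z ord0 j - q z.1 ord0 j); first exact: mtq.
    by apply/funext => z; rewrite !mxE.
  - by apply: measurable_sum => j; exact: (mabs (mtq j)).
  move=> z _; rewrite ger0_norm ?enorm_ge0// ger0_norm ?sumr_ge0//.
  apply: le_trans (enorm_le_sum _) _; rewrite big_ord1.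
  by apply: ler_sum => j _; rewrite !mxE.
apply: le_trans (L2norm_sum ma a0 mP (fun j => mabs (mtq j))) _.
rewrite /horizontal_const EFinM -muleA -[X in (X%:R)%:E](card_ord n); apply: sum_le_const => //.
rewrite mule_ge0// lee_fin addr_ge0// mulr_ge0 ?sqrtr_ge0// mulr_ge0// mulr_ge0// addr_ge0//.
Qed.

End estimate.

Theorem horizontal_interpolation_error q : is_Pi_K v y0 y1 tau Dx q ->
  (L2norm a P (fun z => enorm (tau z - q z.1)) <= horizontal_const%:E * rhs)%E.
Proof.
move=> qP; have /choice[c cP] := horizontal_mean.
apply: (@horizontal_estimate q (\row_j c j) qP) => j.
by rewrite mxE; exact: cP.
Qed.

End horizontal_components.

(** * Raviart-Thomas interpolation in weighted norms *)

Lemma L2norm_positive_weight (R : realType) (n : nat) (a : pt R n -> R) (P : set (pt R n)) (f : pt R n -> R) :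
  strong_A2 a -> measurable (P : set (mpt R n)) -> measurable_fun (P : set (mpt R n)) f ->
  L2norm a P f = L2norm (positive_weight a) P f.
Proof.
move=> sa mP mf; rewrite /L2norm; congr (_ `^ _)%E.
exact: (wint_positive_weight sa mP mf).
Qed.

Theorem lemma4p6 (R : realType) (m : nat) (a : pt R m.+1 -> R) (eta : R) :
  strong_A2 a -> 0 < eta ->
  exists C : R,
  forall (v : 'I_m.+2 -> 'rV[R]_m.+1) (y0 y1 : R),
    let K := simplex v in
    let P := prism v y0 y1 in
    let h := diameter K in
    affinely_independent v -> h / inner_diameter K <= eta -> y0 < y1 ->
  forall (sigma : pt R m.+1 -> pt R m.+1)
    (Dx_tau : pt R m.+1 -> 'M[R]_m.+1) (Dy_tau : pt R m.+1 -> 'rV[R]_m.+1)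
    (Dx_s : pt R m.+1 -> 'rV[R]_m.+1) (Dy_s : pt R m.+1 -> R),
    let tau z := (sigma z).1 in
    let s z := (sigma z).2 in
    (forall i, in_L2 a P (fun z => tau z ord0 i)) -> in_L2 a P s ->
    (forall i j, weak_derivative P (fun z => tau z ord0 i) (e_x j)
                   (fun z => Dx_tau z i j)) ->
    (forall i, weak_derivative P (fun z => tau z ord0 i) (e_y m.+1)
                 (fun z => Dy_tau z ord0 i)) ->
    (forall j, weak_derivative P s (e_x j) (fun z => Dx_s z ord0 j)) ->
    weak_derivative P s (e_y m.+1) Dy_s ->
    let rhs_tau := (L2norm a P (fun z => ((z.2 - y0) * enorm (Dy_tau z))%R)
                    + h%:E * L2norm a P (fun z => enorm (Dx_tau z)))%E in
    let rhs_s := ((y1 - y0)%:E * L2norm a P Dy_s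
                  + h%:E * L2norm a P (fun z => enorm (Dx_s z)))%E in
    ((rhs_tau < +oo)%E ->
      (exists q, is_Pi_K v y0 y1 tau Dx_tau q) /\
      forall q, is_Pi_K v y0 y1 tau Dx_tau q ->
        (L2norm a P (fun z => enorm (tau z - q z.1)) <= C%:E * rhs_tau)%E) /\
    ((rhs_s < +oo)%E ->
      (exists q, is_Pi_y v y0 y1 s Dy_s q) /\
      forall q, is_Pi_y v y0 y1 s Dy_s q ->
        (L2norm a P (fun z => (s z - q z.2)%R) <= C%:E * rhs_s)%E).
Proof.
move=> sa eta0; have [A aA] := positive_weight_A2 sa.
exists (Num.max (horizontal_const (m := m) eta A) (vertical_const (m := m) eta A)).
move=> v y0 y1 K P h av shape y01 sigma Dx_tau Dy_tau Dx_s Dy_s tau s t2 s2 tDx tDy sDx sDy rhs_tau rhs_s.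
have mP : measurable (P : set (mpt R m.+1)) := body_measurable (prism_body av y01).
pose mf (f : pt R m.+1 -> R) := measurable_fun (P : set (mpt R m.+1)) f.
have normE f : mf f -> L2norm a P f = L2norm (positive_weight a) P f.
  by move=> mf'; exact: L2norm_positive_weight.
have mt j : mf (fun z => tau z ord0 j) by case: (t2 j).
have ms : mf s by case: s2.
have my : mf (fun z => z.2) by apply: measurable_funTS; exact: measurable_mpt2.
have h0 : 0 < h := diameter_gt0 av.
have mDx_tau : mf (fun z => enorm (Dx_tau z)).
  by apply: measurable_enorm => i j; case: (tDx i j).
have mDy_tau : mf (fun z => (z.2 - y0) * enorm (Dy_tau z)).
  apply: measurable_funM; first by apply: measurable_funB.
  by apply: measurable_enorm => i j; rewrite ord1; case: (tDy j).
have mDx_s : mf (fun z => enorm (Dx_s z)).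
  by apply: measurable_enorm => i j; rewrite ord1; case: (sDx j).
have mDy_s : mf Dy_s by case: sDy.
have enlarge (C C' : R) (x y : \bar R) : C <= C' -> (0 <= y)%E -> (x <= C%:E * y -> x <= C'%:E * y)%E.
  by move=> CC' y0' /le_trans; apply; apply: lee_wpmul2r; rewrite ?lee_fin.
split.
  have rE : rhs_tau = (L2norm (positive_weight a) P (fun z => ((z.2 - y0) * enorm (Dy_tau z))%R)
      + h%:E * L2norm (positive_weight a) P (fun z => enorm (Dx_tau z)))%E.
    by rewrite /rhs_tau !normE.
  have r0 : (0 <= rhs_tau)%E by rewrite adde_ge0 ?L2norm_ge0// mule_ge0 ?lee_fin ?L2norm_ge0// ltW.
  move=> rfin; have tfin j : (L2norm (positive_weight a) P (fun z => tau z ord0 j) < +oo)%E.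
    by rewrite -normE//; case: (t2 j).
  split.
    apply: (horizontal_interpolation_exists av y01 eta0 shape aA mt tfin tDx (Dy := Dy_tau)).
    by rewrite -rE.
  move=> q qP; rewrite normE; last first.
    apply: measurable_enorm => i j; rewrite ord1.
    have [[A1 [b qE]] _] := qP.
    rewrite (_ : (fun z => _) = fun z => tau z ord0 j - (A1 ord0 j + b * z.1 ord0 j)); last first.
      by apply/funext => z; rewrite qE !mxE.
    apply: measurable_funB; first exact: mt.
    apply: measurable_funD => //; apply: measurable_funM => //.
    by apply: measurable_funTS; exact: measurable_mpt1.
  apply: (enlarge (horizontal_const (m := m) eta A)) => //; first by rewrite le_max lexx.
  rewrite rE; apply: (horizontal_interpolation_error av y01 eta0 shape aA mt tfin tDx tDy _ qP).
  by rewrite -rE.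
have rE : rhs_s = ((y1 - y0)%:E * L2norm (positive_weight a) P Dy_s
    + h%:E * L2norm (positive_weight a) P (fun z => enorm (Dx_s z)))%E.
  by rewrite /rhs_s !normE.
have r0 : (0 <= rhs_s)%E.
  by rewrite adde_ge0 ?mule_ge0 ?lee_fin ?L2norm_ge0// ?subr_ge0// ltW.
move=> rfin; have sfin : (L2norm (positive_weight a) P s < +oo)%E by rewrite -normE//; case: s2.
split.
  by apply: (vertical_interpolation_exists av y01 eta0 shape aA ms sfin sDx sDy); rewrite -rE.
move=> q qP; rewrite normE; last first.
  have [[A1 [b qE]] _] := qP; apply: measurable_funB => //.
  rewrite (_ : (fun z => _) = fun z => A1 + b * z.2); last by apply/funext => z; rewrite qE.
  by apply: measurable_funD => //; exact: measurable_funM.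
apply: (enlarge (vertical_const (m := m) eta A)) => //; first by rewrite le_max lexx orbT.
by rewrite rE; apply: (vertical_interpolation_error av y01 eta0 shape aA ms sfin sDx sDy _ qP); rewrite -rE.
Qed.
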